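(* Let $M$ be an odd-dimensional compact (smooth) manifold, possibly with boundary, let $\mathbb{F}$ be a field of characteristic $0$, and let $k\geq 0$. Then there is an isomorphism of graded $\mathbb{F}$-vector spaces $$H_*(B_k(M);\mathbb{F})\cong \mathrm{Sym}^k\left(H_*(M;\mathbb{F})\right).$$
   Context: $B_k(M)=\mathrm{Conf}_k(M)/\Sigma_k$, where $\mathrm{Conf}_k(M)=\{(x_1,\ldots,x_k)\in M^k:x_i\neq x_j\text{ if }i\neq j\}$. For a graded vector space $V$, $\mathrm{Sym}(V)=\bigoplus_{k\geq0}\mathrm{Sym}^k(V)$ is the graded-symmetric algebra (with Koszul signs): the tensor product of the polynomial algebra on the even-degree part of $V$ with the exterior algebra on the odd-degree part; $\mathrm{Sym}^k(V)$ is the part of word length $k$. *)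

(* Defs.v *)
From HB Require Import structures.
From mathcomp Require Import all_boot all_order perm all_algebra.
From mathcomp Require Import all_classical all_reals all_analysis.
From mathcomp Require Import freeg generic_quotient.

Set Implicit Arguments.
Unset Strict Implicit.
Unset Printing Implicit Defensive.

Import Order.TTheory GRing.Theory Num.Theory.
Import numFieldNormedType.Exports.
Import Quotient.Exports.

Local Open Scope classical_set_scope.
Local Open Scope ring_scope.
Local Open Scope quotient_scope.

Section LinearSpan.
Variables (F : pzRingType) (V : lmodType F) (W : set V).

Definition lspan : pred V := fun v =>
  `[< forall U : {pred V}, submod_closed U ->
        (forall w, W w -> w \in U) -> v \in U >].

Fact lspan_submod_closed : submod_closed lspan.
Proof.
split; first by apply/asboolP => U [].
move=> a u v /asboolP uS /asboolP vS; apply/asboolP => U cU WU.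
by apply: cU.2; [exact: uS|exact: vS].
Qed.

HB.instance Definition _ :=
  GRing.isZmodClosed.Build V lspan (GRing.submod_closedB lspan_submod_closed).
HB.instance Definition _ :=
  GRing.isSubmodClosed.Build F V lspan lspan_submod_closed.

End LinearSpan.

Section QuotientModule.
Variables (F : pzRingType) (V : lmodType F) (W : set V).

Local Notation quot := (Quotient.quot (GRing.ZmodClosed.clone V (lspan W) _)).

Definition quotmod : Type := quot.
HB.instance Definition _ := GRing.Zmodule.on quotmod.

Definition quotmod_scale (a : F) (x : quotmod) : quotmod :=
  \pi_(quot) (a *: (repr (x : quot) : V)).

Lemma quotmod_scale_pi a (v : V) :
  quotmod_scale a (\pi_(quot) v) = \pi_(quot) (a *: v).
Proof.
apply/eqP; rewrite /quotmod_scale -Quotient.idealrBE -scalerBr rpredZ//.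
by rewrite Quotient.idealrBE reprK.
Qed.

Fact quotmod_scaleA a b x :
  quotmod_scale a (quotmod_scale b x) = quotmod_scale (a * b) x.
Proof. by rewrite {2}/quotmod_scale quotmod_scale_pi scalerA. Qed.

Fact quotmod_scale1 : left_id 1 quotmod_scale.
Proof. by move=> x; rewrite /quotmod_scale scale1r reprK. Qed.

Fact quotmod_scaleDr : right_distributive quotmod_scale +%R.
Proof.
move=> a x y; rewrite -[x](@reprK _ quot) -[y](@reprK _ quot).
rewrite -[X in quotmod_scale a X]Quotient.pi_add !quotmod_scale_pi scalerDr.
exact: Quotient.pi_add.
Qed.

Fact quotmod_scaleDl x : {morph quotmod_scale^~ x : a b / a + b}.
Proof.
by move=> a b; rewrite /quotmod_scale scalerDl; exact: Quotient.pi_add.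
Qed.

HB.instance Definition _ := GRing.Zmodule_isLmodule.Build F quotmod
  quotmod_scaleA quotmod_scale1 quotmod_scaleDr quotmod_scaleDl.

End QuotientModule.

Section FreeModuleLift.
Variables (F : nzRingType) (K : choiceType) (V : lmodType F) (f : K -> V).

Fact fglift_is_linear : linear (fglift f : {freeg K / F} -> V).
Proof.
have fgD : zmod_morphism (fglift f) by exact: lift_is_additive.
pose g := HB.pack_for {additive {freeg K / F} -> V} (fglift f)
  (GRing.isZmodMorphism.Build _ _ (fglift f) fgD).
have gZ c D : g (c *: D) = c *: g D.
  rewrite -[D in LHS]freeg_sumE -[D in RHS]freeg_sumE scaler_sumr !raddf_sum.
  apply: eq_bigr => x _.
  rewrite (_ : c *: _ = << c * coeff x D *g x >>) /=.
    by rewrite !liftU scalerA.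
  by apply/eqP/freeg_eqP => y; rewrite coeffZ !coeffU mulrA.
by move=> c D E; rewrite -[RHS]/(c *: g D + g E) -gZ -raddfD.
Qed.

HB.instance Definition _ := GRing.isLinear.Build F {freeg K / F} V *:%R
  (fglift f) fglift_is_linear.

End FreeModuleLift.

Section StandardSimplex.
Variable R : realType.

Definition std_simplex (d : nat) : set 'rV[R]_d.+1 :=
  [set x | (forall i, 0 <= x 0 i) /\ \sum_i x 0 i = 1].
Arguments std_simplex d : clear implicits.

Definition insert0 (d : nat) (i : 'I_d.+2) (x : 'rV[R]_d.+1) : 'rV[R]_d.+2 :=
  \row_j (if unlift i j is Some j' then x 0 j' else 0).

Fact insert0_simplex d (i : 'I_d.+2) (x : std_simplex d) :
  insert0 i (set_val x) \in std_simplex d.+1.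
Proof.
have [x0 x1] := set_valP x; apply/mem_set; split=> [j|].
  by rewrite mxE; case: unliftP => // j' _.
rewrite (bigD1_ord i) //= mxE unlift_none add0r -[RHS]x1.
by apply: eq_bigr => j _; rewrite mxE liftK.
Qed.

Definition face_fun d (i : 'I_d.+2) (x : std_simplex d) : std_simplex d.+1 :=
  exist _ (insert0 i (set_val x)) (insert0_simplex i x).

Fact insert0_continuous d (i : 'I_d.+2) : continuous (@insert0 d i).
Proof.
move=> x A [P Px PA].
exists (fun (_ : 'I_1) j => P 0 (fintype.lift i j)).
  by move=> k j; have := Px 0 (fintype.lift i j); rewrite mxE liftK (ord1 k).
move=> y yP; apply: PA => k j; rewrite mxE (ord1 k).
have := Px 0 j; rewrite mxE; case: unliftP => [j' -> _|-> /nbhs_singleton //].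
exact: yP.
Qed.

Fact face_continuous d (i : 'I_d.+2) : continuous (@face_fun d i).
Proof.
apply: continuous_comp_initial => x.
apply: (@continuous_comp _ _ _ set_val (@insert0 d i)).
  exact: initial_continuous.
exact: insert0_continuous.
Qed.

(* [face i] is the inclusion of the face opposite to the [i]-th vertex. *)
Definition face d (i : 'I_d.+2)
    : continuousType (std_simplex d) (std_simplex d.+1) :=
  mkcts (@face_continuous d i).

End StandardSimplex.
Arguments std_simplex R d : clear implicits.

Section SingularHomology.
Variables (R : realType) (F : fieldType) (X : topologicalType).

Definition singular_simplex (d : nat) : choiceType :=
  continuousType (std_simplex R d) X.

Definition singular_chain (d : nat) : lmodType F :=
  {freeg (singular_simplex d) / F}.

Definition singular_boundary (d : nat)
    : {linear singular_chain d.+1 -> singular_chain d} :=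
  fglift (fun s : singular_simplex d.+1 =>
    \sum_(i < d.+2) << (-1) ^+ i *g ((s \o face R i) : singular_simplex d) >>).

Definition is_cycle (d : nat) : pred (singular_chain d) :=
  match d with
  | 0 => xpredT
  | d'.+1 => fun c => singular_boundary d' c == 0
  end.

Fact is_cycle_submod_closed d : submod_closed (@is_cycle d).
Proof.
case: d => [//|d]; split; first by apply/eqP; exact: linear0.
by move=> a c e /eqP c0 /eqP e0; apply/eqP; rewrite linearP c0 e0 scaler0 addr0.
Qed.

HB.instance Definition _ d := GRing.isSubmodClosed.Build F (singular_chain d)
  (@is_cycle d) (@is_cycle_submod_closed d).

Record singular_cycle (d : nat) := Cycle { cycle_val :> singular_chain d;
  _ : cycle_val \in @is_cycle d }.
HB.instance Definition _ d := [isSub for @cycle_val d].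
HB.instance Definition _ d := [Choice of singular_cycle d by <:].
HB.instance Definition _ d := [SubChoice_isSubLmodule of singular_cycle d by <:].

(* The boundaries already form a subspace of the cycles, so that taking their
   span in [quotmod] is harmless. *)
Definition homology (d : nat) : lmodType F :=
  quotmod [set z : singular_cycle d |
    exists c, singular_boundary d c = z :> singular_chain d].

End SingularHomology.

Section GradedSymmetricAlgebra.
Variables (F : fieldType) (V : nat -> lmodType F).

Definition homog : choiceType := {i : nat & V i}.

Definition hdeg (u : homog) : nat := tag u.

Definition word (k d : nat) : choiceType :=
  {w : seq homog | (size w == k) && (sumn (map hdeg w) == d)}.

(* [monom k d w] is the word [w] if it has length [k] and total degree [d],
   and 0 otherwise. *)
Definition monom (k d : nat) (w : seq homog) : {freeg (word k d) / F} :=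
  if insub w is Some w' then << w' >> else 0.

Inductive sym_rel (k d : nat) : {freeg (word k d) / F} -> Prop :=
| SymLinear (s t : seq homog) i (a : F) (x y : V i) :
    sym_rel (monom k d (s ++ Tagged V (a *: x + y) :: t)
             - (a *: monom k d (s ++ Tagged V x :: t)
                + monom k d (s ++ Tagged V y :: t)))
| SymKoszul (s t : seq homog) (u v : homog) :
    sym_rel (monom k d (s ++ u :: v :: t)
             - (-1) ^+ (hdeg u * hdeg v) *: monom k d (s ++ v :: u :: t))
| SymOddSquare (s t : seq homog) (u : homog) : odd (hdeg u) ->
    sym_rel (monom k d (s ++ u :: u :: t)).

(* The degree [d] part of Sym^k(V): words of length [k] in homogeneous elements
   of [V], modulo multilinearity (giving the [k]-th tensor power of [V]), the
   Koszul rule u v = (-1)^(|u||v|) v u, and u u = 0 for [u] of odd degree. *)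
Definition sym_power (k d : nat) : lmodType F := quotmod (@sym_rel k d).

End GradedSymmetricAlgebra.

Definition graded_isomorphic (F : fieldType) (V W : nat -> lmodType F) : Prop :=
  exists phi : forall d, {linear V d -> W d}, forall d, bijective (phi d).

Section ConfigurationSpaces.
Variables (k : nat) (M : topologicalType).

Definition conf : set {ptws 'I_k -> M} := [set x | injective x].

Definition perm_related : rel conf := fun x y =>
  `[< exists s : 'S_k, forall i, set_val y i = set_val x (s i) >].

Fact perm_related_refl : reflexive perm_related.
Proof. by move=> x; apply/asboolP; exists 1%g => i; rewrite perm1. Qed.

Fact perm_related_sym : symmetric perm_related.
Proof.
move=> x y; apply/asboolP/asboolP => -[s sP]; exists (s^-1)%g => i;
by rewrite sP permKV.
Qed.

Fact perm_related_trans : transitive perm_related.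
Proof.
move=> y x z /asboolP[s sP] /asboolP[t tP]; apply/asboolP; exists (t * s)%g.
by move=> i; rewrite tP sP permM.
Qed.

Canonical perm_related_equiv := EquivRel perm_related
  perm_related_refl perm_related_sym perm_related_trans.
Canonical perm_related_encModRel := defaultEncModRel perm_related.

Definition unordered_conf : topologicalType :=
  quotient_topology {eq_quot perm_related}.

End ConfigurationSpaces.

Section SmoothManifolds.
Variable R : realType.

Fixpoint Ck_on (k m n : nat) (U : set 'rV[R]_m) (f : 'rV[R]_m -> 'rV[R]_n)
    : Prop :=
  {in U, continuous f} /\
  if k is k'.+1 then
    forall i : 'I_m, (forall x, U x -> derivable f x 'e_i) /\
      Ck_on k' U ('D_('e_i) f)
  else True.

(* Smoothness on an arbitrary subset: local extendability to smooth maps on open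
   subsets of Euclidean space. *)
Definition smooth_on (m n : nat) (A : set 'rV[R]_m)
    (f : 'rV[R]_m -> 'rV[R]_n) : Prop :=
  forall x, A x -> exists U (g : 'rV[R]_m -> 'rV[R]_n),
    [/\ open U, U x, forall k, Ck_on k U g & {in U `&` A, f =1 g}].

(* For n = 0 the condition is void and the half-space is R^0. *)
Definition half_space (n : nat) : set 'rV[R]_n :=
  [set x | forall i : 'I_n, i = 0%N :> nat -> 0 <= x 0 i].
Arguments half_space n : clear implicits.

Variables (n : nat) (M : topologicalType).

Record chart := Chart {
  chart_dom : set M;
  chart_map : M -> 'rV[R]_n;
  chart_inv : 'rV[R]_n -> M }.

(* [chart_map c] is a homeomorphism, with inverse [chart_inv c], from the open
   set [chart_dom c] to an open subset of the half-space. *)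
Definition is_chart (c : chart) : Prop :=
  [/\ open (chart_dom c),
      exists2 V, open V & chart_map c @` chart_dom c = V `&` half_space n,
      {in chart_dom c, cancel (chart_map c) (chart_inv c)},
      {within chart_dom c, continuous (chart_map c)} &
      {within chart_map c @` chart_dom c, continuous (chart_inv c)}].

Record is_smooth_atlas (C : set chart) : Prop := IsSmoothAtlas {
  atlas_chart : forall c, C c -> is_chart c;
  atlas_cover : \bigcup_(c in C) chart_dom c = setT;
  atlas_smooth : forall c c', C c -> C c' ->
    smooth_on (chart_map c @` (chart_dom c `&` chart_dom c'))
      (chart_map c' \o chart_inv c) }.

End SmoothManifolds.

(* Smooth manifolds of pure dimension [n], possibly with boundary. *)
Record smooth_manifold (R : realType) (n : nat) := SmoothManifold {
  manifold_space :> topologicalType;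
  manifold_hausdorff : hausdorff_space manifold_space;
  manifold_second_countable : @second_countable manifold_space;
  manifold_atlas : set (chart R n manifold_space);
  manifold_atlasP : is_smooth_atlas manifold_atlas }.

(* Main.v *)
(* Let N be the sum over S_k of the action on the singular chains of M^k.
   Near a configuration with x_a = x_b the transposition tau = (a b) acts, in a
   product of charts, as a reflection of a convex set; the complement of its
   fixed space is homologically a sphere of dimension n - 1 with tau as antipode.
   For n odd this gives z + tau z ~ 0 for cycles z there, so that N z = N tau z
   kills them: after applying N there is no obstruction to removing, one
   coincidence at a time, the configurations with coinciding points. Gluing the
   local statements over small simplices shows that N induces the same
   coinvariants for the homology of Conf_k(M) as for that of M^k.
   In characteristic 0 the transfer of the covering Conf_k(M) -> B_k(M) identifies
   H_*(B_k(M)) with the former, and the latter are Sym^k(H_*(M)) by the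
   Eilenberg-Zilber maps, which are compatible with permutations of the factors
   at the level of transpositions of adjacent factors. *)
From HB Require Import structures.
Require Import Defs.
From mathcomp Require Import all_boot all_order perm all_algebra.
From mathcomp Require Import all_classical all_reals all_analysis.
From mathcomp Require Import freeg generic_quotient lra.

Set Implicit Arguments.
Unset Strict Implicit.
Unset Printing Implicit Defensive.

Import Order.TTheory GRing.Theory Num.Theory.
Import numFieldNormedType.Exports.

Local Open Scope classical_set_scope.
Local Open Scope ring_scope.
Local Open Scope quotient_scope.

(** * Abelian group identities *)

(** The antipode of a sphere of dimension n - 1 has degree (-1)^n; this is where the sign in z + tau
    z ~ 0 comes from. The obstacle is that this holds only near a given point of M^k, for
    neighbourhoods with different stabilizers. The local statement is therefore an exactness modulo
    the coinvariants of the stabilizer of each neighbourhood, and the global one follows by acyclic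
    carriers: a homotopy is built simplex by simplex inside nested good neighbourhoods. The nesting
    needs a uniform notion of smallness on M^k, which compactness supplies. Subdivision, prisms and
    the Eilenberg-Zilber maps all come from one recursion, coning off the boundary, in complexes of
    vertex lists where cones are explicit; naturality then carries them to singular chains.
    Augmenting by an empty simplex makes contractible sets exactly acyclic in every degree. The
    resulting correspondence depends on choices of lifts and subdivisions, so it is treated as a
    linear relation between homology and Sym^k and only at the end shown to be the graph of a
    bijection. *)

Section ZmodNormalForm.
Variable V : zmodType.

(** Reflection for abelian groups: the value of an expression depends only on the integer
    coefficients of its atoms, so that [zmod] decides identities by computation. *)
Inductive zexp := ZVar of nat | ZAdd of zexp & zexp | ZOpp of zexp | ZNul.

Fixpoint zeval (s : seq V) (e : zexp) : V :=
  match e with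
  | ZVar i => nth 0 s i
  | ZAdd a b => zeval s a + zeval s b
  | ZOpp a => - zeval s a
  | ZNul => 0
  end.

Fixpoint zcoef (e : zexp) (i : nat) : int :=
  match e with
  | ZVar j => (i == j)%:Z
  | ZAdd a b => zcoef a i + zcoef b i
  | ZOpp a => - zcoef a i
  | ZNul => 0
  end.

Lemma zevalE s e : zeval s e = \sum_(i < size s) nth 0 s i *~ zcoef e i.
Proof.
elim: e => [j|a IHa b IHb|a IHa|] /=.
- case: (ltnP j (size s)) => [js|sj].
    rewrite (bigD1 (Ordinal js)) //= eqxx mulr1z big1 ?addr0 // => i ij.
    by have /negPf -> : i != j :> nat by apply: contraNneq ij => ij; apply/eqP/val_inj.
  rewrite nth_default // big1 // => i _.
  by have /negPf -> : i != j :> nat by rewrite neq_ltn (leq_trans (ltn_ord i) sj).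
- by rewrite IHa IHb -big_split; apply: eq_bigr => i _; rewrite mulrzDr.
- by rewrite IHa -sumrN; apply: eq_bigr => i _; rewrite mulrNz.
- by rewrite big1 // => i _; rewrite mulr0z.
Qed.

Lemma zeval_eq s e e' :
  all (fun i => zcoef e i == zcoef e' i) (iota 0 (size s)) ->
  zeval s e = zeval s e'.
Proof.
move=> /allP H; rewrite !zevalE; apply: eq_bigr => i _.
by rewrite (eqP (H i _)) // mem_iota /= add0n.
Qed.

End ZmodNormalForm.

(** The inner [match goal] forces [unify] to run while a term is being computed, so atoms are
    identified up to unification and not only syntactically. *)
Ltac zmod_find x s k :=
  lazymatch s with
  | ?y :: ?s' =>
    match goal with
    | _ => let u := match goal with _ => unify x y end in k
    | _ => zmod_find x s' (S k)
    end
  end.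

Ltac zmod_mem x s :=
  lazymatch s with
  | nil => constr:(false)
  | ?y :: ?s' =>
    match goal with
    | _ => let u := match goal with _ => unify x y end in constr:(true)
    | _ => zmod_mem x s'
    end
  end.

Ltac zmod_atoms e s :=
  lazymatch e with
  | (?a + ?b)%R => let s1 := zmod_atoms a s in zmod_atoms b s1
  | (- ?a)%R => zmod_atoms a s
  | @GRing.zero _ => s
  | _ => lazymatch zmod_mem e s with
         | true => s
         | false => constr:(e :: s)
         end
  end.

Ltac zmod_reify e s :=
  lazymatch e with
  | (?a + ?b)%R => let a' := zmod_reify a s in let b' := zmod_reify b s in
                   constr:(ZAdd a' b')
  | (- ?a)%R => let a' := zmod_reify a s in constr:(ZOpp a')
  | @GRing.zero _ => constr:(ZNul)
  | _ => let k := zmod_find e s 0%N in constr:(ZVar k)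
  end.

Ltac zmod :=
  lazymatch goal with
  | |- @eq ?T ?x ?y =>
    let s0 := constr:(@nil T) in
    let s1 := zmod_atoms x s0 in
    let s := zmod_atoms y s1 in
    let x' := zmod_reify x s in
    let y' := zmod_reify y s in
    apply: (@zeval_eq _ s x' y'); vm_compute; reflexivity
  end.

(** * Free modules *)

Section LinearMaps.
Variable F : comNzRingType.

(** A predicate on bare functions: composite expressions are then proved linear by following their
    syntax, without packing each one as a structure. *)
Definition lin (U V : lmodType F) (f : U -> V) :=
  forall a x y, f (a *: x + y) = a *: f x + f y.

Lemma lin0 (U V : lmodType F) (f : U -> V) : lin f -> f 0 = 0.
Proof.
by move=> lf; have := lf (-1) 0 0; rewrite scaler0 addr0 scaleN1r addrC subrr.
Qed.
Lemma lin_can (U V : lmodType F) (f : {linear U -> V}) : lin f.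
Proof. by move=> a x y; rewrite linearP. Qed.
Lemma lin_id (U : lmodType F) : lin (fun x : U => x).
Proof. by []. Qed.
Lemma lin_zero (U V : lmodType F) : lin (fun x : U => 0 : V).
Proof. by move=> a x y; rewrite scaler0 addr0. Qed.
Lemma lin_comp (U V W : lmodType F) (f : V -> W) (g : U -> V) :
  lin f -> lin g -> lin (fun x => f (g x)).
Proof. by move=> lf lg a x y; rewrite lg lf. Qed.
Lemma lin_add (U V : lmodType F) (f g : U -> V) :
  lin f -> lin g -> lin (fun x => f x + g x).
Proof. by move=> lf lg a x y; rewrite lf lg scalerDr; zmod. Qed.
Lemma lin_opp (U V : lmodType F) (f : U -> V) :
  lin f -> lin (fun x => - f x).
Proof. by move=> lf a x y; rewrite lf scalerN; zmod. Qed.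
Lemma lin_scale (U V : lmodType F) (c : F) (f : U -> V) :
  lin f -> lin (fun x => c *: f x).
Proof. by move=> lf a x y; rewrite lf scalerDr !scalerA mulrC. Qed.
Lemma lin_sum (U V : lmodType F) I (r : seq I) (P : pred I) (f : I -> U -> V) :
  (forall i, lin (f i)) -> lin (fun x => \sum_(i <- r | P i) f i x).
Proof.
move=> lf a x y; rewrite scaler_sumr -big_split.
by apply: eq_bigr => i _; rewrite lf.
Qed.

End LinearMaps.

Ltac lin :=
  lazymatch goal with
  | |- lin (fun c => c) => apply: lin_id
  | |- lin (fun c => 0) => apply: lin_zero
  | |- lin (fun c => (@?f c + @?g c)%R) => apply: (@lin_add _ _ _ f g); lin
  | |- lin (fun c => (- (@?f c))%R) => apply: (@lin_opp _ _ _ f); lin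
  | |- lin (fun c => (?a *: (@?f c))%R) => apply: (@lin_scale _ _ _ a f); lin
  | |- lin (fun c => bigop.body _ _ _) => apply: lin_sum => ?; lin
  | |- lin (fun c => ?h (@?g c)) =>
      apply: (@lin_comp _ _ _ _ h g); [exact: (lin_can _) | lin]
  | |- lin _ => exact: (lin_can _)
  end.

Section FreeModules.
Variables (F : fieldType) (K : choiceType).
Implicit Types (c : {freeg K / F}) (P : K -> Prop).

Lemma fglift1 (V : lmodType F) (f : K -> V) k : fglift f << k >> = f k.
Proof. by rewrite liftU scale1r. Qed.

Lemma fgU (a : F) k : << a *g k >> = a *: << k >> :> {freeg K / F}.
Proof. by apply/eqP/freeg_eqP => y; rewrite coeffZ !coeffU mul1r. Qed.

Lemma fg_sumE c : c = \sum_(k <- dom c) coeff k c *: << k >>.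
Proof. by rewrite -[LHS]freeg_sumE; apply: eq_bigr => k _; rewrite fgU. Qed.

(** The one support condition of the development. With different [P] it expresses homogeneity,
    containment in a subset, smallness and being carried. *)
Definition csub P c := forall k, coeff k c != 0 -> P k.

Lemma csubW P Q c : (forall k, P k -> Q k) -> csub P c -> csub Q c.
Proof. by move=> PQ cP k /cP/PQ. Qed.

Lemma csubT c : csub (fun _ => True) c. Proof. by []. Qed.

Lemma csub0 P : csub P 0.
Proof. by move=> k; rewrite coeff0 eqxx. Qed.

Lemma csub1 P k : P k -> csub P << k >>.
Proof.
by move=> Pk k'; rewrite coeffU mul1r; case: (k =P k') => [<- //|_]; rewrite eqxx.
Qed.

Lemma csubD P c d : csub P c -> csub P d -> csub P (c + d).
Proof.
move=> cP dP k; rewrite coeffD; have [c0|c0 _] := eqVneq (coeff k c) 0.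
  by rewrite c0 add0r => /dP.
exact: cP.
Qed.

Lemma csubZ P a c : csub P c -> csub P (a *: c).
Proof. by move=> cP k; rewrite coeffZ mulf_eq0 negb_or => /andP[_ /cP]. Qed.

Lemma csubN P c : csub P c -> csub P (- c).
Proof. by move=> cP; rewrite -scaleN1r; apply: csubZ. Qed.

Lemma csubB P c d : csub P c -> csub P d -> csub P (c - d).
Proof. by move=> cP dP; apply: csubD => //; apply: csubN. Qed.

Lemma csub_sum P I (r : seq I) (Q : pred I) (f : I -> {freeg K / F}) :
  (forall i, Q i -> csub P (f i)) -> csub P (\sum_(i <- r | Q i) f i).
Proof. by move=> fP; elim/big_rec: _ => [|i c Qi cP]; [apply: csub0|apply: csubD => //; apply: fP]. Qed.

Lemma csub_ind P (S : {freeg K / F} -> Prop) c : csub P c ->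
  S 0 -> (forall a d e, S d -> S e -> S (a *: d + e)) ->
  (forall k, P k -> S << k >>) -> S c.
Proof.
move=> cP S0 SD S1; rewrite (fg_sumE c).
have : forall k, k \in dom c -> P k by move=> k; rewrite mem_dom => /cP.
elim: (dom c) => [|k s IHs] sP; first by rewrite big_nil.
rewrite big_cons; apply: SD; first by apply: S1; apply: sP; rewrite mem_head.
by apply: IHs => k' k's; apply: sP; rewrite inE k's orbT.
Qed.

Lemma csub_lin P (V : lmodType F) (f g : {freeg K / F} -> V) c :
  csub P c -> lin f -> lin g -> (forall k, P k -> f << k >> = g << k >>) ->
  f c = g c.
Proof.
move=> cP lf lg fg; apply: (@csub_ind P (fun c => f c = g c) c cP) => //.
- by rewrite !lin0.
- by move=> a d e fd fe; rewrite lf lg fd fe.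
Qed.

Lemma fg_ext (V : lmodType F) (f g : {freeg K / F} -> V) :
  lin f -> lin g -> (forall k, f << k >> = g << k >>) -> forall c, f c = g c.
Proof. by move=> lf lg fg c; apply: (@csub_lin (fun=> True) V f g c) => // k _; exact: fg. Qed.

End FreeModules.

Section FreeModuleMaps.
Variables (F : fieldType) (A B C : choiceType).

Lemma csub_map (P : A -> Prop) (Q : B -> Prop)
    (f : {freeg A / F} -> {freeg B / F}) c :
  lin f -> csub P c -> (forall k, P k -> csub Q (f << k >>)) -> csub Q (f c).
Proof.
move=> lf cP fQ; apply: (@csub_ind _ _ P (fun c => csub Q (f c)) c cP) => //.
- by rewrite lin0 //; apply: csub0.
- by move=> a d e dQ eQ; rewrite lf; apply: csubD => //; apply: csubZ.
Qed.

End FreeModuleMaps.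

(** * Cone recursion *)

Section ConeRecursion.
Variables (F : fieldType) (B : choiceType) (deg : B -> nat).
Variable delta : {linear {freeg B / F} -> {freeg B / F}}.
Variables (Q : lmodType F) (init : B -> Q) (s : B -> {linear Q -> Q}).
Variables (phi : {linear {freeg B / F} -> Q}) (e : F).

Hypothesis deg_delta : forall b, (0 < deg b)%N ->
  csub (fun b' => (deg b').+1 = deg b) (delta << b >>).

(** Solves h(b) = s_b (phi b + e h(delta b)) by induction on the degree, with s_b a cone operator.
    The choice phi = 0, e = 1 produces chain maps; phi a difference of chain maps and e = -1
    produces chain homotopies. *)
Fixpoint cone_fuel (n : nat) (b : B) : Q :=
  if n is n'.+1 then
    if deg b == 0%N then init b
    else s b (phi << b >> + e *: fglift (cone_fuel n') (delta << b >>))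
  else 0.

Definition cone_rec : {freeg B / F} -> Q :=
  fglift (fun b => cone_fuel (deg b).+1 b).
HB.instance Definition _ := GRing.Linear.copy cone_rec (fglift _).

Lemma cone_rec0 b : deg b = 0%N -> cone_rec << b >> = init b.
Proof. by move=> b0; rewrite [LHS]fglift1 /= b0. Qed.

Lemma cone_recS b : (0 < deg b)%N ->
  cone_rec << b >> = s b (phi << b >> + e *: cone_rec (delta << b >>)).
Proof.
move=> b0; rewrite [LHS]fglift1 /= gtn_eqF //; congr (s b (_ + _ *: _)).
apply: (csub_lin (deg_delta b0)) => [||b' b'b]; [lin|lin|].
by rewrite fglift1 [RHS]fglift1 -b'b.
Qed.

Variable bd : {linear Q -> Q}.

(* The cone operators are only required to contract those elements that the
   recursion meets, because in an unaugmented complex the identity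
   [bd s + s bd = 1] fails in degree zero. *)
Lemma cone_rec_bd_on (P : B -> Prop) :
  (forall b, P b -> (0 < deg b)%N -> csub P (delta << b >>)) ->
  (forall b, P b -> (0 < deg b)%N ->
     let y := phi << b >> + e *: cone_rec (delta << b >>) in
     bd y = 0 -> bd (s b y) = y) ->
  (forall b, P b -> deg b = 1%N ->
     bd (phi << b >>) + e *: bd (cone_rec (delta << b >>)) = 0) ->
  (forall b, P b -> (1 < deg b)%N ->
     bd (phi << b >>) + e *: phi (delta << b >>) = 0) ->
  (forall b, P b -> (1 < deg b)%N -> delta (delta << b >>) = 0) ->
  forall b, P b -> (0 < deg b)%N ->
    bd (cone_rec << b >>) = phi << b >> + e *: cone_rec (delta << b >>).
Proof.
move=> Pd sK h1 h2 dd0 b.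
have [n] := ubnP (deg b); elim: n b => // n IHn b bn Pb b0.
rewrite cone_recS // sK // linearD linearZ /=.
have [b1|b1] := leqP (deg b) 1.
  by apply: h1 => //; apply/eqP; rewrite eqn_leq b1.
(* The induction hypothesis gives an extra term e h(delta (delta b)), which vanishes. *)
have -> : bd (cone_rec (delta << b >>)) = phi (delta << b >>).
  have PD : csub (fun b' => P b' /\ (deg b').+1 = deg b) (delta << b >>).
    by move=> b' b'0; split; [apply: (Pd b)|apply: (deg_delta b0)].
  have := csub_lin PD
    (f := fun c => bd (cone_rec c)) (g := fun c => phi c + e *: cone_rec (delta c)).
  move=> ->; [|lin|lin|move=> b' [Pb' b'b]].
    by rewrite dd0 // linear0 scaler0 addr0.
  apply: IHn => //; last by rewrite -ltnS b'b.
  by rewrite -ltnS b'b.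
exact: h2.
Qed.

Lemma cone_rec_bd :
  (forall b, (0 < deg b)%N ->
     let y := phi << b >> + e *: cone_rec (delta << b >>) in
     bd y = 0 -> bd (s b y) = y) ->
  (forall b, deg b = 1%N ->
     bd (phi << b >>) + e *: bd (cone_rec (delta << b >>)) = 0) ->
  (forall b, (1 < deg b)%N ->
     bd (phi << b >>) + e *: phi (delta << b >>) = 0) ->
  (forall b, (1 < deg b)%N -> delta (delta << b >>) = 0) ->
  forall b, (0 < deg b)%N ->
    bd (cone_rec << b >>) = phi << b >> + e *: cone_rec (delta << b >>).
Proof.
move=> sK h1 h2 dd b; apply: (@cone_rec_bd_on (fun=> True)) => //.
- by move=> {}b _; apply: sK.
- by move=> {}b _; apply: h1.
- by move=> {}b _; apply: h2.
- by move=> {}b _; apply: dd.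
Qed.

Lemma cone_rec_graded (P : B -> Prop) (S : nat -> Q -> Prop) :
  (forall m, S m 0) -> (forall m a x y, S m x -> S m y -> S m (a *: x + y)) ->
  (forall b, P b -> (0 < deg b)%N -> csub P (delta << b >>)) ->
  (forall b, P b -> deg b = 0%N -> S 0%N (init b)) ->
  (forall b m, P b -> deg b = m.+1 -> S m (phi << b >>)) ->
  (forall b m y, P b -> deg b = m.+1 -> S m y -> S m.+1 (s b y)) ->
  forall b, P b -> S (deg b) (cone_rec << b >>).
Proof.
move=> S0 SD Pd Si Sp Ss b; move bm: (deg b) => m.
elim: m b bm => [|m IHm] b bm Pb; first by rewrite cone_rec0 //; apply: Si.
have b0 : (0 < deg b)%N by rewrite bm.
rewrite cone_recS //; apply: Ss => //; rewrite addrC; apply: (SD); last exact: Sp.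
have PD : csub (fun b' => P b' /\ (deg b').+1 = deg b) (delta << b >>).
  by move=> b' b'0; split; [apply: (Pd b)|apply: (deg_delta b0)].
apply: (csub_ind (S := fun c => S m (cone_rec c)) PD).
- by rewrite linear0.
- by move=> a c d cS dS; rewrite linearP; apply: SD.
- by move=> b' [Pb' b'b]; apply: IHm => //; apply/eqP; rewrite -eqSS b'b bm.
Qed.

End ConeRecursion.

Section ConeRecursionNaturality.
Variables (F : fieldType) (B B' : choiceType) (deg : B -> nat) (deg' : B' -> nat).
Variable delta : {linear {freeg B / F} -> {freeg B / F}}.
Variable delta' : {linear {freeg B' / F} -> {freeg B' / F}}.
Variables (Q Q' : lmodType F) (init : B -> Q) (init' : B' -> Q').
Variables (s : B -> {linear Q -> Q}) (s' : B' -> {linear Q' -> Q'}).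
Variables (phi : {linear {freeg B / F} -> Q}) (phi' : {linear {freeg B' / F} -> Q'}).
Variable e : F.
Hypothesis deg_delta : forall b, (0 < deg b)%N ->
  csub (fun b' => (deg b').+1 = deg b) (delta << b >>).
Hypothesis deg_delta' : forall b, (0 < deg' b)%N ->
  csub (fun b' => (deg' b').+1 = deg' b) (delta' << b >>).
Variables (P : B -> Prop) (t : B -> F) (al : B -> B').
Variable be : {linear Q -> Q'}.
Variable alc : {linear {freeg B / F} -> {freeg B' / F}}.
Hypothesis alE : forall b, P b -> alc << b >> = t b *: << al b >>.
Hypothesis P_delta : forall b, (0 < deg b)%N -> P b -> csub P (delta << b >>).
Hypothesis deg_al : forall b, P b -> deg' (al b) = deg b.
Hypothesis init_nat : forall b, P b -> deg b = 0%N ->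
  be (init b) = t b *: init' (al b).
Hypothesis s_nat : forall b y, P b -> be (s b y) = s' (al b) (be y).
Hypothesis phi_nat : forall b, P b -> be (phi << b >>) = phi' (alc << b >>).
Hypothesis delta_nat : forall b, P b -> (0 < deg b)%N ->
  alc (delta << b >>) = delta' (alc << b >>).

(** Two recursions with compatible data agree, by induction on the degree. The scalar [t] allows
    basis elements to be mapped with a sign, as is needed for exchanging tensor factors. *)
Lemma cone_rec_nat c : csub P c ->
  be (cone_rec deg delta init s phi e c) =
  cone_rec deg' delta' init' s' phi' e (alc c).
Proof.
move=> cP; apply: (csub_lin cP (f := fun c => be (cone_rec deg delta init s phi e c))
  (g := fun c => cone_rec deg' delta' init' s' phi' e (alc c))); [lin|lin|].
move=> {c cP} b; have [n] := ubnP (deg b); elim: n b => // n IHn b bn Pb.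
rewrite alE // linearZ /=.
have [b0|b0] := posnP (deg b).
  by rewrite !cone_rec0 ?deg_al // init_nat.
rewrite !cone_recS ?deg_al // s_nat // -[RHS]linearZ; congr (s' _ _).
rewrite linearD linearZ /= phi_nat // alE // scalerDr linearZ /=; congr (_ + _).
rewrite [RHS]scalerA [t b * e]mulrC -scalerA; congr (_ *: _).
have -> : t b *: cone_rec deg' delta' init' s' phi' e (delta' << al b >>) =
  cone_rec deg' delta' init' s' phi' e (alc (delta << b >>)).
  by rewrite delta_nat // alE // !linearZ.
have PD : csub (fun b' => P b' /\ (deg b').+1 = deg b) (delta << b >>).
  by move=> b' b'0; split; [apply: (P_delta b0)|apply: (deg_delta b0)].
apply: (csub_lin PD (f := fun c => be (cone_rec deg delta init s phi e c))
  (g := fun c => cone_rec deg' delta' init' s' phi' e (alc c))); [lin|lin|].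
by move=> b' [Pb' b'b]; apply: IHn => //; rewrite -ltnS b'b.
Qed.

End ConeRecursionNaturality.
Arguments cone_rec_nat {F B B' deg deg' delta delta' Q Q' init init' s s' phi phi' e}
  _ _ P t al be alc.

(** * Chains of lists of vertices *)

Section ListChains.
Variables (F : fieldType) (V : choiceType).
Local Notation L := {freeg (seq V) / F}.

Definition lcons (v : V) : L -> L := fglift (fun w => << v :: w >>).
HB.instance Definition _ v := GRing.Linear.copy (lcons v) (fglift _).

Lemma lcons1 v w : lcons v << w >> = << v :: w >>.
Proof. exact: fglift1. Qed.

(** The simplicial boundary by recursion on the first vertex, d(vw) = w - v d(w). The empty list
    sits in degree -1 as augmentation, so the cone identity [lbd_cons] has no exceptional case. *)
Fixpoint lbd_list (w : seq V) : L :=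
  if w is v :: w' then << w' >> - lcons v (lbd_list w') else 0.

Definition lbd : L -> L := fglift lbd_list.
HB.instance Definition _ := GRing.Linear.copy lbd (fglift _).

Lemma lbd1 w : lbd << w >> = lbd_list w.
Proof. exact: fglift1. Qed.

Lemma lbd_nil : lbd << [::] >> = 0.
Proof. exact: lbd1. Qed.

Lemma lbd_cons v c : lbd (lcons v c) = c - lcons v (lbd c).
Proof. by move: c; apply: fg_ext => [||w]; [lin|lin|rewrite lcons1 !lbd1]. Qed.

Lemma lbd_lbd c : lbd (lbd c) = 0.
Proof.
move: c; apply: fg_ext => [||w]; [lin|lin|].
elim: w => [|v w IHw]; first by rewrite lbd_nil linear0.
by rewrite -lcons1 lbd_cons linearB /= lbd_cons IHw linear0; zmod.
Qed.

Definition del (i : nat) (w : seq V) := take i w ++ drop i.+1 w.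

Lemma size_del i w : (i < size w)%N -> size (del i w) = (size w).-1.
Proof.
move=> iw; rewrite size_cat size_drop size_take iw.
by case: (size w) iw => // n iw; rewrite subSS subnKC.
Qed.

Lemma nth_del x0 i w j : nth x0 (del i w) j = nth x0 w (bump i j).
Proof.
rewrite /del /bump nth_cat size_take; case: (ltnP i (size w)) => iw.
  case: (leqP i j) => ij; last by rewrite nth_take.
  by rewrite /= nth_drop addSn subnKC // add1n.
rewrite (drop_oversize (leq_trans iw (leqnSn i))) take_oversize //.
case: ltnP => jw; first by rewrite leqNgt (leq_trans jw iw).
rewrite nth_nil nth_default //; apply: leq_trans jw _.
by rewrite leq_addl.
Qed.

Lemma lbdE w : lbd << w >> = \sum_(i < size w) (-1) ^+ i *: << del i w >>.
Proof.
elim: w => [|v w IHw]; first by rewrite lbd_nil big_ord0.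
rewrite -lcons1 lbd_cons IHw big_ord_recl expr0 scale1r {2}/del /= drop0.
rewrite linear_sum -sumrN; congr (_ + _); apply: eq_bigr => i _.
by rewrite linearZ /= lcons1 exprS mulN1r scaleNr.
Qed.

Lemma csub_lbd (P : V -> Prop) (c : L) :
  csub (fun w : seq V => forall v, v \in w -> P v) c ->
  csub (fun w : seq V => forall v, v \in w -> P v) (lbd c).
Proof.
move=> cP; apply: (csub_map _ cP) => [|w wP]; first by lin.
rewrite lbdE; apply: csub_sum => i _; apply: csubZ; apply: csub1 => v.
by rewrite mem_cat => /orP[/mem_take|/mem_drop] /wP.
Qed.

Lemma size_lbd w : (0 < size w)%N ->
  csub (fun w' => (size w').+1 = size w) (lbd << w >>).
Proof.
move=> w0; rewrite lbdE; apply: csub_sum => i _; apply: csubZ; apply: csub1.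
by rewrite size_del // prednK.
Qed.

End ListChains.

Section ListChainMaps.
Variables (F : fieldType) (V W : choiceType) (f : V -> W).

Definition lmap : {freeg (seq V) / F} -> {freeg (seq W) / F} :=
  fglift (fun w => << map f w >>).
HB.instance Definition _ := GRing.Linear.copy lmap (fglift _).

Lemma lmap1 w : lmap << w >> = << map f w >>.
Proof. exact: fglift1. Qed.

Lemma lmap_cons v c : lmap (lcons v c) = lcons (f v) (lmap c).
Proof. by move: c; apply: fg_ext => [||w]; [lin|lin|rewrite lcons1 !lmap1 lcons1]. Qed.

Lemma lmap_lbd c : lmap (lbd c) = lbd (lmap c).
Proof.
move: c; apply: fg_ext => [||w]; [lin|lin|].
elim: w => [|v w IHw]; first by rewrite lmap1 !lbd_nil linear0.
by rewrite -lcons1 lbd_cons lmap_cons lbd_cons linearB /= lmap_cons -IHw.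
Qed.

End ListChainMaps.

(** * Affine simplices and augmented singular chains *)

Section AffineSimplices.
Variables (R : realType).

Definition lcomb (V : lmodType R) d (w : seq V) (x : 'rV[R]_d.+1) : V :=
  \sum_j x 0 j *: nth 0 w j.

Lemma lcomb_is_linear (V : lmodType R) d (w : seq V) : linear (@lcomb V d w).
Proof.
move=> a x y; rewrite /lcomb scaler_sumr -big_split; apply: eq_bigr => j _.
by rewrite !mxE scalerDl scalerA.
Qed.
HB.instance Definition _ (V : lmodType R) d (w : seq V) :=
  GRing.isLinear.Build R 'rV[R]_d.+1 V *:%R (@lcomb V d w) (@lcomb_is_linear V d w).

Lemma lcomb_map (V W : lmodType R) (g : {linear V -> W}) d (w : seq V) (x : 'rV[R]_d.+1) :
  lcomb (map g w) x = g (lcomb w x).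
Proof.
rewrite /lcomb linear_sum; apply: eq_bigr => j _; rewrite linearZ /=.
have [jw|wj] := ltnP j (size w); first by rewrite (nth_map 0).
by rewrite [in RHS]nth_default // linear0 nth_default // size_map.
Qed.

Lemma lcomb_del (V : lmodType R) d (w : seq V) (i : 'I_d.+2) (x : 'rV[R]_d.+1) :
  lcomb w (insert0 i x) = lcomb (del i w) x.
Proof.
rewrite /lcomb (bigD1_ord i) //= mxE unlift_none scale0r add0r.
by apply: eq_bigr => j _; rewrite mxE liftK nth_del.
Qed.

Lemma insert0_is_linear d (i : 'I_d.+2) : linear (@insert0 R d i).
Proof.
move=> a x y; apply/rowP => j; rewrite !mxE; case: unliftP => [j' _|_].
  by rewrite !mxE.
by rewrite mulr0 addr0.
Qed.
HB.instance Definition _ d (i : 'I_d.+2) :=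
  GRing.isLinear.Build R _ _ *:%R (@insert0 R d i) (insert0_is_linear i).

Definition evs d : seq 'rV[R]_d.+1 := [seq delta_mx 0 j | j <- enum 'I_d.+1].

Lemma size_evs d : size (evs d) = d.+1.
Proof. by rewrite size_map size_enum_ord. Qed.

Lemma nth_evs d (j : 'I_d.+1) : nth 0 (evs d) j = delta_mx 0 j.
Proof. by rewrite (nth_map j) ?size_enum_ord // nth_ord_enum. Qed.

Lemma lcomb_evs d (x : 'rV[R]_d.+1) : lcomb (evs d) x = x.
Proof.
rewrite [RHS]row_sum_delta; apply: eq_bigr => j _.
by rewrite nth_evs.
Qed.

Lemma map_lcomb_evs (V : lmodType R) d (w : seq V) : size w = d.+1 ->
  map (@lcomb V d w) (evs d) = w.
Proof.
move=> wd; apply: (@eq_from_nth _ 0); rewrite size_map size_evs // => i id.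
rewrite (nth_map 0) ?size_evs // (_ : i = Ordinal id) // nth_evs /lcomb.
rewrite (bigD1 (Ordinal id)) //= mxE !eqxx scale1r big1 ?addr0 // => j ji.
by rewrite mxE (negPf ji) scale0r.
Qed.

Definition aff (V : lmodType R) d (w : seq V) (x : std_simplex R d) : V :=
  lcomb w (set_val x).

(** Convexity, in the form in which it is used: affine simplices with vertices in [E] stay in
    [E]. *)
Definition hull_closed (V : lmodType R) (E : set V) :=
  forall d w (x : std_simplex R d), size w = d.+1 ->
    (forall v, v \in w -> E v) -> E (aff w x).

Lemma hull_closed_simplex d : hull_closed (std_simplex R d).
Proof.
move=> e w x we wE; have [x0 x1] := set_valP x.
have nE (j : 'I_e.+1) : std_simplex R d (nth 0 w j) by apply/wE/mem_nth; rewrite we.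
rewrite /aff /lcomb; split=> [i|].
  rewrite summxE sumr_ge0 // => j _; rewrite mxE mulr_ge0 //.
  by have [] := nE j.
under eq_bigr do rewrite summxE.
rewrite exchange_big /= -[RHS]x1; apply: eq_bigr => j _.
under eq_bigr do rewrite mxE.
by rewrite -mulr_sumr; have [_ ->] := nE j; rewrite mulr1.
Qed.

Lemma evs_simplex d v : v \in evs d -> std_simplex R d v.
Proof.
case/mapP => j _ ->; split=> [i|]; first by rewrite mxE; case: (_ && _); rewrite ?ler01.
rewrite (bigD1 j) //= mxE !eqxx big1 ?addr0 // => i ij.
by rewrite mxE (negPf ij).
Qed.

Lemma lcomb_continuous (V : normedModType R) d (w : seq V) : continuous (@lcomb V d w).
Proof.
rewrite /lcomb; elim: (index_enum _) => [|j s IHs].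
  by under eq_fun do rewrite big_nil; move=> x; apply: cst_continuous.
under eq_fun do rewrite big_cons; move=> x.
apply: (@cvgD _ _ _ _ (nbhs_filter x)); last exact: IHs.
apply: (@cvgZ _ _ _ _ (nbhs_filter x)); last exact: cvg_cst.
exact: coord_continuous.
Qed.

Lemma set_val_cts (X : topologicalType) (A : set X) : continuous (@set_val X A).
Proof. exact: initial_continuous. Qed.

Lemma aff_continuous (V : normedModType R) d (w : seq V) : continuous (@aff V d w).
Proof.
move=> x; apply: (@continuous_comp _ _ _ (@set_val _ (std_simplex R d)) (lcomb w)).
  exact: set_val_cts.
exact: lcomb_continuous.
Qed.

End AffineSimplices.

(** Continuity on [A] tested on all continuous maps with values in [A]. This suits singular
    simplices and lets [f] take arbitrary values off [A], without passing to subspace types. *)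
Definition cts_on (X Y : topologicalType) (A : set X) (f : X -> Y) :=
  forall (T : topologicalType) (g : T -> X), continuous g ->
    (forall t, A (g t)) -> continuous (f \o g).

Lemma cts_onW (X Y : topologicalType) (A B : set X) (f : X -> Y) :
  A `<=` B -> cts_on B f -> cts_on A f.
Proof. by move=> AB fB T g gc gA; apply: fB => // t; apply: AB. Qed.

Lemma cts_on_cts (X Y : topologicalType) (A : set X) (f : X -> Y) :
  continuous f -> cts_on A f.
Proof. by move=> fc T g gc _ t; apply: continuous_comp; [exact: gc|exact: fc]. Qed.

Lemma cts_on_comp (X Y Z : topologicalType) (A : set X) (B : set Y)
    (f : X -> Y) (g : Y -> Z) :
  cts_on A f -> cts_on B g -> (forall x, A x -> B (f x)) -> cts_on A (g \o f).
Proof.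
move=> fA gB AB T h hc hA; apply: (gB _ (f \o h)); first exact: fA.
by move=> t; apply: AB.
Qed.

Section AugmentedChains.
Variables (R : realType) (F : fieldType) (X : topologicalType).

(* [None] is the empty simplex, whose role is to augment the chain complex. *)
Definition asimp : choiceType := option {d : nat & singular_simplex R X d}.
Definition achain : lmodType F := {freeg asimp / F}.

(** A discontinuous function gives the empty simplex as a default, so that chains can be written
    down before continuity is known. *)
Definition amk d (f : std_simplex R d -> X) : asimp :=
  if pselect (continuous f) is left fc
  then Some (existT (fun d => singular_simplex R X d) d (mkcts fc)) else None.

Lemma amkE d (s : singular_simplex R X d) : amk s = Some (existT _ d s).
Proof.
rewrite /amk; case: pselect => [sc|[]]; last exact: cts_fun.
by congr (Some (existT _ _ _)); apply/continuousEP.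
Qed.

Lemma amk_ext d (f g : std_simplex R d -> X) : f =1 g -> amk f = amk g.
Proof. by move=> fg; congr (amk _); apply/funext. Qed.

Definition abd_simp (s : asimp) : achain :=
  match s with
  | None => 0
  | Some (existT 0 _) => << None >>
  | Some (existT d.+1 s) => \sum_(i < d.+2) (-1) ^+ i *: << amk (s \o face R i) >>
  end.

Definition abd : achain -> achain := fglift abd_simp.
HB.instance Definition _ := GRing.Linear.copy abd (fglift _).

Lemma abd1 s : abd << s >> = abd_simp s. Proof. exact: fglift1. Qed.

(** The empty simplex counts as lying in every subset; hence chains in [A] form an augmented
    complex. *)
Definition inA (A : set X) (s : asimp) : Prop :=
  if s is Some (existT d s) then forall x, A (s x) else True.

Lemma inA_amk (A : set X) d (f : std_simplex R d -> X) : (forall x, A (f x)) -> inA A (amk f).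
Proof. by move=> fA; rewrite /amk; case: pselect. Qed.

Lemma inAW (A B : set X) s : A `<=` B -> inA A s -> inA B s.
Proof. by move=> AB; case: s => [[d s]|//] /= sA x; apply: AB. Qed.

Lemma csub_abd (A : set X) c : csub (inA A) c -> csub (inA A) (abd c).
Proof.
move=> cA; apply: (csub_map _ cA) => [|s sA]; first by lin.
rewrite abd1; case: s sA => [[[|d] s]|] /= sA; last exact: csub0.
  exact: csub1.
by apply: csub_sum => i _; apply: csubZ; apply: csub1; apply: inA_amk => x; apply: sA.
Qed.

Section Realization.
Variables (V : normedModType R) (G : V -> X).

(** Realizes a vertex list by the affine simplex that it spans, followed by [G]; identities between
    list chains thereby become identities between singular chains. *)
Definition pushs (w : seq V) : asimp :=
  if size w is d.+1 then amk (G \o @aff R V d w) else None.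

Definition push : {freeg (seq V) / F} -> achain := fglift (fun w => << pushs w >>).
HB.instance Definition _ := GRing.Linear.copy push (fglift _).

Lemma push1 w : push << w >> = << pushs w >>. Proof. exact: fglift1. Qed.

Definition good (w : seq V) := forall d, size w = d.+1 -> continuous (G \o @aff R V d w).

Lemma push_lbd c : csub good c -> abd (push c) = push (lbd c).
Proof.
move=> cG; apply: (csub_lin cG (f := fun c => abd (push c)) (g := fun c => push (lbd c)));
  [lin|lin|move=> {c cG} w wG].
rewrite push1 abd1 lbdE linear_sum /pushs; case sw: (size w) => [|[|d]] /=.
- by rewrite big_ord0.
- rewrite big_ord1 expr0 scale1r push1 /pushs size_del ?sw //=.
  by rewrite /amk; case: pselect => [?|[]] //; apply: wG.
rewrite {1}/amk; case: pselect => [wc|[]]; last exact: wG.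
rewrite /abd_simp; apply: eq_bigr => i _.
rewrite linearZ /= push1; congr (_ *: << _ >>).
rewrite /pushs size_del ?sw //=; apply: amk_ext => x /=; congr (G _).
by rewrite /aff /= -lcomb_del.
Qed.

Lemma csub_push (A : set X) (E : set V) c : hull_closed E ->
  (forall v, E v -> A (G v)) -> csub (fun w : seq V => forall v, v \in w -> E v) c ->
  csub (inA A) (push c).
Proof.
move=> hE GA cE; apply: (csub_map _ cE) => [|w wE]; first by lin.
rewrite push1; apply: csub1; rewrite /pushs; case sw: (size w) => [//|d].
by apply: inA_amk => x; apply/GA/hE.
Qed.

Lemma csub_good (E : set V) c : hull_closed E -> cts_on E G ->
  csub (F := F) (fun w : seq V => forall v, v \in w -> E v) c -> csub good c.
Proof.
move=> hE cE; apply: csubW => w wE d wd; apply: cE; first exact: aff_continuous.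
by move=> x; apply: hE.
Qed.

End Realization.

Lemma push_lmap (V W : normedModType R) (g : {linear V -> W}) (G : W -> X) c :
  push G (lmap g c) = push (G \o g) c.
Proof.
move: c; apply: fg_ext => [||w]; [lin|lin|rewrite lmap1 !push1; congr << _ >>].
rewrite /pushs size_map; case: (size w) => // d; apply: amk_ext => x /=.
by rewrite /aff lcomb_map.
Qed.

Lemma push_ext (V : normedModType R) (E : set V) (G G' : V -> X) c : hull_closed E ->
  csub (fun w : seq V => forall v, v \in w -> E v) c -> (forall v, E v -> G v = G' v) ->
  push G c = push G' c.
Proof.
move=> hE cE GG; apply: (csub_lin cE (f := push G) (g := push G')); [lin|lin|move=> w wE].
rewrite !push1 /pushs; congr << _ >>; case sw: (size w) => [//|d]; apply: amk_ext => x /=.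
by apply/GG/hE.
Qed.

(* Extension of a map on the simplex to the whole space, with junk values
   outside of the simplex. *)
Definition sext d (f : std_simplex R d -> X) (v : 'rV[R]_d.+1) : X :=
  f (insubd (exist _ (delta_mx 0 0) (mem_set (@evs_simplex R d _ (map_f _ (mem_enum _ 0))))) v).

Lemma sextE d (f : std_simplex R d -> X) x : sext f (set_val x) = f x.
Proof. by rewrite /sext; congr f; apply/val_inj; rewrite val_insubd (valP x). Qed.

Lemma sextP d (f : std_simplex R d -> X) v : std_simplex R d v ->
  exists2 x, v = set_val x & sext f v = f x.
Proof.
move=> dv; exists (exist _ v (mem_set dv)) => //.
exact: (sextE f (exist _ v (mem_set dv))).
Qed.

Lemma sext_cts d (f : std_simplex R d -> X) : continuous f ->
  cts_on (std_simplex R d) (sext f).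
Proof.
move=> fc T g gc gA; pose h t : std_simplex R d := exist _ (g t) (mem_set (gA t)).
have -> : sext f \o g = f \o h by apply/funext => t /=; rewrite -(sextE f (h t)).
have hc : continuous h by apply: continuous_comp_initial; apply: gc.
by move=> t; apply: continuous_comp; [exact: hc|exact: fc].
Qed.

Lemma pushs_evs d (f : std_simplex R d -> X) : pushs (sext f) (evs R d) = amk f.
Proof.
rewrite /pushs size_evs; apply: amk_ext => x /=.
by rewrite /aff lcomb_evs sextE.
Qed.

Lemma abd_abd c : abd (abd c) = 0.
Proof.
move: c; apply: fg_ext => [||s]; [lin|lin|].
case: s => [[d s]|]; last by rewrite abd1 linear0.
have E1 : csub (fun w : seq 'rV[R]_d.+1 => forall v, v \in w -> std_simplex R d v)
    (<< evs R d >> : {freeg (seq 'rV[R]_d.+1) / F}).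
  by apply: csub1 => v; apply: evs_simplex.
have cs := sext_cts (@cts_fun _ _ s).
(* Every singular simplex is the realization of the vertex list of the standard simplex, which
   reduces the claim to lists. *)
have -> : << Some (existT _ d s) >> = push (sext s) << evs R d >>.
  by rewrite push1 pushs_evs amkE.
rewrite push_lbd; last exact: (csub_good (@hull_closed_simplex R d) cs).
rewrite push_lbd ?lbd_lbd ?linear0 //.
by apply: (csub_good (@hull_closed_simplex R d) cs); apply: csub_lbd.
Qed.

End AugmentedChains.

Section ConeRecursionSupport.
Variables (F : fieldType) (B : choiceType) (deg : B -> nat).
Variable delta : {linear {freeg B / F} -> {freeg B / F}}.
Variables (Q : lmodType F) (init : B -> Q) (s : B -> {linear Q -> Q}).
Variables (phi : {linear {freeg B / F} -> Q}) (e : F).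
Hypothesis deg_delta : forall b, (0 < deg b)%N ->
  csub (fun b' => (deg b').+1 = deg b) (delta << b >>).

Lemma cone_rec_stable (P : B -> Prop) (S : Q -> Prop) :
  S 0 -> (forall a x y, S x -> S y -> S (a *: x + y)) ->
  (forall b, P b -> (0 < deg b)%N -> csub P (delta << b >>)) ->
  (forall b, P b -> S (init b)) -> (forall b y, P b -> (0 < deg b)%N -> S y -> S (s b y)) ->
  (forall b, P b -> S (phi << b >>)) ->
  forall c, csub P c -> S (cone_rec deg delta init s phi e c).
Proof.
move=> S0 SD Pd Si Ss Sp c cP.
have ext d (Pc : csub P d) : (forall b, P b -> coeff b d != 0 ->
    S (cone_rec deg delta init s phi e << b >>)) ->
    S (cone_rec deg delta init s phi e d).
  move=> H; have H2 : csub (fun b => P b /\ coeff b d != 0) d.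
    by move=> b bd; split => //; apply: Pc.
  apply: (@csub_ind _ _ _ (fun d => S (cone_rec deg delta init s phi e d)) d H2) => [|a x y Sx Sy|b [Pb bd]]; last exact: H.
    by rewrite linear0.
  by rewrite linearP; apply: SD.
apply: (ext) => // b Pb _; have [n] := ubnP (deg b); elim: n b Pb => // n IHn b Pb bn.
have [b0|b0] := posnP (deg b); first by rewrite cone_rec0 //; exact: Si.
rewrite cone_recS //; apply: (Ss) => //.
have -> : phi << b >> + e *: cone_rec deg delta init s phi e (delta << b >>) =
  e *: cone_rec deg delta init s phi e (delta << b >>) + phi << b >> by zmod.
apply: (SD); last exact: Sp.
apply: (ext); first exact: Pd.
by move=> b' Pb' b'd; apply: IHn => //; rewrite -ltnS (deg_delta b0 b'd).
Qed.

End ConeRecursionSupport.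
Arguments cone_rec_stable {F B deg delta Q init s phi e} _ P S.

(** * Natural operators on singular chains *)

Definition all_in (V : eqType) (E : set V) (w : seq V) := forall v, v \in w -> E v.

Section HullClosed.
Variable R : realType.

Definition unit_itv : set R^o := [set t | 0 <= t <= 1].

Lemma hull_closed_unit_itv : hull_closed unit_itv.
Proof.
move=> d w x wd wE; have [x0 x1] := set_valP x.
have nE (j : 'I_d.+1) : unit_itv (nth 0 w j) by apply/wE/mem_nth; rewrite wd.
apply/andP; split.
  by apply: sumr_ge0 => j _; apply: mulr_ge0 => //; have /andP[] := nE j.
rewrite -[leRHS]x1; apply: ler_sum => j _.
by rewrite ler_piMr //; have /andP[] := nE j.
Qed.

Lemma hull_closedX (V W : lmodType R) (A : set V) (B : set W) :
  hull_closed A -> hull_closed B -> hull_closed (A `*` B).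
Proof.
move=> hA hB d w x wd wE.
have -> : aff w x = (aff (map fst w) x, aff (map snd w) x).
  by rewrite /aff (lcomb_map (@fst V W)) (lcomb_map (@snd V W)); exact: surjective_pairing.
split.
  by apply: hA; rewrite ?size_map // => v /mapP[u /wE[uA uB] ->].
by apply: hB; rewrite ?size_map // => v /mapP[u /wE[uA uB] ->].
Qed.

Definition bary (V : lmodType R) (w : seq V) : V :=
  (size w)%:R^-1 *: \sum_(v <- w) v.

Lemma bary_map (V W : lmodType R) (g : {linear V -> W}) (w : seq V) :
  bary (map g w) = g (bary w).
Proof.
by rewrite /bary size_map big_map linearZ /=; congr (_ *: _); rewrite linear_sum.
Qed.

Lemma hull_bary (V : lmodType R) (E : set V) w : hull_closed E ->
  (0 < size w)%N -> all_in E w -> E (bary w).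
Proof.
move=> hE w0 wE.
case: w w0 wE => // v w _ wE.
pose u : 'rV[R]_(size w).+1 := const_mx (size w).+1%:R^-1.
have uS : std_simplex R (size w) u.
  split=> [i|]; first by rewrite mxE invr_ge0 ler0n.
  under eq_bigr do rewrite mxE.
  by rewrite sumr_const card_ord -[_ *+ _]mulr_natr mulVf // pnatr_eq0.
have -> : bary (v :: w) = aff (v :: w) (exist _ u (mem_set uS) : std_simplex R (size w)).
  rewrite /bary /aff /lcomb scaler_sumr (big_nth 0) big_mkord.
  by apply: eq_bigr => j _; rewrite mxE.
exact: hE.
Qed.

End HullClosed.

Section ListOperators.
Variables (R : realType) (F : fieldType).
Local Notation L V := {freeg (seq V) / F}.

Definition pair_map (V W : lmodType R) (g : V -> W) (x : R^o * V) : R^o * W :=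
  (x.1, g x.2).

Lemma pair_map_is_linear (V W : lmodType R) (g : {linear V -> W}) :
  linear (pair_map g).
Proof. by move=> a x y; rewrite /pair_map /= linearP. Qed.
HB.instance Definition _ (V W : lmodType R) (g : {linear V -> W}) :=
  GRing.isLinear.Build R _ _ *:%R (pair_map g) (pair_map_is_linear g).

(* The additional coordinate in [0, 1] serves as homotopy parameter. *)
Record lop := Lop {
  lop_fun :> forall V : normedModType R, {linear L V -> L (R^o * V)%type};
  lop_nat : forall (V W : normedModType R) (g : {linear V -> W}) (c : L V),
    lop_fun W (lmap g c) = lmap (pair_map g) (lop_fun V c);
  lop_sup : forall (V : normedModType R) (E : set V) (c : L V), hull_closed E ->
    csub (all_in E) c -> csub (all_in (@unit_itv R `*` E)) (lop_fun V c);
  lop_aug : F;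
  lop_nil : forall V : normedModType R, lop_fun V << [::] >> = lop_aug *: << [::] >> }.

End ListOperators.

Section ChainOperators.
Variables (R : realType) (F : fieldType) (Y X : topologicalType).
Variable H : R -> Y -> X.

(** The operator is applied to the universal list, the vertices of the standard simplex, and the
    result is realized through [s] and the homotopy [H]. *)
Definition oper_simp (Phi : lop R F) (s : asimp R Y) : achain R F X :=
  if s is Some (existT d s) then
    push (fun tv : R^o * 'rV[R]_d.+1 => H tv.1 (sext s tv.2)) (Phi _ << evs R d >>)
  else lop_aug Phi *: << None >>.

Definition oper Phi : achain R F Y -> achain R F X := fglift (oper_simp Phi).
HB.instance Definition _ Phi := GRing.Linear.copy (oper Phi) (fglift _).

Lemma oper1 Phi s : oper Phi << s >> = oper_simp Phi s.
Proof. exact: fglift1. Qed.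

Lemma csub_evs d : csub (F := F) (all_in (std_simplex R d)) << evs R d >>.
Proof. by apply: csub1 => v; apply: evs_simplex. Qed.

(** Any vertex list is the image of the universal one under the linear map [lcomb], so naturality of
    [Phi] computes the operator on every affine realization, in particular on faces. *)
Lemma oper_push Phi (V : normedModType R) (G : V -> Y) c : csub (good G) c ->
  oper Phi (push G c) = push (fun tv : R^o * V => H tv.1 (G tv.2)) (Phi V c).
Proof.
move=> cG; apply: (csub_lin cG (f := fun c => oper Phi (push G c))
  (g := fun c => push (fun tv : R^o * V => H tv.1 (G tv.2)) (Phi V c)));
  [lin|lin|move=> {c cG} w wG].
rewrite push1 oper1 /pushs; case sw: (size w) => [|d].
  by rewrite (size0nil sw) lop_nil linearZ /= push1.
rewrite /amk; case: pselect => [wc|[]]; last exact: wG.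
rewrite /oper_simp.
have hE : hull_closed (@unit_itv R `*` std_simplex R d).
  by apply: hull_closedX; [exact: hull_closed_unit_itv|exact: hull_closed_simplex].
have sE := lop_sup (l := Phi) (@hull_closed_simplex R d) (@csub_evs d).
have := lop_nat Phi (@lcomb R V d w) << evs R d >>.
rewrite lmap1 map_lcomb_evs // => ->; rewrite push_lmap.
apply: (push_ext hE sE) => -[t v] [tI vd] /=; congr H.
by have [x vE E] := sextP (mkcts wc : std_simplex R d -> Y) vd; rewrite [LHS]E /= [v]vE.
Qed.

Variable A : set Y.
Hypothesis Hc : cts_on (X := (R^o * Y)%type) (@unit_itv R `*` A) (fun ty => H ty.1 ty.2).

Lemma homotopy_cts (V : normedModType R) (E : set V) (G : V -> Y) :
  cts_on E G -> (forall v, E v -> A (G v)) ->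
  cts_on (X := (R^o * V)%type) (@unit_itv R `*` E) (fun tv => H tv.1 (G tv.2)).
Proof.
move=> Gc GA T g gc gE.
apply: (Hc (g := fun t => ((g t).1, G (g t).2))); last first.
  by move=> t; have [? ?] := gE t; split => //; apply: GA.
have g2 : continuous (G \o (snd \o g)).
  apply: Gc; last by move=> t; have [] := gE t.
  by move=> t; apply: continuous_comp; [exact: gc|exact: cvg_snd].
move=> t; apply: (cvg_pair (FF := nbhs_filter t) (FG := nbhs_filter _) (FH := nbhs_filter _));
  last exact: g2.
by apply: continuous_comp; [exact: gc|exact: cvg_fst].
Qed.

Lemma oper_bd (Phi Psi : lop R F) (e : F) c :
  (forall (V : normedModType R) (c : {freeg (seq V) / F}),
     lbd (Phi V c) = Psi V c + e *: Phi V (lbd c)) ->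
  csub (inA A) c -> abd (oper Phi c) = oper Psi c + e *: oper Phi (abd c).
Proof.
move=> PP cA; apply: (csub_lin cA (f := fun c => abd (oper Phi c))
  (g := fun c => oper Psi c + e *: oper Phi (abd c))); [lin|lin|move=> {c cA} s sA].
case: s sA => [[d s]|] sA; last first.
  rewrite !oper1 /= linearZ /= !abd1 /= !linear0 addr0.
  (* On the empty list the identity forces the augmentation of [Psi] to vanish. *)
  have := PP ('rV[R]_1 : normedModType R) << [::] >>.
  rewrite !lop_nil linearZ /= !lbd_nil !linear0 addr0.
  move/(congr1 (coeff [::])); rewrite coeff0 coeffZ coeffU eqxx !mulr1 => <-.
  by rewrite scale0r.
have sc : cts_on (std_simplex R d) (sext s).
  exact: (sext_cts (@cts_fun _ _ s)).
have gs := csub_good (@hull_closed_simplex R d) sc (@csub_evs d).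
have -> : << Some (existT _ d s) >> = push (sext s) << evs R d >> :> achain R F Y.
  by rewrite push1 pushs_evs amkE.
have sE := csub_lbd (@csub_evs d).
rewrite push_lbd // !oper_push //; last first.
  exact: csub_good (@hull_closed_simplex R d) sc sE.
rewrite push_lbd ?PP; first by rewrite linearD linearZ.
have hE : hull_closed (@unit_itv R `*` std_simplex R d).
  by apply: hull_closedX; [exact: hull_closed_unit_itv|exact: hull_closed_simplex].
apply: (csub_good hE); last exact: lop_sup (@hull_closed_simplex R d) (@csub_evs d).
apply: homotopy_cts => // v vd.
by have [x _ ->] := sextP (s : std_simplex R d -> Y) vd; apply: sA.
Qed.

Lemma csub_oper (Phi : lop R F) (B : set Y) (D : set X) c :
  (forall t y, unit_itv t -> B y -> D (H t y)) ->
  csub (inA B) c -> csub (inA D) (oper Phi c).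
Proof.
move=> HD cB; apply: (csub_map _ cB) => [|s sB]; first by lin.
rewrite oper1; case: s sB => [[d s]|] sB; last by apply: csubZ; apply: csub1.
have hE : hull_closed (@unit_itv R `*` std_simplex R d).
  by apply: hull_closedX; [exact: hull_closed_unit_itv|exact: hull_closed_simplex].
apply: (csub_push hE); last exact: lop_sup (@hull_closed_simplex R d) (@csub_evs d).
move=> [t v] [tI vd] /=; apply: HD => //.
by have [x _ ->] := sextP (s : std_simplex R d -> Y) vd; apply: sB.
Qed.

End ChainOperators.

Section ListOperatorInstances.
Variables (R : realType) (F : fieldType).
Local Notation L V := {freeg (seq V) / F}.

Lemma size_gt0_lbd (V : choiceType) (w : seq V) : (0 < size w)%N ->
  csub (F := F) (fun w' => (size w').+1 = size w) (lbd << w >>).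
Proof. exact: size_lbd. Qed.

Lemma all_in_lbd (V : choiceType) (E : set V) (w : seq V) : all_in E w ->
  csub (F := F) (all_in E) (lbd << w >>).
Proof. by move=> wE; apply: csub_lbd; apply: csub1. Qed.

Section Sd.
Variable V : lmodType R.

(** Barycentric subdivision, as the cone from the barycenter over the subdivided boundary. *)
Definition sd : L V -> L V :=
  cone_rec size (@lbd F V) (fun w => << w >>) (fun w => @lcons F V (bary w)) \0 (1%R).
HB.instance Definition _ := GRing.Linear.copy sd (cone_rec _ _ _ _ _ _).

Lemma sd_nil : sd << [::] >> = << [::] >>.
Proof. exact: cone_rec0. Qed.

Lemma sd_lbd c : lbd (sd c) = sd (lbd c).
Proof.
move: c; apply: fg_ext => [||w]; [lin|lin|].
have [w0|w0] := posnP (size w).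
  by rewrite (size0nil w0) sd_nil lbd_nil linear0.
rewrite [LHS](cone_rec_bd (@size_gt0_lbd V) (bd := @lbd F V)) //.
- by rewrite /= add0r scale1r.
- by move=> b b0 /= y0; rewrite lbd_cons y0 linear0 subr0.
- move=> b b1; rewrite /= linear0 add0r scale1r; case: b b1 => [|v [|? ?]] // _.
  by rewrite -lcons1 lbd_cons lbd_nil linear0 subr0 cone_rec0 // lbd_nil.
- by move=> b b1; rewrite /= linear0 scaler0 addr0.
- by move=> b b1; exact: lbd_lbd.
Qed.

(** The homotopy between the identity and [sd]: the cone from the barycenter over w - sd w - sdh
    (dw). *)
Definition sdh : L V -> L V :=
  cone_rec size (@lbd F V) (fun w => 0) (fun w => @lcons F V (bary w))
    (idfun \- sd) (-1).
HB.instance Definition _ := GRing.Linear.copy sdh (cone_rec _ _ _ _ _ _).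

Lemma sdh_nil : sdh << [::] >> = 0.
Proof. exact: cone_rec0. Qed.

Lemma sdh_lbd c : lbd (sdh c) = c - sd c - sdh (lbd c).
Proof.
move: c; apply: fg_ext => [||w]; [lin|lin|].
have [w0|w0] := posnP (size w).
  by rewrite (size0nil w0) sd_nil sdh_nil lbd_nil subrr !linear0 addr0.
rewrite [LHS](cone_rec_bd (@size_gt0_lbd V) (bd := @lbd F V)) //.
- by rewrite /= scaleN1r.
- by move=> b b0 /= y0; rewrite lbd_cons y0 linear0 subr0.
- move=> b b1; rewrite /= linearB /= sd_lbd; case: b b1 => [|v [|? ?]] // _.
  rewrite -lcons1 lbd_cons lbd_nil linear0 subr0 sd_nil cone_rec0 // linear0 scaler0.
  by rewrite subrr addr0.
- by move=> b b1; rewrite /= linearB /= sd_lbd scaleN1r subrr.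
- by move=> b b1; exact: lbd_lbd.
Qed.

Lemma sd_sup (E : set V) c : hull_closed E -> csub (all_in E) c -> csub (all_in E) (sd c).
Proof.
move=> hE; apply: (cone_rec_stable (@size_gt0_lbd V) (all_in E) (csub (all_in E))).
- exact: csub0.
- by move=> a x y xE yE; apply: csubD => //; apply: csubZ.
- by move=> w wE _; apply: all_in_lbd.
- by move=> w wE; apply: csub1.
- move=> w y wE w0 yE; apply: (csub_map _ yE) => [|u uE]; first by lin.
  rewrite /= lcons1; apply: csub1 => z; rewrite inE => /orP[/eqP ->|/uE //].
  exact: hull_bary.
- by move=> w wE; exact: csub0.
Qed.

Lemma sdh_sup (E : set V) c : hull_closed E -> csub (all_in E) c -> csub (all_in E) (sdh c).
Proof.
move=> hE; apply: (cone_rec_stable (@size_gt0_lbd V) (all_in E) (csub (all_in E))).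
- exact: csub0.
- by move=> a x y xE yE; apply: csubD => //; apply: csubZ.
- by move=> w wE _; apply: all_in_lbd.
- by move=> w wE; apply: csub0.
- move=> w y wE w0 yE; apply: (csub_map _ yE) => [|u uE]; first by lin.
  rewrite /= lcons1; apply: csub1 => z; rewrite inE => /orP[/eqP ->|/uE //].
  exact: hull_bary.
- by move=> w wE; apply: csubB; [exact: csub1|apply: sd_sup => //; exact: csub1].
Qed.

(** The prism is convex, so any of its points could serve as cone point; the bottom copy of the
    first vertex is one that is natural in linear maps. *)
Definition prism : L V -> L (R^o * V)%type :=
  cone_rec size (@lbd F V) (fun w => 0)
    (fun w => @lcons F (R^o * V)%type (0, head 0 w))
    (lmap (fun v => (1, v) : R^o * V) \- lmap (fun v => (0, v) : R^o * V)) (-1).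
HB.instance Definition _ := GRing.Linear.copy prism (cone_rec _ _ _ _ _ _).

Lemma prism_nil : prism << [::] >> = 0.
Proof. exact: cone_rec0. Qed.

Lemma prism_lbd c : lbd (prism c) =
  lmap (fun v => (1, v) : R^o * V) c - lmap (fun v => (0, v) : R^o * V) c - prism (lbd c).
Proof.
move: c; apply: fg_ext => [||w]; [lin|lin|].
have [w0|w0] := posnP (size w).
  by rewrite (size0nil w0) prism_nil lbd_nil !lmap1 subrr !linear0 addr0.
rewrite [LHS](cone_rec_bd (@size_gt0_lbd V) (bd := @lbd F _)) //.
- by rewrite /= scaleN1r.
- by move=> b b0 /= y0; rewrite lbd_cons y0 linear0 subr0.
- move=> b b1; rewrite /= linearB /= -!lmap_lbd; case: b b1 => [|v [|? ?]] // _.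
  rewrite -lcons1 lbd_cons lbd_nil linear0 subr0 !lmap1 subrr cone_rec0 //.
  by rewrite linear0 scaler0 addr0.
- by move=> b b1; rewrite /= linearB /= -!lmap_lbd scaleN1r subrr.
- by move=> b b1; exact: lbd_lbd.
Qed.

Lemma csub_lmap (W : choiceType) (f : V -> W) (E : set V) (E' : set W) (c : L V) :
  (forall v, E v -> E' (f v)) -> csub (all_in E) c -> csub (all_in E') (lmap f c).
Proof.
move=> fE cE; apply: (csub_map _ cE) => [|w wE]; first by lin.
by rewrite lmap1; apply: csub1 => z /mapP[v vw ->]; apply/fE/wE.
Qed.

Lemma unit_itv0 : @unit_itv R 0. Proof. by rewrite /unit_itv /= lexx ler01. Qed.
Lemma unit_itv1 : @unit_itv R 1. Proof. by rewrite /unit_itv /= lexx ler01. Qed.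

Lemma prism_sup (E : set V) c : hull_closed E -> csub (all_in E) c ->
  csub (all_in (@unit_itv R `*` E)) (prism c).
Proof.
move=> hE; apply: (cone_rec_stable (@size_gt0_lbd V) (all_in E)
  (csub (all_in (@unit_itv R `*` E)))).
- exact: csub0.
- by move=> a x y xE yE; apply: csubD => //; apply: csubZ.
- by move=> w wE _; apply: all_in_lbd.
- by move=> w wE; apply: csub0.
- move=> w y wE w0 yE; apply: (csub_map _ yE) => [|u uE]; first by lin.
  rewrite /= lcons1; apply: csub1 => z; rewrite inE => /orP[/eqP ->|/uE //].
  split; first exact: unit_itv0.
  by case: w w0 wE {uE} => // v w _ wE; apply: wE; rewrite mem_head.
- move=> w wE; apply: csubB; apply: (@csub_lmap _ _ E); last exact: csub1.
  + by move=> v vE; split => //; exact: unit_itv1.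
  + exact: csub1.
  + by move=> v vE; split => //; exact: unit_itv0.
Qed.

End Sd.

Section Naturality.
Variables (V W : lmodType R) (g : {linear V -> W}).

Lemma sd_nat (c : L V) : sd (lmap g c) = lmap g (sd c).
Proof.
apply/esym; apply: (cone_rec_nat (@size_gt0_lbd V) (@size_gt0_lbd W)
  (fun=> True) (fun=> 1) (map g) (lmap g) (lmap g)) => //.
- by move=> b _; rewrite /= lmap1 scale1r.
- by move=> b _; rewrite size_map.
- by move=> b _ _; rewrite /= lmap1 scale1r.
- by move=> b y _; rewrite /= lmap_cons bary_map.
- by move=> b _; rewrite /= linear0.
- by move=> b _ _; rewrite /= lmap_lbd.
Qed.

Lemma sdh_nat (c : L V) : sdh (lmap g c) = lmap g (sdh c).
Proof.
apply/esym; apply: (cone_rec_nat (@size_gt0_lbd V) (@size_gt0_lbd W)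
  (fun=> True) (fun=> 1) (map g) (lmap g) (lmap g)) => //.
- by move=> b _; rewrite /= lmap1 scale1r.
- by move=> b _; rewrite size_map.
- by move=> b _ _; rewrite scale1r linear0.
- by move=> b y _; rewrite /= lmap_cons bary_map.
- by move=> b _; rewrite /= linearB sd_nat.
- by move=> b _ _; rewrite /= lmap_lbd.
Qed.

Lemma prism_nat (c : L V) : prism (lmap g c) = lmap (pair_map g) (prism c).
Proof.
apply/esym; apply: (cone_rec_nat (@size_gt0_lbd V) (@size_gt0_lbd W)
  (fun=> True) (fun=> 1) (map g) (lmap (pair_map g)) (lmap g)) => //.
- by move=> b _; rewrite /= lmap1 scale1r.
- by move=> b _; rewrite size_map.
- by move=> b _ _; rewrite scale1r linear0.
- move=> b y _; rewrite /= lmap_cons /pair_map /=; congr (lcons (0, _) _).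
  by case: b => [|v b] //=; rewrite linear0.
- move=> b _; rewrite /= linearB /= !lmap1 /= -!map_comp.
  by congr (<< _ >> - << _ >>); apply: eq_map.
- by move=> b _ _; rewrite /= lmap_lbd.
Qed.

End Naturality.

End ListOperatorInstances.

Lemma csub_mapT (F : fieldType) (A B : choiceType) (Q : B -> Prop)
    (f : {freeg A / F} -> {freeg B / F}) c :
  lin f -> (forall k, csub Q (f << k >>)) -> csub Q (f c).
Proof. by move=> lf fQ; apply: (csub_map (P := fun=> True) lf) => // k _; apply: fQ. Qed.

Section LopConstructions.
Variables (R : realType) (F : fieldType).
Local Notation L V := {freeg (seq V) / F}.

Section At.
Variables (Phi : forall V : normedModType R, {linear L V -> L V}) (a : F).
Hypothesis Phi_nat : forall (V W : normedModType R) (g : {linear V -> W}) (c : L V),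
  Phi W (lmap g c) = lmap g (Phi V c).
Hypothesis Phi_sup : forall (V : normedModType R) (E : set V) (c : L V),
  hull_closed E -> csub (all_in E) c -> csub (all_in E) (Phi V c).
Hypothesis Phi_nil : forall V : normedModType R, Phi V << [::] >> = a *: << [::] >>.
Variables (t : R) (t01 : @unit_itv R t).

(** Operators that do not involve the homotopy parameter are placed at the constant time [t]. *)
Definition at_fun (V : normedModType R) : {linear L V -> L (R^o * V)%type} :=
  lmap (fun v => (t, v) : R^o * V) \o Phi V.

Fact at_nat (V W : normedModType R) (g : {linear V -> W}) (c : L V) :
  at_fun W (lmap g c) = lmap (pair_map g) (at_fun V c).
Proof.
rewrite /at_fun /= Phi_nat; move: (Phi V c); apply: fg_ext => [||w]; [lin|lin|].
by rewrite !lmap1 -!map_comp.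
Qed.

Fact at_sup (V : normedModType R) (E : set V) (c : L V) : hull_closed E ->
  csub (all_in E) c -> csub (all_in (@unit_itv R `*` E)) (at_fun V c).
Proof. by move=> hE cE; apply: (@csub_lmap _ _ _ _ _ E) => //; apply: Phi_sup. Qed.

Fact at_nil (V : normedModType R) : at_fun V << [::] >> = a *: << [::] >>.
Proof. by rewrite /at_fun /= Phi_nil linearZ /= lmap1. Qed.

Definition at_lop := Lop at_nat at_sup at_nil.

End At.

Definition sub_lop (P Q : lop R F) : lop R F.
Proof.
refine (@Lop R F (fun V => (P V \- Q V : {linear _ -> _})) _ _ (lop_aug P - lop_aug Q) _).
- by move=> V W g c; rewrite /= !lop_nat linearB.
- by move=> V E c hE cE; apply: csubB; apply: lop_sup.
- by move=> V; rewrite /= !lop_nil scalerBl.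
Defined.

Definition zero_lop : lop R F.
Proof.
refine (@Lop R F (fun V => (\0 : {linear _ -> _})) _ _ 0 _).
- by move=> V W g c; rewrite /= linear0.
- by move=> V E c hE cE; apply: csub0.
- by move=> V; rewrite /= scale0r.
Defined.

Definition id_lop t (t01 : @unit_itv R t) : lop R F.
Proof.
by refine (@at_lop (fun V => idfun) 1 _ _ _ t t01) => // V; rewrite scale1r.
Defined.

Definition sd_lop : lop R F.
Proof.
refine (@at_lop (fun V => @sd R F V) 1 _ _ _ 0 (unit_itv0 R)).
- by move=> V W g c; exact: sd_nat.
- by move=> V E c; exact: sd_sup.
- by move=> V; rewrite /= sd_nil scale1r.
Defined.

Definition sdh_lop : lop R F.
Proof.
refine (@at_lop (fun V => @sdh R F V) 0 _ _ _ 0 (unit_itv0 R)).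
- by move=> V W g c; exact: sdh_nat.
- by move=> V E c; exact: sdh_sup.
- by move=> V; rewrite /= sdh_nil scale0r.
Defined.

Definition prism_lop : lop R F.
Proof.
refine (@Lop R F (fun V => @prism R F V) _ _ 0 _).
- by move=> V W g c; exact: prism_nat.
- by move=> V E c; exact: prism_sup.
- by move=> V; rewrite /= prism_nil scale0r.
Defined.

End LopConstructions.

Section Pushforward.
Variables (R : realType) (F : fieldType).

Definition apush_simp (Y X : topologicalType) (f : Y -> X) (s : asimp R Y) : asimp R X :=
  if s is Some (existT d s) then amk (f \o s) else None.

Definition apush (Y X : topologicalType) (f : Y -> X) : achain R F Y -> achain R F X :=
  fglift (fun s => << apush_simp f s >>).
HB.instance Definition _ (Y X : topologicalType) (f : Y -> X) :=
  GRing.Linear.copy (apush f) (fglift _).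

Lemma apush1 (Y X : topologicalType) (f : Y -> X) s : apush f << s >> = << apush_simp f s >>.
Proof. exact: fglift1. Qed.

Variables (Y X Z : topologicalType).

Lemma csub_apush (A : set Y) (B : set X) (f : Y -> X) c :
  (forall y, A y -> B (f y)) -> csub (inA A) c -> csub (inA B) (apush f c).
Proof.
move=> fAB cA; apply: (csub_map _ cA) => [|s sA]; first by lin.
rewrite apush1; apply: csub1; case: s sA => [[d s]|] // sA.
by apply: inA_amk => x; apply/fAB/sA.
Qed.

Lemma apush_ext (A : set Y) (f g : Y -> X) c :
  csub (inA A) c -> (forall y, A y -> f y = g y) -> apush f c = apush g c.
Proof.
move=> cA fg; apply: (csub_lin cA (f := apush f) (g := apush g)); [lin|lin|move=> s sA].
rewrite !apush1; congr << _ >>; case: s sA => [[d s]|] // sA.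
by apply: amk_ext => x; apply/fg/sA.
Qed.

Lemma apush_id c : apush (fun y : Y => y) c = c.
Proof.
move: c; apply: fg_ext => [||s]; [lin|lin|rewrite apush1].
by case: s => [[d s]|] //; rewrite -[in RHS]amkE.
Qed.

Lemma apush_comp (A : set Y) (f : Y -> X) (g : X -> Z) c :
  cts_on A f -> csub (inA A) c -> apush g (apush f c) = apush (g \o f) c.
Proof.
move=> fA cA; apply: (csub_lin cA (f := fun c => apush g (apush f c))
  (g := apush (g \o f))); [lin|lin|move=> s sA].
rewrite !apush1; congr << _ >>; case: s sA => [[d s]|] // sA.
have fs : continuous (f \o s) by apply: fA => //; exact: (@cts_fun _ _ s).
rewrite /= {1}/amk; case: pselect => [sc|[]] //.
Qed.

Lemma apush_push (V : normedModType R) (G : V -> Y) (f : Y -> X) c :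
  csub (good G) c -> apush f (push G c) = push (f \o G) c.
Proof.
move=> cG; apply: (csub_lin cG (f := fun c => apush f (push G c))
  (g := push (f \o G))); [lin|lin|move=> w wG].
rewrite !push1 apush1; congr << _ >>; rewrite /pushs; case sw: (size w) => [//|d].
by rewrite {1}/amk; case: pselect => [wc|[]]; [exact: amk_ext|exact: wG].
Qed.

Lemma oper_id (H : R -> Y -> X) t (t01 : @unit_itv R t) c :
  oper H (id_lop F t01) c = apush (H t) c.
Proof.
move: c; apply: fg_ext => [||s]; [lin|lin|rewrite oper1 apush1].
case: s => [[d s]|] /=; last by rewrite scale1r.
rewrite lmap1 push1 /pushs size_map size_evs; congr << _ >>; apply: amk_ext => x /=.
rewrite /aff.
rewrite (_ : lcomb _ _ = (t, set_val x)) /= ?sextE //.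
rewrite /lcomb (eq_bigr (fun j => (set_val x 0 j *: (t : R^o), set_val x 0 j *: nth 0 (evs R d) j))).
  rewrite [LHS]surjective_pairing !raddf_sum /= -[\sum_(j < _) _ *: _`_ _]/(lcomb _ _).
  rewrite lcomb_evs; congr (_, _); rewrite -scaler_suml; have [_ ->] := set_valP x.
  by rewrite scale1r.
by move=> j _; rewrite (nth_map 0) ?size_evs.
Qed.

Lemma oper_sub (H : R -> Y -> X) (P Q : lop R F) c :
  oper H (sub_lop P Q) c = oper H P c - oper H Q c.
Proof.
move: c; apply: fg_ext => [||s]; [lin|lin|rewrite !oper1].
by case: s => [[d s]|] /=; rewrite ?linearB // scalerBl.
Qed.

Lemma oper_zero (H : R -> Y -> X) c : oper H (zero_lop R F) c = 0.
Proof.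
move: c; apply: fg_ext => [||s]; [lin|lin|rewrite oper1].
by case: s => [[d s]|] /=; rewrite ?linear0 // scale0r.
Qed.

Lemma cts_on_snd (A : set Y) (f : Y -> X) : cts_on A f ->
  cts_on (X := (R^o * Y)%type) (@unit_itv R `*` A) (fun ty => f ty.2).
Proof.
move=> fA T g gc gA; apply: (fA _ (snd \o g)); last by move=> t; have [] := gA t.
by move=> t; apply: continuous_comp; [exact: gc|exact: cvg_snd].
Qed.

Lemma apush_bd (A : set Y) (f : Y -> X) c : cts_on A f -> csub (inA A) c ->
  abd (apush f c) = apush f (abd c).
Proof.
move=> fA cA; have := @oper_bd R F Y X (fun _ => f) A (cts_on_snd fA)
  (id_lop F (unit_itv0 R)) (zero_lop R F) 1 c _ cA.
rewrite !oper_id oper_zero add0r scale1r; apply => V d /=.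
by rewrite add0r scale1r lmap_lbd.
Qed.

(* The homotopy formula with the cone on [None] filling in the augmentation. *)
Lemma homotopy_bd (A : set Y) (H : R -> Y -> X) c :
  cts_on (X := (R^o * Y)%type) (@unit_itv R `*` A) (fun ty => H ty.1 ty.2) ->
  csub (inA A) c ->
  abd (oper H (prism_lop R F) c) =
    apush (H 1) c - apush (H 0) c - oper H (prism_lop R F) (abd c).
Proof.
move=> HA cA; have := @oper_bd R F Y X H A HA (prism_lop R F)
  (sub_lop (id_lop F (unit_itv1 R)) (id_lop F (unit_itv0 R))) (-1) c _ cA.
rewrite oper_sub !oper_id scaleN1r; apply => V d /=.
by rewrite scaleN1r prism_lbd.
Qed.

End Pushforward.

(** * Iterated barycentric subdivision of singular chains *)

Section Subdivision.
Variables (R : realType) (F : fieldType) (X : topologicalType).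
Local Notation C := (achain R F X).

Definition Sd : C -> C := oper (fun _ x => x) (sd_lop R F).
HB.instance Definition _ := GRing.Linear.copy Sd (oper _ _).
Definition Sdh : C -> C := oper (fun _ x => x) (sdh_lop R F).
HB.instance Definition _ := GRing.Linear.copy Sdh (oper _ _).

Let cts_id : cts_on (X := (R^o * X)%type) (@unit_itv R `*` setT) (fun ty => ty.2).
Proof. by apply: (cts_on_snd (f := fun x : X => x)); apply: cts_on_cts => x. Qed.

Let inT (c : C) : csub (inA setT) c.
Proof. by move=> [[d s]|]. Qed.

Lemma Sd_bd c : abd (Sd c) = Sd (abd c).
Proof.
have := @oper_bd R F X X (fun _ x => x) setT cts_id (sd_lop R F) (zero_lop R F) 1 c _ (@inT c).
rewrite oper_zero add0r scale1r; apply => V d /=.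
by rewrite add0r scale1r -lmap_lbd sd_lbd.
Qed.

Lemma Sdh_bd c : abd (Sdh c) = c - Sd c - Sdh (abd c).
Proof.
have := @oper_bd R F X X (fun _ x => x) setT cts_id (sdh_lop R F)
  (sub_lop (id_lop F (unit_itv0 R)) (sd_lop R F)) (-1) c _ (@inT c).
rewrite oper_sub oper_id apush_id scaleN1r; apply => V d /=.
by rewrite scaleN1r -lmap_lbd sdh_lbd !linearB.
Qed.

Lemma csub_Sd (A : set X) c : csub (inA A) c -> csub (inA A) (Sd c).
Proof. exact: csub_oper. Qed.

Lemma csub_Sdh (A : set X) c : csub (inA A) c -> csub (inA A) (Sdh c).
Proof. exact: csub_oper. Qed.

(** The telescoping sum of [Sdh] over the iterates of [Sd], a homotopy from the identity to the n-th
    iterate. *)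
Fixpoint Sdhn n (c : C) : C := if n is n'.+1 then Sdh c + Sdhn n' (Sd c) else 0.

Lemma iter_Sd_bd n c : abd (iter n Sd c) = iter n Sd (abd c).
Proof. by elim: n => //= n IHn; rewrite Sd_bd IHn. Qed.

Lemma Sdhn_bd n c : abd (Sdhn n c) = c - iter n Sd c - Sdhn n (abd c).
Proof.
elim: n c => [|n IHn] c /=; first by rewrite linear0 subrr subr0.
by rewrite linearD /= Sdh_bd IHn -iterSr /= Sd_bd; zmod.
Qed.

Lemma Sdhn0 n : Sdhn n 0 = 0.
Proof. by elim: n => //= n IHn; rewrite !linear0 IHn addr0. Qed.

Lemma csub_iter_Sd (A : set X) n c : csub (inA A) c -> csub (inA A) (iter n Sd c).
Proof. by move=> cA; elim: n => //= n IHn; apply: csub_Sd. Qed.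

Lemma csub_Sdhn (A : set X) n c : csub (inA A) c -> csub (inA A) (Sdhn n c).
Proof.
elim: n c => [|n IHn] c cA /=; first exact: csub0.
by apply: csubD; [exact: csub_Sdh|apply/IHn/csub_Sd].
Qed.

End Subdivision.

Section SubdivisionNaturality.
Variables (R : realType) (F : fieldType) (Y X : topologicalType) (A : set Y) (f : Y -> X).
Hypothesis fA : cts_on A f.

Lemma apush_Sd (c : achain R F Y) : csub (inA A) c -> apush f (Sd c) = Sd (apush f c).
Proof.
move=> cA; apply: (csub_lin cA (f := fun c => apush f (Sd c))
  (g := fun c => Sd (apush f c))); [lin|lin|move=> {c cA} s sA].
case: s sA => [[d s]|] sA; last by rewrite /Sd apush1 !oper1 /= linearZ /= apush1.
have sc : cts_on (std_simplex R d) (sext s) by exact: (sext_cts (@cts_fun _ _ s)).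
have gs := csub_good (@hull_closed_simplex R d) sc (@csub_evs R F d).
have sdA v : std_simplex R d v -> A (sext s v).
  by move=> vd; have [x _ ->] := sextP (s : std_simplex R d -> Y) vd; apply: sA.
have fs : cts_on (std_simplex R d) (f \o sext s) by exact: (cts_on_comp sc fA sdA).
have gfs := csub_good (@hull_closed_simplex R d) fs (@csub_evs R F d).
have -> : << Some (existT _ d s) >> = push (sext s) << evs R d >> :> achain R F Y.
  by rewrite push1 pushs_evs amkE.
rewrite apush_push // /Sd !oper_push // apush_push //.
have hE : hull_closed (@unit_itv R `*` std_simplex R d).
  by apply: hull_closedX; [exact: hull_closed_unit_itv|exact: hull_closed_simplex].
apply: (csub_good hE) => //; first exact: cts_on_snd.
exact: lop_sup (@hull_closed_simplex R d) (@csub_evs R F d).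
Qed.

Lemma apush_iter_Sd n (c : achain R F Y) : csub (inA A) c ->
  apush f (iter n (@Sd R F Y) c) = iter n (@Sd R F X) (apush f c).
Proof. by move=> cA; elim: n => //= n <-; rewrite apush_Sd //; apply: csub_iter_Sd. Qed.

End SubdivisionNaturality.

(** * Contractible subsets *)

Section Contractible.
Variables (R : realType) (F : fieldType) (X : topologicalType).

Section ConstantChains.
Variable p : X.

Definition const_simp d : asimp R X := amk (fun _ : std_simplex R d => p).

(** Raises the dimension of constant simplices by one, starting with the empty simplex: all faces of
    a constant simplex coincide, and the first one survives as the pushforward to [p]. *)
Definition const_cone : achain R F X -> achain R F X :=
  fglift (fun s => << const_simp (if s is Some (existT d _) then d.+1 else 0%N) >>).
HB.instance Definition _ := GRing.Linear.copy const_cone (fglift _).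

Lemma const_cone1 s : const_cone << s >> =
  << const_simp (if s is Some (existT d _) then d.+1 else 0%N) >>.
Proof. exact: fglift1. Qed.

Lemma const_simpE d : exists s : singular_simplex R X d,
  const_simp d = Some (existT _ d s) /\ forall x, s x = p.
Proof.
rewrite /const_simp /amk; case: pselect => [pc|[]]; last exact: cst_continuous.
by exists (mkcts pc : continuousType (std_simplex R d) X).
Qed.

Lemma const_cone_bd c : abd (const_cone c) = apush (fun=> p) c - const_cone (abd c).
Proof.
move: c; apply: fg_ext => [||s]; [lin|lin|].
have face_const d : abd << const_simp d.+1 >> =
    \sum_(i < d.+2) (-1) ^+ i *: << const_simp d >> :> achain R F X.
  have [u [-> uE]] := const_simpE d.+1; rewrite abd1 /=; apply: eq_bigr => i _.
  by congr (_ *: << _ >>); apply: amk_ext => x /=.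
rewrite const_cone1 apush1; case: s => [[d s]|]; last first.
  have [u [-> _]] := const_simpE 0.
  by rewrite !abd1 /= linear0 subr0.
rewrite face_const big_ord_recl expr0 scale1r /=; congr (_ + _).
rewrite abd1; case: d s => [|d] s /=.
  by rewrite const_cone1 big_ord1 expr1 scaleN1r.
rewrite linear_sum -sumrN; apply: eq_bigr => i _; rewrite linearZ /= const_cone1.
rewrite exprS mulN1r scaleNr; congr (- (_ *: << _ >>)).
by rewrite /amk; case: pselect => [//|[]]; move=> x; apply: continuous_comp;
  [exact: face_continuous|exact: (@cts_fun _ _ s)].
Qed.

Lemma csub_const_cone (A : set X) c : A p -> csub (inA A) (const_cone c).
Proof.
move=> Ap; apply: csub_mapT => [|s]; first by lin.
by rewrite const_cone1; apply: csub1; apply: inA_amk.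
Qed.

End ConstantChains.

(** The homotopy joins [z] to its image at [p], and [const_cone] fills the latter. Exactness
    includes degree zero because the chains are augmented. *)
Lemma contractible_acyclic (U : set X) (H : R -> X -> X) (p : X) (z : achain R F X) :
  cts_on (X := (R^o * X)%type) (@unit_itv R `*` U) (fun ty => H ty.1 ty.2) ->
  (forall t x, @unit_itv R t -> U x -> U (H t x)) ->
  (forall x, U x -> H 0 x = x) -> (forall x, U x -> H 1 x = p) -> U p ->
  csub (inA U) z -> abd z = 0 ->
  exists2 e, csub (inA U) e & abd e = z.
Proof.
move=> Hc HU H0 H1 Up zU z0.
exists (const_cone p z - oper H (prism_lop R F) z).
  by apply: csubB; [exact: csub_const_cone|apply: (csub_oper _ zU)].
rewrite linearB /= const_cone_bd (homotopy_bd Hc) // z0 !linear0.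
rewrite (apush_ext zU H1) (apush_ext (g := id) zU H0) apush_id.
by zmod.
Qed.

End Contractible.

(** * Small simplices *)

Section Mesh.
Variables (R : realType) (F : fieldType) (V : normedModType R).
Local Notation L := {freeg (seq V) / F}.

Definition mesh_le (r : R) (w : seq V) :=
  forall u v, u \in w -> v \in w -> `|u - v| <= r.

(* Membership in every closed ball that contains the list; a substitute for
   membership in the convex hull. *)
Definition ball_hull (w : seq V) (x : V) :=
  forall y r, (forall v, v \in w -> `|y - v| <= r) -> `|y - x| <= r.

Lemma bary_subE (w : seq V) y : (0 < size w)%N ->
  y - bary w = (size w)%:R^-1 *: \sum_(v <- w) (y - v).
Proof.
move=> w0; rewrite sumrB scalerBr; congr (_ - _).
have -> : \sum_(v <- w) y = (size w)%:R *: y.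
  by rewrite big_const_seq count_predT iter_addr addr0 scaler_nat.
rewrite scalerA mulVf ?scale1r //.
by rewrite pnatr_eq0 -lt0n.
Qed.

Lemma ball_hull_bary (w : seq V) : (0 < size w)%N -> ball_hull w (bary w).
Proof.
move=> w0 y r yr; rewrite bary_subE // normrZ ger0_norm ?invr_ge0 ?ler0n //.
rewrite ler_pdivrMl ?ltr0n //; apply: le_trans (ler_norm_sum _ _ _) _.
rewrite mulr_natl -[in leRHS](count_predT w) -iter_addr_0 -big_const_seq.
by rewrite [leLHS]big_seq [leRHS]big_seq; apply: ler_sum => v /yr.
Qed.

(** The term of [v] in the average of the differences to [v] is zero, which leaves one summand fewer
    than the denominator. *)
Lemma bary_mesh (w : seq V) r v : mesh_le r w -> v \in w ->
  `|bary w - v| <= (size w).-1%:R / (size w)%:R * r.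
Proof.
move=> wr vw; have w0 : (0 < size w)%N by case: w vw {wr}.
rewrite distrC bary_subE // normrZ ger0_norm ?invr_ge0 ?ler0n //.
rewrite mulrAC ler_pdivlMr ?ltr0n // mulrC mulrA divff ?mul1r ?pnatr_eq0 -?lt0n //.
rewrite (perm_big _ (perm_to_rem vw)) /= big_cons subrr add0r.
apply: le_trans (ler_norm_sum _ _ _) _.
have <- : size (rem v w) = (size w).-1 by rewrite size_rem.
rewrite mulr_natl -[in leRHS](count_predT (rem v w)) -iter_addr_0 -big_const_seq.
by rewrite [leLHS]big_seq [leRHS]big_seq; apply: ler_sum => u /mem_rem uw; apply: wr.
Qed.

Lemma mem_del (i : nat) (w : seq V) v : v \in del i w -> v \in w.
Proof. by rewrite mem_cat => /orP[/mem_take|/mem_drop]. Qed.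

Lemma sdE (w : seq V) : (0 < size w)%N ->
  @sd R F V << w >> = lcons (bary w) (sd (lbd << w >>)).
Proof.
move=> w0; etransitivity; first by apply: cone_recS => //; exact: size_lbd.
by rewrite /= add0r scale1r.
Qed.

(** The claim about [ball_hull] strengthens the induction: it bounds the distance from the new
    barycenter to the vertices produced by subdividing the faces. *)
Lemma sd_mesh n r (w : seq V) : (size w <= n.+1)%N -> mesh_le r w ->
  csub (fun u => [/\ (size u <= n.+1)%N, mesh_le (n%:R / n.+1%:R * r) u &
    forall x, x \in u -> ball_hull w x]) (@sd R F V << w >>).
Proof.
elim: n w r => [|n IHn] w r wn wr.
  case: w wn wr => [|v [|//]] wn wr; first by rewrite sd_nil; apply: csub1; split.
  rewrite sdE // -lcons1 lbd_cons lbd_nil linear0 subr0 sd_nil lcons1; apply: csub1; split=> //.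
    by move=> x y; rewrite !inE => /eqP-> /eqP->; rewrite subrr normr0 !mul0r.
  by move=> x; rewrite inE => /eqP ->; apply: ball_hull_bary.
case: w wn wr => [|v0 w0] wn wr; first by rewrite sd_nil; apply: csub1; split.
set w := v0 :: w0 in wn wr *.
have r0 : 0 <= r by apply: le_trans (wr v0 v0 _ _); rewrite ?normr_ge0 ?mem_head.
have frac m m' : (m <= m')%N -> m%:R / m.+1%:R <= m'%:R / m'.+1%:R :> R.
  move=> mm; rewrite ler_pdivrMr ?ltr0n // mulrAC ler_pdivlMr ?ltr0n //.
  by rewrite -!natrM ler_nat !mulnS mulnC leq_add2r.
rewrite sdE // lbdE !linear_sum.
apply: csub_sum => i _; rewrite !linearZ; apply: csubZ.
have di : (size (del i w) <= n.+1)%N by rewrite size_del //= -ltnS.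
have dr : mesh_le r (del i w) by move=> x y /mem_del xw /mem_del yw; apply: wr.
apply: (csub_map _ (IHn _ _ di dr)) => [|u [un ur uw]]; first by lin.
have uw' x : x \in u -> ball_hull w x.
  by move=> /uw xu y s ys; apply: xu => v /mem_del; apply: ys.
rewrite /= lcons1; apply: csub1; split => //; last first.
  by move=> x; rewrite inE => /orP[/eqP ->|/uw' //]; apply: ball_hull_bary.
have bx x : x \in u -> `|bary w - x| <= n.+1%:R / n.+2%:R * r.
  move=> /uw'; apply => v vw; apply: le_trans (bary_mesh wr vw) _.
  by rewrite ler_wpM2r // frac.
move=> x y; rewrite !inE => /orP[/eqP ->|xu] /orP[/eqP ->|yu].
- by rewrite subrr normr0 mulr_ge0 // divr_ge0 ?ler0n.
- exact: bx.
- by rewrite distrC; apply: bx.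
- by apply: le_trans (ur _ _ xu yu) _; rewrite ler_wpM2r // frac.
Qed.

Lemma iter_sd_mesh n m r (c : L) :
  csub (fun u => (size u <= n.+1)%N /\ mesh_le r u) c ->
  csub (fun u => (size u <= n.+1)%N /\ mesh_le ((n%:R / n.+1%:R) ^+ m * r) u)
    (iter m (@sd R F V) c).
Proof.
move=> cr; elim: m => [|m IHm]; first by rewrite expr0 mul1r.
rewrite iterS; apply: (csub_map _ IHm) => [|u [un ur]]; first by lin.
by apply: csubW (sd_mesh un ur) => w [? + _]; rewrite exprS mulrA.
Qed.

Lemma mesh_le_ex (w : seq V) : exists r, mesh_le r w.
Proof.
exists (\sum_(u <- w) \sum_(v <- w) `|u - v|) => u v uw vw.
rewrite (big_rem u uw) (big_rem v vw) /= -addrA lerDl addr_ge0 ?sumr_ge0 // => x _.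
exact: sumr_ge0.
Qed.

Lemma aff_mesh d (w : seq V) r (x : std_simplex R d) : size w = d.+1 -> mesh_le r w ->
  `|nth 0 w 0 - aff w x| <= r.
Proof.
move=> wd wr; have [x0 x1] := set_valP x.
have -> : nth 0 w 0 - aff w x = \sum_j set_val x 0 j *: (nth 0 w 0 - nth 0 w j).
  under eq_bigr do rewrite scalerBr.
  by rewrite sumrB -scaler_suml x1 scale1r.
apply: le_trans (ler_norm_sum _ _ _) _; rewrite -[leRHS]mul1r -x1 mulr_suml.
apply: ler_sum => j _; rewrite normrZ ger0_norm // ler_wpM2l //.
by apply: wr; apply: mem_nth; rewrite wd.
Qed.

End Mesh.

Section Lebesgue.
Variables (R : realType) (X : topologicalType).

Lemma compact_std_simplex d : compact (std_simplex R d).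
Proof.
apply: (@subclosed_compact _ _ [set v : 'rV[R]_d.+1 | forall i, `[0, 1]%classic (v ord0 i)]).
- have -> : std_simplex R d = (\bigcap_(i in [set: 'I_d.+1])
      (fun x : 'rV[R]_d.+1 => x 0 i) @^-1` [set y | 0 <= y]) `&`
      (fun x : 'rV[R]_d.+1 => \sum_i x 0 i) @^-1` [set y | y = 1].
    apply/seteqP; split => x /= [x0 x1]; split => //.
      by move=> i _ /=; apply: x0.
    by move=> i; apply: x0.
  apply: closedI; first apply: closed_bigI => i _.
    apply: preimage_closed; last exact: closed_ge.
    by move=> x _; apply: coord_continuous.
  apply: preimage_closed; last exact: closed_eq.
  move=> x _; elim: (index_enum _) => [|j s IHs].
    by under eq_fun do rewrite big_nil; apply: cst_continuous.
  under eq_fun do rewrite big_cons.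
  by apply: (@continuousD _ _ _ (fun x : 'rV[R]_d.+1 => x 0 j)); first exact: coord_continuous.
- by apply: (@rV_compact R d.+1 (fun=> `[0, 1]%classic)) => i; exact: segment_compact.
move=> x [x0 x1] i /=; rewrite in_itv /= x0 /= -x1 (bigD1 i) //= lerDl.
by apply: sumr_ge0.
Qed.

Definition covers_simplex (U : set (set X)) d (s : std_simplex R d -> X) :=
  forall x : std_simplex R d, exists2 A, U A & nbhs x (s @^-1` A).

(** Compactness is used in its near-covering form, with the filter of small positive radii; halving
    radii absorbs the displacement of the centre. *)
Lemma lebesgue_number (U : set (set X)) d (s : std_simplex R d -> X) :
  covers_simplex U s -> exists2 e, 0 < e & forall v, std_simplex R d v ->
    exists2 A, U A & forall v', std_simplex R d v' -> `|v - v'| <= e -> A (sext s v').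
Proof.
move=> sU; have /compact_near_coveringP := @compact_std_simplex d.
move=> /(_ R (0^'+) (fun e v => exists2 A, U A & forall v', std_simplex R d v' ->
  `|v - v'| <= e -> A (sext s v'))) [].
- move=> v vd; have [x vE _] := sextP s vd.
  have [A UA xA] := sU x; rewrite /= in xA.
  have [W [Wo Wv WA]] : exists W : set 'rV[R]_d.+1,
      [/\ open W, W v & forall y, W (set_val y) -> A (s y)].
    move: xA => [B [[W Wo <-] Wx WA]]; exists W; split => //.
    by rewrite vE.
  have /nbhs_ballP[e /= e0 eW] : nbhs v W by apply: open_nbhs_nbhs.
  exists (ball v (e / 2), [set t | t < e / 2]).
    split; first by apply: nbhsx_ballx; rewrite divr_gt0.
    by apply: nbhs_right_lt; rewrite divr_gt0.
  move=> [v1 e1] [/= vv1 e1e]; exists A => // v' v'd v1v'.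
  have [x' v'E ->] := sextP s v'd; apply: WA; rewrite -v'E; apply: eW.
  rewrite -ball_normE /= in vv1 *.
  have -> : v - v' = (v - v1) + (v1 - v') by zmod.
  apply: le_lt_trans (ler_normD _ _) _; rewrite [ltRHS]splitr ltrD //.
  exact: le_lt_trans e1e.
move=> e /= e0 eP; exists (e / 2); first by rewrite divr_gt0.
move=> v vd; apply: (eP (e / 2)) => //; last by rewrite divr_gt0.
rewrite /ball_ /= sub0r normrN gtr0_norm ?divr_gt0 // ltr_pdivrMr //.
by rewrite ltr_pMr // ltr1n.
Qed.

End Lebesgue.

Section SmallChains.
Variables (R : realType) (F : fieldType) (X : topologicalType).

Definition small_simp (U : set (set X)) (s : asimp R X) :=
  if s is Some (existT d s) then exists2 A, U A & forall x, A (s x) else True.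

Definition covered_simp (U : set (set X)) (s : asimp R X) :=
  if s is Some (existT d s) then covers_simplex U s else True.

Lemma push_at0 (V : normedModType R) (G : V -> X) (c : {freeg (seq V) / F}) :
  push (fun tv : R^o * V => G tv.2) (lmap (fun v => (0, v) : R^o * V) c) = push G c.
Proof.
move: c; apply: fg_ext => [||w]; [lin|lin|rewrite lmap1 !push1 /pushs size_map].
case: (size w) => [//|d]; congr << _ >>; apply: amk_ext => x /=.
by rewrite /aff -(lcomb_map (@snd R^o V)) -map_comp map_id.
Qed.

Lemma iter_Sd_push (V : normedModType R) (E : set V) (G : V -> X) n (c : {freeg (seq V) / F}) :
  hull_closed E -> cts_on E G -> csub (all_in E) c ->
  iter n (@Sd R F X) (push G c) = push G (iter n (@sd R F V) c) /\
  csub (all_in E) (iter n (@sd R F V) c).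
Proof.
move=> hE cG cE; elim: n => [//|n [IHn IHE]]; split; last exact: sd_sup.
rewrite !iterS IHn /Sd oper_push; last exact: (csub_good hE cG).
exact: push_at0.
Qed.

Lemma small_Sd U c : csub (small_simp U) c -> csub (small_simp U) (@Sd R F X c).
Proof.
move=> cU; apply: (csub_map _ cU) => [|s]; first by lin.
case: s => [[d s]|] /=; last first.
  by move=> _; rewrite /Sd oper1 /=; apply: csubZ; apply: csub1.
move=> [A UA sA]; have : csub (inA A) (@Sd R F X << Some (existT _ d s) >>).
  by apply: csub_Sd; apply: csub1.
by apply: csubW => -[[d' s']|] //= s'A; exists A.
Qed.

Lemma small_chains U c : csub (covered_simp U) c ->
  exists n, csub (small_simp U) (iter n (@Sd R F X) c).
Proof.
(* The form for all large [m] is stable under sums, since two bounds can be replaced by their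
   maximum. *)
move=> cU; suff : exists n, forall m, (n <= m)%N ->
    csub (small_simp U) (iter m (@Sd R F X) c).
  by case=> n nP; exists n; apply: nP.
apply: (csub_ind (S := fun c => exists n, forall m, (n <= m)%N ->
    csub (small_simp U) (iter m (@Sd R F X) c)) cU).
- exists 0%N => m _; have -> : iter m (@Sd R F X) 0 = 0.
    by elim: m => //= m ->; rewrite linear0.
  exact: csub0.
- move=> a d e [n1 H1] [n2 H2]; exists (maxn n1 n2) => m; rewrite geq_max => /andP[m1 m2].
  have -> : iter m (@Sd R F X) (a *: d + e) = a *: iter m (@Sd R F X) d + iter m (@Sd R F X) e.
    by elim: m {m1 m2} => //= m ->; rewrite linearP.
  by apply: csubD; [apply: csubZ; apply: H1|apply: H2].
move=> s sU; suff [n nP] : exists n, csub (small_simp U) (iter n (@Sd R F X) << s >>).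
  exists n => m /subnK <-; rewrite iterD; elim: (m - n)%N => //= k IHk.
  exact: small_Sd.
case: s sU => [[d s]|] sU; last by exists 0%N; apply: csub1.
have [e e0 eP] := lebesgue_number sU.
have sc : cts_on (std_simplex R d) (sext s) by exact: (sext_cts (@cts_fun _ _ s)).
have hD := @hull_closed_simplex R d.
have [r evsM] := mesh_le_ex (evs R d).
have [n nP] : exists n, (d%:R / d.+1%:R) ^+ n * r <= e :> R.
  have q1 : `|d%:R / d.+1%:R : R| < 1.
    by rewrite ger0_norm ?divr_ge0 ?ler0n // ltr_pdivrMr ?ltr0n // mul1r ltr_nat.
  have H : (fun n => (d%:R / d.+1%:R : R) ^+ n * r) x @[x --> \oo] --> (0 : R).
    by rewrite -[X in _ --> X](mul0r r); apply: cvgM; [exact: cvg_expr|exact: cvg_cst].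
  have H2 : \forall m \near \oo, (d%:R / d.+1%:R : R) ^+ m * r < e by apply: (cvgr_lt _ H _ e0).
  by have /filter_ex[m /ltW] := H2; exists m.
exists n.
have -> : << Some (existT _ d s) >> = push (sext s) << evs R d >> :> achain R F X.
  by rewrite push1 pushs_evs amkE.
have [-> cD] := iter_Sd_push n hD sc (@csub_evs R F d).
have cM : csub (F := F) (fun u => (size u <= d.+1)%N /\ mesh_le r u) << evs R d >>.
  by apply: csub1; rewrite size_evs.
have cDM : csub (fun u => all_in (std_simplex R d) u /\ mesh_le e u)
    (iter n (@sd R F _) << evs R d >>).
  move=> u u0; split; first exact: cD.
  have [_ um] := @iter_sd_mesh R F _ d n r _ cM u u0.
  by move=> x y xu yu; apply: le_trans (um _ _ xu yu) nP.
apply: (csub_map _ cDM) => [|u [uD um]]; first by lin.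
rewrite push1; apply: csub1; rewrite /pushs; case su: (size u) => [//|d'].
have u0D : std_simplex R d (nth 0 u 0) by apply/uD/mem_nth; rewrite su.
have [A UA AP] := eP _ u0D.
rewrite /amk; case: pselect => //= uc; exists A => // x.
by apply: AP; [exact: hD|exact: aff_mesh].
Qed.

End SmallChains.

(** * Reflections act by a sign on the complement of their fixed space *)

Section ChainSplitting.
Variables (R : realType) (F : fieldType) (X : topologicalType).

Lemma csub_inAI (A B : set X) (c : achain R F X) :
  csub (inA A) c -> csub (inA B) c -> csub (inA (A `&` B)) c.
Proof.
by move=> cA cB s s0; have := cA s s0; have := cB s s0; case: s {s0} => [[d s]|] //= sB sA x.
Qed.

Lemma small_split (A B : set X) (c : achain R F X) :
  csub (small_simp [set A; B]) c ->
  exists a b, [/\ csub (inA A) a, csub (inA B) b & c = a + b].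
Proof.
move=> cS; apply: (@csub_ind _ _ _ (fun c => exists a b : achain R F X,
  [/\ csub (inA A) a, csub (inA B) b & c = a + b]) c cS).
- by exists 0, 0; split; [exact: csub0|exact: csub0|rewrite addr0].
- move=> t _ _ [a [b [aA bB ->]]] [a' [b' [aA' bB' ->]]].
  exists (t *: a + a'), (t *: b + b'); split.
  + by apply: csubD => //; apply: csubZ.
  + by apply: csubD => //; apply: csubZ.
  + by rewrite scalerDr; zmod.
- move=> [[d s]|] /=; last by exists << None >>, 0; rewrite addr0; split => //; [exact: csub1|exact: csub0].
  move=> [D [->|->] sD].
    by exists << Some (existT _ d s) >>, 0; rewrite addr0; split => //; [exact: csub1|exact: csub0].
  by exists 0, << Some (existT _ d s) >>; rewrite add0r; split => //; [exact: csub0|exact: csub1].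
Qed.

End ChainSplitting.

Section Reflection.
Variables (R : realType) (F : fieldType) (N : normedModType R) (E Z : set N).
Variables (tau : {linear N -> N}) (n : nat) (delta : nat -> {linear N -> R}).
Variables (w : nat -> N) (l0 : N).
Hypothesis tau_cts : continuous tau.
Hypothesis tauK : forall x, tau (tau x) = x.
Hypothesis tauE : forall x, E x -> E (tau x).
Hypothesis E_conv : forall t x y, @unit_itv R t -> E x -> E y -> E ((1 - t) *: x + t *: y).
Hypothesis Z_closed : closed Z.
Hypothesis Z_lin : forall a x y, Z x -> Z y -> Z (a *: x + y).
Hypothesis Z_tau : forall x, Z (tau x - x).
Hypothesis delta_cts : forall j, continuous (delta j).
Hypothesis delta_tau : forall j x, delta j (tau x) = - delta j x.
Hypothesis delta_w : forall i j, i <> j -> delta j (w i) = 0.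
Hypothesis delta_w0 : forall i, (i < n)%N -> 0 < delta i (w i).
Hypothesis Zw : forall i, Z (w i).
Hypothesis Zl0 : Z l0.
Hypothesis delta_l0 : forall j, delta j l0 = 0.
Hypothesis El0w : forall i, (i < n)%N -> E (l0 + w i).

(** The convex set [E] minus the subspace of [Z] where the coordinates [delta j], i <= j < n,
    vanish. Here [tau] is trivial modulo [Z] and negates each [delta j]. At i = n only [Z] is
    removed; lowering i shrinks the removed subspace by one reflected direction. *)
Definition refl_compl i : set N :=
  [set x | E x /\ (~ Z x \/ exists j, [/\ (i <= j)%N, (j < n)%N & delta j x != 0])].

(** [refl_compl i.+1] enlarged by the points where [delta i] has a given sign. The two signs cover
    [refl_compl i], meet in [refl_compl i.+1] and are exchanged by [tau]. *)
Definition refl_half i (sgn : R) : set N :=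
  [set x | E x /\ (~ Z x \/ (exists j, [/\ (i < j)%N, (j < n)%N & delta j x != 0]) \/
    0 < sgn * delta i x)].

Let ZD x y : Z x -> Z y -> Z (x + y).
Proof. by move=> Zx Zy; rewrite -[x]scale1r; apply: Z_lin. Qed.
Let Z0 : Z 0.
Proof. by have := Z_lin (-1) Zl0 Zl0; rewrite scaleN1r addrC subrr. Qed.
Let ZZ a x : Z x -> Z (a *: x).
Proof. by move=> Zx; rewrite -[_ *: _]addr0; apply: Z_lin. Qed.
Let Zcancel x y : Z y -> Z (x + y) -> Z x.
Proof.
move=> Zy Zxy; have -> : x = -1 *: y + (x + y) by rewrite scaleN1r; zmod.
exact: Z_lin.
Qed.

Lemma refl_half_tau i sgn x : refl_half i sgn x -> refl_half i (- sgn) (tau x).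
Proof.
move=> [Ex H]; split; first exact: tauE.
case: H => [nZ|[[j [ij jn dj]]|d0]].
- left => Zt; apply: nZ; have Zd := Z_tau (tau x); rewrite tauK in Zd.
  by have := ZD Zd Zt; rewrite subrK.
- by right; left; exists j; rewrite delta_tau oppr_eq0.
- by right; right; rewrite delta_tau mulrNN.
Qed.

Lemma refl_halfI i : refl_half i 1 `&` refl_half i (-1) `<=` refl_compl i.+1.
Proof.
move=> x [[Ex H1] [_ H2]]; split => //.
case: H1 => [|[|d1]]; [by left|by right|case: H2 => [|[|d2]]; [by left|by right|]].
by rewrite mul1r in d1; rewrite mulN1r oppr_gt0 ltNge (ltW d1) in d2.
Qed.

Lemma refl_compl_half i sgn : refl_compl i.+1 `<=` refl_half i sgn.
Proof. by move=> x [Ex [?|?]]; split => //; [left|right; left]. Qed.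

Lemma refl_half_compl i sgn : (i < n)%N -> refl_half i sgn `<=` refl_compl i.
Proof.
move=> ni x [Ex [?|[[j [ij jn dj]]|d0]]]; split => //; first by left.
  by right; exists j; split => //; exact: ltnW.
by right; exists i; split => //; apply: contraTneq d0 => ->; rewrite mulr0 ltxx.
Qed.

Let open_delta j : open [set x : N | delta j x != 0].
Proof.
rewrite (_ : [set _ | _] = delta j @^-1` [set y : R | y != 0]) //.
apply: open_comp; first by move=> x _; apply: delta_cts.
exact: open_neq.
Qed.

Let open_delta_gt j sgn : open [set x : N | 0 < sgn * delta j x].
Proof.
rewrite (_ : [set _ | _] = (fun x => sgn * delta j x) @^-1` [set y : R | 0 < y]) //.
apply: open_comp; last exact: open_gt.
move=> x _; apply: (@continuousM _ _ (cst sgn) (delta j)); first exact: cst_continuous.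
exact: delta_cts.
Qed.

Lemma refl_covered i (c : achain R F N) : csub (inA (refl_compl i)) c ->
  csub (covered_simp [set refl_half i 1; refl_half i (-1)]) c.
Proof.
apply: csubW => -[[d s]|] //= sS x.
have sc := @cts_fun _ _ s.
have mem sgn (W : set N) : open W -> W (s x) ->
    (forall y, E y -> W y -> refl_half i sgn y) ->
    nbhs x (s @^-1` refl_half i sgn).
  move=> Wo Ws WH; have : nbhs x (s @^-1` W) by apply: sc; apply: open_nbhs_nbhs.
  by apply: filterS => y Wy; apply: WH => //; have [] := sS y.
have [Ex [nZ|[j [ij jn dj]]]] := sS x.
  exists (refl_half i 1); [by left|apply: (mem _ (~` Z)) => //].
    exact: closed_openC.
  by move=> y Ey nZy; split => //; left.
rewrite leq_eqVlt in ij; case/orP: ij => [/eqP ij|ij]; last first.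
  exists (refl_half i 1); [by left|apply: (mem _ [set y | delta j y != 0]) => //].
  by move=> y Ey dy; split => //; right; left; exists j.
rewrite -{j}ij in jn dj *; case: (ltrgtP 0 (delta i (s x))) => [d0|d0|d0].
- exists (refl_half i 1); [by left|apply: (mem _ [set y | 0 < 1 * delta i y]) => //].
    by rewrite /= mul1r.
  by move=> y Ey dy; split => //; right; right.
- exists (refl_half i (-1)); [by right|apply: (mem _ [set y | 0 < -1 * delta i y]) => //].
    by rewrite /= mulN1r oppr_gt0.
  by move=> y Ey dy; split => //; right; right.
- by rewrite -d0 eqxx in dj.
Qed.

Let segment_cts (g : N -> N) : continuous g ->
  continuous (fun tx : R^o * N => (1 - tx.1) *: tx.2 + tx.1 *: g tx.2).
Proof.
move=> gc x.
have c1 : continuous (fun tx : R^o * N => tx.1) by move=> y; exact: cvg_fst.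
have c2 : continuous (fun tx : R^o * N => tx.2) by move=> y; exact: cvg_snd.
apply: (@cvgD _ _ _ _ (nbhs_filter x)).
  apply: (@cvgZ _ _ _ _ (nbhs_filter x)); last exact: c2.
  apply: (@cvgB _ _ _ _ (nbhs_filter x)); first exact: cvg_cst.
  exact: c1.
apply: (@cvgZ _ _ _ _ (nbhs_filter x)); first exact: c1.
by apply: continuous_comp; [exact: c2|exact: gc].
Qed.

(** The half is star-shaped about l0 + w i: this point lies in [Z], annihilates the later
    coordinates and has positive i-th coordinate, so each of the three alternatives persists along
    the segment towards it. *)
Lemma refl_half_acyclic1 i (z : achain R F N) : (i < n)%N ->
  csub (inA (refl_half i 1)) z -> abd z = 0 ->
  exists2 e, csub (inA (refl_half i 1)) e & abd e = z.
Proof.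
move=> ni; pose p := l0 + w i.
have dp : 0 < delta i p by rewrite /p linearD /= delta_l0 add0r delta_w0.
have Zp : Z p by apply: ZD.
have dpj j : i <> j -> delta j p = 0.
  by move=> ij; rewrite /p linearD /= delta_l0 add0r delta_w.
have Up : refl_half i 1 p by split; [exact: El0w|right; right; rewrite mul1r].
apply: (contractible_acyclic (H := fun t x => (1 - t) *: x + t *: p) (p := p)) => //.
- by apply: cts_on_cts; apply: (segment_cts (g := fun=> p)) => x; apply: cst_continuous.
- move=> t x t01 [Ex Hx]; split; first by apply: E_conv => //; apply: El0w.
  have /andP[t0 t1] := t01.
  (* At the end point the first two alternatives are lost, but the third one holds there. *)
  have [->|tn1] := eqVneq t 1.
    by right; right; rewrite subrr scale0r add0r scale1r mul1r.
  have t1' : 0 < 1 - t by rewrite subr_gt0 lt_neqAle tn1.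
  case: Hx => [nZ|[[j [ij jn dj]]|d0]].
  + left => Zy; apply: nZ; have := Zcancel (ZZ t Zp) Zy => /(ZZ (1 - t)^-1).
    by rewrite scalerA mulVf ?scale1r // gt_eqF.
  + right; left; exists j; split => //; rewrite linearP /= linearZ /= dpj.
      by rewrite scaler0 addr0 scaler_eq0 negb_or dj andbT gt_eqF.
    by apply/eqP; rewrite ltn_eqF.
  + right; right; rewrite mul1r linearP /= linearZ /= mul1r in d0 *.
    by rewrite ltr_pwDl ?mulr_gt0 // mulr_ge0 // ltW.
- by move=> x _; rewrite subr0 scale1r scale0r addr0.
- by move=> x _; rewrite subrr scale0r add0r scale1r.
Qed.

Lemma refl_half_acyclicN1 i (z : achain R F N) : (i < n)%N ->
  csub (inA (refl_half i (-1))) z -> abd z = 0 ->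
  exists2 e, csub (inA (refl_half i (-1))) e & abd e = z.
Proof.
move=> ni zU z0.
have tc : cts_on (refl_half i (-1)) tau by exact: cts_on_cts.
have tc1 : cts_on (refl_half i 1) tau by exact: cts_on_cts.
have tzU : csub (inA (refl_half i 1)) (apush tau z).
  by apply: (csub_apush _ zU) => y yU; have := refl_half_tau yU; rewrite opprK.
have [|e eU ez] := refl_half_acyclic1 ni tzU.
  by rewrite (apush_bd tc) // z0 linear0.
exists (apush tau e); first by apply: (csub_apush _ eU) => y; exact: refl_half_tau.
rewrite (apush_bd tc1) // ez (apush_comp _ tc zU).
rewrite (apush_ext (g := id) zU) ?apush_id // => y _.
exact: tauK.
Qed.

(* The complement is homologically a sphere of dimension m - 1, on which the
   reflection acts as the antipode. It is the union of two contractible halves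
   exchanged by [tau], and intersecting in the complement for [i.+1], whence the
   induction. *)
Lemma refl_sign m i (z : achain R F N) : (i + m)%N = n ->
  csub (inA (refl_compl i)) z -> abd z = 0 ->
  exists2 e, csub (inA (refl_compl i)) e & abd e = apush tau z - (-1) ^+ m *: z.
Proof.
elim: m i z => [|m IHm] i z.
  rewrite addn0 => -> {i} zS z0.
  (* Since tau x - x lies in [Z], the segment from x to tau x never enters [Z] if x is outside; so
     [tau] is homotopic to the identity. *)
  pose H t x := (1 - t) *: x + t *: tau x.
  exists (oper H (prism_lop R F) z).
    apply: (csub_oper _ zS) => t x t01 [Ex Hx]; split.
      by apply: E_conv => //; apply: tauE.
    case: Hx => [nZ|[j [nj jn]]]; last by rewrite leqNgt jn in nj.
    left => ZH; apply: nZ; apply: (Zcancel (ZZ t (Z_tau x))).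
    by move: ZH; rewrite /H scalerBl scale1r scalerBr; congr Z; zmod.
  have Hc : cts_on (X := (R^o * N)%type) (@unit_itv R `*` refl_compl n)
      (fun ty => H ty.1 ty.2).
    by apply: cts_on_cts; apply: segment_cts.
  rewrite (homotopy_bd Hc) // z0 linear0 subr0 expr0 scale1r; congr (_ - _).
    by apply: (apush_ext zS) => y _; rewrite /H subrr scale0r add0r scale1r.
  rewrite (apush_ext (g := id) zS) ?apush_id // => y _.
  by rewrite /H subr0 scale1r scale0r addr0.
move=> inm zS z0; have ni : (i < n)%N by rewrite -inm addnS ltnS leq_addr.
(* A Mayer-Vietoris argument by hand: a subdivision of [z] is a + b with one summand in each half,
   and the boundary of [a] lies in the intersection, where the induction hypothesis gives [e]. *)
have [k zk] := small_chains (refl_covered zS).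
have [a [b [aU bU zab]]] := small_split zk.
have tc A : cts_on A tau by exact: cts_on_cts.
have dab : abd a = - abd b.
  apply/eqP; rewrite -subr_eq0 opprK -linearD -zab /=.
  rewrite -[abd _]/(abd (iter k (@Sd R F N) z)) iter_Sd_bd z0; apply/eqP.
  by elim: k {zk zab} => //= k ->; rewrite linear0.
have daS : csub (inA (refl_compl i.+1)) (abd a).
  apply: (csubW (P := inA (refl_half i 1 `&` refl_half i (-1)))).
    by move=> s; apply: inAW; exact: refl_halfI.
  apply: csub_inAI; first exact: csub_abd.
  by rewrite dab; apply: csubN; apply: csub_abd.
have [|e eS eda] := IHm i.+1 (abd a) _ daS (abd_abd a); first by rewrite addSn -addnS.
set t := (-1) ^+ m in eda *.
have tU sgn (c : achain R F N) : csub (inA (refl_half i sgn)) c -> csub (inA (refl_half i (- sgn))) (apush tau c).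
  by move=> cU; apply: (csub_apush _ cU) => y; exact: refl_half_tau.
have eU sgn : csub (inA (refl_half i sgn)) e.
  by apply: csubW eS => s; apply: inAW; exact: refl_compl_half.
(* This chain and tau a + t b - e are cycles in opposite halves, by the choice of [e]. Their sum is
   tau (a + b) + t (a + b), and t = (-1)^m is minus the sign wanted for m + 1. *)
have [||f1 f1U f1E] := @refl_half_acyclic1 i (t *: a + apush tau b + e) ni.
- apply: csubD => //; apply: csubD; first exact: csubZ.
  by rewrite -[1]opprK; apply: (tU).
- rewrite !linearD linearZ /= (apush_bd (tc (refl_half i (-1)))) // eda.
  by rewrite dab !linearN /=; zmod.
have [||f2 f2U f2E] := @refl_half_acyclicN1 i (apush tau a + t *: b - e) ni.
- by apply: csubB => //; apply: csubD; [apply: (tU)|exact: csubZ].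
- rewrite linearB linearD linearZ /= (apush_bd (tc (refl_half i 1))) // eda.
  by rewrite dab !linearN /=; zmod.
have fS sgn (f : achain R F N) : csub (inA (refl_half i sgn)) f -> csub (inA (refl_compl i)) f.
  by apply: csubW => s; apply: inAW; exact: refl_half_compl.
have hS : csub (inA (refl_compl i)) (Sdhn k z) by exact: csub_Sdhn.
have := Sdhn_bd k z; rewrite z0 Sdhn0 subr0 zab => hE.
(* The last summand undoes the subdivision of [z]. *)
exists (f1 + f2 + (apush tau (Sdhn k z) + t *: Sdhn k z)).
  apply: csubD; first by apply: csubD; [apply: fS f1U|apply: fS f2U].
  apply: csubD; last exact: csubZ.
  apply: (csub_apush _ hS) => y [Ey Hy]; split; first exact: tauE.
  case: Hy => [nZ|[j [ij jn dj]]]; last by right; exists j; rewrite delta_tau oppr_eq0.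
  left => Zt; apply: nZ; have Zd := Z_tau (tau y); rewrite tauK in Zd.
  by have := ZD Zd Zt; rewrite subrK.
rewrite !linearD linearZ /= f1E f2E (apush_bd (tc (refl_compl i))) // hE.
rewrite exprS mulN1r scaleNr opprK !linearB !linearD /= -/t.
by zmod.
Qed.

End Reflection.

(** * Product charts *)

Lemma prod_cts (I : eqType) (T M : topologicalType) (f : T -> {ptws I -> M}) :
  (forall i, continuous (fun t => f t i)) -> continuous f.
Proof.
move=> fi t; apply/cvg_sup => i U [V [[W Wo <-] Wf WU]].
have fW : nbhs t (fun x => W (f x i)) by apply: (fi i t W); apply: open_nbhs_nbhs.
suff : nbhs t (f @^-1` U) by [].
by apply: filterS fW => x; exact: WU.
Qed.

Lemma mx_cts (R : realType) (T : topologicalType) m n (f : T -> 'M[R]_(m, n)) :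
  (forall i j, continuous (fun t => f t i j)) -> continuous f.
Proof.
move=> fij t A [P Pf PA].
have : \forall x \near t, forall i j, P i j (f x i j).
  by apply: filter_forall => i; apply: filter_forall => j; apply: (fij i j t).
by apply: filterS => x Px; apply: PA.
Qed.

Lemma shift_ge0 (R : realType) (e x y : R) : 0 < e -> - (e / 4) <= y -> 0 <= x ->
  0 <= x + e / 2 + y.
Proof. by move=> ? ? ?; lra. Qed.

Lemma shift_lt (R : realType) (e x y : R) : 0 < e -> `|x| <= e / 2 -> `|y| <= e / 4 ->
  `|x + y| < e.
Proof. by move=> ? ? ?; apply: le_lt_trans (ler_normD _ _) _; lra. Qed.

Section BoxModel.
Variables (R : realType) (F : fieldType) (k n : nat) (cl : rel 'I_k) (a b : 'I_k).
Local Notation N := 'M[R]_(k, n).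
Variables (c : 'I_k -> 'rV[R]_n) (eps : R).
Hypothesis eps0 : 0 < eps.
Hypothesis n_odd : odd n.
Hypothesis ab : a != b.
Hypothesis cl_refl : reflexive cl.
Hypothesis clab : cl a b.
Hypothesis cl_c : forall i j, cl i j -> c i = c j.
Hypothesis c_half : forall i, half_space (c i).

Definition box (v : 'rV[R]_n) : set 'rV[R]_n :=
  [set u | half_space u /\ forall j, `|v 0 j - u 0 j| < eps].

Definition boxes : set N := [set u | forall i, box (c i) (row i u)].

Definition eq_rows : set N := [set u | forall i j, cl i j -> row i u = row j u].

Let tau (u : N) : N := xrow a b u.
Let tau_linear : linear tau. Proof. by move=> t x y; rewrite /tau linearP. Qed.
HB.instance Definition _ := GRing.isLinear.Build R N N *:%R tau tau_linear.

(** A condition on the symmetric part of [u] alone, so that tau u - u always lies in it; together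
    with the vanishing of all [delta j] it cuts out [eq_rows]. *)
Let Z : set N := [set u | eq_rows (u + tau u)].

Let delta (j : nat) (u : N) : R^o :=
  if insub j is Some j' then u a j' - u b j' else 0.
Let delta_linear j : linear (delta j).
Proof.
move=> t x y; rewrite /delta; case: insub => [j'|]; last by rewrite scaler0 addr0.
by rewrite !mxE /= scalerBr /GRing.scale /=; zmod.
Qed.
HB.instance Definition _ j := GRing.isLinear.Build R N R^o *:%R (delta j) (delta_linear j).

Let half_vec : 'rV[R]_n := \row_j (if j == 0%N :> nat then eps / 2 else 0).
Let l0 : N := \matrix_(i, j) (c i 0 j + half_vec 0 j).
Let w (i : nat) : N := \matrix_(p, q)
  (if q == i :> nat then (eps / 4) * ((p == a)%:R - (p == b)%:R) else 0).

Lemma boxes_conv t x y : @unit_itv R t -> boxes x -> boxes y ->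
  boxes ((1 - t) *: x + t *: y).
Proof.
move=> /andP[t0 t1] xB yB i; have [xh xb] := xB i; have [yh yb] := yB i.
have t1' : 0 <= 1 - t by rewrite subr_ge0.
split=> [j j0|j]; rewrite !mxE.
  by have := xh j j0; have := yh j j0; rewrite !mxE => y0 x0; rewrite addr_ge0 // mulr_ge0.
have := xb j; have := yb j; rewrite !mxE => yj xj.
have -> : c i 0 j - ((1 - t) * x i j + t * y i j) =
    (1 - t) * (c i 0 j - x i j) + t * (c i 0 j - y i j) by lra.
apply: le_lt_trans (ler_normD _ _) _; rewrite !normrM (ger0_norm t1') (ger0_norm t0).
have [->|tn0] := eqVneq t 0; first by rewrite subr0 mul1r mul0r addr0.
have {tn0} t0' : 0 < t by rewrite lt_neqAle eq_sym tn0.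
have -> : eps = (1 - t) * eps + t * eps by lra.
by rewrite ler_ltD // ?ltr_pM2l // ler_wpM2l // ltW.
Qed.

Lemma box_closed_Z : closed Z.
Proof.
have -> : Z = \bigcap_(p in [set: 'I_k * 'I_k * 'I_n])
    [set u | cl p.1.1 p.1.2 -> (u + tau u) p.1.1 p.2 - (u + tau u) p.1.2 p.2 = 0].
  apply/seteqP; split => u /= uZ.
    move=> [[i j] l] _ /= ij; have /rowP/(_ l) := uZ i j ij.
    by rewrite mxE [in RHS]mxE => ->; rewrite subrr.
  move=> i j ij; apply/rowP => l; rewrite mxE [in RHS]mxE.
  by apply/eqP; rewrite -subr_eq0; apply/eqP; apply: (uZ (i, j, l)).
apply: closed_bigI => -[[i j] l] _ /=.
have [ij|nij] := boolP (cl i j); last first.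
  by rewrite (_ : [set _ | _] = setT); [exact: closedT|apply/seteqP; split].
have -> : [set u : N | true -> (u + tau u) i l - (u + tau u) j l = 0] =
    (fun u : N => (u i l + u (tperm a b i) l) - (u j l + u (tperm a b j) l)) @^-1` [set y | y = 0].
  apply/seteqP; split => u /=; rewrite !mxE; first by move/(_ isT).
  by move=> -> _.
apply: preimage_closed; last exact: closed_eq.
move=> u _; apply: (@cvgB _ _ _ _ (nbhs_filter u));
  by apply: (@cvgD _ _ _ _ (nbhs_filter u)); apply: coord_continuous.
Qed.

(** If all [delta j] vanish then rows [a] and [b] agree and [tau] fixes [u]; membership in [Z] then
    compares doubled rows, and 2 can be cancelled. *)
Lemma refl_complE : refl_compl boxes Z n delta 0 = boxes `&` ~` eq_rows.
Proof.
apply/seteqP; split => u [uB H]; split => //.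
  move=> ud; have uab : row a u = row b u by apply: ud.
  have tu : tau u = u.
    apply/row_matrixP => i; rewrite /tau; apply/rowP => l; rewrite !mxE.
    have /rowP/(_ l) := uab; rewrite !mxE => E.
    by case: tpermP => [->|->|//]; rewrite E.
  case: H => [|[j [_ jn]]].
    by apply=> i j ij; rewrite tu !linearD /= (ud i j).
  rewrite -[X in X != 0]/(delta j u); have -> : delta j u = 0; last by rewrite eqxx.
  by rewrite /delta insubT /=; have /rowP/(_ (Sub j jn)) := uab; rewrite !mxE => ->; rewrite subrr.
have [uZ|] := pselect (Z u); [right|by left].
apply: contrapT => H0; apply: H => i j ij.
have uab : row a u = row b u.
  apply/rowP => l; rewrite !mxE; apply/eqP; rewrite -subr_eq0; apply/eqP.
  apply: contrapT => /eqP d0; apply: H0; exists l; split => //.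
  by rewrite -[X in X != 0]/(delta l u) /delta valK.
have tu : tau u = u.
  apply/row_matrixP => p; rewrite /tau; apply/rowP => l; rewrite !mxE.
  have /rowP/(_ l) := uab; rewrite !mxE => E.
  by case: tpermP => [->|->|//]; rewrite E.
have := uZ i j ij; rewrite tu !linearD /=; move: (row i u) (row j u) => x y /eqP.
rewrite -subr_eq0 opprD addrACA -mulr2n -scaler_nat scaler_eq0 pnatr_eq0 /= subr_eq0.
by move/eqP.
Qed.

Let eps2 : 0 < eps / 2. Proof. by rewrite divr_gt0. Qed.

Let half_vec_le j : `|half_vec 0 j| <= eps / 2.
Proof. by rewrite mxE; case: ifP => _; rewrite ?normr0 ?ger0_norm // ltW. Qed.

Lemma boxes_l0 : boxes l0.
Proof.
move=> i; split=> [j j0|j].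
  by rewrite !mxE j0 eqxx addr_ge0 ?c_half // ltW.
rewrite mxE mxE opprD addrA subrr sub0r normrN.
by apply: le_lt_trans (half_vec_le j) _; rewrite ltr_pdivrMr // ltr_pMr // ltr1n.
Qed.

Lemma boxes_l0w i : boxes (l0 + w i).
Proof.
have wle p q : `|w i p q| <= eps / 4.
  rewrite mxE; case: ifP => _; last by rewrite normr0 divr_ge0 // ltW.
  have e4 : 0 <= eps / 4 by rewrite divr_ge0 // ltW.
  rewrite normrM (ger0_norm e4) ler_piMr //.
  by case: (p == a); case: (p == b); rewrite ?subrr ?subr0 ?sub0r ?normrN ?normr0 ?normr1.
move=> p; split=> [q q0|q].
  have := wle p q; rewrite ler_norml => /andP[wq _].
  rewrite [row _ _ _ _]mxE [(l0 + w i) p q]mxE [l0 p q]mxE mxE q0 eqxx.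
  have h2 : 0 <= c p 0 q by exact: c_half.
  exact: shift_ge0 eps0 wq h2.
have -> : c p 0 q - row p (l0 + w i) 0 q = - (half_vec 0 q + w i p q).
  by rewrite [row _ _ _ _]mxE [(l0 + w i) p q]mxE [l0 p q]mxE; zmod.
by rewrite normrN; apply: (shift_lt eps0).
Qed.

Let row_tau i (u : N) : row i (tau u) = row (tperm a b i) u.
Proof. by apply/rowP => l; rewrite !mxE. Qed.

Lemma boxes_sign (z : achain R F N) :
  csub (inA (boxes `&` ~` eq_rows)) z -> abd z = 0 ->
  exists2 e, csub (inA (boxes `&` ~` eq_rows)) e & abd e = apush (xrow a b) z + z.
Proof.
rewrite -refl_complE => zB z0.
have tauK x : tau (tau x) = x.
  by apply/row_matrixP => i; rewrite !row_tau tpermK.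
have dc j : continuous (fun u : N => (delta j u : R)).
  move=> u; rewrite /delta /=; case: insub => [j'|]; last exact: cst_continuous.
  by apply: (@cvgB _ _ _ _ (nbhs_filter u)); apply: coord_continuous.
have dt j x : delta j (tau x) = - delta j x.
  rewrite /delta; case: insub => [j'|]; last by rewrite oppr0.
  by rewrite !mxE tpermL tpermR opprB.
have dw i j : i <> j -> delta j (w i) = 0.
  move=> ij; rewrite /delta; case: insubP => [j' _ j'E|//].
  by rewrite !mxE j'E; case: eqP => [ji|]; [case: ij|rewrite subrr].
have dw0 i : (i < n)%N -> 0 < (delta i (w i) : R).
  move=> ni; rewrite /delta insubT /= !mxE !eqxx (negPf ab) [b == a]eq_sym (negPf ab).
  by rewrite subr0 sub0r mulr1 mulrN1 opprK addr_gt0 // divr_gt0.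
have dl j : delta j l0 = 0.
  rewrite /delta; case: insub => [j'|//].
  by rewrite !mxE (cl_c clab) subrr.
have := @refl_sign R F N boxes Z tau n delta w l0 _ tauK _ boxes_conv box_closed_Z
  _ _ _ _ _ _ _ _ _ (fun i _ => boxes_l0w i) n 0%N z (add0n n) zB z0.
(* The odd dimension enters here: (-1)^n = -1 turns the difference of [tau z] and its sign multiple
   into a sum. *)
rewrite -signr_odd n_odd expr1 scaleN1r opprK; apply.
- apply: mx_cts => i j; rewrite /tau.
  by under eq_fun do rewrite mxE; apply: coord_continuous.
- move=> x xB i; rewrite row_tau.
  case: tpermP => [->|->|_ _]; [|rewrite -(cl_c clab)|]; last exact: xB.
    by rewrite (cl_c clab); apply: xB.
  exact: xB.
- move=> t x y xZ yZ i j ij; rewrite [tau (_ + _)]linearP.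
  have -> : t *: x + y + (t *: tau x + tau y) = t *: (x + tau x) + (y + tau y).
    by rewrite scalerDr; zmod.
  by rewrite !linearP /= (xZ i j ij) (yZ i j ij).
- move=> x i j ij; have -> : tau x - x + tau (tau x - x) = 0.
    by rewrite linearB /= tauK; zmod.
  by rewrite !linear0.
- exact: dc.
- exact: dt.
- exact: dw.
- exact: dw0.
- move=> i p q pq; have -> : w i + tau (w i) = 0.
    apply/matrixP => r s; rewrite !mxE; case: ifP => _; last by rewrite addr0.
    rewrite -mulrDr; case: tpermP => [->|->|/eqP/negPf -> /eqP/negPf ->].
    + by rewrite !eqxx (negPf ab) [b == a]eq_sym (negPf ab) subr0 sub0r subrr mulr0.
    + by rewrite !eqxx (negPf ab) [b == a]eq_sym (negPf ab) subr0 sub0r addrC subrr mulr0.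
    + by rewrite subrr addr0 mulr0.
  by rewrite !linear0.
- move=> i j ij; have tl : tau l0 = l0.
    apply/matrixP => r s; rewrite !mxE; congr (_ + _).
    by case: tpermP => [->|->|//]; rewrite (cl_c clab).
  rewrite tl !linearD /=; have -> : row i l0 = row j l0.
    by apply/rowP => l; rewrite !mxE (cl_c ij).
  by [].
- exact: dl.
Qed.

Lemma boxes_acyclic (z : achain R F N) : csub (inA boxes) z -> abd z = 0 ->
  exists2 e, csub (inA boxes) e & abd e = z.
Proof.
move=> zB z0.
apply: (@contractible_acyclic R F _ boxes (fun t x => (1 - t) *: x + t *: l0) l0 z) => //.
- apply: cts_on_cts => x.
  apply: (@cvgD _ _ _ _ (nbhs_filter x)); apply: (@cvgZ _ _ _ _ (nbhs_filter x)).
  + by apply: (@cvgB _ _ _ _ (nbhs_filter x)); [exact: cvg_cst|exact: cvg_fst].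
  + exact: cvg_snd.
  + exact: cvg_fst.
  + exact: cvg_cst.
- by move=> t x t01 xB; apply: boxes_conv => //; exact: boxes_l0.
- by move=> x _; rewrite subr0 scale1r scale0r addr0.
- by move=> x _; rewrite subrr scale0r add0r scale1r.
- exact: boxes_l0.
Qed.

End BoxModel.

Lemma within_cts_on (X Y : topologicalType) (A : set X) (f : X -> Y) :
  {within A, continuous f} -> cts_on A f.
Proof.
move=> /subspace_continuousP fA T g gc gA t B fB.
have gB : nbhs (g t) (fun y => A y -> B (f y)) by exact: (fA _ (gA t) B fB).
have : nbhs t (fun u => A (g u) -> B (f (g u))) by exact: (gc t _ gB).
by apply: filterS => u; apply.
Qed.

Section BoxNeighbourhoods.
Variables (R : realType) (n : nat).

(** [phi] and [psi] are mutually inverse between the open set [D] and a cube in the half-space; both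
    may be arbitrary elsewhere. *)
Definition box_nbhd (M : topologicalType) (y : M) (phi : M -> 'rV[R]_n)
    (psi : 'rV[R]_n -> M) (e : R) (D : set M) : Prop :=
  [/\ open D /\ D y,
    forall m, D m -> box e (phi y) (phi m) /\ psi (phi m) = m,
    forall u, box e (phi y) u -> D (psi u) /\ phi (psi u) = u,
    cts_on D phi & cts_on (box e (phi y)) psi].

(** All sufficiently small radii are provided, so that one common radius can later be chosen for the
    k coordinates. *)
Lemma box_nbhd_ex (M : smooth_manifold R n) (y : M) (O : set M) : nbhs y O ->
  exists phi psi e0, 0 < e0 /\ forall e, 0 < e <= e0 ->
    exists2 D, D `<=` O & box_nbhd y phi psi e D.
Proof.
move=> yO; have [chP cov _] := manifold_atlasP M.
have : [set: M] y by []; rewrite -cov => -[c cC cy].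
have [dO [V Vo imE] cK cc ic] := chP _ cC.
set phi := chart_map c in imE cK cc ic *; set psi := chart_inv c in cK ic *.
have im m : chart_dom c m -> V (phi m) /\ half_space (phi m).
  move=> dm; have : (phi @` chart_dom c) (phi m) by exists m.
  by rewrite imE.
have cK' m : chart_dom c m -> psi (phi m) = m by move=> dm; apply: cK; rewrite inE.
have [yV yh] := im y cy.
have /nbhs_ballP[e1 /= e10 e1V] : nbhs (phi y) V by apply: open_nbhs_nbhs.
have /subspace_continuousP ic' := ic.
have : nbhs (phi y) (fun u => (phi @` chart_dom c) u -> O (psi u)).
  have imy : (phi @` chart_dom c) (phi y) by exists y.
  have Oy : nbhs (psi (phi y)) O by rewrite cK'.
  exact: (ic' _ imy O Oy).
move=> /nbhs_ballP[e2 /= e20 e2O].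
exists phi, psi, (Num.min e1 e2); split; first by rewrite lt_min e10.
move=> e /andP[e0]; rewrite le_min => /andP[ee1 ee2].
have boxb u r : box e (phi y) u -> e <= r -> ball (phi y) r u.
  move=> [_ ub] er; split; first exact: lt_le_trans er.
  by move=> i j; rewrite (ord1 i); apply: lt_le_trans (ub j) er.
have boxim u : box e (phi y) u -> (phi @` chart_dom c) u.
  by move=> ub; rewrite imE; split; [apply: e1V; exact: boxb ee1|case: ub].
exists [set m | chart_dom c m /\ ball (phi y) e (phi m)].
  move=> m [dm [_ mb]]; have mB : box e (phi y) (phi m).
    by split; [case: (im m dm)|move=> j; have := mb 0 j].
  have := e2O (phi m) (boxb _ _ mB ee2) (boxim _ mB).
  by rewrite cK'.
split.
- split; last by split => //; exact: ballxx.
  rewrite openE => m [dm mb]; apply: filterI; first exact: open_nbhs_nbhs.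
  have cm : {for m, continuous phi}.
    by move: cc; rewrite continuous_open_subspace // => cc; apply: cc; rewrite inE.
  apply: (cm (ball (phi y) e)); apply: open_nbhs_nbhs; split => //.
  exact: ball_open.
- move=> m [dm [_ mb]]; split; last by rewrite cK'.
  by split; [case: (im m dm)|move=> j; have := mb 0 j].
- move=> u uB; have [m dm mu] := boxim u uB.
  have pu : psi u = m by rewrite -mu cK'.
  rewrite pu; split => //; split => //; rewrite mu.
  exact: boxb (lexx e).
- by apply: (@cts_onW _ _ _ (chart_dom c)) => [m []//|]; exact: within_cts_on.
- by apply: (cts_onW boxim); exact: within_cts_on.
Qed.

End BoxNeighbourhoods.

(** * The symmetric group on chains of M^k and local coinvariants *)

Section Action.
Variables (k : nat) (M : topologicalType).
Local Notation X := {ptws 'I_k -> M}.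

Definition act (s : 'S_k) (p : X) : X := fun i => p (s i).

Lemma act_cts s : continuous (act s).
Proof. by apply: prod_cts => i; exact: (@proj_continuous _ (fun=> M) (s i)). Qed.

Lemma actM s t p : act s (act t p) = act (s * t)%g p.
Proof. by apply/funext => i; rewrite /act permM. Qed.

Lemma act1 p : act 1%g p = p.
Proof. by apply/funext => i; rewrite /act perm1. Qed.

Variables (R : realType) (F : fieldType).
Local Notation C := (achain R F X).

Definition actc (s : 'S_k) : C -> C := apush (act s).
HB.instance Definition _ s := GRing.Linear.copy (actc s) (apush (act s)).

Let inT (c : C) : csub (inA setT) c.
Proof. by move=> [[d s]|]. Qed.

Lemma actcM s t c : actc s (actc t c) = actc (s * t)%g c.
Proof.
rewrite /actc (@apush_comp _ _ _ _ _ setT) //; last by apply: cts_on_cts; exact: act_cts.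
by apply: (apush_ext (@inT c)) => p _; exact: actM.
Qed.

Lemma actc1 c : actc 1%g c = c.
Proof. by rewrite -[RHS]apush_id; apply: (apush_ext (@inT c)) => p _; exact: act1. Qed.

Lemma abd_actc s c : abd (actc s c) = actc s (abd c).
Proof. by apply: (@apush_bd _ _ _ _ setT) => //; apply: cts_on_cts; exact: act_cts. Qed.

(* Chains in [V] that become zero in the coinvariants of the stabilizer of [V]
   relative to [W]. *)
Definition relcoinv (W V : set X) (c : C) : Prop :=
  exists (w : C) (f : 'S_k -> C), [/\ csub (inA (V `&` W)) w,
    forall s, csub (inA V) (f s),
    forall s, f s = 0 \/ (forall p, V p -> V (act s p)) &
    c = w + \sum_s (f s - actc s (f s))].

Lemma relcoinv_sub W V c : csub (inA (V `&` W)) c -> relcoinv W V c.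
Proof.
move=> cW; exists c, (fun=> 0); split => // [s|s|]; [exact: csub0|by left|].
by rewrite big1 ?addr0 // => s _; rewrite linear0 subrr.
Qed.

Lemma relcoinvP W V a c d : relcoinv W V c -> relcoinv W V d -> relcoinv W V (a *: c + d).
Proof.
move=> [w [f [wV fV fs ->]]] [w' [f' [wV' fV' fs' ->]]].
exists (a *: w + w'), (fun s => a *: f s + f' s); split.
- by apply: csubD => //; apply: csubZ.
- by move=> s; apply: csubD => //; apply: csubZ.
- move=> s; case: (fs s) => [->|?]; [case: (fs' s) => [->|?]|]; [left|right|right] => //.
  by rewrite scaler0 addr0.
- have -> : \sum_s (a *: f s + f' s - actc s (a *: f s + f' s)) =
      a *: (\sum_s (f s - actc s (f s))) + \sum_s (f' s - actc s (f' s)).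
    rewrite scaler_sumr -big_split; apply: eq_bigr => s _.
    by rewrite linearP scalerBr /=; zmod.
  by rewrite scalerDr; zmod.
Qed.

Lemma relcoinv0 W V : relcoinv W V 0.
Proof. by apply: relcoinv_sub; exact: csub0. Qed.

Lemma relcoinvZ W V a c : relcoinv W V c -> relcoinv W V (a *: c).
Proof. by move=> cK; rewrite -[_ *: _]addr0; apply: relcoinvP => //; exact: relcoinv0. Qed.

Lemma relcoinvD W V c d : relcoinv W V c -> relcoinv W V d -> relcoinv W V (c + d).
Proof. by move=> cK dK; rewrite -[c]scale1r; apply: relcoinvP. Qed.

Lemma relcoinv_sum W V I (r : seq I) (P : pred I) (f : I -> C) :
  (forall i, P i -> relcoinv W V (f i)) -> relcoinv W V (\sum_(i <- r | P i) f i).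
Proof.
move=> fK; elim/big_rec: _ => [|i c Pi cK]; first exact: relcoinv0.
by apply: relcoinvD => //; apply: fK.
Qed.

Lemma csub_actc (V V' : set X) s c : (forall p, V p -> V' (act s p)) ->
  csub (inA V) c -> csub (inA V') (actc s c).
Proof. exact: csub_apush. Qed.

(* [V] is a block: each permutation maps it to itself or off itself. *)
Definition block (V : set X) :=
  forall s p, V p -> V (act s p) -> forall q, V q -> V (act s q).

(** A permutation preserving the nonempty set [V] maps some point of [V'] into [V'], and hence
    preserves the block [V']. *)
Lemma relcoinvS W V V' c : V `<=` V' -> V !=set0 -> block V' ->
  relcoinv W V c -> relcoinv W V' c.
Proof.
move=> VV' [p0 Vp0] bV' [w [f [wV fV fs ->]]]; exists w, f; split => //.
- by apply: csubW wV => s; apply: inAW => p [/VV'].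
- by move=> s; apply: csubW (fV s) => t; apply: inAW.
- by move=> s; case: (fs s) => [->|sV]; [left|right; apply: (bV' s p0); apply: VV'; last exact: sV].
Qed.

(** Exactness of the quotient of the chains in [V] by those in [relcoinv W V], spelled out on
    representatives. *)
Definition rel_acyclic (W V : set X) := forall z, csub (inA V) z ->
  relcoinv W V (abd z) -> exists2 e, csub (inA V) e & relcoinv W V (z - abd e).

Lemma rel_acyclic_sub W V : V `<=` W -> rel_acyclic W V.
Proof.
move=> VW z zV _; exists 0; first exact: csub0.
rewrite linear0 subr0; apply: relcoinv_sub.
by apply: csubW zV => s; apply: inAW => p Vp; split => //; apply: VW.
Qed.

Hypothesis charF : [pchar F]%R =i pred0.

(** Let N be the sum over the stabilizer of [V]. The boundary of N z is N w, a cycle in [V] and [W].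
    The sign hypothesis and tau N w = N w make 2 N w a boundary there, so N z can be corrected to a
    cycle, which bounds because [V] is acyclic. Division by the order of the stabilizer recovers [z]
    modulo coinvariants. *)
Lemma block_rel_acyclic (W V : set X) (tau : 'S_k) : V !=set0 -> block V ->
  (forall s p, W p -> W (act s p)) ->
  (forall p, V p -> V (act tau p)) ->
  (forall z : C, csub (inA V) z -> abd z = 0 -> exists2 e, csub (inA V) e & abd e = z) ->
  (forall z : C, csub (inA (V `&` W)) z -> abd z = 0 ->
     exists2 e, csub (inA (V `&` W)) e & abd e = actc tau z + z) ->
  rel_acyclic W V.
Proof.
move=> [p0 Vp0] bV WG tV acV signW z zV [w [f [wV fV fs dz]]].
(* As [V] is a block, its stabilizer can be read off at the single point [p0]. *)
pose H := [set s : 'S_k | `[< V (act s p0) >] ].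
have HV s : s \in H -> forall p, V p -> V (act s p).
  by rewrite inE => /asboolP sV; apply: (bV s p0).
have VH s : (forall p, V p -> V (act s p)) -> s \in H.
  by move=> sV; rewrite inE; apply/asboolP/sV.
have HM s t : s \in H -> t \in H -> (s * t)%g \in H.
  by move=> /HV sV /HV tV'; apply: VH => p Vp; rewrite -actM; apply/sV/tV'.
have HVi s : s \in H -> (s^-1)%g \in H.
  move=> sH; have := HV _ sH _ Vp0 => Vs.
  by apply: VH; apply: (bV _ _ Vs); rewrite actM mulVg act1.
pose N (c : C) : C := \sum_(s in H) actc s c.
have Nlin a c d : N (a *: c + d) = a *: N c + N d.
  by rewrite /N scaler_sumr -big_split; apply: eq_bigr => s _; rewrite linearP.
have Nact s c : s \in H -> actc s (N c) = N c.
  move=> sH; rewrite /N linear_sum /= [RHS](reindex_inj (mulgI s)) /=.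
  rewrite [LHS](eq_bigl (fun t => (s * t)%g \in H)); last first.
    move=> t; apply/idP/idP => [tH|stH]; first exact: HM.
    by rewrite -[t](mulKg s); apply: HM => //; apply: HVi.
  by apply: eq_bigr => t _; rewrite actcM.
have actN s c : s \in H -> N (actc s c) = N c.
  move=> sH; rewrite /N [RHS](reindex_inj (mulIg s)) /=.
  rewrite [LHS](eq_bigl (fun t => (t * s)%g \in H)); last first.
    move=> t; apply/idP/idP => [tH|stH]; first exact: HM.
    by rewrite -[t](mulgK s); apply: HM => //; apply: HVi.
  by apply: eq_bigr => t _; rewrite actcM.
have Nbd c : abd (N c) = N (abd c).
  by rewrite /N linear_sum; apply: eq_bigr => s _; rewrite /= abd_actc.
have NV (V' : set X) c : (forall s p, s \in H -> V' p -> V' (act s p)) ->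
    csub (inA V') c -> csub (inA V') (N c).
  move=> VV cV; apply: csub_sum => s sH; apply: (csub_actc _ cV) => p; exact: VV.
have H0 : #|H|%:R != 0 :> F.
  rewrite ((pcharf0P F).1 charF) -lt0n; apply/card_gt0P; exists 1%g; apply: VH => p.
  by rewrite act1.
set h := #|H|%:R in H0.
have VWH s p : s \in H -> (V `&` W) p -> (V `&` W) (act s p).
  by move=> sH [Vp Wp]; split; [exact: HV|exact: WG].
have dNz : abd (N z) = N w.
  rewrite Nbd dz -[w]scale1r Nlin !scale1r -[RHS]addr0; congr (_ + _).
  have N0 : N 0 = 0 by rewrite /N big1 // => s _; rewrite linear0.
  have Nsum (r : seq 'S_k) (g : 'S_k -> C) : N (\sum_(s <- r) g s) = \sum_(s <- r) N (g s).
    elim: r => [|s r IHr]; first by rewrite !big_nil.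
    by rewrite !big_cons -[g s]scale1r Nlin IHr !scale1r.
  rewrite Nsum big1 // => s _; case: (fs s) => [->|sV]; first by rewrite linear0 subrr.
  have -> : f s - actc s (f s) = -1 *: actc s (f s) + f s by rewrite scaleN1r addrC.
  by rewrite Nlin actN ?scaleN1r ?subrr //; [rewrite addrC subrr|exact: VH].
have NwW : csub (inA (V `&` W)) (N w) by exact: NV VWH wV.
have Nw0 : abd (N w) = 0 by rewrite -dNz abd_abd.
have [e eW eE] := signW _ NwW Nw0.
rewrite Nact in eE; last exact: VH.
have two : 2%:R != 0 :> F by rewrite ((pcharf0P F).1 charF).
have e2 : abd (2%:R^-1 *: e) = N w.
  by rewrite linearZ /= eE -mulr2n -scaler_nat scalerA mulVf ?scale1r.
have eV : csub (inA V) (2%:R^-1 *: e).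
  by apply: csubZ; apply: csubW eW => s; apply: inAW => p [].
have [||g gV gE] := acV (N z - 2%:R^-1 *: e).
- by apply: csubB => //; apply: (NV V) => // s p sH; exact: HV.
- by rewrite linearB /= dNz e2 subrr.
exists (h^-1 *: g); first exact: csubZ.
rewrite linearZ /= gE scalerBr opprB addrA addrAC.
apply: relcoinvD; last first.
  by apply: relcoinvZ; apply: relcoinv_sub; exact: csubZ.
(* The difference between [z] and its average is a sum of terms that vanish in the coinvariants. *)
have -> : z - h^-1 *: N z = h^-1 *: \sum_(s in H) (z - actc s z).
  rewrite sumrB scalerBr; congr (_ - _).
  by rewrite sumr_const -scaler_nat scalerA mulVf ?scale1r.
apply: relcoinvZ; apply: relcoinv_sum => s sH.
exists 0, (fun t => if t == s then z else 0); split.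
- exact: csub0.
- by move=> t; case: ifP => _ //; exact: csub0.
- by move=> t; case: eqP => [->|_]; [right; exact: HV|left].
- rewrite add0r (bigD1 s) //= eqxx big1 ?addr0 // => t /negPf ->.
  by rewrite linear0 subrr.
Qed.

End Action.

(** * Local structure of the filtration by coincidences *)

Lemma nbhs_all (T : topologicalType) (I : finType) (x : T) (P : I -> set T) :
  (forall i, nbhs x (P i)) -> nbhs x (fun y => forall i, P i y).
Proof. by move=> xP; apply: (@filter_forall _ _ (fun i y => P i y) (nbhs x)). Qed.

Section ProductNeighbourhoods.
Variables (k : nat) (M : topologicalType).
Local Notation X := {ptws 'I_k -> M}.

Lemma nbhs_prod (x : X) (O : set X) : nbhs x O ->
  exists2 P : 'I_k -> set M, forall i, nbhs (x i) (P i) &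
    (fun p : X => forall i, P i (p i)) `<=` O.
Proof.
pose G : set (set X) := fun A => exists2 P : 'I_k -> set M, forall i, nbhs (x i) (P i) &
    (fun p : X => forall i, P i (p i)) `<=` A.
have FG : Filter G.
  split.
  - by exists (fun=> setT) => // i; exact: filterT.
  - move=> A B [P Px PA] [Q Qx QB]; exists (fun i => P i `&` Q i) => [i|p pPQ].
      exact: filterI.
    by split; [apply: PA => i; have [] := pPQ i|apply: QB => i; have [] := pPQ i].
  - by move=> A B AB [P Px PA]; exists P => // p /PA/AB.
suff GX : cvg_to G (nbhs x) by apply: GX.
apply/cvg_sup => i U [V [[A Ao <-] Ax AU]].
exists (fun j => if j == i then A else setT).
  by move=> j; case: eqP => [->|_]; [apply: open_nbhs_nbhs|exact: filterT].
by move=> p pP; apply: AU; have := pP i; rewrite eqxx.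
Qed.

Lemma prod_open (P : 'I_k -> set M) : (forall i, open (P i)) ->
  open (fun p : X => forall i, P i (p i)).
Proof.
move=> Po; rewrite openE => p pP.
apply: (@nbhs_all X _ p (fun i q => P i (q i))) => i.
by apply: (@proj_continuous _ (fun=> M) i p (P i)); apply: open_nbhs_nbhs.
Qed.

End ProductNeighbourhoods.

Section Coincidences.
Variables (k : nat) (M : topologicalType).
Local Notation X := {ptws 'I_k -> M}.

(** Ordered pairs including the diagonal: a configuration has exactly k coincidences, and the
    filtration runs from k to k * k. *)
Definition coincs (p : X) : {set 'I_k * 'I_k} := [set ij | p ij.1 == p ij.2].

Definition coinc_le m : set X := [set p | (#|coincs p| <= m)%N].

Lemma coinc_leT : coinc_le (k * k) = setT.
Proof.
apply/seteqP; split => // p _; rewrite /coinc_le /=; apply: leq_trans (max_card _) _.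
by rewrite card_prod card_ord.
Qed.

Lemma coinc_le_conf : coinc_le k = @conf k M.
Proof.
have dE : [set (i, i) | i : 'I_k]%SET \subset [set: 'I_k * 'I_k]%SET by exact: finset.subsetT.
have cd : #|[set (i, i) | i : 'I_k]%SET| = k.
  by rewrite card_imset ?card_ord // => i j [].
have dp (p : X) : [set (i, i) | i : 'I_k]%SET \subset coincs p.
  by apply/fintype.subsetP => _ /imsetP[i _ ->]; rewrite inE.
apply/seteqP; split => p; rewrite /coinc_le /=.
  rewrite -[k in (_ <= k)%N]cd => pk i j ij.
  have /eqP E : [set (i, i) | i : 'I_k]%SET == coincs p by rewrite eqEcard dp pk.
  have : (i, j) \in coincs p by rewrite inE ij.
  by rewrite -E => /imsetP[l _ [-> ->]].
move=> pi; rewrite -[k in (_ <= k)%N]cd; apply: subset_leq_card; apply/fintype.subsetP => -[i j].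
by rewrite inE /= => /eqP/pi ->; apply/imsetP; exists j.
Qed.

Lemma coinc_act m s p : coinc_le m p -> coinc_le m (act s p).
Proof.
rewrite /coinc_le /= => pm; apply: leq_trans pm.
rewrite -(card_imset (f := fun ij : 'I_k * 'I_k => (s ij.1, s ij.2))); last first.
  by move=> [i j] [i' j'] [/perm_inj -> /perm_inj ->].
by apply: subset_leq_card; apply/fintype.subsetP => _ /imsetP[[i j] ij ->]; rewrite !inE in ij *.
Qed.

Lemma coinc_off_diag (p : X) : (k < #|coincs p|)%N -> exists a b, a != b /\ p a = p b.
Proof.
move=> kp; apply: contrapT => nab.
have : conf p.
  by move=> i j ij; apply/eqP; apply: contraPT kp => nij _; apply: nab; exists i, j.
by rewrite -coinc_le_conf /coinc_le /= leqNgt kp.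
Qed.

End Coincidences.

Section LocalStructure.
Variables (R : realType) (F : fieldType) (n k : nat) (M : smooth_manifold R n).
Local Notation X := {ptws 'I_k -> M}.
Hypothesis n_odd : odd n.
Hypothesis charF : [pchar F]%R =i pred0.

(** The neighbourhoods are indexed by points of [M] rather than by indices. Equal coordinates thus
    receive equal neighbourhoods, and the product is preserved by permutations of coinciding
    coordinates. *)
Lemma sep_nbhds (x : X) (O : set X) : nbhs x O ->
  exists2 P : M -> set M, forall y, nbhs y (P y) &
    (forall p : X, (forall i, P (x i) (p i)) -> O p) /\
    (forall i j m, P (x i) m -> P (x j) m -> x i = x j).
Proof.
move=> /nbhs_prod[Q Qx QO].
have /choice[A AP] : forall yz : M * M, exists AB : set M * set M,
    yz.1 != yz.2 -> [/\ nbhs yz.1 AB.1, nbhs yz.2 AB.2 & AB.1 `&` AB.2 = set0].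
  move=> [y z] /=; have [->|yz] := eqVneq y z; first by exists (setT, setT).
  have := @manifold_hausdorff _ _ M; rewrite open_hausdorff => /(_ y z yz)[AB [yA zB] [Ao Bo /eqP AB0]].
  by exists AB => _; split => //; apply: open_nbhs_nbhs; split => //; exact: set_mem.
exists (fun y => fun m => forall j, (if x j == y then Q j
    else (A (y, x j)).1 `&` (A (x j, y)).2) m).
  move=> y; apply: nbhs_all => j.
  case: eqP => [<- //|/eqP xy]; apply: filterI.
    by have [] := AP (y, x j); rewrite //= eq_sym.
  by have [] := AP (x j, y).
split=> [p pP|i j m im jm].
  by apply: QO => i; have := pP i i; rewrite eqxx.
apply: contrapT => /eqP xij; have := im j; have := jm i.
rewrite (negPf xij) eq_sym (negPf xij) => -[_ m2] [m1 _].
have [_ _ A0] := AP (x i, x j) xij.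
have : ((A (x i, x j)).1 `&` (A (x i, x j)).2) m by split.
by rewrite A0.
Qed.

Lemma nbhs_coinc (x : X) : nbhs x (coinc_le #|coincs x|).
Proof.
have [P Py [_ Ps]] := sep_nbhds (@filterT _ (nbhs x) _).
have : nbhs x (fun p : X => forall i, P (x i) (p i)).
  apply: (@nbhs_all X _ x (fun i p => P (x i) (p i))) => i;  apply: (@proj_continuous _ (fun=> M : topologicalType) i x); exact: Py.
apply: filterS => p pP; rewrite /coinc_le /=; apply: subset_leq_card.
apply/fintype.subsetP => -[i j]; rewrite !inE /= => /eqP pij.
by apply/eqP; apply: (Ps i j (p i)) => //; rewrite pij.
Qed.

Lemma box_product (x : X) (O : set X) : nbhs x O ->
  exists (V : set X) (phi : M -> M -> 'rV[R]_n) (psi : M -> 'rV[R]_n -> M) (eps : R) (D : M -> set M),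
  [/\ [/\ V `<=` O, 0 < eps & V = fun p => forall i, D (x i) (p i)],
    forall i, box_nbhd (x i) (phi (x i)) (psi (x i)) eps (D (x i)) &
    forall i j m, D (x i) m -> D (x j) m -> x i = x j].
Proof.
move=> /sep_nbhds[P Py [PO Ps]].
have /choice[t tP] : forall y : M, exists t : (M -> 'rV[R]_n) * ('rV[R]_n -> M) * R,
    0 < t.2 /\ forall e, 0 < e <= t.2 ->
      exists2 D, D `<=` P y & box_nbhd y t.1.1 t.1.2 e D.
  by move=> y; have [phi [psi [e0 H]]] := box_nbhd_ex (Py y); exists (phi, psi, e0).
have [eps eps0 epsl] : exists2 eps, 0 < eps & forall i, eps <= (t (x i)).2.
  exists (\big[Num.min/1]_i (t (x i)).2).
    by apply: lt_bigmin => // i _; have [] := tP (x i).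
  by move=> i; apply: bigmin_le_cond.
have /choice[D DP] : forall y : M, exists D, eps <= (t y).2 ->
    D `<=` P y /\ box_nbhd y (t y).1.1 (t y).1.2 eps D.
  move=> y; have [ey|] := pselect (eps <= (t y).2); last by exists set0.
  by have [|D] := (tP y).2 eps; [rewrite eps0|exists D].
exists (fun p => forall i, D (x i) (p i)), (fun y => (t y).1.1), (fun y => (t y).1.2), eps, D.
split.
- by split => // p pD; apply: PO => i; apply: (DP _ (epsl i)).1.
- by move=> i; exact: (DP _ (epsl i)).2.
- by move=> i j m im jm; apply: (Ps i j m); [apply: (DP _ (epsl i)).1|apply: (DP _ (epsl j)).1].
Qed.

(** With at most m coincidences at [x], a neighbourhood inside [coinc_le m] is relatively acyclic
    for trivial reasons. Otherwise there are m + 1 > k, so two coordinates [a] and [b] agree, and a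
    product of small boxes transports the statement to the linear model. *)
Lemma good_nbhd m (x : X) (O : set X) : (k <= m)%N -> coinc_le m.+1 x -> nbhs x O ->
  exists V : set X, [/\ open V /\ V x, V `<=` O `&` coinc_le m.+1,
    rel_acyclic R F (coinc_le m) V & V `<=` coinc_le m \/ block V].
Proof.
move=> km xm xO; have [xm'|xm'] := leqP #|coincs x| m.
  have : nbhs x (O `&` coinc_le #|coincs x|) by apply: filterI => //; exact: nbhs_coinc.
  rewrite nbhsE => -[V [Vo Vx] VO].
  have VW : V `<=` coinc_le m by move=> p /VO[_ pm]; exact: leq_trans pm xm'.
  exists V; split => //; last by left.
    by move=> p Vp; split; [case: (VO p Vp)|apply: leqW; exact: VW].
  exact: rel_acyclic_sub.
have {xm'} xm' : #|coincs x| = m.+1 by apply/eqP; rewrite eqn_leq xm'; have := xm; rewrite /coinc_le /= => ->.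
have [a [b [ab xab]]] : exists a b, a != b /\ x a = x b.
  by apply: coinc_off_diag; rewrite xm' ltnS.
have [V [phi [psi [eps [D [[VO eps0 VE] Db Ds]]]]]] := box_product xO.
have Vx : V x by rewrite VE => i; have [[]] := Db i.
pose tau := tperm a b.
have xtau i : x (tau i) = x i by rewrite /tau; case: tpermP => [->|->|].
have tV p : V p -> V (act tau p).
  by rewrite VE => Vp i; rewrite /act -xtau; apply: Vp.
have bV : block V.
  rewrite VE => s p Vp Vsp q Vq i; rewrite /act.
  by rewrite -(Ds (s i) i (p (s i)) (Vp _) (Vsp _)); apply: Vq.
have cV p : V p -> coincs p \subset coincs x.
  rewrite VE => Vp; apply/fintype.subsetP => -[i j]; rewrite !inE /= => /eqP pij.
  by apply/eqP; apply: (Ds i j (p i)) => //; rewrite pij.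
have Vm p : V p -> coinc_le m.+1 p by move=> /cV/subset_leq_card; rewrite xm'.
pose cl : rel 'I_k := fun i j => x i == x j.
(* Coincidences in [V] are among those of [x], which number m + 1; having at most m means losing at
   least one. *)
have VWE p : V p -> coinc_le m p <-> ~ (forall i j, cl i j -> p i = p j).
  move=> Vp; split=> [pm H|H].
    have : coincs x \subset coincs p.
      by apply/fintype.subsetP => -[i j]; rewrite !inE /= => /H ->.
    by move=> /subset_leq_card; rewrite xm' leqNgt ltnS pm.
  rewrite /coinc_le /= leqNgt; apply/negP => pm; apply: H => i j ij.
  have /eqP E : coincs p == coincs x by rewrite eqEcard cV // xm'.
  have : (i, j) \in coincs p by rewrite E inE.
  by rewrite inE => /eqP.
pose c i := phi (x i) (x i).
pose Phi (p : X) : 'M[R]_(k, n) := \matrix_(i, j) phi (x i) (p i) 0 j.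
pose Psi (u : 'M[R]_(k, n)) : X := fun i => psi (x i) (row i u).
have rowPhi i p : row i (Phi p) = phi (x i) (p i) by apply/rowP => j; rewrite !mxE.
have PhiV p : V p -> boxes c eps (Phi p).
  by rewrite VE => Vp i; rewrite rowPhi; have [_ /(_ _ (Vp i))[]] := Db i.
have PsiV u : boxes c eps u -> V (Psi u).
  by rewrite VE => uB i; have [_ _ /(_ _ (uB i))[]] := Db i.
have PhiK p : V p -> Psi (Phi p) = p.
  rewrite VE => Vp; apply/funext => i; rewrite /Psi rowPhi.
  by have [_ /(_ _ (Vp i))[]] := Db i.
have PsiK u : boxes c eps u -> forall i, phi (x i) (Psi u i) = row i u.
  by move=> uB i; have [_ _ /(_ _ (uB i))[]] := Db i.
have PhiC : cts_on V Phi.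
  move=> T g gc gV; apply: mx_cts => i j.
  under eq_fun do rewrite /= mxE; move=> t.
  have gi : continuous (fun t => g t i).
    by move=> u; apply: (@continuous_comp _ _ _ g (fun p : X => p i)); [exact: gc|exact: (@proj_continuous _ (fun=> M : topologicalType) i)].
  have pc : continuous (phi (x i) \o (fun t => g t i)).
    by have [_ _ _ pc _] := Db i; apply: pc => // u; have := gV u; rewrite VE; apply.
  apply: (@continuous_comp _ _ _ (phi (x i) \o (fun t => g t i)) (fun v : 'rV[R]_n => v 0 j)).
    exact: pc.
  exact: coord_continuous.
have PsiC : cts_on (boxes c eps) Psi.
  move=> T g gc gB; apply: prod_cts => i.
  have [_ _ _ _ pc] := Db i; apply: (pc _ (fun t => row i (g t))); last by move=> t; apply: gB.
  apply: mx_cts => i' j; under eq_fun do rewrite mxE; move=> t.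
  apply: (@continuous_comp _ _ _ g (fun v : 'M[R]_(k, n) => v i j)); first exact: gc.
  exact: coord_continuous.
have half i : half_space (c i) by have [[_ Dx] /(_ _ Dx)[[]]] := Db i.
have clc i j : cl i j -> c i = c j by move=> /eqP ij; rewrite /c ij.
have clxx : reflexive cl by move=> i; exact: eqxx.
have clab : cl a b by apply/eqP.
exists V; split; [split => //| | |by right].
- by rewrite VE; apply: (@prod_open k M (fun i => D (x i))) => i; have [[]] := Db i.
- by move=> p Vp; split; [exact: VO|exact: Vm].
apply: (@block_rel_acyclic _ _ _ _ charF _ _ tau) => //; first by exists x.
- exact: coinc_act.
- move=> z zV z0.
  have [||e eB eE] := @boxes_acyclic R F k n c eps eps0 half (apush Phi z).
  + by apply: csub_apush zV; exact: PhiV.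
  + by rewrite (apush_bd PhiC zV) z0 linear0.
  exists (apush Psi e); first by apply: csub_apush eB; exact: PsiV.
  rewrite (apush_bd PsiC eB) eE (apush_comp _ PhiC) //.
  by rewrite -[RHS]apush_id; apply: (apush_ext zV) => p; exact: PhiK.
- move=> z zVW z0.
  have zV : csub (inA V) z by apply: csubW zVW => s; apply: inAW => p [].
  have [||e eB eE] := @boxes_sign R F k n cl a b c eps eps0 n_odd ab clab clc half (apush Phi z).
  + apply: csub_apush zVW => p [Vp /(VWE p Vp) np]; split; first exact: PhiV.
    move=> H; apply: np => i j ij; have := H i j ij; rewrite !rowPhi.
    have pK l : p l = psi (x l) (phi (x l) (p l)) by rewrite -[in LHS](PhiK p Vp) /Psi rowPhi.
    by move=> E; rewrite (pK i) (pK j) E (eqP ij).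
  + by rewrite (apush_bd PhiC zV) z0 linear0.
  have eB' : csub (inA (boxes c eps)) e by apply: csubW eB => s; apply: inAW => p [].
  exists (apush Psi e).
    apply: csub_apush eB => u [uB ud]; split; first exact: PsiV.
    apply/(VWE _ (PsiV _ uB)) => H; apply: ud => i j ij.
    by rewrite -!PsiK // (H i j ij) (eqP ij).
  rewrite (apush_bd PsiC eB') eE linearD /= (apush_comp _ PhiC) //; congr (_ + _).
    have xc : continuous (xrow a b : 'M[R]_(k, n) -> 'M[R]_(k, n)).
      by apply: mx_cts => i j; under eq_fun do rewrite mxE; exact: coord_continuous.
    have PxC : cts_on V (fun p => xrow a b (Phi p)).
      by apply: (cts_on_comp PhiC (cts_on_cts (A := setT) xc)).
    rewrite (apush_comp _ PxC) //; apply: (apush_ext zV) => p Vp; apply/funext => i.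
    rewrite /act /= -[in RHS](PhiK p Vp) /Psi xtau; congr (psi (x i) _).
    by apply/rowP => j; rewrite !mxE.
  by rewrite (apush_comp _ PhiC) // -[RHS]apush_id; apply: (apush_ext zV) => p; exact: PhiK.
Qed.

End LocalStructure.

(** * From local to global *)

(** Smallness at different points of M^k has to be compared, and entourages do so without a metric.
    They are written as relations, so that E x is the neighbourhood of x. *)
Record uniformity (X : topologicalType) (ent : set (X -> X -> Prop)) : Prop := Uniformity {
  ent_ex : exists E, ent E;
  ent_refl : forall E x, ent E -> E x x;
  ent_split : forall E, ent E -> exists2 E', ent E' &
    (forall x y, E' x y -> E' y x) /\ (forall x y z, E' x y -> E' y z -> E x z);
  ent_nbhs : forall E x, ent E -> nbhs x (E x);
  nbhs_ent : forall x A, nbhs x A -> exists2 E, ent E & E x `<=` A;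
  entI : forall E E', ent E -> ent E' -> exists2 E'', ent E'' &
    forall x y, E'' x y -> E x y /\ E' x y }.

Lemma compact_uniformity (R : realType) (X : topologicalType) :
  hausdorff_space X -> compact [set: X] -> exists ent, @uniformity X ent.
Proof.
move=> hX cX.
have crs : completely_regular_space X.
  apply: (@normal_completely_regular R); first exact: compact_normal.
  exact: hausdorff_accessible.
pose T : uniformType := @completely_regular_uniformity.type R X crs.
exists (fun E => @entourage T (fun xy => E xy.1 xy.2)); split.
- by exists (fun _ _ => True); have := @entourageT T.
- by move=> E x entE; have := @entourage_refl T _ x entE.
- move=> E entE.
  have [E' entE' E'E] := @entourage_split_ex T _ entE.
  pose S : set (T * T) := E' `&` [set xy | E' (xy.2, xy.1)].
  have entS : entourage S by apply: filterI => //; exact: (@entourage_inv T).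
  exists (fun x y => S (x, y)); first by apply: filterS entS => -[].
  split=> [x y [xy yx] //|x y z [xy _] [yz _]].
  have : (fun xy : T * T => E xy.1 xy.2) (x, z) by apply: E'E; exists y.
  by [].
- move=> E x entE; have : @nbhs T T x (xsection (fun xy : T * T => E xy.1 xy.2) x).
    exact: nbhs_entourage.
  by apply: filterS => y /xsectionP.
- move=> x A xA; have : @nbhs T T x A by [].
  rewrite -nbhs_entourageE => -[E entE EA].
  exists (fun x y => E (x, y)); first by apply: filterS entE => -[].
  by move=> y xy; apply: EA; apply/xsectionP.
- move=> E E' entE entE'; exists (fun x y => E x y /\ E' x y) => //.
  exact: filterI entE entE'.
Qed.

Section SimplexCompactness.
Variables (R : realType) (X : topologicalType).

(** Compactness of the simplex: what holds eventually near each point of the image holds eventually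
    on the whole image. *)
Lemma simplex_near d (s : singular_simplex R X d) (I : Type) (G : set_system I)
    (P : I -> X -> Prop) : Filter G ->
  (forall x, \forall y \near s x & i \near G, P i y) ->
  \forall i \near G, forall x, P i (s x).
Proof.
move=> FG sP; have /compact_near_coveringP/near_covering_withinP cov := @compact_std_simplex R d.
have : \forall i \near G, std_simplex R d `<=` (fun v => P i (sext s v)).
  apply: cov => v vd; have [x vE _] := sextP s vd.
  have [[A B] /= [sA GB] AB] := sP x.
  have [W [Wo Wv WA]] : exists W : set 'rV[R]_d.+1,
      [/\ open W, W v & forall y, W (set_val y) -> A (s y)].
    have : nbhs x (s @^-1` A) by apply: (@cts_fun _ _ s).
    move=> [C [[W Wo <-] Wx WA]]; exists W; split => //.
    by rewrite vE.
  exists (W, B); first by split => //; apply: open_nbhs_nbhs.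
  move=> [v' i] /= [Wv' Bi] v'd; have [y v'E ->] := sextP s v'd.
  by apply: (AB (s y, i)); split => //; apply: WA; rewrite -v'E.
apply: filterS => i Pi x.
by have := Pi (set_val x) (set_valP x); rewrite /= sextE.
Qed.

End SimplexCompactness.

Section Degree.
Variables (R : realType) (F : fieldType) (X : topologicalType).

(** Shifted by one, so that the empty simplex has degree 0. *)
Definition adeg (s : asimp R X) : nat := if s is Some (existT d _) then d.+1 else 0.

Lemma adeg_amk d (f : std_simplex R d -> X) : (adeg (amk f) <= d.+1)%N.
Proof. by rewrite /amk; case: pselect. Qed.

Lemma adeg_abd s : csub (fun t => (adeg t < adeg s)%N) (@abd R F X << s >>).
Proof.
rewrite abd1; case: s => [[[|d] s]|] /=; [exact: csub1| |exact: csub0].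
by apply: csub_sum => i _; apply: csubZ; apply: csub1; apply: adeg_amk.
Qed.

Lemma adeg_Sd n (c : achain R F X) : csub (fun s => (adeg s <= n)%N) c ->
  csub (fun s => (adeg s <= n)%N) (Sd c).
Proof.
move=> cn; apply: (csub_map _ cn) => [|s sn]; first by lin.
apply: (@csubW _ _ (fun t => (adeg t <= adeg s)%N)) => [t ts|]; first exact: leq_trans ts sn.
case: s {sn} => [[d s]|]; last by rewrite /Sd oper1 /=; apply: csubZ; apply: csub1.
have sc : cts_on (std_simplex R d) (sext s) by exact: (sext_cts (@cts_fun _ _ s)).
have -> : Sd << Some (existT _ d s) >> = push (sext s) (@sd R F _ << evs R d >>).
  have := (@iter_Sd_push R F X _ _ (sext s) 1 << evs R d >> (@hull_closed_simplex R d) sc (@csub_evs _ _ d)).1.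
  by rewrite /= push1 pushs_evs amkE.
have [r evsM] := mesh_le_ex (evs R d).
have esz : (size (evs R d) <= d.+1)%N by rewrite size_evs.
apply: (csub_map _ (sd_mesh esz evsM)) => [|u [ud _ _]]; first by lin.
rewrite push1; apply: csub1; rewrite /pushs; case: (size u) ud => // e ed.
exact: leq_trans (adeg_amk _) ed.
Qed.

Lemma adeg_ex (c : achain R F X) : exists n, csub (fun s => (adeg s <= n)%N) c.
Proof.
exists (\max_(s <- dom c) adeg s)%N => s; rewrite -mem_dom => sc.
exact: (@leq_bigmax_seq _ _ xpredT).
Qed.

End Degree.

Section LocalToGlobal.
Variables (R : realType) (F : fieldType) (k : nat) (M : topologicalType).
Local Notation X := {ptws 'I_k -> M}.
Local Notation C := (achain R F X).
Variables (W X1 : set X) (ent : set (X -> X -> Prop)).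
Hypothesis entP : uniformity ent.
Hypothesis WX : W `<=` X1.
Hypothesis X1_act : forall s p, X1 p -> X1 (act s p).

Definition good_set (V : set X) :=
  [/\ V `<=` X1, rel_acyclic R F W V & V `<=` W \/ block V].

Hypothesis good_nbhds : forall x O, X1 x -> nbhs x O ->
  exists V, [/\ open V, V x, V `<=` O & good_set V].

(** The properties that hold for all sufficiently fine relations, so that uniform choices can be
    made by [simplex_near]. *)
Let ent_filter : set_system (X -> X -> Prop) :=
  [set S | exists2 E0, ent E0 & forall E, (forall x y, E x y -> E0 x y) -> S E].

Let ent_filterP : Filter ent_filter.
Proof.
have [E0 entE0] := ent_ex entP; split.
- by exists E0.
- move=> S T [E1 e1 S1] [E2 e2 S2]; have [E e EE] := entI entP e1 e2.
  exists E => // E' E'E; split; [apply: S1|apply: S2] => x y /E'E/EE[] //.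
- by move=> S T ST [E e SE]; exists E => // E' /SE/ST.
Qed.

Let ent_half E : ent E -> exists2 E', ent E' &
  [/\ forall x y, E' x y -> E x y, forall x y, E' x y -> E' y x &
   forall x y z, E' x y -> E' y z -> E x z].
Proof.
move=> entE; have [E' e' [sym tr]] := ent_split entP entE.
by exists E' => //; split => // x y xy; apply: tr xy _; exact: (ent_refl entP).
Qed.

(** A Lebesgue-type statement: around each point of the simplices of [c] some good set fits between
    the E'-neighbourhood and the E-neighbourhood. *)
Let refine (c : C) E : csub (inA X1) c -> ent E -> exists2 E', ent E' &
  [/\ forall x y, E' x y -> E x y, forall x y z, E' x y -> E' y z -> E x z &
   forall s, coeff s c != 0 -> if s is Some (existT d s) then
     forall x, exists V, [/\ good_set V, E' (s x) `<=` V & V `<=` E (s x)] else True].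
Proof.
move=> cX entE; have FE := ent_filterP.
pose P (E' : X -> X -> Prop) y := exists V, [/\ good_set V, E' y `<=` V & V `<=` E y].
have near1 s : coeff s c != 0 -> \forall E' \near ent_filter,
    if s is Some (existT d s) then forall x, P E' (s x) else True.
  move=> /cX; case: s => [[d s]|]; last by move=> _; exists E.
  move=> /= sX; apply: simplex_near => x.
  have [E1 e1 [E1E E1s E1t]] := ent_half entE.
  have [V [Vo Vx VE gV]] := good_nbhds (sX x) (ent_nbhs entP (s x) e1).
  have [E2 e2 E2V] := nbhs_ent entP (open_nbhs_nbhs (conj Vo Vx)).
  have [E3 e3 [_ _ E3t]] := ent_half e2.
  exists (V `&` E3 (s x), [set E' | forall y z, E' y z -> E3 y z]).
    split; last by exists E3.
    by apply: filterI; [exact: open_nbhs_nbhs|exact: (ent_nbhs entP)].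
  move=> [y E'] /= [[Vy xy] E'3]; exists V; split => //.
    by move=> z /E'3 yz; apply: E2V; apply: E3t xy yz.
  move=> z /VE xz; apply: E1t xz; apply: E1s; exact: VE.
have [E1 e1 [E1E _ E1t]] := ent_half entE.
have : \forall E' \near ent_filter, forall s, s \in dom c ->
    if s is Some (existT d s) then forall x, P E' (s x) else True.
  have : forall s, s \in dom c -> coeff s c != 0 by move=> s; rewrite mem_dom.
  elim: (dom c) => [|s r IHr] rc; first by exists E.
  have /IHr H : forall t, t \in r -> coeff t c != 0 by move=> t tr; apply: rc; rewrite inE tr orbT.
  apply: filterS2 (near1 s (rc s (mem_head _ _))) H => E' H1 H2 t.
  by rewrite inE => /orP[/eqP ->|/H2].
move=> [E2 e2 H2]; have [E3 e3 E3E] := entI entP e1 e2.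
exists E3 => //; split.
- by move=> x y /E3E[/E1E].
- by move=> x y z /E3E[xy _] /E3E[yz _]; apply: E1t xy yz.
- by move=> s sc; apply: (H2 E3) => [x y /E3E[]//|]; rewrite mem_dom.
Qed.

Let near_simp (E : X -> X -> Prop) (s : asimp R X) :=
  if s is Some (existT d s) then forall x y, E (s x) (s y) else True.

Let csub_abd_near E s : near_simp E s -> csub (near_simp E) (@abd R F X << s >>).
Proof.
case: s => [[[|d] s]|] /= sE; rewrite abd1; [exact: csub1| |exact: csub0].
apply: csub_sum => i _; apply: csubZ; apply: csub1.
by rewrite /amk; case: pselect => //= sc x y; apply: sE.
Qed.

Let base d : std_simplex R d := exist _ (delta_mx 0 0) (mem_set (@evs_simplex R d _ (map_f _ (mem_enum _ 0)))).

(** Good sets are attached to small simplices according to their degree, finer ones in lower degree,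
    so that the carrier of a face lies in the carrier of the simplex. *)
Let carriers (c : C) D : csub (inA X1) c -> exists S K (V : asimp R X -> set X),
  [/\ ent S, csub (inA K) c,
    forall s, inA K s -> near_simp S s -> (0 < adeg s <= D)%N -> good_set (V s) /\ inA (V s) s &
    forall s t, inA K s -> near_simp S s -> (adeg s <= D)%N -> (0 < adeg t < adeg s)%N ->
      (forall B, inA B s -> inA B t) -> V t `<=` V s].
Proof.
move=> cX.
(* The union of the images of the simplices of [c]; every subdivision of [c] stays in it. *)
pose K : set X := [set y | exists s d x, coeff s c != 0 /\ s = Some (existT _ d x) /\ exists u, y = x u].
have /choice[f fP] : forall E, exists E', ent E -> [/\ ent E',
    forall x y, E' x y -> E x y, forall x y z, E' x y -> E' y z -> E x z &
    forall y, K y -> exists V, [/\ good_set V, E' y `<=` V & V `<=` E y]].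
  move=> E; have [/(refine cX)[E' e' [EE Et H]]|] := pselect (ent E); last by exists E.
  exists E' => _; split => // _ [s [d [x [sc [sE [u ->]]]]]].
  by have := H s sc; rewrite sE.
have /choice[v vP] : forall Ey : (X -> X -> Prop) * X, exists V, ent Ey.1 -> K Ey.2 ->
    [/\ good_set V, f Ey.1 Ey.2 `<=` V & V `<=` Ey.1 Ey.2].
  move=> [E y]; have [[entE Ky]|H] := pselect (ent E /\ K y).
    by have [_ _ _ /(_ _ Ky)[V VP]] := fP E entE; exists V.
  by exists set0 => /= e Ky; case: H.
have [E0 e0] := ent_ex entP.
pose E_ j := iter j f E0.
have entE j : ent (E_ j) by elim: j => //= j /fP[].
have E_S j x y z : E_ j.+1 x y -> E_ j.+1 y z -> E_ j x z by have [_ _ /(_ x y z)] := fP _ (entE j).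
have E_le i j x y : (i <= j)%N -> E_ j x y -> E_ i x y.
  move=> /subnK <-; elim: (j - i)%N => [//|l IHl] xy; apply: IHl.
  by have [_ H _ _] := fP _ (entE (l + i)%N); exact: H xy.
(* Each degree uses two refinements: one for fitting a neighbourhood into the carrier, the other for
   the passage from the base point of a simplex to that of its face. *)
pose lev (s : asimp R X) := (D - adeg s).*2.
pose V (s : asimp R X) : set X := if s is Some (existT d s') then
  v (E_ (lev s), s' (base d)) else setT.
exists (E_ D.*2), K, V; split => //.
- by move=> s sc; case: s sc => [[d s]|] // sc x; exists (Some (existT _ d s)), d, s; split => //; split => //; exists x.
- move=> [[d s]|] //= sK sS dD.
  have [gV fV VE] := vP (E_ (lev (Some (existT _ d s))), s (base d)) (entE _) (sK _).
  split => // x; apply: fV; have := sS (base d) x; apply: (@E_le (lev _).+1).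
  by rewrite /lev /= ltn_double ltn_subrL (leq_trans _ dD).
- move=> [[d s]|]; last by move=> t _ _ _ /andP[_].
  case=> [[d' t]|] // sK sS sD /andP[_ dd] st.
  have [gV fV VE] := vP (E_ (lev (Some (existT _ d s))), s (base d)) (entE _) (sK _).
  have tK : K (t (base d')) by apply: (st K).
  have [gV' fV' VE'] := vP (E_ (lev (Some (existT _ d' t))), t (base d')) (entE _) tK.
  move=> y /VE' /= ty; apply: fV => /=.
  have st' : E_ D.*2 (s (base d)) (t (base d')).
    by apply: (st (E_ D.*2 (s (base d)))) => x; apply: sS.
  set l := lev _; rewrite -[f (E_ l)]/(E_ l.+1); apply: (@E_S _ _ (t (base d'))); rewrite {}/l.
    by apply: E_le st'; rewrite /lev /= -doubleS leq_double ltn_subrL /= (leq_trans _ sD).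
  apply: E_le ty; rewrite /lev /= -doubleS leq_double.
  by apply: ltn_sub2l => //; exact: leq_trans dd sD.
Qed.

Let face_val s : csub (fun t => forall B, inA B s -> inA B t) (@abd R F X << s >>).
Proof.
case: s => [[[|d] s]|]; rewrite abd1 /=; [by apply: csub1| |exact: csub0].
by apply: csub_sum => i _; apply: csubZ; apply: csub1 => B sB; apply: inA_amk => x; apply: sB.
Qed.

Section Carried.
Variables (S : X -> X -> Prop) (K : set X) (D : nat) (V : asimp R X -> set X).
Hypothesis V_good : forall s, inA K s -> near_simp S s -> (0 < adeg s <= D)%N ->
  good_set (V s) /\ inA (V s) s.
Hypothesis V_le : forall s t, inA K s -> near_simp S s -> (adeg s <= D)%N ->
  (0 < adeg t < adeg s)%N -> (forall B, inA B s -> inA B t) -> V t `<=` V s.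

Let P s := [/\ inA K s, near_simp S s & (adeg s <= D)%N].

Let abd_P s : P s -> csub (fun t => [/\ P t, (adeg t < adeg s)%N & forall B, inA B s -> inA B t])
  (@abd R F X << s >>).
Proof.
move=> [sK sS sD] t t0; have tK := csub_abd (csub1 sK) t0.
have tS := csub_abd_near sS t0; have td := adeg_abd t0.
split => //; last exact: (face_val t0).
by split => //; apply: leq_trans sD; exact: ltnW.
Qed.

(** A contracting homotopy up to degree n: it is carried by [V], vanishes on simplices in [W], and
    satisfies s = d h(s) + h(ds) modulo [relcoinv]. *)
Let carried (h : asimp R X -> C) n := forall s, P s -> (adeg s <= n)%N ->
  (inA W s -> h s = 0) /\ ((0 < adeg s)%N -> csub (inA (V s)) (h s) /\
    relcoinv W (V s) (<< s >> - abd (h s) - fglift h (abd << s >>))).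

Let inA_deg (s : asimp R X) B : inA B s -> adeg s = 0%N \/ exists x, B x.
Proof. by case: s => [[d s]|] sB; [right; exists (s (base d)); apply: sB|left]. Qed.

Let fglift_ext (h h' : asimp R X -> C) (Q : asimp R X -> Prop) c : csub Q c ->
  (forall s, Q s -> h s = h' s) -> fglift h c = fglift h' c.
Proof.
move=> cQ hh; apply: (csub_lin cQ (f := fglift h) (g := fglift h')); [lin|lin|].
by move=> s /hh E; rewrite !fglift1.
Qed.

Let defect_lin (h : asimp R X -> C) :
  lin (fun c : C => c - abd (fglift h c) - fglift h (abd c)).
Proof. lin. Qed.

(** The extension step of acyclic carriers: s - h(ds) lies in [V s] and is a cycle modulo
    [relcoinv], so relative acyclicity of [V s] supplies the value at [s]. *)
Let carried_step h n s : carried h n -> P s -> adeg s = n.+1 ->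
  exists y, (inA W s -> y = 0) /\ (csub (inA (V s)) y /\
    relcoinv W (V s) (<< s >> - abd y - fglift h (abd << s >>))).
Proof.
move=> hP Ps sn; have [sK sS sD] := Ps.
have s0 : (0 < adeg s)%N by rewrite sn.
have [[VX Vac VWb] Vs] := V_good sK sS (introT andP (conj s0 sD)).
(* In [W] the value 0 works: all faces lie in [W] as well, and [s] itself is zero relative to
   [W]. *)
have [sW|sW] := pselect (inA W s).
  exists 0; split => //; split; first exact: csub0.
  rewrite linear0 subr0; have -> : fglift h (abd << s >>) = 0.
    have HW := csub_abd (csub1 sW : csub (inA W) (<< s >> : C)).
    have : csub (fun t => h t = 0) (@abd R F X << s >>).
      move=> t t0; have [Pt ts _] := abd_P Ps t0.
      have tn : (adeg t <= n)%N by rewrite -ltnS -sn.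
      by have [/(_ (HW t t0))] := hP t Pt tn.
    move=> H; rewrite (@fglift_ext h (fun=> 0) _ _ H) //.
    by move: (abd _); apply: fg_ext => [||t]; [lin|lin|rewrite fglift1].
  rewrite subr0; apply: relcoinv_sub; apply: csub1.
  by case: (s) Vs sW => [[d s']|] //= Vs sW x; split.
have bV : block (V s).
  by case: VWb => // VW; case: sW; apply: inAW Vs.
have hfV : csub (inA (V s)) (fglift h (abd << s >>)).
  apply: (csub_map _ (abd_P Ps)) => [|t [Pt ts tB]]; first by lin.
  rewrite fglift1; have tn : (adeg t <= n)%N by rewrite -ltnS -sn.
  have [tW tC] := hP t Pt tn; have [t0|t0] := posnP (adeg t).
    by rewrite tW; [exact: csub0|case: (t) t0 => [[]|]].
  have [tV _] := tC t0; apply: csubW tV => u; apply: inAW.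
  by apply: V_le => //; rewrite t0 ts.
have [||y yV yR] := Vac (<< s >> - fglift h (abd << s >>)).
- by apply: csubB => //; apply: csub1.
(* Since dds = 0, the boundary equals c - d h(c) - h(dc) for c = ds, which the hypothesis on [h]
   controls face by face. *)
- have -> : abd (<< s >> - fglift h (abd << s >>)) =
      (fun c => c - abd (fglift h c) - fglift h (abd c)) (abd << s >>).
    by rewrite /= abd_abd linearB /= linear0 subr0.
  apply: (csub_ind (S := fun c => relcoinv W (V s) (c - abd (fglift h c) - fglift h (abd c))) (abd_P Ps)).
  + by rewrite (lin0 (defect_lin h)); exact: relcoinv0.
  + by move=> a c e cR eR; rewrite (defect_lin h a c e); apply: relcoinvP.
  + move=> t [Pt ts tB]; have tn : (adeg t <= n)%N by rewrite -ltnS -sn.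
    have [tW tC] := hP t Pt tn; have [t0|t0] := posnP (adeg t).
      rewrite fglift1 tW; last by case: (t) t0 => [[]|].
      case: (t) t0 => [[]|] // _; rewrite abd1 /= !linear0 !addr0.
      by apply: relcoinv_sub; apply: csub1.
    rewrite fglift1; have [tV tR] := tC t0; apply: relcoinvS bV tR.
      by apply: V_le => //; rewrite t0 ts.
    have [tK tS tD] := Pt; have [_ tVt] := V_good tK tS (introT andP (conj t0 tD)).
    by case: (inA_deg tVt) => [t00|[x Vx]]; [rewrite t00 in t0|exists x].
by exists y; split => //; split => //; rewrite addrAC.
Qed.

Let carried_ex n : exists h, carried h n.
Proof.
elim: n => [|n [h hP]].
  exists (fun=> 0) => s _; rewrite leqn0 => /eqP s0; split => //.
  by rewrite s0.
have /choice[h' h'P] : forall s, exists y, P s -> adeg s = n.+1 ->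
  (inA W s -> y = 0) /\ (csub (inA (V s)) y /\
    relcoinv W (V s) (<< s >> - abd y - fglift h (abd << s >>))).
  move=> s; have [[Ps sn]|H] := pselect (P s /\ adeg s = n.+1).
    by have [y yP] := carried_step hP Ps sn; exists y.
  by exists 0 => Ps sn; case: H.
exists (fun s => if (adeg s <= n)%N then h s else h' s) => s Ps sn.
have -> : fglift (fun s => if (adeg s <= n)%N then h s else h' s) (abd << s >>) =
    fglift h (abd << s >>).
  apply: (fglift_ext (@adeg_abd R F X s)) => t ts.
  by rewrite -ltnS (leq_trans ts sn).
case: ifP => sn'; first exact: hP.
have /(h'P s Ps)[? ?] : adeg s = n.+1 by apply/eqP; rewrite eqn_leq sn ltnNge sn'.
by [].
Qed.

(** The homotopy vanishes on the boundary of [c], which lies in [W]; so c - d h(c) is itself zero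
    modulo [relcoinv]. *)
Lemma carried_chain (c : C) : csub P c -> csub (inA W) (abd c) ->
  exists e r, [/\ csub (inA X1) e, relcoinv W X1 r & c = abd e + r].
Proof.
move=> cP cW; have [h hP] := carried_ex D.
have bX : block X1 by move=> s _ _ _ q; exact: X1_act.
have VX s : P s -> (0 < adeg s)%N -> V s `<=` X1 /\ V s !=set0.
  move=> [sK sS sD] s0; have [[VX1 _ _] Vs] := V_good sK sS (introT andP (conj s0 sD)).
  by split => //; case: (inA_deg Vs) => [s00|[x Vx]]; [rewrite s00 in s0|exists x].
exists (fglift h c), (c - abd (fglift h c)); split; last by zmod.
  apply: (csub_map _ cP) => [|s Ps]; first by lin.
  have [_ _ sD] := Ps; rewrite fglift1; have [sW sC] := hP s Ps sD.
  have [s0|s0] := posnP (adeg s).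
    by rewrite sW; [exact: csub0|case: (s) s0 => [[]|]].
  have [sV _] := sC s0; apply: csubW sV => t; apply: inAW.
  by have [] := VX s Ps s0.
have hc0 : fglift h (abd c) = 0.
  have cPW : csub (fun s => h s = 0) (abd c).
    have : csub P (abd c) by apply: (csub_map _ cP) => [|s Ps]; [lin|apply: csubW (abd_P Ps) => t []].
    move=> H s s0; have Ps := H s s0; have [_ _ sD] := Ps.
    by have [/(_ (cW s s0))] := hP s Ps sD.
  rewrite (@fglift_ext h (fun=> 0) _ _ cPW) //.
  by move: (abd _); apply: fg_ext => [||t]; [lin|lin|rewrite fglift1].
rewrite -[_ - _]subr0 -hc0.
apply: (csub_ind (S := fun c => relcoinv W X1 (c - abd (fglift h c) - fglift h (abd c))) cP).
- by rewrite (lin0 (defect_lin h)); exact: relcoinv0.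
- by move=> a d e dR eR; rewrite (defect_lin h a d e); apply: relcoinvP.
- move=> s Ps; have [_ _ sD] := Ps; rewrite fglift1; have [sW sC] := hP s Ps sD.
  have [s0|s0] := posnP (adeg s).
    rewrite sW; last by case: (s) s0 => [[]|].
    case: (s) s0 => [[]|] // _; rewrite abd1 /= !linear0 !addr0.
    by apply: relcoinv_sub; apply: csub1.
  have [_ sR] := sC s0; have [VX1 V0] := VX s Ps s0.
  exact: relcoinvS VX1 V0 bX sR.
Qed.

End Carried.

Lemma local_to_global (c : C) : csub (inA X1) c -> csub (inA W) (abd c) ->
  exists e r, [/\ csub (inA X1) e, relcoinv W X1 r & c = abd e + r].
Proof.
move=> cX cW; have [D cD] := adeg_ex c.
have [S [K [V [entS cK Vg Vl]]]] := carriers D cX.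
have [S' e' [S'S S's S't]] := ent_half entS.
(* Subdivision makes any two points of a simplex [S]-close, after which the carriers apply. *)
have [|n cn] := @small_chains R F X [set A | forall x y, A x -> A y -> S x y] c.
  suff cT : forall s : asimp R X, covered_simp [set A | forall x y, A x -> A y -> S x y] s by move=> s _; exact: cT.
  move=> [[d s]|] // x.
  exists (S' (s x)); first by move=> y z xy xz; apply: S't xz; apply: S's.
  by apply: (@cts_fun _ _ s); exact: (ent_nbhs entP).
have [||e [r [eX rR E]]] := carried_chain Vg Vl (c := iter n (@Sd R F X) c).
- have c1 : csub (inA K) (iter n (@Sd R F X) c) by exact: csub_iter_Sd.
  have c2 : csub (fun s => (adeg s <= D)%N) (iter n (@Sd R F X) c).
    by elim: (n) => //= m; exact: adeg_Sd.
  move=> s s0; split; [exact: c1|  |exact: c2].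
  have := cn s s0; case: (s) => [[d s']|] //= [A AS sA] x y.
  exact: AS.
- by rewrite iter_Sd_bd; apply: csub_iter_Sd.
exists (e + Sdhn n c), (r + Sdhn n (abd c)); split.
- by apply: csubD => //; apply: csub_Sdhn.
- apply: relcoinvD => //; apply: relcoinv_sub.
  have H : csub (inA W) (Sdhn n (abd c)) by exact: csub_Sdhn.
  by apply: csubW H => s; apply: inAW => p Wp; split => //; exact: WX.
- by rewrite linearD /= Sdhn_bd E; zmod.
Qed.

End LocalToGlobal.

(** * Symmetrized chains and their reduction to configurations *)

Section Symmetrization.
Variables (R : realType) (F : fieldType) (k : nat) (M : topologicalType).
Local Notation X := {ptws 'I_k -> M}.
Local Notation C := (achain R F X).
Hypothesis charF : [pchar F]%R =i pred0.

Definition symm (c : C) : C := \sum_(s : 'S_k) actc s c.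

Lemma symm_is_linear : linear symm.
Proof.
move=> a c d; rewrite /symm scaler_sumr -big_split.
by apply: eq_bigr => s _; rewrite linearP.
Qed.
HB.instance Definition _ := GRing.isLinear.Build F C C *:%R symm symm_is_linear.

Lemma actc_symm s c : actc s (symm c) = symm c.
Proof.
rewrite /symm linear_sum /= [RHS](reindex_inj (mulgI s)) /=.
by apply: eq_bigr => t _; rewrite actcM.
Qed.

Lemma symm_actc s c : symm (actc s c) = symm c.
Proof.
rewrite /symm [RHS](reindex_inj (mulIg s)) /=.
by apply: eq_bigr => t _; rewrite actcM.
Qed.

Lemma symm_bd c : abd (symm c) = symm (abd c).
Proof. by rewrite /symm linear_sum; apply: eq_bigr => s _; rewrite /= abd_actc. Qed.

Lemma fact_neq0 : (k`!)%:R != 0 :> F.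
Proof. by rewrite ((pcharf0P F).1 charF) -lt0n fact_gt0. Qed.

Lemma symm_symm c : symm (symm c) = (k`!)%:R *: symm c.
Proof.
rewrite {1}/symm (eq_bigr (fun=> symm c)); last by move=> s _; rewrite actc_symm.
by rewrite sumr_const -scaler_nat card_Sn.
Qed.

Lemma csub_symm (A : set X) c : (forall s p, A p -> A (act s p)) ->
  csub (inA A) c -> csub (inA A) (symm c).
Proof. by move=> AA cA; apply: csub_sum => s _; exact: (@csub_actc _ _ _ _ A A s c (AA s) cA). Qed.

(** Symmetrization cancels each difference f - s f, whatever stabilizer it came from, so the local
    quotients become one global statement. *)
Lemma symm_relcoinv (W V : set X) c : relcoinv W V c ->
  exists2 w, csub (inA W) w & symm c = symm w.
Proof.
move=> [w [f [wW _ _ ->]]]; exists w; first by apply: csubW wW => s; apply: inAW => p [].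
rewrite linearD linear_sum /= big1 ?addr0 // => s _.
by rewrite linearB /= symm_actc subrr.
Qed.

Lemma symm_None a : symm (a *: << None >>) = (k`!)%:R *: (a *: << None >>).
Proof.
rewrite {1}/symm (eq_bigr (fun=> a *: << None >>)).
  by rewrite sumr_const -scaler_nat card_Sn.
by move=> s _; rewrite linearZ /= /actc apush1.
Qed.

End Symmetrization.

Section ConfigurationChains.
Variables (R : realType) (F : fieldType) (n k : nat) (M : smooth_manifold R n).
Local Notation X := {ptws 'I_k -> M}.
Local Notation C := (achain R F X).
Hypothesis n_odd : odd n.
Hypothesis charF : [pchar F]%R =i pred0.
Hypothesis M_compact : compact [set: M].

Let X_uniformity : exists ent, @uniformity X ent.
Proof.
apply: (@compact_uniformity R).
  by apply: hausdorff_product => i; exact: manifold_hausdorff.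
have := @tychonoff 'I_k (fun=> M : topologicalType) (fun=> setT) (fun=> M_compact).
by rewrite (_ : [set f | _] = setT) //; apply/seteqP; split.
Qed.

(** One step down the filtration: after symmetrization the local-to-global principle leaves a
    boundary and a chain with fewer coincidences. *)
Let reduce m c : (k <= m)%N -> csub (inA (coinc_le m.+1)) c -> csub (inA (coinc_le m)) (abd c) ->
  exists (e w : C), [/\ csub (inA (coinc_le m.+1)) e, csub (inA (coinc_le m)) w &
    symm c = abd (symm e) + symm w].
Proof.
move=> km cX cW; have [ent entP] := X_uniformity.
have [|||e [r [eX rR E]]] := @local_to_global R F k M (coinc_le m) (coinc_le m.+1) ent entP _ _ _ c cX cW.
- by move=> p; rewrite /coinc_le /=; exact: leqW.
- exact: coinc_act.
- move=> x O xX xO; have [V [[Vo Vx] VO Vac Vb]] := @good_nbhd R F n k M n_odd charF m x O km xX xO.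
  exists V; split => //; first by move=> p /VO[].
  by split => // p /VO[].
have [w wW wE] := symm_relcoinv rR.
by exists e, w; split => //; rewrite E linearD /= symm_bd wE.
Qed.

(** Surjectivity on symmetrized classes, descending from k * k to k coincidences. The multiple of
    the empty simplex is the augmentation of [z]; it lies in every subset and so never obstructs the
    descent. *)
Lemma conf_cycle (z : C) a : abd z = a *: << None >> ->
  exists z' e, [/\ csub (inA (@conf k M)) z', abd z' = abd z & symm z = symm z' + abd e].
Proof.
move=> zN; have zT : csub (inA (@coinc_le k M (k * k))) z.
  by rewrite coinc_leT => -[[d s]|].
have kk : (k <= k * k)%N by case: (k) => // j; rewrite mulSn leq_addr.
rewrite -coinc_le_conf; move: kk zT; move: (k * k)%N => m /subnKC <-.
have k0 := fact_neq0 k charF.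
elim: (m - k)%N z zN => [|j IHj] z zN; first by rewrite addn0 => zX; exists z, 0; rewrite linear0 addr0.
rewrite addnS => zX; have [||e [w [eX wW E]]] := @reduce (k + j)%N z _ zX.
- exact: leq_addr.
- by rewrite zN; apply: csubZ; apply: csub1.
(* Normalized so that its symmetrization is that of [w], while its boundary is again that of [z]. *)
pose z1 := (k`!)%:R^-1 *: symm w.
have z1N : abd z1 = a *: << None >>.
  have : abd (symm z) = abd (symm w) by rewrite E linearD /= abd_abd add0r.
  rewrite symm_bd zN symm_None => H; rewrite /z1 linearZ /= -H.
  by rewrite [LHS]scalerA mulVf // scale1r.
have [|z' [e' [z'X z'E z1E]]] := IHj z1 z1N.
  by apply: csubZ; apply: (@csub_symm _ _ _ _ (coinc_le (k + j))) => //; exact: coinc_act.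
exists z', (e' + symm e); split => //; first by rewrite z'E z1N zN.
rewrite E linearD /= addrA -z1E /z1 linearZ /= symm_symm scalerA mulVf // scale1r.
by rewrite addrC.
Qed.

(** Injectivity: the same descent applied to the bounding chain, whose boundary already lies in the
    configuration space. *)
Lemma conf_boundary (z b : C) : csub (inA (@conf k M)) z -> symm z = abd b ->
  exists2 b', csub (inA (@conf k M)) b' & symm z = abd b'.
Proof.
move=> zX zb; have bT : csub (inA (@coinc_le k M (k * k))) b.
  by rewrite coinc_leT => -[[d s]|].
have kk : (k <= k * k)%N by case: (k) => // j; rewrite mulSn leq_addr.
rewrite -coinc_le_conf in zX *; move: kk bT; move: (k * k)%N => m /subnKC <-.
have k0 := fact_neq0 k charF.
elim: (m - k)%N b zb => [|j IHj] b zb; first by rewrite addn0 => bX; exists b.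
rewrite addnS => bX; have [||e [w [eX wW E]]] := @reduce (k + j)%N b _ bX.
- exact: leq_addr.
- rewrite -zb; apply: (@csub_symm _ _ _ _ (coinc_le (k + j))); first exact: coinc_act.
  apply: csubW zX => s; apply: inAW => p; rewrite /coinc_le /= => pk.
  exact: leq_trans pk (leq_addr _ _).
apply: (IHj ((k`!)%:R^-1 *: symm w)).
  have : abd (symm b) = abd (symm w) by rewrite E linearD /= abd_abd add0r.
  rewrite symm_bd -zb symm_symm linearZ /= => <-.
  by rewrite scalerA mulVf // scale1r.
by apply: csubZ; apply: (@csub_symm _ _ _ _ (coinc_le (k + j))) => //; exact: coinc_act.
Qed.

End ConfigurationChains.

Section ContinuousPush.
Variables (R : realType) (F : fieldType) (X Y Z : topologicalType) (f : X -> Y).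
Hypothesis fc : continuous f.

Let inT (c : achain R F X) : csub (inA setT) c.
Proof. by move=> [[d s]|]. Qed.

Let fcT : cts_on setT f.
Proof. exact: cts_on_cts. Qed.

Lemma apush_compc (g : Y -> Z) (c : achain R F X) : apush g (apush f c) = apush (g \o f) c.
Proof. exact: (@apush_comp _ _ _ _ _ setT f g c fcT (@inT c)). Qed.

Lemma apush_eq (g : X -> Y) (c : achain R F X) : f =1 g -> apush f c = apush g c.
Proof. by move=> fg; apply: (@apush_ext _ _ _ _ setT f g c (@inT c)) => x _. Qed.

Lemma apush_bdc (c : achain R F X) : abd (apush f c) = apush f (abd c).
Proof. exact: (@apush_bd _ _ _ _ setT f c fcT (@inT c)). Qed.

Lemma apush_iter_Sdc m (c : achain R F X) :
  apush f (iter m (@Sd R F X) c) = iter m (@Sd R F Y) (apush f c).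
Proof. exact: (@apush_iter_Sd _ _ _ _ setT f fcT m c (@inT c)). Qed.

End ContinuousPush.

(** * The covering of unordered by ordered configurations *)

Section SimplexConnected.
Variable R : realType.

Lemma simplex_connected d : connected (std_simplex R d).
Proof.
pose v0 : 'rV[R]_d.+1 := delta_mx 0 0.
have v0d : std_simplex R d v0 by apply: (@evs_simplex R d); apply: (map_f _ (mem_enum _ 0)).
pose seg (y : 'rV[R]_d.+1) := [set (1 - t) *: v0 + t *: y | t in `[0, 1]%classic].
have -> : std_simplex R d = \bigcup_(y in std_simplex R d) seg y.
  apply/seteqP; split => [y yd|_ [y yd] [t /= t01 <-]].
    by exists y => //; exists 1; rewrite ?subrr ?scale0r ?scale1r ?add0r //= in_itv /= ler01 lexx.
  move: t01; rewrite in_itv /= => /andP[t0 t1].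
  have [a0 a1] := v0d; have [b0 b1] := yd; split=> [i|].
    by rewrite 3!mxE; apply: addr_ge0; rewrite ?mulr_ge0 ?subr_ge0 //; rewrite mxE mulr_ge0.
  under eq_bigr do rewrite mxE [X in X + _]mxE [X in _ + X]mxE.
  rewrite big_split /= -!mulr_sumr.
  by rewrite a1 b1 !mulr1 subrK.
apply: bigcup_connected.
  by exists v0 => y _; exists 0; rewrite ?subr0 ?scale0r ?scale1r ?addr0 //= in_itv /= ler01 lexx.
move=> y _; apply: connected_continuous_connected; first exact: segment_connected.
apply: continuous_subspaceT => t.
apply: (@cvgD _ _ _ _ (nbhs_filter t)); apply: (@cvgZ _ _ _ _ (nbhs_filter t)).
- by apply: (@cvgB _ _ _ _ (nbhs_filter t)); [exact: cvg_cst|exact: cvg_id].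
- exact: cvg_cst.
- exact: cvg_id.
- exact: cvg_cst.
Qed.

Lemma simplex_clopen d (A : set (std_simplex R d)) x : open A -> open (~` A) -> A x ->
  forall y, A y.
Proof.
move=> [C Co CA] [D Do DA] Ax y.
have H := @simplex_connected d (set_val @` A).
have AE z : A z <-> C (set_val z) by rewrite -CA.
have nAE z : ~ A z <-> D (set_val z) by have : (~` A) z <-> D (set_val z) by rewrite -DA.
have : set_val @` A = std_simplex R d.
  apply: H; first by exists (set_val x), x.
  - exists C => //; apply/seteqP; split => [_ [z Az <-]|v [vd Cv]].
      by split; [exact: set_valP|apply/AE].
    by exists (exist _ v (mem_set vd)) => //; apply/AE.
  - exists (~` D); first exact: open_closedC.
    apply/seteqP; split => [_ [z Az <-]|v [vd nD]].
      by split; [exact: set_valP|move=> /nAE].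
    exists (exist _ v (mem_set vd)) => //; apply: contrapT => /nAE.
    exact: nD.
move/seteqP => [_ /(_ _ (set_valP y))[z Az zy]].
by rewrite -(val_inj zy).
Qed.

End SimplexConnected.

Section Subspace.
Variables (R : realType) (F : fieldType) (X : topologicalType) (A : set X).

(** Discards simplices that leave [A]; as a left inverse of the inclusion it shows that chains of a
    subspace inject. *)
Let res_simp (s : asimp R X) : achain R F A :=
  if s is Some (existT d s) then
    if pselect (forall x, A (s x)) is left sA then
      << amk (fun x => exist _ (s x) (mem_set (sA x)) : A) >>
    else 0
  else << None >>.

Let res_inc (s : asimp R A) : fglift res_simp (apush set_val << s >>) = << s >> :> achain R F A.
Proof.
rewrite apush1 fglift1; case: s => [[d s]|] //=.
have sc : continuous (set_val \o s).
  by move=> x; apply: continuous_comp; [exact: (@cts_fun _ _ s)|exact: set_val_cts].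
rewrite /amk; case: pselect => [sc'|[]] //=.
case: pselect => [sA|[]] /=; last by move=> x; exact: set_valP.
rewrite -amkE; congr << _ >>; apply: amk_ext => x.
exact: val_inj.
Qed.

Lemma sub_inj (c : achain R F A) : apush set_val c = 0 -> c = 0.
Proof.
move=> c0; suff -> : c = fglift res_simp (apush set_val c) by rewrite c0 linear0.
by move: c {c0}; apply: fg_ext => [||s]; [lin|lin|rewrite res_inc].
Qed.

Lemma sub_lift (c : achain R F X) : csub (inA A) c ->
  exists c' : achain R F A, apush set_val c' = c.
Proof.
move=> cA; apply: (csub_ind (S := fun c => exists c' : achain R F A, apush set_val c' = c) cA).
- by exists 0; rewrite linear0.
- by move=> a d e [d' <-] [e' <-]; exists (a *: d' + e'); rewrite linearP.
move=> [[d s]|] sA; last by exists << None >>; rewrite apush1.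
have sc : continuous (fun x => exist _ (s x) (mem_set (sA x)) : A).
  by apply: continuous_comp_initial; exact: (@cts_fun _ _ s).
exists << Some (existT (fun d => singular_simplex R A d) d (mkcts sc)) >>; rewrite apush1 /=.
by rewrite -[RHS]/(<< Some _ >>) -amkE; congr << _ >>; apply: amk_ext.
Qed.

Lemma inc_csub (c : achain R F A) : csub (inA A) (apush set_val c).
Proof.
apply: csub_mapT => [|[[d s]|]]; rewrite ?apush1; [lin| |exact: csub1].
by apply: csub1; apply: inA_amk => x; exact: set_valP.
Qed.

Lemma inc_bd (c : achain R F A) : abd (apush set_val c) = apush set_val (abd c).
Proof.
apply: (@apush_bd _ _ _ _ setT); first by apply: cts_on_cts; exact: set_val_cts.
by move=> [[d s]|].
Qed.

End Subspace.

Section Covering.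
Variables (R : realType) (F : fieldType) (n k : nat) (M : smooth_manifold R n).
Local Notation X := {ptws 'I_k -> M}.
Local Notation Y := (@conf k M : Type).
Local Notation B := (unordered_conf k M).
Hypothesis charF : [pchar F]%R =i pred0.

Definition unorder (y : Y) : B := \pi_(B) y.

Lemma unorder_cts : continuous unorder.
Proof. exact: pi_continuous. Qed.

Lemma conf_act s (p : X) : conf p -> conf (act s p).
Proof. by move=> pi i j /pi/perm_inj. Qed.

Definition act_conf (s : 'S_k) (y : Y) : Y :=
  exist _ (act s (set_val y)) (mem_set (@conf_act s _ (set_valP y))).

Lemma act_conf_cts s : continuous (act_conf s).
Proof.
apply: continuous_comp_initial => y.
apply: (@continuous_comp _ _ _ (@set_val X (@conf k M)) (act s)); first exact: set_val_cts.
exact: act_cts.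
Qed.

Lemma coverP y y' : unorder y = unorder y' <-> exists s, y' = act_conf s y.
Proof.
split=> [E|[s ->]].
  have /eqmodP/asboolP[s sP] : y = y' %[mod {eq_quot @perm_related k M}] by exact: E.
  exists s; apply: val_inj; apply/funext => i.
  exact: sP.
suff : y = act_conf s y %[mod {eq_quot @perm_related k M}] by [].
by apply/eqmodP/asboolP; exists s.
Qed.

Lemma unorder_act s y : unorder (act_conf s y) = unorder y.
Proof. by apply/esym/coverP; exists s. Qed.

Lemma act_conf_inj s t y : act_conf s y = act_conf t y -> s = t.
Proof.
move=> E; apply/permP => i; apply: (set_valP y).
have /(congr1 (fun z : Y => set_val z i)) := E; exact.
Qed.

Lemma act_confM s t y : act_conf s (act_conf t y) = act_conf (s * t)%g y.
Proof. by apply: val_inj; exact: actM. Qed.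

Lemma unorder_open (U : set Y) : open U -> open (unorder @` U).
Proof.
move=> Uo; rewrite /open /= /quotient_open.
have -> : \pi_(B) @^-1` (unorder @` U) = \bigcup_(s in [set: 'S_k]) act_conf s @^-1` U.
  apply/seteqP; split => y.
    by move=> [u Uu /esym/coverP[s us]]; exists s => //; rewrite /preimage /= -us.
  by move=> [s _ Us]; exists (act_conf s y) => //; exact: unorder_act.
by apply: bigcup_open => s _; apply: open_comp => // y _; exact: act_conf_cts.
Qed.

Lemma unorder_local_inj (y : Y) : exists U : set Y, [/\ open U, U y &
  forall u u' : Y, U u -> U u' -> unorder u = unorder u' -> u = u'].
Proof.
have [P Py [_ Ps]] := sep_nbhds (@filterT _ (nbhs (set_val y)) _).
exists (set_val @^-1` (fun p : X => forall i, (P (set_val y i))° (p i))); split.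
- apply: open_comp; first by move=> z _; exact: set_val_cts.
  by apply: (@prod_open k M (fun i => (P (set_val y i))°)) => i; exact: open_interior.
- by move=> i; exact: Py.
- move=> u u' uU u'U /coverP[s us]; rewrite us; apply: val_inj; apply/funext => i /=.
  rewrite /act; congr (set_val u _); symmetry.
  apply: (set_valP y); apply: (Ps _ _ (set_val u' i)).
    by apply: interior_subset; have := uU (s i); rewrite us.
  by apply: interior_subset; exact: u'U.
Qed.

(** The sets where [t] agrees with g s are closed, disjoint for different g by freeness of the
    action, and finite in number; so they are also open, and the simplex is connected. *)
Lemma simplex_lift_unique d (s t : singular_simplex R Y d) :
  (forall x, unorder (s x) = unorder (t x)) -> exists g, forall x, t x = act_conf g (s x).
Proof.
move=> st; pose x0 : std_simplex R d :=
  exist _ (delta_mx 0 0) (mem_set (@evs_simplex R d _ (map_f _ (mem_enum _ 0)))).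
have [g g0] := (coverP _ _).1 (st x0).
have hY : hausdorff_space Y.
  move=> p q H; apply: val_inj; have hX : hausdorff_space X.
    by apply: hausdorff_product => i; exact: manifold_hausdorff.
  apply: hX => U V /set_val_cts pU /set_val_cts qV.
  by have [z [Uz Vz]] := H _ _ pU qV; exists (set_val z).
have agree h : closed [set x | t x = act_conf h (s x)].
  rewrite -[X in closed X]setCK; apply: open_closedC; rewrite openE => x /= nx.
  have /eqP tx : t x <> act_conf h (s x) by [].
  have := hY; rewrite open_hausdorff => /(_ _ _ tx)[[U V] /= [Ux Vx] [Uo Vo /eqP UV]].
  have tU : nbhs x (t @^-1` U).
    by apply: (@cts_fun _ _ t); apply: open_nbhs_nbhs; split => //; exact: set_mem.
  have hc : continuous (act_conf h \o s).
    by move=> z; apply: continuous_comp; [exact: (@cts_fun _ _ s)|exact: act_conf_cts].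
  have sV : nbhs x ((act_conf h \o s) @^-1` V).
    by apply: hc; apply: open_nbhs_nbhs; split => //; exact: set_mem.
  apply: filterS2 tU sV => z /= Uz Vz tz; rewrite tz in Uz.
  have : (U `&` V) (act_conf h (s z)) by [].
  by rewrite UV.
exists g => x; apply: (@simplex_clopen R d [set x | t x = act_conf g (s x)] x0) => //.
  have -> : [set x | t x = act_conf g (s x)] =
      ~` \bigcup_(h in [set h | h <> g]) [set x | t x = act_conf h (s x)].
    apply/seteqP; split => z.
      by move=> /= tz [h /= hg]; rewrite tz => /act_conf_inj E; apply: hg.
    move=> /= H; have [h tz] := (coverP _ _).1 (st z).
    have [hg|hg] := pselect (h = g); first by rewrite tz hg.
    by exfalso; apply: H; exists h.
  by apply: closed_openC; apply: closed_bigcup => //; exact: finite_finset.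
by apply: closed_openC; exact: agree.
Qed.

(** Simplices inside the image of one sheet lift through the local inverse; subdivision reduces all
    chains to these. *)
Lemma simplex_lift_exists (U : set Y) d (s : singular_simplex R B d) : open U ->
  (forall u u' : Y, U u -> U u' -> unorder u = unorder u' -> u = u') ->
  (forall x, (unorder @` U) (s x)) ->
  exists t : singular_simplex R Y d, forall x, unorder (t x) = s x.
Proof.
move=> Uo Ui sU.
have /choice[t tP] : forall x, exists y, U y /\ unorder y = s x.
  by move=> x; have [y Uy ys] := sU x; exists y.
have tc : continuous t.
  move=> x O; rewrite nbhsE => -[U' [U'o U'x] U'O].
  have : nbhs (s x) (unorder @` (U' `&` U)).
    apply: open_nbhs_nbhs; split; first by apply: unorder_open; exact: openI.
    by have [Ut <-] := tP x; exists (t x).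
  move=> /(@cts_fun _ _ s) H; suff : nbhs x (t @^-1` O) by [].
  have {H} : nbhs x (s @^-1` (unorder @` (U' `&` U))) by [].
  apply: filterS => x' [y [U'y Uy] ys]; apply: U'O.
  by have [Ut tx] := tP x'; rewrite (Ui (t x') y) // tx.
by exists (mkcts tc : continuousType (std_simplex R d) (@conf k M)) => x; have [] := tP x.
Qed.

Definition symm_conf (c : achain R F Y) : achain R F Y := \sum_(s : 'S_k) apush (act_conf s) c.

Lemma symm_conf_is_linear : linear symm_conf.
Proof.
move=> a c d; rewrite /symm_conf scaler_sumr -big_split.
by apply: eq_bigr => s _; rewrite linearP.
Qed.
HB.instance Definition _ := GRing.isLinear.Build F _ _ *:%R symm_conf symm_conf_is_linear.

Lemma symm_conf_act s c : symm_conf (apush (act_conf s) c) = symm_conf c.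
Proof.
rewrite /symm_conf [RHS](reindex_inj (mulIg s)) /=; apply: eq_bigr => t _.
rewrite (apush_compc (@act_conf_cts s)); by apply: apush_eq => y; exact: act_confM.
Qed.

Lemma symm_conf_bd c : abd (symm_conf c) = symm_conf (abd c).
Proof.
rewrite /symm_conf linear_sum; apply: eq_bigr => s _.
exact: (apush_bdc (@act_conf_cts s)).
Qed.

Lemma unorder_symm c : apush unorder (symm_conf c) = (k`!)%:R *: apush unorder c.
Proof.
rewrite /symm_conf linear_sum /= (eq_bigr (fun=> apush unorder c)).
  by rewrite sumr_const -scaler_nat card_Sn.
move=> s _; rewrite (apush_compc (@act_conf_cts s)).
by apply: apush_eq => y; exact: unorder_act.
Qed.

Lemma inc_symm c : apush set_val (symm_conf c) = symm (apush set_val c).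
Proof.
rewrite /symm_conf /symm linear_sum /=; apply: eq_bigr => s _.
rewrite (apush_compc (@act_conf_cts s)).
by rewrite /actc (apush_compc (@set_val_cts _ _)).
Qed.

(** The transfer: the sum of the translates of one chosen lift, independent of the choice by
    uniqueness of lifts. A simplex without lift gets the default 0. *)
Let transfer_simp (s : asimp R B) : achain R F Y :=
  if s is Some (existT d s) then
    if pselect (exists t : singular_simplex R Y d, forall x, unorder (t x) = s x) is left H
    then symm_conf << Some (existT _ d (projT1 (cid H))) >> else 0
  else symm_conf << None >>.

Let transfer_cover c : fglift transfer_simp (apush unorder c) = symm_conf c.
Proof.
move: c; apply: fg_ext => [||s]; [lin|lin|rewrite apush1 fglift1].
case: s => [[d s]|] //=.
have sc : continuous (unorder \o s).
  by move=> x; apply: continuous_comp; [exact: (@cts_fun _ _ s)|exact: unorder_cts].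
rewrite /amk; case: pselect => [sc'|[]] //=.
case: pselect => [H|[]] /=; last by exists s.
case: cid => t /= tP.
have [|g gP] := @simplex_lift_unique d s t; first by move=> x; rewrite tP.
rewrite -(symm_conf_act g << Some (existT _ d s) >>) apush1 /=; congr (symm_conf << _ >>).
by rewrite -amkE; apply: amk_ext => x; exact: gP.
Qed.

Lemma unorder_eq0 c : apush unorder c = 0 -> symm_conf c = 0.
Proof. by move=> c0; rewrite -transfer_cover c0 linear0. Qed.

Definition evenly_covered : set (set B) := [set unorder @` U | U in
  [set U : set Y | open U /\ forall u u' : Y, U u -> U u' -> unorder u = unorder u' -> u = u']].

Lemma lift_chain (c : achain R F B) : exists m c', apush unorder c' = iter m (@Sd R F B) c.
Proof.
have [|m cm] := @small_chains R F B evenly_covered c.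
  suff cT : forall s : asimp R B, covered_simp evenly_covered s by move=> s _; exact: cT.
  move=> [[d s]|] // x.
  have [U [Uo Uy Ui]] := unorder_local_inj (repr (s x)).
  exists (unorder @` U); first by exists U.
  apply: (@cts_fun _ _ s); apply: open_nbhs_nbhs; split; first exact: unorder_open.
  by exists (repr (s x)) => //; exact: reprK.
exists m; apply: (csub_ind (S := fun c => exists c', apush unorder c' = c) cm).
- by exists 0; rewrite linear0.
- by move=> a d e [d' <-] [e' <-]; exists (a *: d' + e'); rewrite linearP.
move=> [[d s]|]; last by exists << None >>; rewrite apush1.
move=> [_ [U [Uo Ui] <-] sU].
have [t tP] := simplex_lift_exists Uo Ui sU.
exists << Some (existT _ d t) >>; rewrite apush1 /= -[RHS]/(<< Some _ >>) -amkE; congr << _ >>.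
by apply: amk_ext => x; exact: tP.
Qed.

Let iter_Sd_None (Z : topologicalType) m a : iter m (@Sd R F Z) (a *: << None >>) = a *: << None >>.
Proof. by elim: m => //= m ->; rewrite linearZ /= /Sd oper1 /= scale1r. Qed.

Let Sdhn_None (Z : topologicalType) m a : Sdhn m (a *: << None >> : achain R F Z) = 0.
Proof.
elim: m => //= m IHm; rewrite [X in Sdhn m X](iter_Sd_None _ 1) IHm addr0.
by rewrite linearZ /= /Sdh oper1 /= scale0r scaler0.
Qed.

(** A lift of a subdivision of [b] need not be a cycle, but the defect of its boundary projects to
    zero and is therefore annihilated by symmetrization; the symmetrized lift is divided by k!. *)
Lemma unorder_cycle (b : achain R F B) a : abd b = a *: << None >> ->
  exists z e, abd z = a *: << None >> /\ b = apush unorder z + abd e.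
Proof.
move=> bN; have [m [c cE]] := lift_chain b; have k0 := fact_neq0 k charF.
have s0 : symm_conf (abd c - a *: << None >>) = 0.
  apply: unorder_eq0; rewrite linearB /= -(apush_bdc unorder_cts) cE iter_Sd_bd bN.
  by rewrite iter_Sd_None linearZ /= apush1 subrr.
have sN : symm_conf (a *: << None >>) = (k`!)%:R *: (a *: << None >>).
  rewrite /symm_conf (eq_bigr (fun=> a *: << None >>)).
    by rewrite sumr_const -scaler_nat card_Sn.
  by move=> s _; rewrite linearZ /= apush1.
exists ((k`!)%:R^-1 *: symm_conf c), (Sdhn m b); split.
  rewrite linearZ /= symm_conf_bd; move: s0; rewrite linearB /= => /eqP.
  by rewrite subr_eq0 => /eqP ->; rewrite sN [LHS]scalerA mulVf // scale1r.
rewrite linearZ /= unorder_symm scalerA mulVf // scale1r cE Sdhn_bd bN Sdhn_None.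
by zmod.
Qed.

(** The same for injectivity: a lift of a subdivision of [e] bounds the subdivided [z] after
    symmetrization. *)
Lemma unorder_boundary (z : achain R F Y) a e : abd z = a *: << None >> ->
  apush unorder z = abd e -> exists e', symm_conf z = abd e'.
Proof.
move=> zN ze; have [m [c cE]] := lift_chain e.
have s0 : symm_conf (iter m (@Sd R F Y) z - abd c) = 0.
  apply: unorder_eq0; rewrite linearB /= -(apush_bdc unorder_cts) cE iter_Sd_bd -ze.
  by rewrite (apush_iter_Sdc unorder_cts) subrr.
exists (symm_conf c + symm_conf (Sdhn m z)).
rewrite linearD /= !symm_conf_bd Sdhn_bd zN Sdhn_None subr0.
move: s0; rewrite linearB /= => /eqP; rewrite subr_eq0 => /eqP H.
by rewrite linearB /= H; zmod.
Qed.

End Covering.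

(** * Tensor powers of based complexes *)

(** Complexes with a homogeneous basis in degrees at least 0; the tensor powers then have lists of
    basis elements as basis. In degree 0 the condition [gbd_deg] forces a zero boundary. *)
Record gbasis (F : fieldType) := Gbasis {
  gb_sort :> choiceType;
  gdeg : gb_sort -> nat;
  gbd : gb_sort -> {freeg gb_sort / F};
  gbd_deg : forall a, csub (fun b => (gdeg b).+1 = gdeg a) (gbd a);
  gbd_gbd : forall a, fglift gbd (gbd a) = 0 }.

Section Tensor.
Variables (F : fieldType) (A : gbasis F).
Local Notation C := {freeg A / F}.
Local Notation T := {freeg (seq A) / F}.

Definition gd : C -> C := fglift (@gbd F A).
HB.instance Definition _ := GRing.Linear.copy gd (fglift _).

Lemma gd1 a : gd << a >> = gbd a. Proof. exact: fglift1. Qed.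

(** The Koszul sign as an operator, so that sign rules can be stated for inhomogeneous chains. *)
Definition gsgn : C -> C := fglift (fun a => (-1) ^+ gdeg a *: << a >>).
HB.instance Definition _ := GRing.Linear.copy gsgn (fglift _).

Lemma gsgn1 a : gsgn << a >> = (-1) ^+ gdeg a *: << a >>. Proof. exact: fglift1. Qed.

Lemma gsgn_deg d c : csub (fun a : A => gdeg a = d) c -> gsgn c = (-1) ^+ d *: c.
Proof.
move=> cd; apply: (csub_lin cd (f := gsgn) (g := fun c => (-1) ^+ d *: c)); [lin|lin|].
by move=> a ad; rewrite gsgn1 ad.
Qed.

Lemma sgnK (m : nat) (V : lmodType F) (x : V) : (-1) ^+ m *: ((-1) ^+ m *: x) = x.
Proof. by rewrite scalerA -expr2 sqrr_sign scale1r. Qed.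

Lemma gsgn_gbd a : gsgn (gbd a) = - ((-1) ^+ gdeg a *: gbd a).
Proof.
have H : csub (fun b => (gdeg b).+1 = gdeg a) (gbd a) by exact: gbd_deg.
have -> : - ((-1) ^+ gdeg a *: gbd a) = (fun c => - ((-1) ^+ gdeg a *: c)) (gbd a) by [].
apply: (csub_lin H (f := gsgn) (g := fun c => - ((-1) ^+ gdeg a *: c))); [lin|lin|].
by move=> b ba; rewrite gsgn1 -ba exprS mulN1r scaleNr opprK.
Qed.

Lemma gsgn_gd c : gsgn (gd c) = - gd (gsgn c).
Proof.
move: c; apply: fg_ext => [||a]; [lin|lin|].
by rewrite gd1 gsgn_gbd gsgn1 [gd (_ *: _)]linearZ /= gd1.
Qed.

Lemma gd_gd c : gd (gd c) = 0.
Proof. by move: c; apply: fg_ext => [||a]; [lin|lin|rewrite gd1; exact: gbd_gbd]. Qed.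

Definition tens (t : T) : C -> T := fglift (fun a => lcons a t).
HB.instance Definition _ t := GRing.Linear.copy (tens t) (fglift _).

Lemma tens1 t a : tens t << a >> = lcons a t. Proof. exact: fglift1. Qed.

Lemma tens_linr c : lin (fun t => tens t c).
Proof.
move=> x t u; move: c; apply: fg_ext => [||a]; [lin|lin|].
by rewrite !tens1 linearP.
Qed.

Fixpoint tbd_seq (s : seq A) : T :=
  if s is a :: r then tens << r >> (gbd a) + (-1) ^+ gdeg a *: lcons a (tbd_seq r) else 0.

Definition tbd : T -> T := fglift tbd_seq.
HB.instance Definition _ := GRing.Linear.copy tbd (fglift _).

Lemma tbd1 s : tbd << s >> = tbd_seq s. Proof. exact: fglift1. Qed.

Lemma tbd_nil : tbd << [::] >> = 0. Proof. exact: tbd1. Qed.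

Lemma tbd_lcons a t : tbd (lcons a t) = tens t (gbd a) + (-1) ^+ gdeg a *: lcons a (tbd t).
Proof.
have L := tens_linr (gbd a).
move: t; apply: fg_ext => [|| r]; [lin| |by rewrite lcons1 !tbd1].
by apply: lin_add; [exact: L|lin].
Qed.

Lemma tbd_tens t c : tbd (tens t c) = tens t (gd c) + tens (tbd t) (gsgn c).
Proof.
move: c; apply: fg_ext => [||a]; [lin|lin|].
by rewrite tens1 tbd_lcons gd1 gsgn1 linearZ /= tens1.
Qed.

Lemma tbd_tbd t : tbd (tbd t) = 0.
Proof.
move: t; apply: fg_ext => [||s]; [lin|lin|].
elim: s => [|a r IHr]; first by rewrite tbd_nil linear0.
rewrite -lcons1 tbd_lcons linearD /= tbd_tens linearZ /= tbd_lcons IHr !linear0 addr0.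
rewrite -gd1 gd_gd gd1 gsgn_gbd !linear0 add0r linearN linearZ /=.
by rewrite addrC subrr.
Qed.

Definition tdeg (s : seq A) := sumn (map (@gdeg F A) s).

Lemma tdeg_cons a r : tdeg (a :: r) = (gdeg a + tdeg r)%N. Proof. by []. Qed.

Lemma csub_lcons (P Q : seq A -> Prop) a t : (forall r, P r -> Q (a :: r)) -> csub P (t : T) ->
  csub Q (lcons a t : T).
Proof.
move=> PQ tP; apply: (csub_map _ tP) => [|r /PQ aQ]; first by lin.
by rewrite lcons1; apply: csub1.
Qed.

Lemma csub_tens (P : A -> Prop) (Q S : seq A -> Prop) t c :
  (forall a r, P a -> Q r -> S (a :: r)) -> csub P c -> csub Q t -> csub S (tens t c).
Proof.
move=> PQ cP tQ; apply: (csub_map _ cP) => [|a aP]; first by lin.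
by rewrite tens1; apply: csub_lcons tQ => r; apply: PQ.
Qed.

Lemma tbd_deg s : csub (fun r => (tdeg r).+1 = tdeg s /\ size r = size s) (tbd << s >>).
Proof.
elim: s => [|a r IHr]; first by rewrite tbd_nil; exact: csub0.
rewrite -lcons1 tbd_lcons; apply: csubD.
  have H : csub (fun s => s = r) (<< r >> : T) by exact: csub1.
  apply: (csub_tens _ (@gbd_deg F A a) H) => b s /= ba ->.
  by rewrite !tdeg_cons -ba addSn.
apply: csubZ; apply: csub_lcons IHr => s [sr /= ->].
by rewrite !tdeg_cons -sr addnS.
Qed.

End Tensor.

Section TensorMap.
Variables (F : fieldType) (A B : gbasis F).
Local Notation CA := {freeg A / F}.
Local Notation CB := {freeg B / F}.
Local Notation lins := (nat -> {linear CA -> CB}).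

(** The maps are indexed by position, since models will be realized in a different simplex in each
    factor. *)
Fixpoint tmap_seq (f : lins) (s : seq A) : {freeg (seq B) / F} :=
  if s is a :: r then tens (tmap_seq (fun i => f i.+1) r) (f 0%N << a >>) else << [::] >>.

Definition tmap (f : lins) : {freeg (seq A) / F} -> {freeg (seq B) / F} :=
  fglift (tmap_seq f).
HB.instance Definition _ f := GRing.Linear.copy (tmap f) (fglift _).

Lemma tmap1 (f : lins) s : tmap f << s >> = tmap_seq f s. Proof. exact: fglift1. Qed.

Lemma tmap_nil (f : lins) : tmap f << [::] >> = << [::] >>. Proof. exact: tmap1. Qed.

Lemma tmap_lcons (f : lins) a t : tmap f (lcons a t) = tens (tmap (fun i => f i.+1) t) (f 0%N << a >>).
Proof.
have L := tens_linr (f 0%N << a >>).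
move: t; apply: fg_ext => [|| r]; [lin| |by rewrite lcons1 !tmap1].
by apply: (lin_comp L); lin.
Qed.

Lemma tmap_tens (f : lins) t c : tmap f (tens t c) = tens (tmap (fun i => f i.+1) t) (f 0%N c).
Proof. by move: c; apply: fg_ext => [||a]; [lin|lin|rewrite tens1 tmap_lcons]. Qed.

Lemma tmap_bd (f : lins) t : (forall i c, gd (f i c) = f i (gd c)) ->
  (forall i c, gsgn (f i c) = f i (gsgn c)) -> tbd (tmap f t) = tmap f (tbd t).
Proof.
move=> fb fs; move: t; apply: fg_ext => [||s]; [lin|lin|].
elim: s f fb fs => [|a r IHr] f fb fs; first by rewrite tmap_nil !tbd_nil linear0.
rewrite -lcons1 tmap_lcons tbd_tens tbd_lcons linearD /= tmap_tens linearZ /= tmap_lcons.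
by rewrite IHr // fb gd1 fs gsgn1 !linearZ.
Qed.

End TensorMap.

Lemma gsgn_map (F : fieldType) (A B : gbasis F) (f : {linear {freeg A / F} -> {freeg B / F}}) c :
  (forall a, csub (fun b => gdeg b = gdeg a) (f << a >>)) -> gsgn (f c) = f (gsgn c).
Proof.
move=> fd; move: c; apply: fg_ext => [||a]; [lin|lin|].
by rewrite (gsgn_deg (fd a)) gsgn1 linearZ.
Qed.

Section TensorHomotopy.
Variables (F : fieldType) (A : gbasis F).
Local Notation C := {freeg A / F}.
Local Notation T := {freeg (seq A) / F}.
Variables (D P : {linear C -> C}).
Hypothesis DP : forall c, gd (D c) + D (gd c) = c - P c.
Hypothesis D_sgn : forall c, gsgn (D c) = - D (gsgn c).
Hypothesis P_gd : forall c, gd (P c) = P (gd c).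
Hypothesis P_sgn : forall c, gsgn (P c) = P (gsgn c).

(** The tensor power of a homotopy [D] from the identity to [P]: the sum over positions of P ... P D
    1 ... 1, with Koszul signs. *)
Fixpoint thom_seq (s : seq A) : T :=
  if s is a :: r then tens << r >> (D << a >>) + tens (thom_seq r) (gsgn (P << a >>)) else 0.

Definition thom : T -> T := fglift thom_seq.
HB.instance Definition _ := GRing.Linear.copy thom (fglift _).

Lemma thom1 s : thom << s >> = thom_seq s. Proof. exact: fglift1. Qed.

Lemma thom_lcons a t : thom (lcons a t) = tens t (D << a >>) + tens (thom t) (gsgn (P << a >>)).
Proof.
have L1 := tens_linr (D << a >>); have L2 := tens_linr (gsgn (P << a >>)).
move: t; apply: fg_ext => [|| r]; [lin| |by rewrite lcons1 !thom1].
by apply: lin_add; [exact: L1|apply: (lin_comp L2); lin].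
Qed.

Lemma thom_tens t c : thom (tens t c) = tens t (D c) + tens (thom t) (gsgn (P c)).
Proof. by move: c; apply: fg_ext => [||a]; [lin|lin|rewrite tens1 thom_lcons]. Qed.

Lemma thom_bd t : tbd (thom t) + thom (tbd t) = t - tmap (fun=> P) t.
Proof.
move: t; apply: fg_ext => [||s]; [lin|lin|].
elim: s => [|a r IHr].
  by rewrite tbd_nil linear0 addr0 tmap_nil subrr thom1 linear0.
have Pa c : gsgn (gsgn c) = c :> C.
  move: c; apply: fg_ext => [||b]; [lin|lin|].
  by rewrite gsgn1 linearZ /= gsgn1 sgnK.
rewrite -lcons1 thom_lcons linearD /= !tbd_tens tbd_lcons linearD /= thom_tens.
rewrite linearZ /= thom_lcons tmap_lcons /= Pa.
(* [E1] is the homotopy formula in the first factor, [E4] the induction hypothesis in the others; in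
   [E2] and [E3] the mixed terms cancel by the sign rules. *)
have E1 : tens << r >> (gd (D << a >>)) + tens << r >> (D (gbd a)) =
    lcons a << r >> - tens << r >> (P << a >>).
  by rewrite -linearD /= -[gbd a]gd1 DP linearB /= tens1.
have E2 : tens (tbd << r >>) (gsgn (D << a >>)) + (-1) ^+ gdeg a *: tens (tbd << r >>) (D << a >>) = 0.
  rewrite D_sgn gsgn1 [D _]linearZ [tens _ _]linearN /= [tens _ (_ *: _)]linearZ /=.
    by rewrite addrC subrr.
have E3 : tens (thom << r >>) (gd (gsgn (P << a >>))) + tens (thom << r >>) (gsgn (P (gbd a))) = 0.
  by rewrite -linearD /= -[gbd a]gd1 -P_gd gsgn_gd subrr linear0.
have E4 : tens (tbd (thom << r >>)) (P << a >>) + (-1) ^+ gdeg a *: tens (thom (tbd << r >>)) (gsgn (P << a >>)) =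
    tens << r >> (P << a >>) - tens (tmap (fun=> P) << r >>) (P << a >>).
  have -> : (-1) ^+ gdeg a *: tens (thom (tbd << r >>)) (gsgn (P << a >>)) =
      tens (thom (tbd << r >>)) (P << a >>).
    by rewrite P_sgn gsgn1 !linearZ /= sgnK.
  have L := tens_linr (P << a >>).
  by rewrite -[X in X + _]scale1r -L scale1r IHr -[X in tens X _]/(_ + _) -[_ - _]addrC -scaleN1r L scaleN1r addrC.
rewrite scalerDr.
rewrite -[RHS]addr0.
transitivity ((tens << r >> (gd (D << a >>)) + tens << r >> (D (gbd a))) +
  (tens (tbd << r >>) (gsgn (D << a >>)) + (-1) ^+ gdeg a *: tens (tbd << r >>) (D << a >>)) +
  (tens (thom << r >>) (gd (gsgn (P << a >>))) + tens (thom << r >>) (gsgn (P (gbd a)))) +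
  (tens (tbd (thom << r >>)) (P << a >>) + (-1) ^+ gdeg a *: tens (thom (tbd << r >>)) (gsgn (P << a >>)))).
  by zmod.
by rewrite E1 E2 E3 E4; zmod.
Qed.

End TensorHomotopy.

Section TensorSwap.
Variables (F : fieldType) (A : gbasis F).
Local Notation T := {freeg (seq A) / F}.

Fixpoint swap (V : Type) p (s : seq V) : seq V :=
  match p, s with
  | 0%N, a :: b :: r => b :: a :: r
  | p'.+1, a :: r => a :: swap p' r
  | _, _ => s
  end.

Fixpoint swap_deg p (s : seq A) : nat :=
  match p, s with
  | 0%N, a :: b :: r => gdeg a * gdeg b
  | p'.+1, a :: r => swap_deg p' r
  | _, _ => 0
  end.

Definition tswap p : T -> T := fglift (fun s => (-1) ^+ swap_deg p s *: << swap p s >>).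
HB.instance Definition _ p := GRing.Linear.copy (tswap p) (fglift _).

Lemma tswap1 p s : tswap p << s >> = (-1) ^+ swap_deg p s *: << swap p s >>.
Proof. exact: fglift1. Qed.

Lemma tswapS p a t : tswap p.+1 (lcons a t) = lcons a (tswap p t).
Proof.
move: t; apply: fg_ext => [||s]; [lin|lin|].
by rewrite lcons1 !tswap1 linearZ /= lcons1.
Qed.

Lemma tswap0 a b t : tswap 0 (lcons a (lcons b t)) =
  (-1) ^+ (gdeg a * gdeg b) *: lcons b (lcons a t).
Proof.
move: t; apply: fg_ext => [||s]; [lin|lin|].
by rewrite !lcons1 tswap1.
Qed.

Lemma tswap_bd p t : tbd (tswap p t) = tswap p (tbd t).
Proof.
move: t; apply: fg_ext => [||s]; [lin|lin|].
elim: p s => [|p IHp] [|a s].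
- by rewrite tswap1 /= scale1r tbd_nil linear0.
- case: s => [|b r].
    rewrite tswap1 /= scale1r -lcons1 tbd_lcons tbd_nil !linear0 addr0.
    by move: (gbd a); apply: fg_ext => [||b]; [lin|lin|rewrite tens1 lcons1 tswap1 scale1r].
  rewrite -!lcons1 tswap0 linearZ /= !tbd_lcons.
  have E1 : tswap 0 (tens (lcons b << r >>) (gbd a)) =
      ((-1) ^+ (gdeg a * gdeg b) * (-1) ^+ gdeg b) *: lcons b (tens << r >> (gbd a)).
    apply: (csub_lin (@gbd_deg F A a) (f := fun c => tswap 0 (tens (lcons b << r >>) c))
      (g := fun c => ((-1) ^+ (gdeg a * gdeg b) * (-1) ^+ gdeg b) *: lcons b (tens << r >> c)));
      [lin|lin|move=> a' aE].
    rewrite !tens1 tswap0 -aE mulSn exprD mulrAC -expr2 sqrr_sign mul1r.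
    by [].
  have E2 : tswap 0 (lcons a (tens << r >> (gbd b))) =
      ((-1) ^+ (gdeg a * gdeg b) * (-1) ^+ gdeg a) *: tens (lcons a << r >>) (gbd b).
    apply: (csub_lin (@gbd_deg F A b) (f := fun c => tswap 0 (lcons a (tens << r >> c)))
      (g := fun c => ((-1) ^+ (gdeg a * gdeg b) * (-1) ^+ gdeg a) *: tens (lcons a << r >>) c));
      [lin|lin|move=> b' bE].
    rewrite !tens1 tswap0 -bE mulnS exprD mulrAC -expr2 sqrr_sign mul1r.
    by [].
  rewrite [tswap 0 (_ + _)]linearD /= [tswap 0 (_ *: _)]linearZ /= E1.
  rewrite [lcons a (_ + _)]linearD [tswap 0 (_ + _)]linearD /= [lcons a (_ *: _)]linearZ [tswap 0 (_ *: _)]linearZ /= E2 tswap0.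
  rewrite [lcons b (_ + _)]linearD /= [lcons b (_ *: _)]linearZ /= !scalerDr !scalerA.
  set x := (-1) ^+ (_ * _); set y := (-1) ^+ gdeg a; set z := (-1) ^+ gdeg b.
  have -> : y * (x * y) = x by rewrite mulrCA -expr2 sqrr_sign mulr1.
  have -> : y * z * x = x * z * y by rewrite mulrC mulrA mulrAC.
  by zmod.
- by rewrite tswap1 /= scale1r tbd_nil linear0.
- rewrite -lcons1 tswapS !tbd_lcons IHp linearD linearZ /= tswapS; congr (_ + _).
  have L := tens_linr; move: (gbd a) => c.
  by move: c; apply: fg_ext => [||b]; [lin|lin|rewrite !tens1 tswapS].
Qed.

Lemma tdeg_swap p (s : seq A) : tdeg (swap p s) = tdeg s.
Proof.
elim: p s => [|p IHp] [|a s] //=; last by rewrite /tdeg /= -!/(tdeg _) IHp.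
by case: s => [|b r] //; rewrite /tdeg /= addnCA.
Qed.

End TensorSwap.

Lemma size_swap (V : Type) p (s : seq V) : size (swap p s) = size s.
Proof. by elim: p s => [|p IHp] [|a s] //=; [case: s|rewrite IHp]. Qed.

Lemma map_swap (V W : Type) (f : V -> W) p s : map f (swap p s) = swap p (map f s).
Proof. by elim: p s => [|p IHp] [|a s] //=; [case: s|rewrite IHp]. Qed.

(** * Combinatorial models for the Eilenberg-Zilber maps *)

Lemma csubI (F : fieldType) (K : choiceType) (P Q : K -> Prop) (c : {freeg K / F}) :
  csub P c -> csub Q c -> csub (fun k => P k /\ Q k) c.
Proof. by move=> cP cQ k k0; split; [apply: cP|apply: cQ]. Qed.

Section VertexLists.
Variable F : fieldType.
Local Notation L := {freeg (seq nat) / F}.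

(** Unaugmented, unlike [lbd]: a factor in a tensor product must have its dimension as degree, with
    nothing below zero. *)
Definition vbd (w : seq nat) : L := if (size w <= 1)%N then 0 else lbd << w >>.

Fact vbd_deg w : csub (fun u : seq nat => (size u).-1.+1 = (size w).-1) (vbd w).
Proof.
rewrite /vbd; case: leqP => w1; first exact: csub0.
have w0 : (0 < size w)%N by exact: ltnW.
apply: (csubW _ (@size_lbd F _ w w0)) => u uw.
by rewrite -[in RHS]uw /= prednK // -ltnS uw.
Qed.

Fact vbd_vbd w : fglift vbd (vbd w) = 0.
Proof.
have := @vbd_deg w; rewrite /vbd; case: leqP => w1 H; first by rewrite linear0.
have [w2|w2] := leqP (size w) 2.
  have -> : (0 : L) = (\0 : {linear L -> L}) (lbd << w >>) by [].
  apply: (csub_lin H (f := fglift vbd) (g := (\0 : {linear L -> L}))); [lin|lin|move=> u uw].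
  rewrite fglift1 /vbd ifT //=; move: uw w1 w2; case: (size w) => [|[|[|?]]] //=.
  by case: (size u) => [|[|?]].
transitivity (lbd (lbd << w >>) : L); last exact: lbd_lbd.
apply: (csub_lin H (f := fglift vbd) (g := @lbd F _)); [lin|lin|move=> u uw].
rewrite fglift1 /vbd ifF //; apply/negbTE; rewrite -ltnNge.
by move: uw w2; case: (size u) => [|[|?]] //; case: (size w) => [|[|[|?]]].
Qed.

Definition vlists : gbasis F := Gbasis vbd_deg vbd_vbd.

Lemma gd_lmap (f : nat -> nat) c : @gd F vlists (lmap f c) = lmap f (@gd F vlists c).
Proof.
move: c; apply: fg_ext => [||w]; [lin|lin|].
rewrite lmap1 !gd1 /= /vbd size_map; case: ifP => _; first by rewrite linear0.
by rewrite lmap_lbd lmap1.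
Qed.

Lemma lmap_deg (f : nat -> nat) (w : vlists) : csub (fun u : vlists => gdeg u = gdeg w) (lmap f << w >> : {freeg vlists / F}).
Proof. by rewrite lmap1; apply: csub1; rewrite /= size_map. Qed.

End VertexLists.

Fixpoint mapi (A B : Type) (f : nat -> A -> B) (s : seq A) : seq B :=
  if s is a :: r then f 0%N a :: mapi (fun i => f i.+1) r else [::].

Lemma size_mapi (A B : Type) (f : nat -> A -> B) s : size (mapi f s) = size s.
Proof. by elim: s f => //= a s IHs f; rewrite IHs. Qed.

Section Models.
Variables (F : fieldType) (k : nat).
Local Notation A := (vlists F).
Local Notation T := {freeg (seq A) / F}.
Local Notation L := {freeg (seq (seq nat)) / F}.

Definition heads (b : seq (seq nat)) : seq nat := map (head 0%N) b.
Definition singles (v : seq nat) : seq (seq nat) := map (fun x => [:: x]) v.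

Definition ttuple (b : seq A) := size b = k /\ all (fun w : seq nat => (0 < size w)%N) b.
Definition ltuple (b : seq (seq nat)) := (0 < size b)%N /\ all (fun v : seq nat => size v == k) b.

Definition teps : T -> F^o := fglift (fun b => ((tdeg b == 0%N)%:R : F^o)).
HB.instance Definition _ := GRing.Linear.copy teps (fglift _).

Lemma teps1 b : teps << b >> = (tdeg b == 0%N)%:R. Proof. exact: fglift1. Qed.

Lemma teps_deg m t : csub (fun b => tdeg b = m.+1) t -> teps t = 0.
Proof.
move=> tm; apply: (csub_lin tm (f := teps) (g := \0)); [lin|lin|move=> b bm].
by rewrite teps1 bm.
Qed.

Lemma teps_lcons a t : teps (lcons a t) = (gdeg a == 0%N)%:R *: teps t.
Proof.
move: t; apply: fg_ext => [||b]; [lin|lin|].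
rewrite lcons1 !teps1 tdeg_cons addn_eq0; case: (gdeg a == 0%N) => /=.
  by rewrite scale1r.
by rewrite scale0r.
Qed.

Lemma teps_tbd t : teps (tbd t) = 0.
Proof.
move: t; apply: fg_ext => [||b]; [lin|lin|].
elim: b => [|a r IHr]; first by rewrite tbd_nil linear0.
rewrite -lcons1 tbd_lcons linearD /= [X in _ + X]linearZ /= teps_lcons IHr !scaler0 addr0.
pose f (c : {freeg A / F}) : F^o := teps (tens << r >> c).
rewrite -[LHS]/(f (gbd a)) /= /vbd; case: leqP => a1; first by rewrite /f !linear0.
case: a a1 => [|x [|y [|z a]]] //= _.
  rewrite -[<< _ >>]lcons1 lbd_cons -[<< _ >>]lcons1 lbd_cons lbd_nil linear0 subr0.
  rewrite /f linearB /= !lcons1 !tens1 linearB /= !teps_lcons /=.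
  by rewrite subrr.
apply: (@teps_deg (size a + tdeg r)).
have H : csub (fun w : A => gdeg w = (size a).+1) (lbd << [:: x, y, z & a] >> : {freeg A / F}).
  have w0 : (0 < size [:: x, y, z & a])%N by [].
  have := @size_lbd F _ _ w0; apply: csubW => u /= [us].
  by rewrite us.
have H' : csub (fun s : seq A => s = r) (<< r >> : T) by exact: csub1.
apply: (csub_tens _ H H') => w s wE ->.
by rewrite tdeg_cons wE.
Qed.

Lemma tbd_ttuple b : ttuple b -> csub ttuple (tbd << b >>).
Proof.
move=> [bk b0].
suff H : csub (fun s : seq A => all (fun w : seq nat => (0 < size w)%N) s) (tbd << b >>).
  by apply: (csubW _ (csubI (@tbd_deg F A b) H)) => s [[_ sb] s0]; split; rewrite ?sb.
elim: b b0 {bk} => [|w r IHr] /=; first by rewrite tbd_nil => _; exact: csub0.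
move=> /andP[w0 r0]; rewrite -lcons1 tbd_lcons; apply: csubD.
  have H : csub (fun w : A => (0 < size w)%N) (@gbd F A w).
    rewrite /= /vbd; case: leqP => w1; first exact: csub0.
    by apply: (csubW _ (@size_lbd F _ w w0)) => u uw; rewrite -ltnS uw.
  have H' : csub (fun s : seq A => s = r) (<< r >> : T) by exact: csub1.
  by apply: (csub_tens _ H H') => u s u0 -> /=; rewrite u0.
by apply: csubZ; apply: csub_lcons (IHr r0) => s s0 /=; rewrite w0.
Qed.

(** The contraction of a tensor product of simplices: cone off the first factor and, where that
    factor is a vertex, replace it by the cone point and continue with the next one. *)
Fixpoint tcone_seq (v : seq nat) (b : seq A) : T :=
  match v, b with
  | x :: v', w :: r => << ((x :: w : A) :: r) >> +
      (gdeg w == 0%N)%:R *: lcons ([:: x] : A) (tcone_seq v' r)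
  | _, _ => 0
  end.

Definition tcone v : T -> T := fglift (tcone_seq v).
HB.instance Definition _ v := GRing.Linear.copy (tcone v) (fglift _).

Lemma tcone1 v b : tcone v << b >> = tcone_seq v b. Proof. exact: fglift1. Qed.

Lemma tcone_lcons x v (w : A) t : tcone (x :: v) (lcons w t) =
  lcons (x :: w : A) t + (gdeg w == 0%N)%:R *: lcons ([:: x] : A) (tcone v t).
Proof. by move: t; apply: fg_ext => [||r]; [lin|lin|rewrite !lcons1 !tcone1]. Qed.

(** The complex is unaugmented, whence the error term in degree zero; the cone contracts elements of
    augmentation zero. *)
Lemma tcone_bd1 v (b : seq A) : size v = size b -> all (fun w : seq nat => (0 < size w)%N) b ->
  tbd (tcone v << b >>) + tcone v (tbd << b >>) = << b >> - teps << b >> *: << singles v : seq A >>.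
Proof.
elim: b v => [|w r IHr] [|x v] //=.
  by rewrite tcone1 linear0 tbd_nil linear0 addr0 teps1 scale1r subrr.
move=> [vr] /andP[w0 r0]; have {IHr} IHr := IHr v vr r0.
have tb0 (a : nat) u : tbd (lcons ([:: a] : A) u) = lcons ([:: a] : A) (tbd u).
  by rewrite tbd_lcons linear0 add0r expr0 scale1r.
rewrite -lcons1; case: w w0 => [|y [|z w]] //= _.
  rewrite tb0 !tcone_lcons !scale1r [tbd (_ + _)]linearD /= tb0 tbd_lcons expr1 scaleN1r.
  have -> : @gbd F A [:: x; y] = << [:: y] >> - << [:: x] >>.
    rewrite /= /vbd /= -lcons1 lbd_cons -[in X in _ - X]lcons1 lbd_cons lbd_nil linear0 subr0.
    by rewrite lcons1.
  have -> : tcone v (tbd << r >>) = << r >> - teps << r >> *: << singles v : seq A >> - tbd (tcone v << r >>).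
    by rewrite -IHr; zmod.
  rewrite [tens _ (_ - _)]linearB /= [lcons [:: x] (_ - _)]linearB /= [lcons [:: x] (_ - _)]linearB /=.
  rewrite teps_lcons scale1r !tens1 [lcons _ (_ *: _)]linearZ /=.
  by rewrite !lcons1; zmod.
have tc (u : seq nat) t : (1 < size u)%N -> tcone (x :: v) (lcons (u : A) t) = lcons (x :: u : A) t.
  by case: u => [|? []] // ? ? _; rewrite tcone_lcons /= scale0r addr0.
have E1 : tcone (x :: v) (tens << r >> (lbd << [:: y, z & w] >>)) =
    tens << r >> (lcons x (lbd << [:: y, z & w] >>)).
  have [w0|w0] := posnP (size w).
    rewrite (size0nil w0) -[<< [:: y; z] >>]lcons1 lbd_cons -[<< [:: z] >>]lcons1 lbd_cons lbd_nil linear0 subr0.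
    rewrite [lcons x (_ - _)]linearB /= !lcons1 ![tens _ (_ - _)]linearB /= !tens1.
    by rewrite [tcone _ (_ - _)]linearB /= !tcone_lcons /= !scale1r; zmod.
  have H : csub (fun u => (size u).+1 = (size w).+2) (lbd << [:: y, z & w] >> : {freeg (seq nat) / F}) by exact: size_lbd.
  apply: (csub_lin H (f := fun c => tcone (x :: v) (tens << r >> c))
    (g := fun c => tens << r >> (lcons x c))); [lin|lin|move=> u [us]].
  by rewrite tens1 [lcons x _]lcons1 tens1 tc // us.
rewrite tc // !tbd_lcons [tcone _ (_ + _)]linearD /= [tcone _ (_ *: _)]linearZ /= tc //.
rewrite /vbd /= E1 -[<< [:: x, y, z & w] >>]lcons1 lbd_cons teps_lcons scale0r scale0r subr0.
rewrite [tens _ (_ - _)]linearB /= tens1 exprS mulN1r scaleNr.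
by zmod.
Qed.

Lemma tcone_bd v t m : size v = m ->
  csub (fun b : seq A => size b = m /\ all (fun w : seq nat => (0 < size w)%N) b) t ->
  teps t = 0 -> tbd t = 0 -> tbd (tcone v t) = t.
Proof.
move=> vm tP t0 dt; have vP : forall b : seq A, size b = m /\ all (fun w : seq nat => (0 < size w)%N) b ->
    tbd (tcone v << b >>) + tcone v (tbd << b >>) = << b >> - teps << b >> *: << singles v : seq A >>.
  by move=> b [bm b0]; apply: tcone_bd1; rewrite ?vm.
pose g (s : T) : T := s - (teps s : F) *: << singles v : seq A >>.
have lg : lin g by move=> a x y; rewrite /g linearP /= scalerBr scalerA -[a *: (teps x : F^o)]/(a * _) scalerDl; zmod.
have := csub_lin tP (f := fun t => tbd (tcone v t) + tcone v (tbd t)) (g := g).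
rewrite /g t0 scale0r subr0 dt linear0 addr0; apply; [lin|exact: lg|exact: vP].
Qed.

Definition tgood m (t : T) := csub (fun b => tdeg b = m /\ ttuple b) t.
Definition lgood m (t : L) := csub (fun b => size b = m.+1 /\ ltuple b) t.

Lemma tgood0 m : tgood m 0. Proof. exact: csub0. Qed.
Lemma tgoodD m a x y : tgood m x -> tgood m y -> tgood m (a *: x + y).
Proof. by move=> xm ym; apply: csubD => //; apply: csubZ. Qed.
Lemma lgood0 m : lgood m 0. Proof. exact: csub0. Qed.
Lemma lgoodD m a x y : lgood m x -> lgood m y -> lgood m (a *: x + y).
Proof. by move=> xm ym; apply: csubD => //; apply: csubZ. Qed.

Lemma tcone_good m v t : tgood m t -> tgood m.+1 (tcone v t).
Proof.
move=> tm; apply: (csub_map _ tm) => [|b [bm [bk b0]]]; first by lin.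
rewrite tcone1; apply: (csubW (P := fun s : seq A => [/\ tdeg s = (tdeg b).+1, size s = size b &
  all (fun w : seq nat => (0 < size w)%N) s])) => [s [sb ss s0]|].
  by split; [rewrite sb bm|split; rewrite ?ss].
elim: v b b0 {bm bk} => [|x v IHv] [|w r] /=; try by move=> _; exact: csub0.
move=> /andP[w0 r0]; apply: csubD; first apply: csub1.
  by split => //; rewrite !tdeg_cons /=; case: (w) w0.
case: eqP => [w1|_]; last by rewrite scale0r; exact: csub0.
apply: csubZ; apply: csub_lcons (IHv r r0) => s [sr ss s0]; split; rewrite /= ?ss //.
by rewrite !tdeg_cons sr /= w1.
Qed.

Lemma heads_good m (b : seq A) t : ttuple b -> lgood m t -> lgood m.+1 (lcons (heads b) t).
Proof.
move=> [bk _] tm; apply: (csub_map _ tm) => [|u [um [u0 uk]]]; first by lin.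
by rewrite lcons1; apply: csub1; split; [rewrite /= um|split => //=; rewrite size_map bk eqxx].
Qed.

(* Acyclic models: the Eilenberg-Zilber maps [ez_x], [ez_y] and the homotopies
   [ez_g], [ez_k] from their composites to the identity are all determined by
   coning off the first vertex, here of a product of simplices with vertices in
   [nat]. A product simplex is the list of its vertices in [L], while [T] is the
   tensor product of the chains of the factors. *)
Definition ez_x : T -> L :=
  cone_rec (@tdeg F A) (@tbd F A) (fun b => << [:: heads b] >>)
    (fun b => @lcons F _ (heads b)) \0 1.
HB.instance Definition _ := GRing.Linear.copy ez_x (cone_rec _ _ _ _ _ _).

Lemma tbd_tdeg (b : seq A) : (0 < tdeg b)%N -> csub (fun b' => (tdeg b').+1 = tdeg b) (tbd << b >>).
Proof. by move=> _; apply: (csubW _ (@tbd_deg F A b)) => s []. Qed.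

Lemma ez_x0 b : tdeg b = 0%N -> ez_x << b >> = << [:: heads b] >>.
Proof. by move=> b0; rewrite /ez_x cone_rec0. Qed.

Lemma ez_x_bd b : (0 < tdeg b)%N -> lbd (ez_x << b >>) = ez_x (tbd << b >>).
Proof.
move=> b0; rewrite [LHS](cone_rec_bd tbd_tdeg (bd := @lbd F _)) //=.
- by rewrite add0r scale1r.
- by move=> {}b {}b0 y0; rewrite lbd_cons y0 linear0 subr0.
- move=> {b0}b b1; rewrite linear0 add0r scale1r -/(ez_x _).
  (* In degree one the recursion asks that the boundary have augmentation zero, which is
     [teps_tbd]. *)
  have H : csub (fun s : seq A => tdeg s = 0%N) (tbd (<< b >> : T)).
    by apply: (csubW _ (@tbd_deg F A b)) => s []; rewrite b1 => -[].
  have -> : 0 = (teps (tbd (<< b >> : T)) : F) *: << [::] >> :> L by rewrite teps_tbd scale0r.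
  apply: (csub_lin H (f := fun c => lbd (ez_x c)) (g := fun c => (teps c : F) *: << [::] >>)); [lin| |].
    by move=> a x y; rewrite linearP /= scalerDl -scalerA.
  move=> s s0; rewrite ez_x0 // teps1 s0 scale1r -lcons1 lbd_cons lbd_nil linear0 subr0.
  by [].
- by move=> {b0}b _; rewrite linear0 scaler0 addr0.
- by move=> {b0}b _; exact: (@tbd_tbd F A).
Qed.

Lemma ez_x_good b : ttuple b -> lgood (tdeg b) (ez_x << b >>).
Proof.
apply: (@cone_rec_graded _ _ _ _ _ _ _ _ _ tbd_tdeg ttuple lgood).
- exact: lgood0.
- exact: lgoodD.
- by move=> {}b bP _; exact: tbd_ttuple.
- by move=> {}b [bk _] _; apply: csub1; split => //; split => //=; rewrite size_map bk eqxx.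
- by move=> *; exact: lgood0.
- by move=> {}b m y bP _; exact: heads_good.
Qed.

Definition lsize (b : seq (seq nat)) := (size b).-1.

Lemma lbd_lsize b : (0 < lsize b)%N -> csub (fun b' => (lsize b').+1 = lsize b) (lbd << b >> : L).
Proof.
rewrite /lsize => b0; have b1 : (0 < size b)%N by case: (size b) b0.
by apply: (csubW _ (@size_lbd F _ b b1)) => u; case: (size b) b0 => //= m m0 [->]; rewrite prednK.
Qed.

Lemma lbd_ltuple b : ltuple b -> (0 < lsize b)%N -> csub ltuple (lbd << b >> : L).
Proof.
move=> [b0 bk] b1; have H : csub (fun w : seq (seq nat) => forall v, v \in w -> size v == k) (lbd << b >> : L).
  by apply: csub_lbd; apply: csub1 => v vb; exact: (allP bk).
have H2 : csub (fun u => (size u).+1 = size b) (lbd << b >> : L) by exact: size_lbd.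
apply: (csubW _ (csubI H H2)) => u [uk ub]; split; last by apply/allP.
by move: b1; rewrite /lsize -ub.
Qed.

Definition ez_y : L -> T :=
  cone_rec lsize (@lbd F _) (fun b => if b is v :: _ then << singles v : seq A >> else 0)
    (fun b => tcone (head [::] b)) \0 1.
HB.instance Definition _ := GRing.Linear.copy ez_y (cone_rec _ _ _ _ _ _).

Lemma ez_y0 v : ez_y << [:: v] >> = << singles v : seq A >>.
Proof. by rewrite /ez_y cone_rec0. Qed.

Lemma singles_good v : size v == k -> tgood 0 << singles v : seq A >>.
Proof.
move=> /eqP vk; apply: csub1; split; first by rewrite /tdeg; elim: (v).
by split; [rewrite size_map|apply/allP => w /mapP[x _ ->]].
Qed.

Lemma ez_y_good b : ltuple b -> tgood (lsize b) (ez_y << b >>).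
Proof.
apply: (@cone_rec_graded _ _ _ _ _ _ _ _ _ lbd_lsize ltuple tgood).
- exact: tgood0.
- exact: tgoodD.
- exact: lbd_ltuple.
- by move=> [|v b'] [] //= _ /andP[vk _] _; exact: singles_good.
- by move=> *; exact: tgood0.
- by move=> {}b m y bP _; exact: tcone_good.
Qed.

Lemma csub_ez_y m c : lgood m c -> tgood m (ez_y c).
Proof.
move=> cm; apply: (csub_map _ cm) => [|b [bm bP]]; first by lin.
by have := ez_y_good bP; rewrite /lsize bm.
Qed.

Lemma ez_y_bd b : ltuple b -> (0 < lsize b)%N -> tbd (ez_y << b >>) = ez_y (lbd << b >>).
Proof.
move=> bP b0; rewrite [LHS](cone_rec_bd_on lbd_lsize (bd := @tbd F A) (P := ltuple)) //=.
- by rewrite add0r scale1r.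
- exact: lbd_ltuple.
- move=> {bP b0}b bP b0; rewrite add0r scale1r -/(ez_y _) => y0.
  have bk : size (head [::] b) = k.
    by case: (b) bP => [[]//|v ?] [_ /= /andP[/eqP]].
  have bm : lgood (lsize b).-1 (lbd << b >>).
    apply: (csubW _ (csubI (lbd_ltuple bP b0) (lbd_lsize b0))) => u [uP ub]; split => //.
    by rewrite -ub /= /lsize prednK //; case: uP.
  have ym := csub_ez_y bm.
  apply: (tcone_bd bk) => //; first by apply: (csubW _ ym) => s [_].
  (* The augmentation vanishes for degree reasons, except in degree zero where two vertices are
     subtracted. *)
  have [m1|m0] := posnP (lsize b).-1; last first.
    by apply: (@teps_deg (lsize b).-2); apply: (csubW _ ym) => s [-> _]; rewrite prednK.
  case: (b) bP b0 m1 => [|v [|w [|? ?]]] // [_ /= /and3P[vk wk _]] _ _.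
  rewrite -lcons1 lbd_cons -[<< [:: w] >>]lcons1 lbd_cons lbd_nil linear0 subr0 lcons1 lcons1.
  rewrite linearB /= !ez_y0 linearB /= !teps1.
  have sd (u : seq nat) : tdeg (singles u : seq A) = 0%N by elim: u.
  by rewrite !sd subrr.
- move=> {bP b0}b bP b1; rewrite linear0 add0r scale1r -/(ez_y _).
  have b0 : (0 < lsize b)%N by rewrite b1.
  have H : tgood 0 (ez_y (lbd << b >>)).
    apply: csub_ez_y; apply: (csubW _ (csubI (lbd_ltuple bP b0) (lbd_lsize b0))) => u [uP ub].
    split => //; move: uP ub; rewrite b1 /lsize => -[]; by case: (size u) => [|[]].
  have H' : csub (fun _ : seq A => False) (tbd (ez_y (lbd << b >>))).
    apply: (csub_map _ H) => [|s [s0 _]]; first by lin.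
    by apply: (csubW _ (@tbd_deg F A s)) => u []; rewrite s0.
  apply: (csub_lin H' (f := fun x => x) (g := \0)) => //; lin.
- by move=> {bP b0}b _ _; rewrite linear0 scaler0 addr0.
- by move=> {bP b0}b _ _; exact: lbd_lbd.
Qed.

Lemma csub_ez_x m t : tgood m t -> lgood m (ez_x t).
Proof.
move=> tm; apply: (csub_map _ tm) => [|b [bm bP]]; first by lin.
by have := ez_x_good bP; rewrite bm.
Qed.

Lemma tbd_good m t : tgood m.+1 t -> tgood m (tbd t).
Proof.
move=> tm; apply: (csub_map _ tm) => [|b [bm bP]]; first by lin.
by apply: (csubW _ (csubI (tbd_ttuple bP) (@tbd_deg F A b))) => s [sP []]; rewrite bm => -[].
Qed.

Lemma tbd_good0 t : tgood 0 t -> tbd t = 0.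
Proof.
move=> tm; apply: (csub_lin tm (f := @tbd F A) (g := \0)); [lin|lin|move=> b [b0 bP]].
have H : csub (fun _ : seq A => False) (tbd << b >>).
  by apply: (csubW _ (@tbd_deg F A b)) => s []; rewrite b0.
by apply: (csub_lin H (f := fun x => x) (g := \0)) => //; lin.
Qed.

Lemma lbd_good m c : lgood m.+1 c -> lgood m (lbd c).
Proof.
move=> cm; apply: (csub_map _ cm) => [|b [bm bP]]; first by lin.
have b0 : (0 < lsize b)%N by rewrite /lsize bm.
apply: (csubW _ (csubI (lbd_ltuple bP b0) (lbd_lsize b0))) => u [uP ub]; split => //.
by move: ub; rewrite /lsize bm /= => -[<-]; rewrite prednK //; case: uP.
Qed.

Lemma ez_x_bdE m t : tgood m.+1 t -> lbd (ez_x t) = ez_x (tbd t).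
Proof.
move=> tm; apply: (csub_lin tm (f := fun t => lbd (ez_x t)) (g := fun t => ez_x (tbd t)));
  [lin|lin|move=> b [bm _]].
by apply: ez_x_bd; rewrite bm.
Qed.

Lemma ez_y_bdE m c : lgood m.+1 c -> tbd (ez_y c) = ez_y (lbd c).
Proof.
move=> cm; apply: (csub_lin cm (f := fun t => tbd (ez_y t)) (g := fun t => ez_y (lbd t)));
  [lin|lin|move=> b [bm bP]].
by apply: ez_y_bd => //; rewrite /lsize bm.
Qed.

Lemma ez_yx0 t : tgood 0 t -> ez_y (ez_x t) = t.
Proof.
move=> tm; apply: (csub_lin tm (f := fun t => ez_y (ez_x t)) (g := fun t => t));
  [lin|lin|move=> b [b0 [_ bP]]].
rewrite ez_x0 // ez_y0; congr << _ >>.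
elim: b b0 bP => //= w r IHr /eqP; rewrite tdeg_cons addn_eq0 => /andP[/eqP w0 /eqP r0].
move=> /andP[w1 rP]; rewrite IHr //; congr (_ :: _).
by case: (w) w0 w1 => [|x []].
Qed.

Lemma ez_xy0 c : lgood 0 c -> ez_x (ez_y c) = c.
Proof.
move=> cm; apply: (csub_lin cm (f := fun t => ez_x (ez_y t)) (g := fun t => t));
  [lin|lin|move=> [|v [|? ?]] [] // _ _].
rewrite ez_y0 ez_x0; last by rewrite /tdeg; elim: (v).
by rewrite /heads /singles -map_comp map_id.
Qed.

Let gphi : T -> T := idfun \- (ez_y \o ez_x).
HB.instance Definition _ := GRing.Linear.copy gphi (idfun \- (ez_y \o ez_x)).

Definition ez_g : T -> T :=
  cone_rec (@tdeg F A) (@tbd F A) (fun b => 0) (fun b => tcone (heads b)) gphi (-1).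
HB.instance Definition _ := GRing.Linear.copy ez_g (cone_rec _ _ _ _ _ _).

Let gphi_good b : ttuple b -> tgood (tdeg b) (gphi << b >>).
Proof.
move=> bP; apply: csubB; first by apply: csub1.
by apply: csub_ez_y; exact: ez_x_good.
Qed.

Lemma ez_g_good1 b : ttuple b -> tgood (tdeg b).+1 (ez_g << b >>).
Proof.
apply: (@cone_rec_graded _ _ _ _ _ _ _ _ _ tbd_tdeg ttuple (fun m => tgood m.+1)).
- by move=> m; exact: tgood0.
- by move=> m; exact: tgoodD.
- by move=> {}b bP _; exact: tbd_ttuple.
- by move=> *; exact: tgood0.
- by move=> {}b m bP bm; rewrite -bm; exact: gphi_good.
- by move=> {}b m y bP _; exact: tcone_good.
Qed.

Lemma ez_g_good m t : tgood m t -> tgood m.+1 (ez_g t).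
Proof.
move=> tm; apply: (csub_map _ tm) => [|b [bm bP]]; first by lin.
by have := ez_g_good1 bP; rewrite bm.
Qed.

Lemma ez_g0 t : tgood 0 t -> ez_g t = 0.
Proof.
move=> tm; apply: (csub_lin tm (f := ez_g) (g := \0)); [lin|lin|move=> b [b0 _]].
by rewrite /ez_g cone_rec0.
Qed.

Let tbd_gphi b : ttuple b -> (0 < tdeg b)%N -> tbd (gphi << b >>) = gphi (tbd << b >>).
Proof.
move=> bP b0; have bg : tgood (tdeg b).-1.+1 << b >> by apply: csub1; rewrite prednK.
rewrite /gphi /= linearB /= (ez_y_bdE (csub_ez_x bg)).
by rewrite (ez_x_bdE bg).
Qed.

Lemma ez_g_bd m t : tgood m t -> tbd (ez_g t) + ez_g (tbd t) = t - ez_y (ez_x t).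
Proof.
case: m => [|m] tm.
  by rewrite (ez_g0 tm) (tbd_good0 tm) !linear0 addr0 ez_yx0 // subrr.
apply: (csub_lin tm (f := fun t => tbd (ez_g t) + ez_g (tbd t)) (g := fun t => t - ez_y (ez_x t)));
  [lin|lin|move=> b [bm bP]].
rewrite -[RHS]/(gphi << b >>).
rewrite [X in X + _](cone_rec_bd_on tbd_tdeg (bd := @tbd F A) (P := ttuple)) //=; last by rewrite bm.
- by rewrite -/(ez_g _) scaleN1r subrK.
- by move=> {bm bP}b bP _; exact: tbd_ttuple.
- move=> {bm bP}b bP b0; rewrite -/(ez_g _) => y0.
  have bg : tgood (@tdeg F A b).-1.+1 << b >> by apply: csub1; rewrite prednK.
  have yg : tgood (@tdeg F A b) (gphi << b >> + -1 *: ez_g (tbd (<< b >> : T))).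
    apply: csubD; first exact: gphi_good.
    by apply: csubZ; rewrite -(prednK b0); apply/ez_g_good/tbd_good.
  have [bk _] := bP; apply: (@tcone_bd _ _ k) => //.
  + by rewrite size_map.
  + by apply: (csubW _ yg) => s [_].
  + by apply: (@teps_deg (@tdeg F A b).-1); apply: (csubW _ yg) => s [-> _]; rewrite prednK.
- move=> {bm bP}b bP b1; rewrite -/(ez_g _) tbd_gphi ?b1 //.
  have bg : tgood 1 << b >> by exact: csub1.
  rewrite (ez_g0 (tbd_good bg)) linear0 scaler0 addr0 /gphi /=.
  by rewrite (ez_yx0 (tbd_good bg)) subrr.
- move=> {bm bP}b bP b1; rewrite -/(ez_g _) tbd_gphi //; last exact: ltnW.
  by rewrite scaleN1r subrr.
- by move=> {bm bP}b _ _; exact: (@tbd_tbd F A).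
Qed.

Let kphi : L -> L := idfun \- (ez_x \o ez_y).
HB.instance Definition _ := GRing.Linear.copy kphi (idfun \- (ez_x \o ez_y)).

Definition ez_k : L -> L :=
  cone_rec lsize (@lbd F _) (fun b => 0) (fun b => @lcons F _ (head [::] b)) kphi (-1).
HB.instance Definition _ := GRing.Linear.copy ez_k (cone_rec _ _ _ _ _ _).

Let kphi_good b : ltuple b -> lgood (lsize b) (kphi << b >>).
Proof.
move=> bP; have bg : lgood (lsize b) << b >>.
  by apply: csub1; split => //; rewrite prednK //; case: bP.
by apply: csubB => //; apply/csub_ez_x/csub_ez_y.
Qed.

Lemma ez_k_good m c : lgood m c -> lgood m.+1 (ez_k c).
Proof.
move=> cm; apply: (csub_map _ cm) => [|b [bm bP]]; first by lin.
have -> : m = lsize b by rewrite /lsize bm.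
move: b bP {bm}.
apply: (@cone_rec_graded _ _ _ _ _ _ _ _ _ lbd_lsize ltuple (fun m => lgood m.+1)).
- by move=> i; exact: lgood0.
- by move=> i; exact: lgoodD.
- exact: lbd_ltuple.
- by move=> *; exact: lgood0.
- by move=> b i bP bi; rewrite -bi; exact: kphi_good.
- move=> b i y bP _ yi; apply: (csub_map _ yi) => [|u [ui [u0 uk]]]; first by lin.
  rewrite /= lcons1; apply: csub1; split; first by rewrite /= ui.
  by split => //=; rewrite uk andbT; case: (b) bP => [[]|v ?] // [_ /= /andP[]].
Qed.

Lemma ez_k0 c : lgood 0 c -> ez_k c = 0.
Proof.
move=> cm; apply: (csub_lin cm (f := ez_k) (g := \0)); [lin|lin|move=> b [b0 _]].
by rewrite /ez_k cone_rec0 // /lsize b0.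
Qed.

Let lbd_kphi b : ltuple b -> (0 < lsize b)%N -> lbd (kphi << b >>) = kphi (lbd << b >>).
Proof.
move=> bP b0; have bg : lgood (lsize b).-1.+1 << b >>.
  by apply: csub1; split => //; rewrite prednK // prednK //; case: bP.
rewrite /kphi /= linearB /= (ez_x_bdE (csub_ez_y bg)).
by rewrite (ez_y_bdE bg).
Qed.

Lemma ez_k_bd m c : lgood m.+1 c -> lbd (ez_k c) + ez_k (lbd c) = c - ez_x (ez_y c).
Proof.
move=> cm.
apply: (csub_lin cm (f := fun t => lbd (ez_k t) + ez_k (lbd t)) (g := fun t => t - ez_x (ez_y t)));
  [lin|lin|move=> b [bm bP]].
rewrite -[RHS]/(kphi << b >>).
rewrite [X in X + _](cone_rec_bd_on lbd_lsize (bd := @lbd F _) (P := ltuple)) //=; last by rewrite /lsize bm.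
- by rewrite -/(ez_k _) scaleN1r subrK.
- exact: lbd_ltuple.
- by move=> {bm bP}b bP b0 y0; rewrite lbd_cons y0 linear0 subr0.
- move=> {bm bP}b bP b1; rewrite -/(ez_k _) lbd_kphi ?b1 //.
  have bg : lgood 1 << b >>.
    by apply: csub1; split => //; move: b1; rewrite /lsize; case: (size b) => [|[|[]]].
  rewrite (ez_k0 (lbd_good bg)) linear0 scaler0 addr0 /kphi /=.
  by rewrite (ez_xy0 (lbd_good bg)) subrr.
- move=> {bm bP}b bP b1; rewrite -/(ez_k _) lbd_kphi //; last exact: ltnW.
  by rewrite scaleN1r subrr.
- by move=> {bm bP}b _ _; exact: lbd_lbd.
Qed.

Section Relabelling.
Variable f : nat -> nat -> nat.

Definition vmap (g : nat -> nat) : {freeg A / F} -> {freeg A / F} := @lmap F _ _ g.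
HB.instance Definition _ g := GRing.Linear.copy (vmap g) (@lmap F _ _ g).

(** Each factor is relabelled independently. Naturality under these vertex maps lets the models act
    on tuples of singular simplices. *)
Definition trelabel : T -> T := @tmap F A A (fun i => vmap (f i)).
HB.instance Definition _ := GRing.Linear.copy trelabel (@tmap F A A _).

Definition lrelabel : L -> L := @lmap F _ _ (mapi f).
HB.instance Definition _ := GRing.Linear.copy lrelabel (@lmap F _ _ _).

End Relabelling.

Lemma trelabel_lcons f (a : A) t :
  trelabel f (lcons a t) = lcons (map (f 0%N) a : A) (trelabel (fun i => f i.+1) t).
Proof. by rewrite /trelabel tmap_lcons /= /vmap lmap1 tens1. Qed.

Lemma trelabel1 f b : trelabel f << b >> = << mapi (fun i => map (f i)) b : seq A >>.
Proof.
elim: b f => [|a r IHr] f; first by rewrite /trelabel tmap_nil.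
by rewrite -lcons1 trelabel_lcons IHr lcons1.
Qed.

Lemma trelabel_bd f t : tbd (trelabel f t) = trelabel f (tbd t).
Proof.
apply: tmap_bd => i c; first exact: gd_lmap.
by apply: gsgn_map => a; exact: lmap_deg.
Qed.

Lemma mapi_tdeg (f : nat -> nat -> nat) (b : seq A) :
  tdeg (mapi (fun i => map (f i)) b : seq A) = tdeg b.
Proof. by elim: b f => //= a r IHr f; rewrite !tdeg_cons IHr /= size_map. Qed.

Let mapi_heads f (b : seq A) : ttuple b ->
  mapi f (heads b) = heads (mapi (fun i => map (f i)) b).
Proof.
move=> [_]; elim: b f => //= a r IHr f /andP[a0 r0]; rewrite IHr //.
by case: (a) a0.
Qed.

Lemma ez_x_relabel f t : csub ttuple t -> lrelabel f (ez_x t) = ez_x (trelabel f t).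
Proof.
apply: (cone_rec_nat tbd_tdeg tbd_tdeg ttuple (fun=> 1) (mapi (fun i => map (f i)))
  (lrelabel f) (trelabel f)).
- by move=> b _; rewrite scale1r; exact: trelabel1.
- by move=> b _ bP; exact: tbd_ttuple.
- by move=> b _; exact: mapi_tdeg.
- by move=> b bP _; rewrite scale1r /= /lrelabel lmap1 /= mapi_heads.
- by move=> b y bP /=; rewrite /lrelabel lmap_cons mapi_heads.
- by move=> b _ /=; rewrite linear0.
- by move=> b _ _; exact/esym/trelabel_bd.
Qed.

Lemma tcone_relabel f v t : trelabel f (tcone v t) = tcone (mapi f v) (trelabel f t).
Proof.
move: t; apply: fg_ext => [||b]; [lin|lin|].
elim: v b f => [|x v IHv] [|a r] f.
- by rewrite tcone1 trelabel1 tcone1 linear0.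
- by rewrite tcone1 trelabel1 tcone1 linear0.
- by rewrite tcone1 trelabel1 tcone1 linear0.
rewrite -lcons1 tcone_lcons trelabel_lcons [LHS]linearD /= [trelabel f (_ *: _)]linearZ /=.
by rewrite !trelabel_lcons tcone_lcons IHv /= size_map.
Qed.

Lemma ez_y_relabel f c : trelabel f (ez_y c) = ez_y (lrelabel f c).
Proof.
apply: (cone_rec_nat lbd_lsize lbd_lsize (fun=> True) (fun=> 1) (map (mapi f))
  (trelabel f) (lrelabel f)) => //.
- by move=> b _; rewrite scale1r /= /lrelabel lmap1.
- by move=> b _; rewrite /lsize size_map.
- move=> [|v b] _ _; rewrite scale1r /=; first by rewrite linear0.
  rewrite trelabel1; congr << _ >>; elim: (v) f => //= x u IHu f.
  by rewrite IHu.
- by move=> b y _; rewrite /= tcone_relabel; case: (b).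
- by move=> b _ /=; rewrite linear0.
- by move=> b _ _; rewrite /= /lrelabel lmap_lbd.
Qed.

Let ltuple_good b : ltuple b -> lgood (lsize b) << b >>.
Proof. by move=> bP; apply: csub1; split => //; rewrite prednK //; case: bP. Qed.

Lemma tgoodT m t : tgood m t -> csub ttuple t.
Proof. by apply: csubW => b []. Qed.

Lemma ez_g_relabel f t : csub ttuple t -> trelabel f (ez_g t) = ez_g (trelabel f t).
Proof.
apply: (cone_rec_nat tbd_tdeg tbd_tdeg ttuple (fun=> 1) (mapi (fun i => map (f i)))
  (trelabel f) (trelabel f)).
- by move=> b _; rewrite scale1r; exact: trelabel1.
- by move=> b _ bP; exact: tbd_ttuple.
- by move=> b _; exact: mapi_tdeg.
- by move=> b bP _; rewrite scale1r /= linear0.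
- by move=> b y bP /=; rewrite tcone_relabel mapi_heads.
- move=> b bP /=; rewrite /gphi /= linearB /= ez_y_relabel ez_x_relabel //.
  exact: csub1.
- by move=> b _ _; exact/esym/trelabel_bd.
Qed.

Lemma ez_k_relabel f c : csub ltuple c -> lrelabel f (ez_k c) = ez_k (lrelabel f c).
Proof.
apply: (cone_rec_nat lbd_lsize lbd_lsize ltuple (fun=> 1) (map (mapi f))
  (lrelabel f) (lrelabel f)).
- by move=> b _; rewrite scale1r /= /lrelabel lmap1.
- by move=> b b0 bP; exact: lbd_ltuple.
- by move=> b _; rewrite /lsize size_map.
- by move=> b bP _; rewrite scale1r /= linear0.
- by move=> b y _ /=; rewrite /lrelabel lmap_cons; case: (b).
- move=> b bP /=; rewrite /kphi /= linearB /= -ez_y_relabel ez_x_relabel //.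
  by apply: (@tgoodT (lsize b)); apply: csub_ez_y; exact: ltuple_good.
- by move=> b _ _; rewrite /= /lrelabel lmap_lbd.
Qed.

(** The cone point [heads b] is permuted along with the factors, so the compatibility is exact. The
    cone behind [ez_y] treats the factors in order and has no such symmetry. *)
Lemma ez_x_swap p t : lmap (swap p) (ez_x t) = ez_x (tswap p t).
Proof.
apply: (cone_rec_nat tbd_tdeg tbd_tdeg (fun=> True) (fun b => (-1) ^+ swap_deg p (b : seq A)) (swap p)
  (@lmap F _ _ (swap p)) (@tswap F A p)) => //.
- by move=> b _; exact: (@tswap1 F A).
- by move=> b _; exact: (@tdeg_swap F A).
- move=> b _ b0; rewrite [LHS](@lmap1 F) /= /heads map_swap.
  have -> : swap_deg p (b : seq A) = 0%N; last by rewrite scale1r.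
  elim: p b b0 => [|p IHp] [|a r] //=; last first.
    by move/eqP; rewrite tdeg_cons addn_eq0 => /andP[_ /eqP/IHp].
  case: r => [//|a' r] /eqP; rewrite !tdeg_cons addn_eq0 => /andP[/eqP /= -> _].
  by rewrite mul0n.
- by move=> b y _ /=; rewrite lmap_cons /heads map_swap.
- by move=> b _ /=; rewrite linear0.
- by move=> b _ _; exact/esym/(@tswap_bd F A).
Qed.

End Models.

Section BasisMap.
Variables (F : fieldType) (A B : choiceType).

Definition bmap (f : A -> B) : {freeg A / F} -> {freeg B / F} :=
  fglift (fun a => << f a >>).
HB.instance Definition _ f := GRing.Linear.copy (bmap f) (fglift _).

Lemma bmap1 f k : bmap f << k >> = << f k >>.
Proof. exact: fglift1. Qed.

End BasisMap.

(** * The Eilenberg-Zilber maps of a power of a space *)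

Section SimplexBasis.
Variables (R : realType) (F : fieldType) (Z : topologicalType).

Definition ssimp : choiceType := {d : nat & singular_simplex R Z d}.

Definition mk_ssimp d (s : singular_simplex R Z d) : ssimp :=
  existT (fun d => singular_simplex R Z d) d s.

Definition ssimp_bd (a : ssimp) : {freeg ssimp / F} :=
  match a with
  | existT 0 _ => 0
  | existT d.+1 s => \sum_(i < d.+2) (-1) ^+ i *: << mk_ssimp (s \o face R i) >>
  end.

Definition unaug : achain R F Z -> {freeg ssimp / F} :=
  fglift (fun o => if o is Some a then << a >> else 0).
HB.instance Definition _ := GRing.Linear.copy unaug (fglift _).

Lemma unaug1 a : unaug << Some a >> = << a >>. Proof. exact: fglift1. Qed.

Lemma unaug_abd c : unaug (abd c) = fglift ssimp_bd (unaug c).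
Proof.
move: c; apply: fg_ext => [||[[[|d] s]|]]; [lin|lin| | |].
- by rewrite abd1 unaug1 fglift1 /= [LHS]fglift1.
- rewrite abd1 unaug1 fglift1 /= linear_sum; apply: eq_bigr => i _.
  by rewrite linearZ /= amkE unaug1.
- by rewrite abd1 linear0 [unaug _]fglift1 linear0.
Qed.

Fact ssimp_bd_deg a : csub (fun b : ssimp => (tag b).+1 = tag a) (ssimp_bd a).
Proof.
case: a => [[|d] s] /=; first exact: csub0.
by apply: csub_sum => i _; apply: csubZ; apply: csub1.
Qed.

Fact ssimp_bd_bd a : fglift ssimp_bd (ssimp_bd a) = 0.
Proof.
have -> : ssimp_bd a = fglift ssimp_bd (unaug << Some a >>) by rewrite unaug1 fglift1.
by rewrite -!unaug_abd abd_abd linear0.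
Qed.

Definition sbasis : gbasis F := Gbasis ssimp_bd_deg ssimp_bd_bd.

Lemma unaug_bd c : unaug (abd c) = @gd F sbasis (unaug c).
Proof. exact: unaug_abd. Qed.

Lemma ssimp_eq d (s t : singular_simplex R Z d) : s =1 t -> mk_ssimp s = mk_ssimp t.
Proof. by move=> st; congr (existT _ _ _); apply/continuousEP. Qed.

End SimplexBasis.

Section SimplicialMaps.
Variable R : realType.

Definition vtx m j : 'rV[R]_m.+1 := delta_mx 0 (inord j).

Definition smap_list m e (w : seq nat) := mkseq (fun l => vtx m (nth 0%N w l)) e.+1.

Fact smap_proof m e (w : seq nat) (x : std_simplex R e) :
  aff (smap_list m e w) x \in std_simplex R m.
Proof.
apply/mem_set/hull_closed_simplex; first by rewrite size_mkseq.
move=> v /mapP[l _ ->]; apply: (@evs_simplex R m).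
by apply: (map_f _ (mem_enum _ _)).
Qed.

Definition smap_fun m e (w : seq nat) (x : std_simplex R e) : std_simplex R m :=
  exist _ (aff (smap_list m e w) x) (smap_proof m w x).

Fact smap_cts m e w : continuous (@smap_fun m e w).
Proof. by apply: continuous_comp_initial; exact: aff_continuous. Qed.

Definition smap m e w : continuousType (std_simplex R e) (std_simplex R m) :=
  mkcts (@smap_cts m e w).

Lemma smapE m e w (x : std_simplex R e) :
  set_val (smap m e w x) = \sum_(l < e.+1) set_val x 0 l *: vtx m (nth 0%N w l).
Proof. by rewrite /= /aff /lcomb; apply: eq_bigr => l _; rewrite nth_mkseq. Qed.

Lemma smap_iota m x : smap m m (iota 0 m.+1) x = x.
Proof.
apply: val_inj; rewrite -[LHS]/(set_val _) smapE [RHS]row_sum_delta.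
by apply: eq_bigr => l _; rewrite nth_iota // add0n /vtx inord_val.
Qed.

Lemma smap_face m e w (i : 'I_e.+2) x : smap m e.+1 w (face R i x) = smap m e (del i w) x.
Proof.
apply: val_inj; rewrite -[LHS]/(set_val _) -[RHS]/(set_val _) !smapE.
rewrite (bigD1_ord i) //= mxE unlift_none scale0r add0r.
by apply: eq_bigr => l _; rewrite mxE liftK nth_del.
Qed.

(** [inord] repeats the truncation of labels in [vtx], so that simplicial maps compose for arbitrary
    labels. *)
Definition relab d (u : seq nat) (j : nat) : nat := nth 0%N u (inord j : 'I_d.+1).

Lemma smap_comp m d e u w x : (e < size w)%N ->
  smap m d u (smap d e w x) = smap m e (map (relab d u) w) x.
Proof.
move=> ew; apply: val_inj; rewrite -[LHS]/(set_val _) -[RHS]/(set_val _) !smapE.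
transitivity (\sum_(l < d.+1) \sum_(p < e.+1)
    (set_val x 0 p * (inord (nth 0%N w p) == l)%:R) *: vtx m (nth 0%N u l)).
  apply: eq_bigr => l _; rewrite -scaler_suml; congr (_ *: _).
  rewrite summxE; apply: eq_bigr => p _.
  by rewrite !mxE eqxx eq_sym.
rewrite exchange_big; apply: eq_bigr => p _ /=.
rewrite (bigD1 (inord (nth 0%N w p))) //= eqxx mulr1 big1 ?addr0; last first.
  by move=> l /negPf lp; rewrite eq_sym lp mulr0 scale0r.
by rewrite (nth_map 0%N) // (leq_trans (ltn_ord p)).
Qed.

End SimplicialMaps.

Section Realization.
Variables (R : realType) (F : fieldType) (Z : topologicalType).
Local Notation S := (sbasis R F Z).

Definition sreal (a : S) (w : vlists F) : S :=
  mk_ssimp (projT2 a \o smap R (tag a) (size w).-1 w).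

Lemma sreal_eq (a : S) e (w : vlists F) : (size w).-1 = e ->
  sreal a w = mk_ssimp (projT2 a \o smap R (tag a) e w).
Proof. by move=> <-. Qed.

Definition realize (a : S) : {freeg (vlists F) / F} -> {freeg S / F} := @bmap F _ _ (sreal a).
HB.instance Definition _ a := GRing.Linear.copy (realize a) (@bmap F _ _ (sreal a)).

Lemma realize1 a w : realize a << w >> = << sreal a w >>. Proof. exact: bmap1. Qed.

Lemma realize_bd a c : gd (realize a c) = realize a (gd c).
Proof.
move: c; apply: fg_ext => [||w]; [lin|lin|rewrite realize1 !gd1 /= /vbd].
case: leqP => w1; first by rewrite linear0 /sreal; case: (size w) w1 => [|[]].
rewrite lbdE linear_sum /sreal; case sw: (size w) w1 => [|[|e]] //= _.
apply: eq_bigr => i _; rewrite linearZ /= realize1; congr (_ *: << _ >>).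
rewrite (sreal_eq _ (e := e)); last by rewrite size_del ?sw.
by apply: ssimp_eq => x; apply: (congr1 (projT2 a)); exact: smap_face.
Qed.

Lemma realize_deg a (w : vlists F) :
  csub (fun b : S => gdeg b = gdeg w) (realize a << w >>).
Proof. by rewrite realize1; apply: csub1. Qed.

Lemma sreal_iota (a : S) : sreal a (iota 0 (tag a).+1) = a.
Proof.
rewrite (sreal_eq _ (e := tag a)); last by rewrite size_iota.
case: a => d s; rewrite -[RHS]/(mk_ssimp _); by apply: ssimp_eq => x; exact: (congr1 s (smap_iota x)).
Qed.

Lemma sreal_comp (a : S) u (w : vlists F) : (0 < size w)%N ->
  sreal (sreal a u) w = sreal a (map (relab (size u).-1 u) w).
Proof.
move=> w0; rewrite [RHS](sreal_eq _ (e := (size w).-1)) ?size_map //.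
apply: ssimp_eq => x; apply: (congr1 (projT2 a)).
by apply: smap_comp; rewrite prednK.
Qed.

End Realization.

(** * Realizing the models in a tuple of singular simplices *)

Section Contexts.
Variables (R : realType) (F : fieldType) (k : nat) (M : topologicalType).
Local Notation X := {ptws 'I_k -> M}.
Local Notation S := (sbasis R F M).
Local Notation SX := (sbasis R F X).
Local Notation A := (vlists F).
Local Notation TA := {freeg (seq A) / F}.
Local Notation TS := {freeg (seq S) / F}.
Local Notation L := {freeg (seq (seq nat)) / F}.
Implicit Types t : k.-tuple S.

Definition ctx_maps (s : seq S) (i : nat) : {linear {freeg A / F} -> {freeg S / F}} :=
  if drop i s is a :: _ then realize a else \0.

Definition treal (s : seq S) : TA -> TS := tmap (ctx_maps s).
HB.instance Definition _ s := GRing.Linear.copy (treal s) (tmap _).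

Lemma treal_bd s c : tbd (treal s c) = treal s (tbd c).
Proof.
apply: tmap_bd => i x; rewrite /ctx_maps; case: (drop i s) => [|a _] /=.
- by rewrite linear0.
- exact: realize_bd.
- by rewrite linear0.
- by apply: (@gsgn_map F A S (realize a)) => w; exact: realize_deg.
Qed.

Definition ctx_comp t (v : seq (seq nat)) : k.-tuple S :=
  [tuple sreal (tnth t i) (nth [::] v i) | i < k].

Lemma zip_map_tnth (T U V : Type) (t : k.-tuple T) (y0 : U) (w : seq U) (f : T -> U -> V) :
  size w = k -> [seq f p.1 p.2 | p <- zip t w] = [tuple f (tnth t i) (nth y0 w i) | i < k].
Proof.
move=> wk; case: (posnP k) => [k0|k0].
  have -> : [seq f p.1 p.2 | p <- zip t w] = [::].
    by apply: size0nil; rewrite size_map size_zip size_tuple wk minnn.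
  by apply/esym/size0nil; rewrite size_tuple.
pose i0 : 'I_k := Ordinal k0; pose y := f (tnth t i0) y0.
apply: (@eq_from_nth _ y); first by rewrite size_map size_zip size_tuple wk minnn size_tuple.
move=> i; rewrite size_map size_zip size_tuple wk minnn => ik.
have := tnth_mktuple (fun i => f (tnth t i) (nth y0 w i)) (Ordinal ik).
rewrite (tnth_nth y) -[nat_of_ord _]/i => ->.
rewrite (nth_map (tnth t i0, y0)) ?size_zip ?size_tuple ?wk ?minnn // nth_zip ?size_tuple //.
by rewrite [in RHS](tnth_nth (tnth t i0)).
Qed.

Lemma treal1 t (w : seq A) : size w = k -> treal t << w >> = << ctx_comp t w : seq S >>.
Proof.
move=> wk; rewrite -[ctx_comp t w : seq S](@zip_map_tnth S A S t [::] w (@sreal R F M)) //.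
have : size (t : seq S) = size w by rewrite size_tuple.
elim: w (t : seq S) {wk} => [|x w IHw] [|a s] //=; first by rewrite /treal tmap_nil.
move=> [sw]; rewrite -lcons1 /treal tmap_lcons -[tmap _ _]/(treal s << w >>) IHw //.
by rewrite /ctx_maps /= realize1 tens1 lcons1.
Qed.

(** A simplex of M^k whose i-th coordinate is the i-th simplex of the tuple, precomposed with the
    simplicial map given by the i-th labels. *)
Definition lreal1 t (u : seq (seq nat)) : SX :=
  mk_ssimp (mkcts (@prod_cts _ _ M (fun (x : std_simplex R (size u).-1) (i : 'I_k) =>
    projT2 (tnth t i) (smap R (tag (tnth t i)) (size u).-1 [seq nth 0%N v i | v <- u] x))
    (fun i => @cts_fun _ _ (projT2 (tnth t i) \o smap R (tag (tnth t i)) (size u).-1 [seq nth 0%N v i | v <- u])))).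

Definition lreal t : L -> {freeg SX / F} := @bmap F _ _ (lreal1 t).
HB.instance Definition _ t := GRing.Linear.copy (lreal t) (@bmap F _ _ (lreal1 t)).

Lemma lreal1E t u : lreal t << u >> = << lreal1 t u >>. Proof. exact: bmap1. Qed.

Lemma mk_eq t e (u : seq (seq nat)) (s : singular_simplex R X e) : (size u).-1 = e ->
  (forall x i, s x i = projT2 (tnth t i) (smap R (tag (tnth t i)) e [seq nth 0%N v i | v <- u] x)) ->
  lreal1 t u = mk_ssimp s.
Proof.
by move=> ue; move: s; rewrite -ue => s sE; apply: ssimp_eq => x; apply/funext => i; rewrite sE.
Qed.

(** Single vertices are excluded because [lbd] sends them to the empty list, which has no simplex as
    realization. *)
Lemma lreal_bd t c : csub (fun u => (1 < size u)%N) c -> gd (lreal t c) = lreal t (lbd c).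
Proof.
move=> c1; apply: (csub_lin c1 (f := fun c => gd (lreal t c)) (g := fun c => lreal t (lbd c)));
  [lin|lin|move=> {c c1} u u1].
rewrite lreal1E gd1 lbdE linear_sum /lreal1; case su: (size u) u1 => [|[|e]] //= _.
apply: eq_bigr => i _; rewrite linearZ /= lreal1E; congr (_ *: << _ >>).
apply/esym/mk_eq; first by rewrite size_del ?su.
move=> x j /=; apply: (congr1 (projT2 (tnth t j))).
rewrite -[LHS]/(smap R _ e.+1 _ (face R i x)) smap_face; congr (smap R _ _ _ x).
by rewrite /del map_cat map_take map_drop.
Qed.

Lemma lreal_deg t m (u : seq (seq nat)) : size u = m.+1 -> gdeg (lreal1 t u) = m.
Proof. by rewrite /= => ->. Qed.

Definition relabs (v : seq (seq nat)) (i : nat) : nat -> nat :=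
  relab (size (nth [::] v i)).-1 (nth [::] v i).

Lemma nth_mapi (U V : Type) (x0 : U) (y0 : V) (f : nat -> U -> V) (s : seq U) i :
  (i < size s)%N -> nth y0 (mapi f s) i = f i (nth x0 s i).
Proof. by elim: s f i => [|x s IHs] f [|i] //= /IHs ->. Qed.

Lemma treal_comp t v c : csub (ttuple k) c ->
  treal (ctx_comp t v) c = treal t (trelabel (relabs v) c).
Proof.
move=> ck; apply: (csub_lin ck (f := treal (ctx_comp t v))
  (g := fun c => treal t (trelabel (relabs v) c))); [lin|lin|move=> w [wk w0]].
rewrite trelabel1 !treal1 ?size_mapi //; congr << _ >>; congr (tval _).
apply: eq_from_tnth => i; rewrite !tnth_mktuple.
have iw : (i < size w)%N by rewrite wk.
by rewrite (nth_mapi ([::] : seq nat)) // -sreal_comp //; apply: (all_nthP [::] w0).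
Qed.

Lemma lreal_comp t v c : csub (ltuple k) c ->
  lreal (ctx_comp t v) c = lreal t (lrelabel (relabs v) c).
Proof.
move=> ck; apply: (csub_lin ck (f := lreal (ctx_comp t v))
  (g := fun c => lreal t (lrelabel (relabs v) c))); [lin|lin|move=> u [u0 uk]].
rewrite /lrelabel lmap1 !lreal1E; congr << _ >>; apply/esym/mk_eq; first by rewrite size_map.
move=> x i.
rewrite -[LHS]/(projT2 (tnth (ctx_comp t v) i) (smap R (tag (tnth (ctx_comp t v) i))
  (size u).-1 [seq nth 0%N w i | w <- u] x)) tnth_mktuple.
apply: (congr1 (projT2 (tnth t i))).
rewrite -[RHS]/(smap R _ _ _ x) -[LHS]/(smap R _ _ _ (smap R _ _ _ x)).
rewrite smap_comp ?size_map ?prednK // -!map_comp; congr (smap R _ _ _ x).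
apply/eq_in_map => w wu; rewrite /= (nth_mapi 0%N) //.
by rewrite (eqP (allP uk w wu)).
Qed.

Definition ctx_proj (b : SX) : k.-tuple S :=
  [tuple mk_ssimp (mkcts (fun x => @continuous_comp _ _ _ (projT2 b) (fun p : X => p i) x
     (@cts_fun _ _ (projT2 b) x) (@proj_continuous _ (fun=> M) i _)) :
       continuousType (std_simplex R (tag b)) M) | i < k].

(** A simplex of M^k is the realization of the diagonal in the tuple of its own projections; this is
    the universal element for [ezY] and [ezK]. *)
Definition diag (w : seq nat) : seq (seq nat) := map (nseq k) w.

Lemma ctx_proj_real t u : ctx_proj (lreal1 t u) = ctx_comp t (mkseq (fun i => [seq nth 0%N v i | v <- u]) k).
Proof.
apply: eq_from_tnth => i; rewrite !tnth_mktuple nth_mkseq //.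
rewrite (sreal_eq _ (e := (size u).-1)) ?size_map //.
by apply: ssimp_eq => x.
Qed.

Lemma lreal_proj (b : SX) : lreal1 (ctx_proj b) (diag (iota 0 (tag b).+1)) = b.
Proof.
case: b => d s; apply: mk_eq; first by rewrite size_map size_iota.
move=> x i; rewrite tnth_mktuple.
have E : [seq nth 0%N v i | v <- diag (iota 0 d.+1)] = iota 0 d.+1.
  by rewrite -map_comp -[RHS]map_id; apply: eq_map => j /=; rewrite nth_nseq ltn_ord.
by rewrite [tag _]/= E; exact: esym (congr1 (fun y => s y i) (smap_iota x)).
Qed.

Definition iotas (s : seq S) : seq A := [seq (iota 0 (tag a).+1 : A) | a <- s].

Lemma iotas_ttuple t : ttuple k (iotas t).
Proof.
split; first by rewrite size_map size_tuple.
by apply/allP => w /mapP[a _ ->]; rewrite size_iota.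
Qed.

Lemma tdeg_iotas s : tdeg (iotas s) = tdeg s.
Proof. by elim: s => // a s IHs; rewrite !tdeg_cons -IHs /= size_iota. Qed.

Lemma treal_iotas t : treal t << iotas t >> = << t : seq S >>.
Proof.
have [ik _] := iotas_ttuple t; rewrite treal1 //; congr << _ >>; congr (tval _).
apply: eq_from_tnth => i; rewrite tnth_mktuple.
rewrite (nth_map (tnth t i)) ?size_tuple // -tnth_nth.
exact: sreal_iota.
Qed.

Definition diagb (b : SX) := diag (iota 0 (tag b).+1).

Lemma diagb_ltuple b : size (diagb b) = (tag b).+1 /\ ltuple k (diagb b).
Proof.
split; first by rewrite size_map size_iota.
by split; [rewrite size_map size_iota|apply/allP => v /mapP[j _ ->]; rewrite size_nseq].
Qed.

(** The model map at the universal element, realized in the given tuple; lists of length other than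
    k are sent to 0. *)
Definition ezX : TS -> {freeg SX / F} :=
  fglift (fun s => if insub s is Some t then lreal (t : k.-tuple S) (ez_x << iotas t >>) else 0).
HB.instance Definition _ := GRing.Linear.copy ezX (fglift _).

Definition ezY : {freeg SX / F} -> TS :=
  fglift (fun b => treal (ctx_proj b) (ez_y << diagb b >>)).
HB.instance Definition _ := GRing.Linear.copy ezY (fglift _).

Definition ezG : TS -> TS :=
  fglift (fun s => if insub s is Some t then treal (t : k.-tuple S) (ez_g << iotas t >>) else 0).
HB.instance Definition _ := GRing.Linear.copy ezG (fglift _).

Definition ezK : {freeg SX / F} -> {freeg SX / F} :=
  fglift (fun b => lreal (ctx_proj b) (ez_k << diagb b >>)).
HB.instance Definition _ := GRing.Linear.copy ezK (fglift _).

Lemma ezX1 t : ezX << t : seq S >> = lreal t (ez_x << iotas t >>).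
Proof. by rewrite [LHS]fglift1 valK. Qed.

Lemma ezG1 t : ezG << t : seq S >> = treal t (ez_g << iotas t >>).
Proof. by rewrite [LHS]fglift1 valK. Qed.

Lemma ezY1 b : ezY << b >> = treal (ctx_proj b) (ez_y << diagb b >>).
Proof. exact: fglift1. Qed.

Lemma ezK1 b : ezK << b >> = lreal (ctx_proj b) (ez_k << diagb b >>).
Proof. exact: fglift1. Qed.

Lemma map_relab (u : seq nat) : (0 < size u)%N ->
  map (relab (size u).-1 u) (iota 0 (size u).-1.+1) = u.
Proof.
move=> u0; rewrite prednK //; apply: (@eq_from_nth _ 0%N); first by rewrite size_map size_iota.
move=> i; rewrite size_map size_iota => iu.
rewrite (nth_map 0%N) ?size_iota // nth_iota // add0n /relab inordK ?prednK //.
Qed.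

Lemma relabel_iotas t (w : seq A) : ttuple k w ->
  mapi (fun i => map (relabs w i)) (iotas (ctx_comp t w)) = w.
Proof.
move=> [wk w0]; apply: (@eq_from_nth _ [::]).
  by rewrite size_mapi size_map size_tuple wk.
move=> i; rewrite size_mapi size_map size_tuple => ik.
have iw : (0 < size (nth [::] w i))%N by apply: (all_nthP _ w0); rewrite wk.
have si : size (iotas (ctx_comp t w)) = k by rewrite size_map size_tuple.
rewrite (nth_mapi ([::] : seq nat)) ?si //.
have -> : nth [::] (iotas (ctx_comp t w)) i = iota 0 (size (nth [::] w i)).-1.+1.
  rewrite (nth_map (tnth (ctx_comp t w) (Ordinal ik))) ?size_tuple //.
  by rewrite -[i in LHS]/(nat_of_ord (Ordinal ik)) -tnth_nth tnth_mktuple.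
exact: map_relab.
Qed.

Lemma relabel_diagb t u : ltuple k u ->
  map (mapi (relabs (mkseq (fun i => [seq nth 0%N v i | v <- u]) k))) (diagb (lreal1 t u)) = u.
Proof.
move=> [u0 uk]; have tu : (tag (lreal1 t u)).+1 = size u by rewrite /= prednK.
rewrite /diagb tu; apply: (@eq_from_nth _ [::]); first by rewrite !size_map size_iota.
move=> l; rewrite !size_map size_iota => lu.
rewrite (nth_map [::]) ?size_map ?size_iota //.
rewrite (nth_map 0%N) ?size_iota // nth_iota // add0n.
have lk : size (nth [::] u l) = k by apply/eqP; apply: (all_nthP _ uk).
apply: (@eq_from_nth _ 0%N); first by rewrite size_mapi size_nseq lk.
move=> i; rewrite size_mapi size_nseq => ik.
rewrite (nth_mapi 0%N) ?size_nseq // nth_nseq ik /relabs nth_mkseq // size_map /relab.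
by rewrite inordK ?prednK // (nth_map [::]).
Qed.

(** A realized list is itself a tuple of simplices, and realizing in it amounts to relabelling the
    universal element. *)
Lemma ezX_nat t c : csub (ttuple k) c -> ezX (treal t c) = lreal t (ez_x c).
Proof.
move=> ck; apply: (csub_lin ck (f := fun c => ezX (treal t c)) (g := fun c => lreal t (ez_x c)));
  [lin|lin|move=> w wk].
have [w1 w0] := wk; rewrite treal1 // ezX1 lreal_comp; last first.
  have H : lgood k (tdeg (iotas (ctx_comp t w))) (ez_x << iotas (ctx_comp t w) >>).
    by apply: csub_ez_x; apply: csub1; split => //; exact: iotas_ttuple.
  by apply: (csubW _ H) => u [].
rewrite (@ez_x_relabel F k); last by apply: csub1; exact: iotas_ttuple.
by rewrite trelabel1 relabel_iotas.
Qed.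

Lemma ezG_nat t c : csub (ttuple k) c -> ezG (treal t c) = treal t (ez_g c).
Proof.
move=> ck; apply: (csub_lin ck (f := fun c => ezG (treal t c)) (g := fun c => treal t (ez_g c)));
  [lin|lin|move=> w wk].
have [w1 w0] := wk; rewrite treal1 // ezG1 treal_comp; last first.
  have H : tgood k (tdeg (iotas (ctx_comp t w))).+1 (ez_g << iotas (ctx_comp t w) >>).
    by apply: ez_g_good; apply: csub1; split => //; exact: iotas_ttuple.
  by apply: (csubW _ H) => u [].
rewrite (@ez_g_relabel F k); last by apply: csub1; exact: iotas_ttuple.
by rewrite trelabel1 relabel_iotas.
Qed.

Lemma ezY_nat t c : csub (ltuple k) c -> ezY (lreal t c) = treal t (ez_y c).
Proof.
move=> ck; apply: (csub_lin ck (f := fun c => ezY (lreal t c)) (g := fun c => treal t (ez_y c)));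
  [lin|lin|move=> u uk].
have [d1 d0] := diagb_ltuple (lreal1 t u).
rewrite lreal1E ezY1 ctx_proj_real treal_comp; last first.
  have H : tgood k (tag (lreal1 t u)) (ez_y (<< diagb (lreal1 t u) >> : L)).
    by apply: csub_ez_y; apply: csub1.
  by apply: (csubW _ H) => w [].
rewrite (@ez_y_relabel F) /lrelabel lmap1; congr (treal t (ez_y << _ >>)).
exact: relabel_diagb.
Qed.

Lemma ezK_nat t c : csub (ltuple k) c -> ezK (lreal t c) = lreal t (ez_k c).
Proof.
move=> ck; apply: (csub_lin ck (f := fun c => ezK (lreal t c)) (g := fun c => lreal t (ez_k c)));
  [lin|lin|move=> u uk].
have [d1 d0] := diagb_ltuple (lreal1 t u).
rewrite lreal1E ezK1 ctx_proj_real lreal_comp; last first.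
  have H : lgood k (tag (lreal1 t u)).+1 (ez_k (<< diagb (lreal1 t u) >> : L)).
    by apply: ez_k_good; apply: csub1.
  by apply: (csubW _ H) => w [].
rewrite (@ez_k_relabel F k); last by apply: csub1.
rewrite /lrelabel lmap1; congr (lreal t (ez_k << _ >>)).
exact: relabel_diagb.
Qed.

Let iotas_good t : tgood k (tdeg (t : seq S)) (<< iotas t >> : TA).
Proof. by apply: csub1; split; [exact: tdeg_iotas|exact: iotas_ttuple]. Qed.

Let diagb_good b : lgood k (tag b) (<< diagb b >> : L).
Proof. by apply: csub1; exact: diagb_ltuple. Qed.

Let good_gt1 m (c : L) : lgood k m.+1 c -> csub (fun u => (1 < size u)%N) c.
Proof. by apply: csubW => u [->]. Qed.

Let sized (f g : TS -> {freeg SX / F}) c : lin f -> lin g ->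
  csub (fun s : seq S => size s = k) c -> (forall t, f << t : seq S >> = g << t : seq S >>) -> f c = g c.
Proof.
move=> lf lg ck fg; apply: (csub_lin ck lf lg) => s /eqP sk.
exact: (fg (Tuple sk)).
Qed.

Lemma ezX_bd c : csub (fun s : seq S => size s = k) c -> gd (ezX c) = ezX (tbd c).
Proof.
move=> ck; apply: (sized (f := fun c => gd (ezX c)) (g := fun c => ezX (tbd c))) => //; [lin|lin|move=> t].
rewrite ezX1 -[in RHS]treal_iotas treal_bd; have tg : tgood k (tdeg (t : seq S)) (<< iotas t >> : TA) by exact: iotas_good.
case td: (tdeg (t : seq S)) => [|m]; rewrite td in tg.
  rewrite (tbd_good0 tg) !linear0; have H := csub_ez_x tg.
  rewrite (csub_lin H (f := fun c => gd (lreal t c)) (g := \0)) //; [lin|lin|].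
  move=> u [u1 _]; rewrite lreal1E gd1; move: (@lreal_deg t _ u u1).
  by case: (lreal1 t u) => [[|d] s].
rewrite ezX_nat; last by apply: (csubW _ (tbd_good tg)) => w [].
by rewrite -(ez_x_bdE tg) lreal_bd //; apply: (good_gt1 (csub_ez_x tg)).
Qed.

Lemma ezY_bd c : tbd (ezY c) = ezY (gd c).
Proof.
move: c; apply: fg_ext => [||b]; [lin|lin|].
rewrite ezY1 treal_bd; have dg : lgood k (tag b) (<< diagb b >> : L) by exact: diagb_good.
case bd: (tag b) => [|m]; rewrite bd in dg.
  rewrite (tbd_good0 (csub_ez_y dg)) gd1; have -> : @gbd F SX b = 0 by case: (b) bd => [[|d] s].
  by rewrite !linear0.
rewrite (ez_y_bdE dg) -[X in gd << X >>]lreal_proj -lreal1E lreal_bd; last exact: good_gt1 dg.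
by rewrite ezY_nat //; apply: (csubW _ (lbd_good dg)) => u [].
Qed.

Lemma ezG_bd c : csub (fun s : seq S => size s = k) c ->
  tbd (ezG c) + ezG (tbd c) = c - ezY (ezX c).
Proof.
move=> ck; apply: (csub_lin ck (f := fun c => tbd (ezG c) + ezG (tbd c)) (g := fun c => c - ezY (ezX c)));
  [lin|lin|move=> s /eqP sk].
rewrite -[s]/(tval (Tuple sk)); move: (Tuple sk) => t {s sk}.
have tg : tgood k (tdeg (t : seq S)) (<< iotas t >> : TA) by exact: iotas_good.
have tE : << t : seq S >> = treal t << iotas t >> by rewrite treal_iotas.
rewrite ezG1 ezX1 treal_bd [in tbd << _ >>]tE treal_bd ezG_nat; last first.
  by case td: (tdeg (t : seq S)) tg => [|m] tg;
    [rewrite (tbd_good0 tg); exact: csub0|apply: (csubW _ (tbd_good tg)) => w []].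
rewrite ezY_nat; last by apply: (csubW _ (csub_ez_x tg)) => u [].
by rewrite -linearD /= (ez_g_bd tg) linearB tE.
Qed.

Lemma ezK_bd c : gd (ezK c) + ezK (gd c) = c - ezX (ezY c).
Proof.
move: c; apply: fg_ext => [||b]; [lin|lin|].
have dg : lgood k (tag b) (<< diagb b >> : L) by exact: diagb_good.
rewrite ezK1 ezY1 ezX_nat; last by apply: (csubW _ (csub_ez_y dg)) => w [].
have bE : << b >> = lreal (ctx_proj b) << diagb b >> by rewrite lreal1E lreal_proj.
case bd: (tag b) => [|m]; rewrite bd in dg.
  rewrite (ez_k0 dg) !linear0 add0r gd1; have -> : @gbd F SX b = 0 by case: (b) bd => [[|d] s].
  by rewrite linear0 (ez_xy0 dg) bE subrr.
rewrite bE lreal_bd; last exact: good_gt1 (ez_k_good dg).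
rewrite lreal_bd; last exact: good_gt1 dg.
rewrite ezK_nat; last by apply: (csubW _ (lbd_good dg)) => u [].
by rewrite -linearD /= (ez_k_bd dg) linearB.
Qed.

Lemma ezY_deg b : csub (fun s : seq S => tdeg s = tag b /\ size s = k) (ezY << b >>).
Proof.
rewrite ezY1; apply: (csub_map _ (csub_ez_y (@diagb_good b))) => [|w [wb [wk w0]]]; first by lin.
rewrite treal1 //; apply: csub1; split; last by rewrite size_tuple.
by rewrite -tdeg_iotas -wb -[in RHS](relabel_iotas (ctx_proj b) (conj wk w0)) mapi_tdeg.
Qed.

Definition act_ssimp (s : 'S_k) (b : SX) : SX :=
  mk_ssimp (mkcts (fun x => @continuous_comp _ _ _ (projT2 b) (act s) x
    (@cts_fun _ _ (projT2 b) x) (@act_cts k M s _)) : continuousType (std_simplex R (tag b)) X).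

Definition sact s : {freeg SX / F} -> {freeg SX / F} := @bmap F _ _ (act_ssimp s).
HB.instance Definition _ s := GRing.Linear.copy (sact s) (@bmap F _ _ (act_ssimp s)).

Lemma unaug_actc s (c : achain R F X) : unaug (actc s c) = sact s (unaug c).
Proof.
move: c; apply: fg_ext => [||[[d x]|]]; [lin|lin| |].
  rewrite /actc apush1 unaug1 [RHS]bmap1 /=.
  have xc : continuous (act s \o x).
    by move=> y; apply: continuous_comp; [exact: (@cts_fun _ _ x)|exact: act_cts].
  by rewrite /amk; case: pselect => [xc'|[]] //; rewrite unaug1; congr << _ >>; apply: ssimp_eq.
by rewrite /actc apush1 [unaug << None >>]fglift1 linear0.
Qed.

Lemma nth_swap (T : Type) (x0 : T) p (s : seq T) i : (p.+1 < size s)%N ->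
  nth x0 (swap p s) i = nth x0 s (if i == p then p.+1 else if i == p.+1 then p else i).
Proof.
elim: p s i => [|p IHp] [|a s] //= i.
  by case: s => // b r _; case: i => [|[|i]].
by rewrite ltnS => ps; case: i => [//|i] /=; rewrite IHp // !eqSS; case: eqP => // _; case: eqP.
Qed.

Lemma ezX_swap p (a b : 'I_k) c : a = p :> nat -> b = p.+1 :> nat ->
  csub (fun s : seq S => size s = k) c -> ezX (tswap p c) = sact (tperm a b) (ezX c).
Proof.
move=> ap bp ck.
apply: (sized (f := fun c => ezX (tswap p c)) (g := fun c => sact (tperm a b) (ezX c))) => //;
  [lin|lin|move=> t].
have pk : (p.+1 < k)%N by rewrite -bp.
have sk : size (swap p (t : seq S)) == k by rewrite size_swap size_tuple.
have idx (i : 'I_k) : (if i == p :> nat then p.+1 else if i == p.+1 :> nat then p else i) = tperm a b i.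
  case: tpermP => [->|->|/eqP ia /eqP ib]; first by rewrite ap eqxx.
    by rewrite bp eqxx gtn_eqF // ap.
  have /negPf -> : i != p :> nat by rewrite -ap.
  by have /negPf -> : i != p.+1 :> nat by rewrite -bp.
rewrite tswap1 linearZ /= -[swap p t]/(tval (Tuple sk)) ezX1.
have -> : swap_deg p (t : seq S) = swap_deg p (iotas t).
  elim: p (t : seq S) {ap bp pk sk idx} => [|p IHp] [|x s] //=.
  by case: s => //= y s; rewrite !size_iota.
have -> : iotas (Tuple sk) = swap p (iotas t) by rewrite /iotas -map_swap.
rewrite -linearZ /= -[X in lreal _ X]linearZ /=.
have <- : tswap p << iotas t >> = (-1) ^+ swap_deg p (iotas t) *: << swap p (iotas t) >> by rewrite tswap1.
rewrite -ez_x_swap ezX1.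
have H := csub_ez_x (@iotas_good t).
apply: (csub_lin H (f := fun c => lreal (Tuple sk) (lmap (swap p) c))
  (g := fun c => sact (tperm a b) (lreal t c))); [lin|lin|move=> u [u1 [u0 uk]]].
rewrite lmap1 !lreal1E [RHS]bmap1; congr << _ >>; apply: mk_eq; first by rewrite size_map.
move=> x i /=; rewrite /act /=.
have -> : tnth (Tuple sk) i = tnth t (tperm a b i).
  by rewrite (tnth_nth (tnth t i)) /= nth_swap ?size_tuple // idx -tnth_nth.
apply: (congr1 (projT2 (tnth t (tperm a b i)))).
rewrite -[LHS]/(smap R _ _ _ x) -[RHS]/(smap R _ _ _ x) -map_comp; congr (smap R _ _ _ x).
apply/eq_in_map => v vu; rewrite /= nth_swap ?idx //.
by rewrite (eqP (allP uk v vu)).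
Qed.

End Contexts.

(** * Splitting the complex of a space *)

Section Splitting.
Variable F : fieldType.

Definition mklin (U V : lmodType F) (f : U -> V) (lf : lin f) : {linear U -> V} :=
  HB.pack_for {linear U -> V} f (GRing.isLinear.Build F U V *:%R f lf).

Lemma mklinE (U V : lmodType F) (f : U -> V) (lf : lin f) x : mklin lf x = f x.
Proof. by []. Qed.

Lemma linear_projection (V : lmodType F) (W : set V) : W 0 ->
  (forall a x y, W x -> W y -> W (a *: x + y)) ->
  exists p : {linear V -> V}, (forall v, W (p v)) /\ (forall w, W w -> p w = w).
Proof.
move=> W0 WD.
pose P (U : set V) := (forall a x y, U x -> U y -> U (a *: x + y)) /\
  (forall x, U x -> W x -> x = 0).
have WZ a x : W x -> W (a *: x) by move=> Wx; rewrite -[_ *: _]addr0; apply: WD.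
have WB x y : W x -> W y -> W (x - y) by move=> Wx Wy; rewrite -scaleN1r addrC; apply: WD.
have [U [[UD UW] Umax]] : exists U, P U /\ forall U', U `<` U' -> ~ P U'.
  apply: Zorn_bigcup => G GP Gt; split => [a x y [A GA Ax] [B GB By]|x [A GA Ax]].
    by have [AB|BA] := Gt _ _ GA GB;
      [exists B => //; apply: (GP _ GB).1 => //; apply: AB
      |exists A => //; apply: (GP _ GA).1 => //; apply: BA].
  exact: (GP _ GA).2.
(* The closure condition in [P] admits the empty set, so 0 is adjoined. *)
pose U0 := U `|` [set 0].
have U0D a x y : U0 x -> U0 y -> U0 (a *: x + y).
  move=> [Ux|->] [Uy|->]; rewrite ?scaler0 ?add0r ?addr0; [by left; apply: UD| |by left|by right].
  by left; have := UD (a - 1) _ _ Ux Ux; rewrite scalerBl scale1r subrK.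
have U0W x : U0 x -> W x -> x = 0 by move=> [/UW|->].
have dec v : exists w, W w /\ U0 (v - w).
  apply: contrapT => Hv.
  pose U' := [set x | exists a u, U0 u /\ x = a *: v + u].
  apply: (Umax U').
    split=> [x Ux|U'U]; first by exists 0, x; split; [left|rewrite scale0r add0r].
    apply: Hv; exists 0; split => //; left; apply: U'U; exists 1, 0; split; [by right|].
    by rewrite scale1r subr0 addr0.
  split=> [a x y [b [u [Uu ->]]] [c [u' [Uu' ->]]]|x [a [u [Uu ->]]]].
    exists (a * b + c), (a *: u + u'); split; first exact: U0D.
    by rewrite scalerDr scalerA scalerDl; zmod.
  have [->|a0] := eqVneq a 0; first by rewrite scale0r add0r; apply: U0W.
  move=> Wx; case: Hv; exists (a^-1 *: (a *: v + u)); split; first exact: WZ.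
  rewrite scalerDr scalerA mulVf // scale1r opprD addrA subrr add0r -[X in U0 X]addr0 -scaleNr.
  by apply: U0D => //; right.
have /choice[p pP] := dec.
have pu v w : W w -> U0 (v - w) -> w = p v.
  move=> Ww Uw; have [Wp Up] := pP v; apply/eqP; rewrite -subr_eq0; apply/eqP.
  apply: U0W; last exact: WB.
  have -> : w - p v = (-1) *: (v - w) + (v - p v) by rewrite scaleN1r; zmod.
  exact: U0D.
have pl : lin p.
  move=> a x y; apply/esym/pu; first by apply: WD; [have [] := pP x|have [] := pP y].
  have -> : a *: x + y - (a *: p x + p y) = a *: (x - p x) + (y - p y).
    by rewrite scalerBr; zmod.
  by apply: U0D; [have [] := pP x|have [] := pP y].
exists (mklin pl); split => [v|w Ww] /=; first by have [] := pP v.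
by apply/esym/pu => //; right; rewrite subrr.
Qed.

(** Removing from a chosen preimage its projection to the kernel makes the result independent of the
    choice, hence linear. *)
Lemma linear_section (U V : lmodType F) (f : {linear U -> V}) :
  exists g : {linear V -> U}, forall u, f (g (f u)) = f u.
Proof.
have [|a x y x0 y0|q [q0 qE]] := @linear_projection U [set u | f u = 0]; first exact: linear0.
  by rewrite /= linearP x0 y0 scaler0 addr0.
have [|a x y [u _ fu] [v _ fv]|r [r0 rE]] := @linear_projection V [set f u | u in setT].
- by exists 0 => //; rewrite linear0.
- by exists (a *: u + v) => //; rewrite linearP fu fv.
have H v : exists u, f u = r v by have [u _ fu] := r0 v; exists u.
have /choice[g gP] := H.
have qf x y : f x = f y -> x - q x = y - q y.
  move=> xy; have := qE (x - y); rewrite /= !linearB /= xy subrr => /(_ erefl) E.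
  apply/eqP; rewrite -subr_eq0; apply/eqP; transitivity ((x - y) - (q x - q y)); first by zmod.
  by rewrite E subrr.
have gl : lin (fun v => g v - q (g v)).
  move=> a x y; rewrite scalerBr -linearZ /= addrACA -opprD -linearD /=; apply: qf.
  by rewrite gP !linearP /= !gP.
exists (mklin gl) => u; rewrite mklinE linearB /= (q0 (g (f u))) subr0 gP.
by apply: rE; exists u.
Qed.

End Splitting.

Section Typed.
Variables (R : realType) (F : fieldType) (Z : topologicalType).
Local Notation S := (sbasis R F Z).
Local Notation chain d := (singular_chain R F Z d).

(** [tin] and [tout] pass between chains of one dimension, as in the definition of homology, and
    chains of all dimensions together. *)
Definition tin d : chain d -> {freeg S / F} :=
  @bmap F (singular_simplex R Z d) S (@mk_ssimp R Z d).
HB.instance Definition _ d := GRing.Linear.copy (@tin d) (@bmap F _ _ _).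

Lemma tin1 d (s : singular_simplex R Z d) : tin << s >> = << mk_ssimp s : S >>.
Proof. exact: bmap1. Qed.

Definition tout d : {freeg S / F} -> chain d :=
  fglift (fun a : S => untag (0 : chain d) (fun s => << s >>) a).
HB.instance Definition _ d := GRing.Linear.copy (@tout d) (fglift _).

Lemma tout1 d (s : singular_simplex R Z d) : tout d << mk_ssimp s : S >> = << s >>.
Proof.
by rewrite [LHS]fglift1 (@untagE _ _ _ _ _ _ (mk_ssimp s) erefl); congr << _ >>; exact: etaggedE.
Qed.

Lemma tout_ne d (a : S) : tag a <> d -> tout d << a >> = 0.
Proof. by move=> /eqP ad; rewrite [LHS]fglift1 untag_dflt. Qed.

Lemma tinK d (c : chain d) : tout d (tin c) = c.
Proof. by move: c; apply: fg_ext => [||s]; [lin|lin|rewrite tin1 tout1]. Qed.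

Lemma toutK d c : csub (fun a : S => gdeg a = d) c -> tin (tout d c) = c.
Proof.
move=> cd; apply: (csub_lin cd (f := fun c => tin (tout d c)) (g := id)); [lin|lin|].
by move=> [e s] /= <-; rewrite -/(mk_ssimp s) tout1 tin1.
Qed.

Lemma tin_deg d (c : chain d) : csub (fun a : S => gdeg a = d) (tin c).
Proof. by apply: csub_mapT => [|s]; [lin|rewrite tin1; apply: csub1]. Qed.

Lemma tin_bd d (c : chain d.+1) : gd (tin c) = tin (singular_boundary R F Z d c).
Proof.
move: c; apply: fg_ext => [||s]; [lin|lin|].
rewrite tin1 gd1 /= fglift1 linear_sum /=; apply: eq_bigr => i _.
by rewrite [in RHS]fgU linearZ /= tin1.
Qed.

Lemma tin_bd0 (c : chain 0) : gd (tin c) = 0.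
Proof. by move: c; apply: fg_ext => [||s]; [lin|lin|rewrite tin1 gd1]. Qed.

Lemma tout_bd d c : tout d (gd c) = singular_boundary R F Z d (tout d.+1 c).
Proof.
move: c; apply: fg_ext => [||[e s]]; [lin|lin|].
have [ed|ed] := pselect (e = d.+1).
  case: _ / (esym ed) s => s; rewrite -/(mk_ssimp s) -tin1 tin_bd.
  by rewrite tinK tinK.
rewrite [tout d.+1 _]tout_ne // linear0 gd1.
have H := @gbd_deg F S (existT _ e s).
apply: (csub_lin H (f := tout d) (g := \0)); [lin|lin|].
move=> a ae; apply: tout_ne => ad; apply: ed; move: ae.
by rewrite /= ad => ->.
Qed.

Definition augm : {freeg S / F} -> achain R F Z := @bmap F S _ Some.
HB.instance Definition _ := GRing.Linear.copy augm (@bmap F _ _ _).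

Lemma unaugK c : augm (unaug c) = c - coeff None c *: << None >>.
Proof.
have L : lin (fun c : achain R F Z => coeff None c *: << None >> : achain R F Z).
  by move=> a x y; rewrite coeffD coeffZ scalerDl scalerA.
move: c; apply: fg_ext => [||[a|]]; [lin|by apply: lin_add; [lin|apply: lin_comp; [lin|]]| |].
  by rewrite unaug1 [LHS]bmap1 coeffU /= mulr0 scale0r subr0.
by rewrite [unaug _]fglift1 linear0 coeffU eqxx mulr1 scale1r subrr.
Qed.

Lemma augmK c : unaug (augm c) = c.
Proof. by move: c; apply: fg_ext => [||a]; [lin|lin|rewrite [augm _]bmap1 unaug1]. Qed.

Lemma augm_tin_bd d (c : chain d.+1) : abd (augm (tin c)) = augm (tin (singular_boundary R F Z d c)).
Proof.
move: c; apply: fg_ext => [||s]; [lin|lin|].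
rewrite tin1 [augm _]bmap1 abd1 /= fglift1 !linear_sum /=; apply: eq_bigr => i _.
by rewrite [in RHS]fgU !linearZ /= tin1 [augm _]bmap1 amkE.
Qed.

Lemma augm_cycle c : gd c = 0 -> exists a, abd (augm c) = a *: << None >>.
Proof.
move=> c0; exists (coeff None (abd (augm c))); apply/eqP; rewrite -subr_eq0 -unaugK.
by rewrite unaug_bd augmK c0 linear0.
Qed.

End Typed.

Section QuotientMap.
Variables (F : pzRingType) (V : lmodType F) (W : set V).

Definition qpi (v : V) : quotmod W :=
  \pi_(Quotient.quot (GRing.ZmodClosed.clone V (lspan W) _)) v.

Fact qpi_is_linear : linear qpi.
Proof.
move=> a x y; rewrite /qpi Quotient.pi_add; congr (_ + _).
exact/esym/quotmod_scale_pi.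
Qed.
HB.instance Definition _ := GRing.isLinear.Build F V (quotmod W) *:%R qpi qpi_is_linear.

Lemma qpi_eq0 v : qpi v = 0 <-> v \in lspan W.
Proof.
rewrite -[0](linear0 qpi); split => [/eqP|vW].
  by rewrite /qpi -Quotient.idealrBE subr0.
by apply/eqP; rewrite /qpi -Quotient.idealrBE subr0.
Qed.

Lemma qpi_surj x : exists v, qpi v = x.
Proof. by exists (repr (x : Quotient.quot (GRing.ZmodClosed.clone V (lspan W) _))); exact: reprK. Qed.

Lemma qpi_rel w : W w -> qpi w = 0.
Proof. by move=> Ww; apply/qpi_eq0/asboolP => U _; apply. Qed.

Lemma qpi_ker (V' : lmodType F) (f : {linear V -> V'}) v :
  (forall w, W w -> f w = 0) -> qpi v = 0 -> f v = 0.
Proof.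
move=> fW /qpi_eq0/asboolP/(_ [pred v | `[< f v = 0 >]]) H.
suff /asboolP : v \in [pred v | `[< f v = 0 >]] by [].
apply: H => [|w Ww]; last exact/asboolP/fW.
split; first by apply/asboolP; exact: linear0.
by move=> a x y /asboolP x0 /asboolP y0; apply/asboolP; rewrite linearP x0 y0 scaler0 addr0.
Qed.

End QuotientMap.

(** * Homology as a deformation retract of the singular chains *)

Section SplitComplex.
Variables (R : realType) (F : fieldType) (Z : topologicalType).
Local Notation S := (sbasis R F Z).
Local Notation chain d := (singular_chain R F Z d).
Local Notation H := (homology R F Z).

Definition hclass d : singular_cycle R F Z d -> H d := @qpi F (singular_cycle R F Z d)
  [set z | exists c, singular_boundary R F Z d c = z :> singular_chain R F Z d].

Fact hclass_is_linear d : linear (@hclass d). Proof. exact: linearP. Qed.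
HB.instance Definition _ d :=
  GRing.isLinear.Build F (singular_cycle R F Z d) (H d) *:%R (@hclass d) (@hclass_is_linear d).

Lemma hclass_surj d h : exists z, @hclass d z = h.
Proof. exact: qpi_surj. Qed.

Lemma hclass_eq0 d (z : singular_cycle R F Z d) : hclass z = 0 <->
  exists c, singular_boundary R F Z d c = cycle_val z.
Proof.
split=> [/qpi_eq0/asboolP H0|H0]; last exact: qpi_rel.
have := H0 [pred z : singular_cycle R F Z d | `[< exists c, singular_boundary R F Z d c = cycle_val z >]].
move=> /(_ _ _)/asboolP; apply.
  split; first by apply/asboolP; exists 0; rewrite linear0.
  by move=> a x y /asboolP[c cx] /asboolP[e ey]; apply/asboolP; exists (a *: c + e); rewrite linearP cx ey.
by move=> w Ww; apply/asboolP.
Qed.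

Record splitting := Splitting {
  hrho : forall d, {linear chain d -> H d};
  hsec : forall d, {linear H d -> chain d};
  hhom : forall d, {linear chain d -> chain d.+1};
  hrho_bd : forall d c, hrho d (singular_boundary R F Z d c) = 0;
  hsec_cycle : forall d h, hsec d h \in @is_cycle R F Z d;
  hrho_sec : forall d h, hrho d (hsec d h) = h;
  hhom_bd0 : forall c, singular_boundary R F Z 0 (hhom 0 c) = c - hsec 0 (hrho 0 c);
  hhom_bd : forall d c, singular_boundary R F Z d.+1 (hhom d.+1 c) +
    hhom d (singular_boundary R F Z d c) = c - hsec d.+1 (hrho d.+1 c) }.

Lemma boundary_cycle d c : singular_boundary R F Z d c \in @is_cycle R F Z d.
Proof.
case: d c => [//|d] c; apply/eqP.
by rewrite -[c]tinK -[X in singular_boundary _ _ _ _ X]tout_bd -tout_bd gd_gd linear0.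
Qed.

(** [pz] projects chains onto cycles, [sig] inverts the boundary with values in the complement of
    the cycles, and [sc] picks representatives. The homotopy is [sig] applied to the cycle part of a
    chain minus the representative of its class. *)
Lemma homology_splitting : splitting.
Proof.
have cycles_proj d : exists p : {linear chain d -> chain d},
    (forall v, [set z | z \in @is_cycle R F Z d] (p v)) /\ (forall w, [set z | z \in @is_cycle R F Z d] w -> p w = w).
  apply: linear_projection => [|a x y xz yz]; first exact: rpred0.
  by apply: rpredD => //; apply: rpredZ.
pose pz d := projT1 (cid (cycles_proj d)); have pzP d := projT2 (cid (cycles_proj d)).
rewrite -/(pz _) in pzP.
have pzc d v : pz d v \in @is_cycle R F Z d by have [+ _] := pzP d; apply.
have pzE d v : v \in @is_cycle R F Z d -> pz d v = v by have [_ +] := pzP d; apply.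
pose rho0 d c := hclass (Cycle (pzc d c)).
have rl d : lin (rho0 d).
  by move=> a x y; rewrite /rho0 -linearP; congr hclass; apply: val_inj; rewrite /= linearP.
pose sc d := projT1 (cid (@linear_section F _ _ (@hclass d))).
have scP d u : hclass (sc d (hclass u)) = hclass u := projT2 (cid (@linear_section F _ _ (@hclass d))) u.
have scl d : lin (fun h => cycle_val (sc d h)) by move=> a x y; rewrite linearP.
pose bs d := projT1 (cid (@linear_section F _ _ (singular_boundary R F Z d))).
have bsP d u : singular_boundary R F Z d (bs d (singular_boundary R F Z d u)) = singular_boundary R F Z d u :=
  projT2 (cid (@linear_section F _ _ (singular_boundary R F Z d))) u.
pose sig d (b : chain d) := bs d b - pz d.+1 (bs d b).
have sigB d c : sig d (singular_boundary R F Z d c) = c - pz d.+1 c.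
  have : bs d (singular_boundary R F Z d c) - c \in @is_cycle R F Z d.+1.
    by apply/eqP; rewrite linearB /= bsP subrr.
  move=> /pzE; rewrite linearB /= /sig => E.
  transitivity ((bs d (singular_boundary R F Z d c) - c) -
    (pz d.+1 (bs d (singular_boundary R F Z d c)) - pz d.+1 c) + (c - pz d.+1 c)); first by zmod.
  by rewrite E subrr add0r.
have bsig d c : singular_boundary R F Z d (sig d (singular_boundary R F Z d c)) = singular_boundary R F Z d c.
  by rewrite sigB linearB /= (eqP (pzc d.+1 c)) subr0.
pose hom d c := sig d (pz d c - cycle_val (sc d (rho0 d c))).
have hl d : lin (hom d).
  have sl : lin (sig d) by rewrite /sig; lin.
  apply: (lin_comp sl); apply: (@lin_add _ _ _ (pz d)); first by lin.
  by apply: lin_opp; exact: (lin_comp (scl d) (rl d)).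
have rB d c : rho0 d (singular_boundary R F Z d c) = 0.
  apply/hclass_eq0; exists c; rewrite /= pzE //; exact: boundary_cycle.
have rS d h : rho0 d (cycle_val (sc d h)) = h.
  rewrite /rho0 -[RHS](_ : hclass (sc d h) = h).
    by congr hclass; apply: val_inj; rewrite /= pzE //; case: (sc d h).
  by have [z <-] := hclass_surj h; exact: scP.
have hB d c : singular_boundary R F Z d (hom d c) = pz d c - cycle_val (sc d (rho0 d c)).
  have : hclass (Cycle (pzc d c) - sc d (rho0 d c)) = 0.
    rewrite linearB /= -/(rho0 d c) -{1}(rS d (rho0 d c)) /rho0.
    apply/eqP; rewrite subr_eq0; apply/eqP; congr hclass; apply: val_inj.
    by rewrite /= pzE //; case: (sc d _).
  by move=> /hclass_eq0[e]; rewrite /hom /= => <-; exact: bsig.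
have homB d c : hom d (singular_boundary R F Z d c) = c - pz d.+1 c.
  have scl0 : cycle_val (sc d 0) = 0 by exact: (lin0 (scl d)).
  by rewrite /hom rB scl0 subr0 pzE ?sigB //; exact: boundary_cycle.
have hB0 c : singular_boundary R F Z 0 (hom 0 c) = c - cycle_val (sc 0 (rho0 0 c)).
  by rewrite hB pzE.
have hBS d c : singular_boundary R F Z d.+1 (hom d.+1 c) + hom d (singular_boundary R F Z d c) =
    c - cycle_val (sc d.+1 (rho0 d.+1 c)).
  by rewrite hB homB addrC addrA subrK.
have scc d h : cycle_val (sc d h) \in @is_cycle R F Z d by case: (sc d h).
exact: (@Splitting (fun d => mklin (rl d)) (fun d => mklin (scl d)) (fun d => mklin (hl d))
  rB scc rS hB0 hBS).
Qed.

End SplitComplex.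

(** * From tensor powers of chains to symmetric powers of homology *)

Section SplitTensor.
Variables (R : realType) (F : fieldType) (M : topologicalType).
Local Notation S := (sbasis R F M).
Local Notation C := {freeg S / F}.
Local Notation TS := {freeg (seq S) / F}.
Local Notation chain d := (singular_chain R F M d).
Local Notation H := (homology R F M).
Variable sp : splitting R F M.

Definition rho1 (a : S) : homog H := Tagged H (hrho sp (tag a) << projT2 a >>).

Definition hproj : C -> C :=
  fglift (fun a : S => tin (hsec sp (tag a) (hrho sp (tag a) << projT2 a >>))).
HB.instance Definition _ := GRing.Linear.copy hproj (fglift _).

Definition hcontr : C -> C := fglift (fun a : S => tin (hhom sp (tag a) << projT2 a >>)).
HB.instance Definition _ := GRing.Linear.copy hcontr (fglift _).

Lemma hproj_tin d (c : chain d) : hproj (tin c) = tin (hsec sp d (hrho sp d c)).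
Proof. by move: c; apply: fg_ext => [||s]; [lin|lin|rewrite tin1 [LHS]fglift1]. Qed.

Lemma hcontr_tin d (c : chain d) : hcontr (tin c) = tin (hhom sp d c).
Proof. by move: c; apply: fg_ext => [||s]; [lin|lin|rewrite tin1 [LHS]fglift1]. Qed.

Lemma gd_cycle d (c : chain d) : c \in @is_cycle R F M d -> gd (tin c) = 0.
Proof. by case: d c => [|d] c; [rewrite tin_bd0|move=> /eqP c0; rewrite tin_bd c0 linear0]. Qed.

Lemma hcontr_bd c : gd (hcontr c) + hcontr (gd c) = c - hproj c.
Proof.
move: c; apply: fg_ext => [||[d s]]; [lin|lin|].
have -> : << existT _ d s >> = tin << s >> :> C by rewrite tin1.
rewrite hcontr_tin hproj_tin tin_bd; case: d s => [|d] s.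
  by rewrite tin_bd0 hhom_bd0 linear0 addr0 linearB.
by rewrite tin_bd hcontr_tin -linearD /= hhom_bd linearB.
Qed.

Lemma hproj_gd c : gd (hproj c) = hproj (gd c).
Proof.
move: c; apply: fg_ext => [||[d s]]; [lin|lin|].
have -> : << existT _ d s >> = tin << s >> :> C by rewrite tin1.
rewrite hproj_tin gd_cycle ?hsec_cycle //; case: d s => [|d] s.
  by rewrite tin_bd0 linear0.
by rewrite tin_bd hproj_tin hrho_bd !linear0.
Qed.

Lemma hproj_deg (a : S) : csub (fun b : S => gdeg b = gdeg a) (hproj << a >>).
Proof. by rewrite [hproj _]fglift1; exact: tin_deg. Qed.

Lemma hproj_sgn c : gsgn (hproj c) = hproj (gsgn c).
Proof. exact: (@gsgn_map _ _ _ hproj _ hproj_deg). Qed.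

Lemma hcontr_sgn c : gsgn (hcontr c) = - hcontr (gsgn c).
Proof.
move: c; apply: fg_ext => [||a]; [lin|lin|].
rewrite gsgn1 [hcontr (_ *: _)]linearZ /= [hcontr _]fglift1.
by rewrite (gsgn_deg (@tin_deg _ _ _ _ _)) exprS mulN1r scaleNr.
Qed.

Local Notation thomS := (thom (hcontr : {linear C -> C}) (hproj : {linear C -> C})).

Lemma hthom_bd t : tbd (thomS t) + thomS (tbd t) = t - tmap (fun=> hproj : {linear C -> C}) t.
Proof.
by apply: thom_bd; [exact: hcontr_bd|exact: hcontr_sgn|exact: hproj_gd|exact: hproj_sgn].
Qed.

Lemma hthom_size s : csub (fun r => size r = size s) (thomS << s >>).
Proof.
elim: s => [|a r IHr]; first by rewrite thom1; exact: csub0.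
rewrite -lcons1 thom_lcons; apply: csubD.
  have H0 : csub (fun s => s = r) (<< r >> : TS) by exact: csub1.
  by apply: (csub_tens _ (@csubT _ _ _) H0) => b s _ ->.
by apply: (csub_tens _ (@csubT _ _ _) IHr) => b s _ /= ->.
Qed.

(** The tensor product of the chosen representative cycles. *)
Fixpoint cross (w : seq (homog H)) : TS :=
  if w is u :: r then tens (cross r) (tin (hsec sp (tag u) (tagged u))) else << [::] >>.

Lemma cross_bd w : tbd (cross w) = 0.
Proof.
elim: w => [|u w IHw] /=; first by rewrite tbd_nil.
rewrite tbd_tens gd_cycle ?hsec_cycle // linear0 add0r IHw.
set c := gsgn _; exact: (lin0 (tens_linr c)).
Qed.

Lemma cross_deg w :
  csub (fun s => tdeg s = sumn (map (@hdeg F H) w) /\ size s = size w) (cross w).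
Proof.
elim: w => [|u w IHw] /=; first exact: csub1.
apply: (csub_tens _ (@tin_deg _ _ _ _ _) IHw) => a s au [sw /= ->].
by rewrite tdeg_cons au sw.
Qed.

Lemma tmap_cross s : tmap (fun=> hproj : {linear C -> C}) << s >> = cross (map rho1 s).
Proof.
elim: s => [|a s IHs]; first by rewrite tmap_nil.
by rewrite -lcons1 tmap_lcons IHs /= [hproj _]fglift1.
Qed.

Lemma cross_lin s t i : lin (fun x : H i => cross (s ++ Tagged H x :: t)).
Proof.
elim: s => [|u s IHs] /=; first by lin.
exact: (lin_comp (tens_linr _) IHs).
Qed.

Lemma tswap_tens p (t : TS) c : tswap p.+1 (tens t c) = tens (tswap p t) c.
Proof. by move: c; apply: fg_ext => [||a]; [lin|lin|rewrite !tens1 tswapS]. Qed.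

Lemma tswap_tens0 (t : TS) d e (c : chain d) (c' : chain e) :
  tswap 0 (tens (tens t (tin c')) (tin c)) = (-1) ^+ (d * e) *: tens (tens t (tin c)) (tin c').
Proof.
have L (x : C) : lin (fun t : TS => tens t x) by exact: tens_linr.
move: c; apply: fg_ext => [||a]; [lin| |].
  by apply: lin_scale; apply: (lin_comp (L _)); lin.
move: c'; apply: fg_ext => [||b]; [| |].
- by apply: (@lin_comp _ _ _ _ (tswap 0)); [lin|apply: (lin_comp (L _)); lin].
- by lin.
by rewrite !tin1 !tens1 tswap0.
Qed.

Lemma cross_swap s t u v : tswap (size s) (cross (s ++ u :: v :: t)) =
  (-1) ^+ (hdeg u * hdeg v) *: cross (s ++ v :: u :: t).
Proof.
elim: s => [|x s IHs] /=; first exact: tswap_tens0.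
rewrite tswap_tens IHs; set c := tin _.
have L := tens_linr c; have := L ((-1) ^+ (hdeg u * hdeg v)) (cross (s ++ v :: u :: t)) 0.
by rewrite addr0 (lin0 L) addr0.
Qed.

Section ToSym.
Variables k d : nat.
Local Notation Sym := (sym_power H k d).
Local Notation W := {freeg (word H k d) / F}.

Definition sclass : W -> Sym := @qpi F W (@sym_rel F H k d).
Fact sclass_is_linear : linear sclass. Proof. exact: linearP. Qed.
HB.instance Definition _ := GRing.isLinear.Build F W Sym *:%R sclass sclass_is_linear.

Lemma sclass_rel w : sym_rel w -> sclass w = 0. Proof. exact: qpi_rel. Qed.

Lemma sclass_lin s t i : lin (fun x : H i => sclass (monom k d (s ++ Tagged H x :: t))).
Proof.
move=> a x y; apply/eqP; rewrite -subr_eq0; apply/eqP.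
have := sclass_rel (SymLinear k d s t a x y).
by rewrite linearB /= linearP.
Qed.

Definition tolift : TS -> W := fglift (fun s => monom k d (map rho1 s)).
HB.instance Definition _ := GRing.Linear.copy tolift (fglift _).

(** The prefix collects the letters already read off, so that inductions on the tensor factors go
    through. *)
Definition tosym (pre : seq (homog H)) : TS -> Sym :=
  fglift (fun s => sclass (monom k d (pre ++ map rho1 s))).
HB.instance Definition _ pre := GRing.Linear.copy (tosym pre) (fglift _).

Lemma tosym_lift t : tosym [::] t = sclass (tolift t).
Proof. by move: t; apply: fg_ext => [||s]; [lin|lin|rewrite [LHS]fglift1 [tolift _]fglift1]. Qed.

Lemma tosym_lcons pre a t : tosym pre (lcons a t) = tosym (rcons pre (rho1 a)) t.
Proof.
move: t; apply: fg_ext => [||s]; [lin|lin|].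
by rewrite lcons1 [LHS]fglift1 [RHS]fglift1 cat_rcons.
Qed.

Lemma tosym_tens pre t i (c : chain i) :
  tosym pre (tens t (tin c)) = tosym (rcons pre (Tagged H (hrho sp i c))) t.
Proof.
have L (x : C) : lin (fun t : TS => tens t x) by exact: tens_linr.
move: t; apply: fg_ext => [||s]; [by apply: (@lin_comp _ _ _ _ (tosym pre)); [lin|exact: L]|lin|].
rewrite [RHS]fglift1; move: c; apply: fg_ext => [||a]; [lin| |].
  have E x : rcons pre (Tagged H (hrho sp i x)) ++ map rho1 s = pre ++ Tagged H (hrho sp i x) :: map rho1 s.
    by rewrite cat_rcons.
  move=> b x y; rewrite !E; exact: (lin_comp (sclass_lin pre (map rho1 s) (i := i)) (lin_can (hrho sp i))).
by rewrite tin1 tens1 tosym_lcons [LHS]fglift1.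
Qed.

Lemma tosym_cross pre w : tosym pre (cross w) = sclass (monom k d (pre ++ w)).
Proof.
elim: w pre => [|[i h] w IHw] pre /=; first by rewrite [LHS]fglift1.
by rewrite tosym_tens IHw hrho_sec cat_rcons.
Qed.

Lemma tosym_bd pre t : tosym pre (tbd t) = 0.
Proof.
move: t; apply: fg_ext => [||s]; [lin|lin|].
elim: s pre => [|[i x] s IHs] pre; first by rewrite tbd_nil linear0.
rewrite -lcons1 tbd_lcons linearD linearZ /= -[X in tosym _ (tens _ X) + _]/(gbd (existT _ i x : S)).
rewrite tosym_lcons IHs scaler0 addr0 -gd1; have -> : << existT _ i x >> = tin << x >> :> C by rewrite tin1.
case: i x => [|i] x; first by rewrite tin_bd0 !linear0.
rewrite tin_bd tosym_tens hrho_bd [LHS]fglift1 cat_rcons.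
exact: (lin0 (sclass_lin pre (map rho1 s) (i := i))).
Qed.

Lemma tosym_swap pre p t : tosym pre (tswap p t) = tosym pre t.
Proof.
move: t; apply: fg_ext => [||s]; [lin|lin|].
elim: p s pre => [|p IHp] [|a s] pre; try by rewrite tswap1 /= scale1r.
  case: s => [|b s]; first by rewrite tswap1 /= scale1r.
  rewrite tswap1 linearZ /= [X in _ *: X]fglift1 [RHS]fglift1 /=.
  apply/eqP; rewrite eq_sym -subr_eq0; apply/eqP.
  have := sclass_rel (SymKoszul k d pre (map rho1 s) (rho1 a) (rho1 b)).
  by rewrite linearB /= linearZ.
by rewrite -lcons1 tswapS !tosym_lcons IHp.
Qed.

End ToSym.
End SplitTensor.

Section SymmetricAction.
Variables (R : realType) (F : fieldType) (k : nat) (M : topologicalType).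
Local Notation X := {ptws 'I_k -> M}.
Local Notation SX := (sbasis R F X).
Local Notation CX := {freeg SX / F}.

Lemma sact_bd s (c : CX) : gd (sact s c) = sact s (gd c).
Proof.
rewrite -[c in LHS]augmK -[c in RHS]augmK -unaug_actc -!unaug_bd abd_actc.
exact: unaug_actc.
Qed.

Lemma sactM s t (c : CX) : sact s (sact t c) = sact (s * t)%g c.
Proof. by rewrite -[c]augmK -!unaug_actc actcM. Qed.

Lemma sact1 (c : CX) : sact 1%g c = c.
Proof. by rewrite -[c in LHS]augmK -unaug_actc actc1 augmK. Qed.

Definition ssym (c : CX) : CX := \sum_(s : 'S_k) sact s c.

Fact ssym_is_linear : linear ssym.
Proof.
move=> a c d; rewrite /ssym scaler_sumr -big_split.
by apply: eq_bigr => s _; rewrite linearP.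
Qed.
HB.instance Definition _ := GRing.isLinear.Build F CX CX *:%R ssym ssym_is_linear.

Lemma ssym_sact s c : ssym (sact s c) = ssym c.
Proof.
rewrite /ssym [RHS](reindex_inj (mulIg s)) /=.
by apply: eq_bigr => t _; rewrite sactM.
Qed.

Lemma ssym_bd c : gd (ssym c) = ssym (gd c).
Proof. by rewrite /ssym linear_sum; apply: eq_bigr => s _; rewrite /= sact_bd. Qed.

Lemma unaug_symm (c : achain R F X) : unaug (symm c) = ssym (unaug c).
Proof. by rewrite /symm linear_sum; apply: eq_bigr => s _; rewrite /= unaug_actc. Qed.

End SymmetricAction.

(** A transposition of distant indices is reduced by conjugating with the adjacent transposition at
    its upper end. *)
Lemma adjacent_transpositions (k : nat) (P : 'S_k -> Prop) : P 1%g ->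
  (forall s t, P s -> P t -> P (s * t)%g) ->
  (forall a b : 'I_k, b = a.+1 :> nat -> P (tperm a b)) -> forall s, P s.
Proof.
case: k P => [|k] P P1 PM Pa s.
  by have -> : s = 1%g by apply/permP => -[].
have PV (a b : 'I_k.+1) (m : nat) : b = (a + m)%N :> nat -> P (tperm a b).
  elim: m b => [|m IHm] b; first by rewrite addn0 => /val_inj ->; rewrite tperm1.
  case: m IHm => [|m] IHm ab; first by apply: Pa; rewrite ab addn1.
  have ck : (a + m.+1 < k.+1)%N by apply: ltn_trans (ltn_ord b); rewrite ab ltn_add2l.
  pose c := Ordinal ck.
  have ca : tperm c b a = a.
    by rewrite tpermD //; apply/eqP => /(congr1 val) /= H; move: H; rewrite ?ab -[X in _ = X]addn0 => /addnI.
  have -> : tperm a b = (tperm c b * tperm a c * tperm c b)%g.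
    have := tpermJ a c (tperm c b); rewrite ca tpermL => <-.
    by rewrite conjgE tpermV mulgA.
  have Pc : P (tperm c b) by apply: Pa; rewrite ab /= addnS.
  by apply: (PM) => //; apply: (PM) => //; apply: IHm.
have PT (a b : 'I_k.+1) : P (tperm a b).
  case: (leqP a b) => [ab|/ltnW ba]; first by apply: (PV a b (b - a)%N); rewrite subnKC.
  by rewrite tpermC; apply: (PV b a (a - b)%N); rewrite subnKC.
have [ts -> _] := prod_tpermP s.
by elim: ts => [|[a b] ts IHts]; rewrite ?big_nil // big_cons; apply: (PM).
Qed.

Lemma lin_absorb (F : comNzRingType) (U V : lmodType F) (f : U -> V) x b :
  lin f -> f b = 0 -> f (x + b) = f x.
Proof. by move=> fl b0; rewrite -{1}[x]scale1r fl b0 addr0 scale1r. Qed.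

(** * Symmetric Künneth theorem for M^k *)

Section Kunneth.
Variables (R : realType) (F : fieldType) (M : topologicalType) (k : nat).
Local Notation X := {ptws 'I_k -> M}.
Local Notation S := (sbasis R F M).
Local Notation SX := (sbasis R F X).
Local Notation CX := {freeg SX / F}.
Local Notation C := {freeg S / F}.
Local Notation TS := {freeg (seq S) / F}.
Local Notation H := (homology R F M).
Variable sp : splitting R F M.

Local Notation sized := (csub (fun s : seq S => size s = k)).

Let ezY_size (c : CX) : sized (ezY c).
Proof.
apply: csub_mapT => [|b]; first by lin.
by apply: (csubW _ (@ezY_deg R F k M b)) => s [].
Qed.

Let tswap_size p (c : TS) : sized c -> sized (tswap p c).
Proof.
move=> ck; apply: (csub_map _ ck) => [|s sk]; first by lin.
by rewrite tswap1; apply: csubZ; apply: csub1; rewrite size_swap.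
Qed.

Let cross_size w : size w = k -> sized (cross sp w).
Proof. by move=> wk; have H' := @cross_deg _ _ _ sp w; apply: (csubW _ H') => s [_ ->]. Qed.

Section Degree.
Variable d : nat.
Local Notation Sym := (sym_power H k d).
Local Notation W := {freeg (word H k d) / F}.

Definition kmap (c : CX) : Sym := tosym sp k d [::] (ezY c).
Fact kmap_is_linear : linear kmap.
Proof. exact: (lin_comp (lin_can (tosym sp k d [::])) (lin_can (@ezY R F k M))). Qed.
HB.instance Definition _ := GRing.isLinear.Build F CX Sym *:%R kmap kmap_is_linear.


Lemma kmap_bd c : kmap (gd c) = 0.
Proof. by rewrite /kmap -ezY_bd tosym_bd. Qed.

Lemma kmap_ezX t : sized t -> tbd t = 0 -> kmap (ezX k t) = tosym sp k d [::] t.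
Proof.
move=> tk t0; have := ezG_bd tk; rewrite t0 linear0 addr0 => E.
have Y : ezY (ezX k t) = t - tbd (@ezG R F k M t) by rewrite E; zmod.
by rewrite /kmap Y [tosym _ _ _ _ _]linearB /= tosym_bd subr0.
Qed.

(** As [ezY] is not symmetric, [z] is first replaced by the homologous ezX (ezY z), where
    transpositions act by signed exchanges of factors; these are invisible in Sym^k. *)
Lemma kmap_tperm (a b : 'I_k) z : b = a.+1 :> nat -> gd z = 0 -> kmap (sact (tperm a b) z) = kmap z.
Proof.
move=> ab z0; have := ezK_bd z; rewrite z0 linear0 addr0 => E.
have zE : z = ezX k (ezY z) + gd (@ezK R F k M z) by rewrite E; zmod.
have Y0 : tbd (@ezY R F k M z) = 0 by rewrite ezY_bd z0 linear0.
have -> : sact (tperm a b) z = sact (tperm a b) (ezX k (ezY z)) +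
    gd (sact (tperm a b) (@ezK R F k M z)).
  by rewrite sact_bd -[RHS]linearD -zE.
rewrite (lin_absorb _ kmap_is_linear (kmap_bd _)).
rewrite -(ezX_swap (p := a) (erefl _) ab (@ezY_size z)) kmap_ezX; first by rewrite tosym_swap.
  by apply: tswap_size; exact: (@ezY_size z).
by rewrite tswap_bd Y0 linear0.
Qed.

Lemma kmap_sact s z : gd z = 0 -> kmap (sact s z) = kmap z.
Proof.
move: s z; apply: adjacent_transpositions => [z _|s t IHs IHt z z0|a b ab z z0].
- by rewrite sact1.
- by rewrite -sactM IHs ?IHt // sact_bd z0 linear0.
- exact: kmap_tperm.
Qed.

Lemma kmap_ssym z : gd z = 0 -> kmap (ssym z) = (k`!)%:R *: kmap z.
Proof.
move=> z0; rewrite /ssym linear_sum (eq_bigr (fun=> kmap z)) /=.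
  by rewrite sumr_const -scaler_nat card_Sn.
by move=> s _; rewrite kmap_sact.
Qed.

Lemma kmap_surj u : exists2 z, gd z = 0 & kmap z = u.
Proof.
have [v <-] := qpi_surj u; rewrite -/(sclass v).
apply: (csub_ind (S := fun v => exists2 z, gd z = 0 & kmap z = sclass v) (@csubT _ _ v)).
- by exists 0; rewrite !linear0.
- move=> a x y [z z0 zx] [z' z'0 zy]; exists (a *: z + z').
    have -> : gd (a *: z + z') = a *: gd z + gd z' by exact: (lin_can (@gd F SX)).
    by rewrite z0 z'0 scaler0 addr0.
  by rewrite (kmap_is_linear a z z') zx zy (sclass_is_linear a x y).
move=> w _; have /andP[/eqP wk /eqP wd] := valP w.
have ck := cross_size wk.
exists (ezX k (cross sp (val w))); first by rewrite ezX_bd // cross_bd linear0.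
by rewrite kmap_ezX ?cross_bd // tosym_cross /= /monom valK.
Qed.

(** The symmetrized cross product satisfies the relations of Sym^k on the chain level, and so
    provides the map in the opposite direction. *)
Definition symx (w : seq (homog H)) : CX := ssym (ezX k (cross sp w)).

Lemma symx_koszul s t u v : size (s ++ u :: v :: t) = k ->
  symx (s ++ u :: v :: t) = (-1) ^+ (hdeg u * hdeg v) *: symx (s ++ v :: u :: t).
Proof.
move=> sk; have ab : ((size s).+1 < k)%N by rewrite -sk size_cat /= !addnS !ltnS leq_addr.
pose a : 'I_k := Ordinal (ltnW ab); pose b : 'I_k := Ordinal ab.
have ck := cross_size sk.
rewrite /symx -(ssym_sact (tperm a b)) -(@ezX_swap R F k M (size s) a b _ (erefl _) (erefl _) ck).
by rewrite cross_swap !linearZ.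
Qed.

Hypothesis charF : [pchar F]%R =i pred0.

Lemma symx_square s t u : size (s ++ u :: u :: t) = k -> odd (hdeg u) ->
  symx (s ++ u :: u :: t) = 0.
Proof.
move=> sk uo; have := symx_koszul sk; rewrite -signr_odd oddM uo scaleN1r => E.
have : 2%:R *: symx (s ++ u :: u :: t) = 0.
  by rewrite scaler_nat mulr2n {1}E addNr.
move/eqP; rewrite scaler_eq0 => /orP[|/eqP //].
by have := fact_neq0 2 charF => /negPf ->.
Qed.

Definition wsym : W -> CX := fglift (fun w => symx (val w)).
HB.instance Definition _ := GRing.Linear.copy wsym (fglift _).

Lemma wsym_monom w : wsym (monom k d w) =
  if (size w == k) && (sumn (map (@hdeg F H) w) == d) then symx w else 0.
Proof.
rewrite /monom; case: insubP => [w' wP wE|/negPf ->]; last by rewrite linear0.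
by rewrite [LHS]fglift1 wE wP.
Qed.

Lemma wsym_rel r : @sym_rel F H k d r -> wsym r = 0.
Proof.
case=> [s t i a x y|s t u v|s t u uo].
- rewrite linearB linearD linearZ /= !wsym_monom !size_cat !map_cat /=.
  case: ifP => _; last by rewrite scaler0 addr0 subr0.
  have L : lin (fun x : H i => symx (s ++ Tagged H x :: t)).
    by apply: (@lin_comp _ _ _ _ (@ssym R F k M \o @ezX R F k M)); [lin|exact: cross_lin].
  by rewrite (L a x y) subrr.
- rewrite linearB linearZ /= !wsym_monom !size_cat !map_cat !sumn_cat /= [(hdeg v + (_ + _))%N]addnCA.
  case: ifP => [/andP[/eqP sk _]|_]; last by rewrite scaler0 subr0.
  by rewrite symx_koszul ?subrr // size_cat.
- rewrite wsym_monom; case: ifP => // /andP[/eqP sk _].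
  exact: symx_square.
Qed.

(** Up to boundaries [z] is ezX of ezY z, and ezY z is a combination of cross products of
    representatives. Symmetrizing the latter factors through Sym^k, where the class is zero by
    assumption. *)
Lemma kmap_inj z : gd z = 0 -> csub (fun b : SX => gdeg b = d) z -> kmap z = 0 ->
  exists e, ssym z = gd e.
Proof.
move=> z0 zd; have := ezK_bd z; rewrite z0 linear0 addr0 => E.
pose w : TS := ezY z; have zE : z = ezX k w + gd (@ezK R F k M z) by rewrite E; zmod.
have wP : csub (fun s : seq S => tdeg s = d /\ size s = k) w.
  apply: (@csub_map _ _ _ _ _ (@ezY R F k M) z _ zd) => [|b <-]; [exact: lin_can|exact: ezY_deg].
have wk : sized w by apply: csubW wP => s [].
have w0 : tbd w = 0 by rewrite ezY_bd z0 linear0.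
have := hthom_bd sp w; rewrite w0 linear0 addr0; set h := thom _ _ w => hE.
have hk : sized h.
  apply: (csub_map _ wk) => [|s <-]; [by lin|exact: hthom_size].
rewrite /kmap -/w tosym_lift => /(qpi_ker wsym_rel); rewrite -[X in X = 0]/(wsym (tolift sp k d w)).
have -> : wsym (tolift sp k d w) = ssym (ezX k (tmap (fun=> hproj sp : {linear C -> C}) w)).
  apply: (csub_lin wP (f := fun w => wsym (tolift sp k d w))
    (g := fun w => ssym (ezX k (tmap (fun=> hproj sp : {linear C -> C}) w)))); [lin|lin|move=> s [sd sk]].
  rewrite tmap_cross [tolift _ _ _ _]fglift1 wsym_monom size_map sk eqxx /= -map_comp.
  by rewrite -[sumn _]/(tdeg s) sd eqxx.
move=> P0; exists (ssym (ezX k h) + ssym (ezK z)).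
rewrite linearD /= !ssym_bd ezX_bd // hE !linearB /= P0 subr0 -linearD /= -zE.
by [].
Qed.

End Degree.
End Kunneth.

(** * The isomorphism *)

(** Triviality of the two kernels makes the relation a function with an inverse; the choices hidden
    in [T] need not be made coherently. *)
Lemma linear_correspondence (F : fieldType) (V U : lmodType F) (T : V -> U -> Prop) :
  (forall a v u v' u', T v u -> T v' u' -> T (a *: v + v') (a *: u + u')) ->
  (forall v, exists u, T v u) -> (forall u, exists v, T v u) ->
  (forall u, T 0 u -> u = 0) -> (forall v, T v 0 -> v = 0) ->
  exists f : {linear V -> U}, bijective f.
Proof.
move=> TD Tt Ts T0 T1.
have Tf v u u' : T v u -> T v u' -> u = u'.
  move=> Tu Tu'; have := TD (-1) _ _ _ _ Tu Tu'; rewrite !scaleN1r addNr => /T0/eqP.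
  by rewrite addrC subr_eq0 => /eqP.
have Ti v v' u : T v u -> T v' u -> v = v'.
  move=> Tu Tu'; have := TD (-1) _ _ _ _ Tu Tu'; rewrite !scaleN1r addNr => /T1/eqP.
  by rewrite addrC subr_eq0 => /eqP.
have /choice[f fT] := Tt; have /choice[g gT] := Ts.
have fl : lin f by move=> a x y; apply: (Tf (a *: x + y)) => //; apply: TD.
exists (mklin fl); exists g => x /=; first exact: Ti (gT (f x)) (fT x).
exact: Tf (fT (g x)) (gT x).
Qed.

Lemma lin_unscale (F : fieldType) (U V : lmodType F) (f : U -> V) a x :
  lin f -> a != 0 -> f (a *: x) = 0 -> f x = 0.
Proof.
move=> fl a0; have := fl a x 0; rewrite addr0 (lin0 fl) addr0 => -> /eqP.
by rewrite scaler_eq0 (negPf a0) => /eqP.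
Qed.

Section DegreePart.
Variables (R : realType) (F : fieldType).

(** Augmented chains mix all dimensions; this keeps the d-dimensional component. *)
Definition dpart (Z : topologicalType) d (c : achain R F Z) : achain R F Z :=
  augm (tin (tout d (unaug c))).

Lemma dpart1 (Z : topologicalType) d (s : singular_simplex R Z d) :
  dpart d << Some (mk_ssimp s) >> = << Some (mk_ssimp s) >> :> achain R F Z.
Proof. by rewrite /dpart unaug1 tout1 tin1 [LHS]bmap1. Qed.

Lemma dpart_ne (Z : topologicalType) d (a : ssimp R Z) : tag a <> d ->
  dpart d << Some a >> = 0 :> achain R F Z.
Proof. by move=> ad; rewrite /dpart unaug1 tout_ne // !linear0. Qed.

Lemma dpart_lin (Z : topologicalType) d : lin (@dpart Z d).
Proof. by rewrite /dpart; lin. Qed.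

Lemma apush_simplex (Z Z' : topologicalType) (f : Z -> Z') (fc : continuous f)
    d (s : singular_simplex R Z d) : exists t : singular_simplex R Z' d,
  apush f << Some (mk_ssimp s) >> = << Some (mk_ssimp t) >> :> achain R F Z'.
Proof.
have sc : continuous (f \o s).
  by move=> x; apply: continuous_comp; [exact: (@cts_fun _ _ s)|exact: fc].
exists (mkcts sc : continuousType (std_simplex R d) Z'); rewrite apush1 /=.
by rewrite /amk; case: pselect => [sc'|[]] //; congr << Some _ >>; apply: ssimp_eq.
Qed.

Lemma dpart_apush (Z Z' : topologicalType) (f : Z -> Z') d (c : achain R F Z) :
  continuous f -> apush f (dpart d c) = dpart d (apush f c).
Proof.
move=> fc; have L := @dpart_lin Z d; have L' := @dpart_lin Z' d.
move: c; apply: fg_ext => [||[[e s]|]].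
- by apply: (@lin_comp _ _ _ _ (apush f)) => //; lin.
- by apply: (lin_comp L'); lin.
- have [t tE] := apush_simplex fc s; rewrite -/(mk_ssimp s) tE.
  have [ed|ed] := pselect (e = d); last by rewrite !dpart_ne // linear0.
  by case: _ / ed s t tE => s t tE; rewrite !dpart1.
- by rewrite apush1 /dpart [unaug << None >>]fglift1 !linear0 [unaug << None >>]fglift1 !linear0.
Qed.

Lemma unaug_cycle (Z : topologicalType) (c : achain R F Z) a :
  abd c = a *: << None >> -> @gd F (sbasis R F Z) (unaug c) = 0.
Proof. by move=> c0; rewrite -unaug_bd c0 linearZ /= [unaug _]fglift1 scaler0. Qed.

Lemma tout_cycle (Z : topologicalType) d (c : {freeg (sbasis R F Z) / F}) :
  gd c = 0 -> tout d c \in @is_cycle R F Z d.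
Proof. by case: d => [//|d] c0; apply/eqP; rewrite -tout_bd c0 linear0. Qed.

Lemma dpart_cycle (Z : topologicalType) d (c : achain R F Z) a :
  abd c = a *: << None >> -> exists a', abd (dpart d c) = a' *: << None >>.
Proof. by move=> /unaug_cycle c0; apply: augm_cycle; apply: gd_cycle; exact: tout_cycle. Qed.

End DegreePart.

Section Isomorphism.
Variables (R : realType) (F : fieldType) (n k : nat) (M : smooth_manifold R n).
Hypothesis n_odd : odd n.
Hypothesis M_compact : compact [set: M].
Hypothesis charF : [pchar F]%R =i pred0.
Local Notation X := {ptws 'I_k -> M}.
Local Notation SX := (sbasis R F X).
Local Notation Y := (@conf k M : Type).
Local Notation B := (unordered_conf k M).
Local Notation inc := (@apush R F _ _ (@set_val X (@conf k M))).
Local Notation sp := (homology_splitting R F M).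

Lemma kmap_dpart d (c : achain R F X) : kmap sp d (unaug (dpart d c)) = kmap sp d (unaug c).
Proof.
rewrite /dpart augmK; move: (unaug c) => {}c.
move: c; apply: fg_ext => [||[e s]].
- by apply: (@lin_comp _ _ _ _ (@kmap R F M k sp d)); [exact: kmap_is_linear|lin].
- exact: kmap_is_linear.
rewrite -/(mk_ssimp s); have [ed|ed] := pselect (e = d).
  by case: _ / ed s => s; rewrite tout1 tin1.
rewrite tout_ne // linear0 (lin0 (@kmap_is_linear R F M k sp d)); apply/esym.
have H := @ezY_deg R F k M (mk_ssimp s).
apply: (csub_lin H (f := tosym sp k d [::]) (g := \0)); [lin|lin|move=> r [re rk]].
rewrite [LHS]fglift1 /= /monom; case: insubP => [w /andP[_ /eqP wd] _|_]; last by rewrite linear0.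
by case: ed; rewrite -wd -map_comp -[sumn _]/(tdeg r) re.
Qed.

Lemma augm_ssym (c : {freeg SX / F}) : augm (ssym c) = symm (augm c).
Proof.
rewrite /ssym /symm linear_sum; apply: eq_bigr => s _ /=.
move: c; apply: fg_ext => [||[d x]]; [lin|lin|].
have [t tE] := @apush_simplex R F _ _ (act s) (@act_cts k M s) d x.
rewrite -/(mk_ssimp x) [sact _ _]bmap1 ![augm _]bmap1 /actc apush1 /=.
have xc : continuous (act s \o x).
  by move=> y; apply: continuous_comp; [exact: (@cts_fun _ _ x)|exact: act_cts].
by rewrite /amk; case: pselect => [xc'|[]] //; congr << Some _ >>; apply: ssimp_eq.
Qed.

Lemma ssym_deg d (c : {freeg SX / F}) : csub (fun b : SX => gdeg b = d) c ->
  csub (fun b : SX => gdeg b = d) (ssym c).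
Proof.
move=> cd; apply: csub_sum => s _; apply: (csub_map _ cd) => [|b bd]; first by lin.
by rewrite [sact _ _]bmap1; apply: csub1.
Qed.

Lemma unaug_inc_symm (z : achain R F Y) :
  unaug (inc (symm_conf z)) = ssym (unaug (inc z)).
Proof. by rewrite inc_symm unaug_symm. Qed.

(* The graph of the isomorphism; [a] is the augmentation of [z]. *)
Definition corresponds d (h : homology R F B d) (u : sym_power (homology R F M) k d) :=
  exists (z : achain R F Y) a, [/\ abd z = a *: << None >>,
    exists2 w : singular_cycle R F B d, hclass w = h &
      cycle_val w = tout d (unaug (apush (@unorder R n k M) z)) &
    u = kmap sp d (unaug (inc z))].

Lemma inc_cycle (z : achain R F Y) a : abd z = a *: << None >> -> abd (inc z) = a *: << None >>.
Proof. by move=> z0; rewrite inc_bd z0 linearZ /= apush1. Qed.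

Lemma unorder_cyc (z : achain R F Y) a : abd z = a *: << None >> ->
  abd (apush (@unorder R n k M) z) = a *: << None >>.
Proof. by move=> z0; rewrite (apush_bdc (@unorder_cts R n k M)) z0 linearZ /= apush1. Qed.

Lemma corresponds_lin d a h u h' u' : @corresponds d h u -> corresponds h' u' ->
  corresponds (a *: h + h') (a *: u + u').
Proof.
move=> [z [b [z0 [w wh wE] ->]]] [z' [b' [z'0 [w' wh' w'E] ->]]].
exists (a *: z + z'), (a * b + b'); split.
- have L : lin (@abd R F Y) by lin.
  by rewrite (L a z z') z0 z'0 scalerA scalerDl.
- have L : lin (fun z : achain R F Y => tout d (unaug (apush (@unorder R n k M) z))) by lin.
  by exists (a *: w + w'); [rewrite (hclass_is_linear a w w') wh wh'|rewrite (L a z z') -wE -w'E].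
- have L : lin (fun z : achain R F Y => kmap sp d (unaug (inc z))) by lin.
  by rewrite (L a z z').
Qed.

Lemma corresponds_total d h : exists u, @corresponds d h u.
Proof.
have [w wh] := hclass_surj h.
have w0 : gd (tin (cycle_val w)) = 0 by apply: gd_cycle; case: (w).
have [a b0] := augm_cycle w0.
have [z [e [z0 bE]]] := unorder_cycle charF b0.
exists (kmap sp d (unaug (inc z))), z, a; split => //.
have zc := tout_cycle d (unaug_cycle (unorder_cyc z0)).
exists (Cycle zc) => //; rewrite -wh; apply/eqP; rewrite eq_sym -subr_eq0 -linearB /=; apply/eqP.
apply/hclass_eq0; exists (tout d.+1 (unaug e)); rewrite -tout_bd -unaug_bd /=.
have -> : abd e = augm (tin (cycle_val w)) - apush (@unorder R n k M) z by rewrite bE; zmod.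
by rewrite linearB /= augmK linearB /= tinK.
Qed.

(** By transfer the symmetrization of the d-part of [z] bounds in the ordered configurations; [kmap]
    kills boundaries and turns symmetrization into multiplication by k!. *)
Lemma corresponds_fun d u : @corresponds d 0 u -> u = 0.
Proof.
move=> [z [a [z0 [w /hclass_eq0[c cw] wE] ->]]].
have [a' z'0] := dpart_cycle d z0.
have zE : apush (@unorder R n k M) (dpart d z) = abd (augm (tin c)).
  by rewrite (dpart_apush _ _ (@unorder_cts R n k M)) /dpart -wE -cw augm_tin_bd.
have [e' /(congr1 inc)/(congr1 (@unaug R F X))] := unorder_boundary z'0 zE.
rewrite unaug_inc_symm -inc_bd unaug_bd => /(congr1 (kmap sp d)).
rewrite kmap_bd kmap_ssym ?(unaug_cycle (inc_cycle z'0)) //.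
rewrite (dpart_apush _ _ (@set_val_cts _ _)) kmap_dpart => /eqP.
by rewrite scaler_eq0 (negPf (fact_neq0 k charF)) => /eqP.
Qed.

(** The symmetrized cycle bounds in M^k by [kmap_inj], hence among configurations by
    [conf_boundary]; its projection to the unordered ones is k! times a representative of [h]. *)
Lemma corresponds_inj d h : @corresponds d h 0 -> h = 0.
Proof.
move=> [z [a [z0 [w wh wE] /esym]]]; rewrite -kmap_dpart -(dpart_apush _ _ (@set_val_cts _ _)).
have [a' z'0] := dpart_cycle d z0; have zd := dpart_apush d z (@set_val_cts X (@conf k M)).
set x := unaug _ => x0; have xE : x = tin (tout d (unaug (inc z))).
  by rewrite /x zd /dpart augmK.
have xd : csub (fun b : SX => gdeg b = d) x by rewrite xE; exact: tin_deg.
have [e eE] := kmap_inj charF (unaug_cycle (inc_cycle z'0)) xd x0.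
have : symm (inc (dpart d z)) = abd (augm (tin (tout d.+1 e))).
  rewrite augm_tin_bd -tout_bd -eE (toutK (ssym_deg xd)) augm_ssym xE zd.
  by [].
move=> /(conf_boundary n_odd charF M_compact (@inc_csub _ _ _ _ _))[b' b'c].
have [b'' <-] := sub_lift b'c.
rewrite -inc_symm inc_bd => E; have {E} E : symm_conf (dpart d z) = abd b''.
  by apply/eqP; rewrite -subr_eq0; apply/eqP; apply: sub_inj; rewrite linearB /= E subrr.
have := congr1 (apush (@unorder R n k M)) E.
rewrite unorder_symm -(apush_bdc (@unorder_cts R n k M)) (dpart_apush _ _ (@unorder_cts R n k M)).
move=> /(congr1 (@unaug R F B))/(congr1 (@tout R F B d)); rewrite unaug_bd tout_bd 2!linearZ /= /dpart augmK tinK -wE.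
move=> kw; have : hclass ((k`!)%:R *: w) = 0 by apply/hclass_eq0; eexists; exact: esym kw.
rewrite -wh; exact: (lin_unscale (@hclass_is_linear _ _ _ _) (fact_neq0 k charF)).
Qed.

Lemma corresponds_surj d u : exists h, @corresponds d h u.
Proof.
have [x x0 <-] := kmap_surj sp u; have [a b0] := augm_cycle x0.
have [z' [e [z'c z'0 zE]]] := conf_cycle n_odd charF M_compact b0.
have [z zz'] := sub_lift z'c.
have z0 : abd z = a *: << None >>.
  apply/eqP; rewrite -subr_eq0; apply/eqP; apply: sub_inj.
  by rewrite linearB /= -inc_bd zz' z'0 b0 linearZ /= apush1 subrr.
have zc := tout_cycle d (unaug_cycle (unorder_cyc z0)).
exists (hclass (Cycle zc)), z, a; split => //; first by exists (Cycle zc).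
(* Only the symmetrizations of the two cycles are known to be homologous, so the comparison is made
   after multiplying by k!. *)
apply: (scalerI (fact_neq0 k charF)).
rewrite -!kmap_ssym //; last exact: unaug_cycle (inc_cycle z0).
rewrite -[x in LHS]augmK -!unaug_symm zE zz' linearD /= unaug_bd.
by rewrite (lin_absorb _ (@kmap_is_linear _ _ _ _ _ _) (kmap_bd _ _ _)).
Qed.

End Isomorphism.


Theorem theorem7p0p1 (R : realType) (F : fieldType) (n : nat)
    (M : smooth_manifold R n) (k : nat) :
  odd n ->
  compact [set: M] ->
  [pchar F]%R =i pred0 ->
  graded_isomorphic (homology R F (unordered_conf k M))
    (sym_power (homology R F M) k).
Proof.
move=> n_odd Mc charF.
have iso d := @linear_correspondence _ _ _ (@corresponds R F n k M d) (@corresponds_lin R F n k M d)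
  (corresponds_total charF (d := d)) (corresponds_surj n_odd Mc charF (d := d))
  (corresponds_fun charF (d := d)) (corresponds_inj n_odd Mc charF (d := d)).
by exists (fun d => projT1 (cid (iso d))) => d; exact: projT2 (cid (iso d)).
Qed.
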